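(* Let $(M,g)$ be a semi-Riemannian manifold of dimension $n$ and index $\nu$, with $g\in L^\infty_{\rm loc}$ and with the Levi-Civita connection $\nabla$ of $g$ in $L^p_{\rm loc}$ for some $p>2$. Let $\{\mathcal W_\varepsilon\}$ be a family of connection $1$-forms with the same index, i.e., there are fixed positive integers $k,\tau$ such that $$\mathcal W_\varepsilon\in L^p_{\rm loc}\big(M;\,T^*M\otimes\mathfrak o(\nu+\tau,(n+k)-(\nu+\tau))\big)\quad\text{for each }\varepsilon .$$ Assume that $\{\mathcal W_\varepsilon\}$ is uniformly bounded in $L^p_{\rm loc}$ and that each $\mathcal W_\varepsilon$ satisfies the Cartan structural system $$d\mathcal W_\varepsilon=\mathcal W_\varepsilon\wedge\mathcal W_\varepsilon$$ in the sense of distributions. Then, after passing to a subsequence if necessary, $\mathcal W_\varepsilon$ converges weakly in $L^p_{\rm loc}$ to a connection $1$-form $\mathcal W$ that also satisfies $d\mathcal W=\mathcal W\wedge\mathcal W$ in the sense of distributions.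
   Context: A semi-Riemannian metric is a symmetric non-degenerate $2$-tensor on $TM$ of constant index (number of negative directions); for $L^\infty_{\rm loc}$ metrics non-degeneracy is understood a.e. ($g$ and $g^{-1}$ in $L^\infty_{\rm loc}$). A connection is $L^p_{\rm loc}$ if its Christoffel symbols are. Let $\epsilon=\mathrm{diag}(\epsilon^1,\dots,\epsilon^{n+k})=\epsilon_{n,\nu}\oplus\epsilon_{k,\tau}$, where $\epsilon_{n,\nu}=\mathrm{diag}(-1,\dots,-1,1,\dots,1)$ with $\nu$ entries $-1$ and $n-\nu$ entries $1$, and likewise $\epsilon_{k,\tau}$. Then $\mathfrak o(\nu+\tau,(n+k)-(\nu+\tau))=\{A\in\mathfrak{gl}(n+k;\mathbb R):\epsilon A^\top+A\epsilon=0\}$. Connection $1$-forms: let $E\to M$ be a vector bundle with fibre $\mathbb R^k_\tau$ ($\mathbb R^k$ with a metric of index $\tau$), let $\{\partial_i\}_{1\le i\le n}$ and $\{\partial_\alpha\}_{n+1\le\alpha\le n+k}$ be (local) orthonormal frames of $TM$ and $E$ with $\langle\partial_a,\partial_b\rangle=\epsilon^a\delta_{ab}$ and dual coframes $\{\theta^a\}$. For a symmetric tensor $\mathrm{II}:TM\times TM\to E$ and a metric connection $\nabla^E$ on $E$, the connection $1$-form is the matrix of $1$-forms $\mathcal W=\{\omega^a_b\}$ ($a$ = row, $b$ = column) given by $\omega^i_j(\partial_l)=\theta^j(\nabla_{\partial_l}\partial_i)$, $\omega^i_\alpha(\partial_j)=\theta^\alpha(\mathrm{II}(\partial_i,\partial_j))$,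 $\omega^\alpha_\beta(\partial_i)=\theta^\beta(\nabla^E_{\partial_i}\partial_\alpha)$, $\omega^\alpha_i=-\epsilon^i\epsilon^\alpha\omega^i_\alpha$. It takes values in $\mathfrak o(\nu+\tau,(n+k)-(\nu+\tau))$. $d\mathcal W$ is the entrywise exterior derivative, and $(\mathcal W\wedge\mathcal W)(U,V)=\mathcal W(U)\cdot\mathcal W(V)-\mathcal W(V)\cdot\mathcal W(U)$ (matrix products), i.e. the system reads $d\omega^a_c=\sum_b\omega^a_b\wedge\omega^b_c$. *)

(* Defs.v *)
From HB Require Import structures.
From mathcomp Require Import all_boot all_order all_algebra.
From mathcomp Require Import all_classical all_reals all_analysis.
Set Implicit Arguments.
Unset Strict Implicit.
Unset Printing Implicit Defensive.
Import Order.TTheory GRing.Theory Num.Theory.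
Import numFieldNormedType.Exports.
Local Open Scope classical_set_scope.
Local Open Scope ring_scope.

Definition rV_display : measure_display.
Proof. exact: default_measure_display. Qed.

(* 'rV[R]_n carries the sigma-algebra generated by the coordinate functions,
   as n.-tuple R does; it is the Borel sigma-algebra of R^n. *)
Section rV_measurable.
Context (R : realType) (n : nat).

Definition rV_coord (i : 'I_n) (x : 'rV[R]_n) : measurableTypeR R := x ord0 i.

Let rV_set0 : g_sigma_preimage rV_coord set0.
Proof. exact: sigma_algebra0. Qed.

Let rV_setC A : g_sigma_preimage rV_coord A -> g_sigma_preimage rV_coord (~` A).
Proof. exact: sigma_algebraC. Qed.

Let rV_bigcup (F : _^nat) : (forall i, g_sigma_preimage rV_coord (F i)) ->
  g_sigma_preimage rV_coord (\bigcup_i (F i)).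
Proof. exact: sigma_algebra_bigcup. Qed.

HB.instance Definition _ :=
  @isMeasurable.Build rV_display 'rV[R]_n
    (g_sigma_preimage rV_coord) rV_set0 rV_setC rV_bigcup.
End rV_measurable.

Section rV_lebesgue.
Context (R : realType).
Implicit Types n : nat.

Lemma measurable_rV_coord n (i : 'I_n) :
  measurable_fun [set: 'rV[R]_n] (@rV_coord R n i).
Proof.
move=> _ Y mY; rewrite setTI; apply: sub_sigma_algebra => /=.
rewrite -bigcup_seq/=; exists i => /=; first by rewrite mem_index_enum.
by exists Y => //; rewrite setTI.
Qed.

Lemma measurable_fun_rVP d (T : measurableType d) n (f : T -> 'rV[R]_n) :
  (forall i, measurable_fun [set: T] (@rV_coord R n i \o f)) ->
  measurable_fun [set: T] f.
Proof.
move=> mf _ Y mY; rewrite setTI.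
have : <<s \big[setU/set0]_(i < n)
     preimage_set_system setT (@rV_coord R n i) measurable >> Y by [].
move=> /(_ [set A | measurable (f @^-1` A)]); apply; split.
- split => //=; first by rewrite preimage_set0.
  + by move=> A mA; rewrite setTD preimage_setC; exact: measurableC.
  + by move=> F mF; rewrite preimage_bigcup; exact: bigcupT_measurable.
- rewrite -bigcup_seq/=; apply: bigcup_sub => i _ A [B mB <-].
  by rewrite setTI; have := mf i measurableT B mB; rewrite setTI.
Qed.

Definition rV_cons n (p : measurableTypeR R * 'rV[R]_n) : 'rV[R]_n.+1 :=
  row_mx (p.1)%:M p.2 : 'rV[R]_(1 + n).

Definition rV_uncons n (x : 'rV[R]_n.+1) : measurableTypeR R * 'rV[R]_n :=
  (x ord0 ord0, rsubmx (x : 'rV[R]_(1 + n))).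

Lemma rV_consK n : cancel (@rV_cons n) (@rV_uncons n).
Proof.
case=> a x; rewrite /rV_uncons /rV_cons /= row_mxKr; congr pair.
rewrite (_ : (ord0 : 'I_n.+1) = @lshift 1 n ord0); last exact/val_inj.
by rewrite [LHS](@row_mxEl R 1 1 n a%:M x ord0 ord0) mxE eqxx mulr1n.
Qed.

Lemma measurable_rV_cons n : measurable_fun [set: _] (@rV_cons n).
Proof.
apply: measurable_fun_rVP => i.
have [->|i0] := eqVneq i ord0.
  rewrite (_ : _ \o _ = fst); first exact: measurable_fst.
  by apply/funext => p /=; rewrite -{2}(rV_consK p).
have [j ->] : exists j : 'I_n, i = rshift 1 j.
  have [j|j] := @split_ordP 1 n i; last by exists j.
  by move=> ij; move: i0; rewrite ij ord1 lshift0 eqxx.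
rewrite (_ : _ \o _ = @rV_coord R n j \o snd).
  by apply: measurableT_comp; [exact: measurable_rV_coord|exact: measurable_snd].
by apply/funext => -[a x] /=; exact: (@row_mxEr R 1 1 n a%:M x ord0 j).
Qed.

Lemma measurable_rV_uncons n : measurable_fun [set: _] (@rV_uncons n).
Proof.
apply: measurable_fun_pair; first exact: (@measurable_rV_coord _ ord0).
apply: measurable_fun_rVP => i.
rewrite (_ : _ \o _ = @rV_coord R n.+1 (rshift 1 i)).
  exact: measurable_rV_coord.
by apply/funext => x; rewrite /rV_coord/= mxE.
Qed.

End rV_lebesgue.

Section rV_lebesgue_step.
Context (R : realType) (n : nat) (m : {sigma_finite_measure set 'rV[R]_n -> \bar R}).

Definition rV_lebesgue_step : set 'rV[R]_n.+1 -> \bar R :=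
  pushforward (@lebesgue_measure R \x m)%E (@rV_cons R n).

Let mcons (A : set 'rV[R]_n.+1) :
  measurable A -> measurable (@rV_cons R n @^-1` A).
Proof. by move=> mA; rewrite -[X in measurable X]setTI; exact: measurable_rV_cons. Qed.

Let step0 : rV_lebesgue_step set0 = 0%E.
Proof. by rewrite /rV_lebesgue_step /pushforward preimage_set0 measure0. Qed.

Let step_ge0 A : (0 <= rV_lebesgue_step A)%E.
Proof. by rewrite /rV_lebesgue_step /pushforward measure_ge0. Qed.

Let step_sigma_additive : semi_sigma_additive rV_lebesgue_step.
Proof.
move=> F mF tF mUF; rewrite /rV_lebesgue_step /pushforward preimage_bigcup.
apply: measure_semi_sigma_additive => [k||]; first exact: mcons.
- apply/trivIsetP => /= i j _ _ ij; rewrite -preimage_setI.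
  by move/trivIsetP : tF => /(_ _ _ _ _ ij) ->//; rewrite preimage_set0.
- by rewrite -preimage_bigcup; exact: mcons.
Qed.

HB.instance Definition _ :=
  isMeasure.Build _ _ _ rV_lebesgue_step step0 step_ge0 step_sigma_additive.

Let rV_lebesgue_step_sigma_finite : sigma_finite setT rV_lebesgue_step.
Proof.
have /sigma_finiteP[F [TF ndF Foo]] := sigma_finiteT (@lebesgue_measure R).
have /sigma_finiteP[G [TG ndG Goo]] := sigma_finiteT m.
exists (fun k => @rV_uncons R n @^-1` (F k `*` G k)).
  apply/esym; rewrite -subTset => x _; rewrite -preimage_bigcup /=.
  have [i _ Fi] : (\bigcup_k F k) (rV_uncons x).1 by rewrite -TF.
  have [j _ Gj] : (\bigcup_k G k) (rV_uncons x).2 by rewrite -TG.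
  exists (maxn i j) => //; split.
  - by apply: subsetPset Fi; exact/ndF/leq_maxl.
  - by apply: subsetPset Gj; exact/ndG/leq_maxr.
move=> k; have [mF Fk] := Foo k; have [mG Gk] := Goo k.
have mFG : measurable (F k `*` G k) by exact: measurableX.
split; first by rewrite -[X in measurable X]setTI; exact: measurable_rV_uncons.
rewrite /rV_lebesgue_step /pushforward -comp_preimage.
rewrite (_ : _ \o _ = id); last first.
  by apply/funext => p /=; rewrite rV_consK.
by rewrite preimage_id product_measure1E// lte_mul_pinfty// ge0_fin_numE.
Qed.

HB.instance Definition _ :=
  Measure_isSigmaFinite.Build _ _ _ rV_lebesgue_step rV_lebesgue_step_sigma_finite.
End rV_lebesgue_step.

(* Lebesgue measure on R^n, as the n-fold product of lebesgue_measure. *)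
Fixpoint leb (R : realType) (n : nat) :
    {sigma_finite_measure set 'rV[R]_n -> \bar R} :=
  match n with
  | 0%N => dirac (0 : 'rV[R]_0)
  | n'.+1 => rV_lebesgue_step (leb R n')
  end.

Section functions_on_Rn.
Context (R : realType) (n : nat).
Implicit Types (U : set 'rV[R]_n) (f : 'rV[R]_n -> R).

Definition partial (i : 'I_n) f : 'rV[R]_n -> R :=
  fun x => 'D_(delta_mx ord0 i) f x.

(* Smoothness on an open set U: all iterated partial derivatives are
   differentiable at every point of U. *)
Definition smooth_on U f : Prop :=
  forall (s : seq 'I_n) x, U x -> differentiable (foldr partial f s) x.

Definition test_function U f : Prop :=
  smooth_on setT f /\
  exists K, [/\ compact K, K `<=` U & forall x, ~ K x -> f x = 0].

Definition Lp_loc (p : R) U f : Prop :=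
  measurable_fun U f /\
  forall K, compact K -> K `<=` U ->
    (\int[leb R n]_(x in K) (`|f x| `^ p)%:E < +oo)%E.

Definition Linf_loc U f : Prop :=
  measurable_fun U f /\
  forall K, compact K -> K `<=` U ->
    exists C : R, {ae leb R n, forall x, K x -> `|f x| <= C}.

(* h is the distributional derivative of f on U in the direction i. *)
Definition weak_partial U (i : 'I_n) f (h : 'rV[R]_n -> R) : Prop :=
  forall phi, test_function U phi ->
    \int[leb R n]_(x in U) (f x * partial i phi x) =
    - \int[leb R n]_(x in U) (h x * phi x).

Definition weak_cvg_Lp_loc (p : R) U (u : nat -> 'rV[R]_n -> R) f : Prop :=
  forall K, compact K -> K `<=` U ->
  forall psi : 'rV[R]_n -> R, measurable_fun K psi ->
    (\int[leb R n]_(x in K) (`|psi x| `^ (p / (p - 1)))%:E < +oo)%E ->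
    (fun j => \int[leb R n]_(x in K) (u j x * psi x)) @ \oo -->
      \int[leb R n]_(x in K) (f x * psi x).

End functions_on_Rn.

Record chart (R : realType) (n : nat) (M : topologicalType) := Chart {
  cdom : set M;
  cimg : set 'rV[R]_n;
  cto : M -> 'rV[R]_n;
  cfrom : 'rV[R]_n -> M;
  cdom_open : open cdom;
  cimg_open : open cimg;
  cto_img : forall y, cdom y -> cimg (cto y);
  cfrom_dom : forall x, cimg x -> cdom (cfrom x);
  ctoK : forall y, cdom y -> cfrom (cto y) = y;
  cfromK : forall x, cimg x -> cto (cfrom x) = x;
  cto_continuous : forall y, cdom y -> {for y, continuous cto};
  cfrom_continuous : forall x, cimg x -> {for x, continuous cfrom}
}.

Section transitions.
Context (R : realType) (n : nat) (M : topologicalType).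
Implicit Types c d : chart R n M.

Definition overlap c d : set 'rV[R]_n :=
  [set x | cimg c x /\ cdom d (cfrom c x)].

Definition transition c d (x : 'rV[R]_n) : 'rV[R]_n := cto d (cfrom c x).

(* Row m, column r: the m-th partial derivative of the r-th component. *)
Definition transition_jac c d (x : 'rV[R]_n) : 'M[R]_n :=
  \matrix_(m, r) partial m (fun y => transition c d y ord0 r) x.

End transitions.

Record smooth_manifold (R : realType) (n : nat) := SmoothManifold {
  carrier :> topologicalType;
  atlas : set (chart R n carrier);
  manifold_hausdorff : hausdorff_space carrier;
  manifold_second_countable : @second_countable carrier;
  atlas_cover : forall y, exists2 c, atlas c & cdom c y;
  atlas_smooth : forall c d, atlas c -> atlas d -> forall r,
    smooth_on (overlap c d) (fun x => transition c d x ord0 r)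
}.

(* Tensor fields on M are given by their components in the charts of the
   atlas, as functions on the images of the charts; the components are defined
   up to null sets and are related on overlaps by the tensorial
   transformation law. *)
Section geometry.
Context (R : realType) (n : nat) (M : smooth_manifold R n).
Implicit Types c d : chart R n M.

Definition region (O : set M) c : set 'rV[R]_n :=
  [set x | cimg c x /\ O (cfrom c x)].

Definition neg_def_on (B U : 'M[R]_n) : Prop :=
  forall v : 'rV[R]_n, (v <= U)%MS -> v != 0 -> (v *m B *m v^T) ord0 ord0 < 0.

(* The largest dimension of a subspace (the row space of U) on which the
   bilinear form B is negative definite. *)
Definition has_index (B : 'M[R]_n) (nu : nat) : Prop :=
  (exists2 U : 'M[R]_n, neg_def_on B U & \rank U = nu) /\
  (forall U : 'M[R]_n, neg_def_on B U -> (\rank U <= nu)%N).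

(* (g c x) i j = g(d/dx^i, d/dx^j) in the chart c. *)
Definition bilinear_field := chart R n M -> 'rV[R]_n -> 'M[R]_n.

Record semi_riemannian (nu : nat) (g : bilinear_field) : Prop := {
  metric_law : forall c d, atlas c -> atlas d ->
    {ae leb R n, forall x, overlap c d x ->
      g c x = transition_jac c d x *m g d (transition c d x)
              *m (transition_jac c d x)^T};
  metric_sym : forall c, atlas c ->
    {ae leb R n, forall x, cimg c x -> (g c x)^T = g c x};
  metric_unit : forall c, atlas c ->
    {ae leb R n, forall x, cimg c x -> g c x \in unitmx};
  metric_index : forall c, atlas c ->
    {ae leb R n, forall x, cimg c x -> has_index (g c x) nu};
  metric_Linf : forall c, atlas c -> forall i j,
    Linf_loc (cimg c) (fun x => g c x i j);
  metric_inv_Linf : forall c, atlas c -> forall i j,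
    Linf_loc (cimg c) (fun x => invmx (g c x) i j)
}.

(* (Gamma c x l) j r is the Christoffel symbol Gamma^r_{lj}: the covariant
   derivative of d/dx^j along d/dx^l is the sum over r of
   Gamma^r_{lj} d/dx^r. *)
Definition christoffel := chart R n M -> 'rV[R]_n -> 'I_n -> 'M[R]_n.

(* The Levi-Civita connection of g, in L^p_loc: torsion-free and
   metric-compatible, the derivatives of g being distributional.
   These conditions determine Gamma (a.e.) in each chart, so that the
   transformation law of Christoffel symbols need not be required. *)
Record levi_civita (p : R) (g : bilinear_field) (Gamma : christoffel) : Prop := {
  christoffel_Lp : forall c, atlas c -> forall l j r,
    Lp_loc p (cimg c) (fun x => Gamma c x l j r);
  christoffel_torsion_free : forall c, atlas c ->
    {ae leb R n, forall x, cimg c x ->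
      forall l j r, Gamma c x l j r = Gamma c x j l r};
  christoffel_metric : forall c, atlas c -> forall l i j,
    weak_partial (cimg c) l (fun x => g c x i j)
      (fun x => (Gamma c x l *m g c x + g c x *m (Gamma c x l)^T) i j)
}.

(* (omega c x m) a b = omega^a_b(d/dx^m) in the chart c. *)
Definition matrix_form (N : nat) := chart R n M -> 'rV[R]_n -> 'I_n -> 'M[R]_N.

Definition sign_row (N nu : nat) : 'rV[R]_N :=
  \row_(i < N) (if (i < nu)%N then -1 else 1).

Definition signature (k nu tau : nat) : 'rV[R]_(n + k) :=
  row_mx (sign_row n nu) (sign_row k tau).

Definition so_algebra (N : nat) (s : 'rV[R]_N) (A : 'M[R]_N) : Prop :=
  diag_mx s *m A^T + A *m diag_mx s = 0.

(* omega is a section of class L^p_loc of the bundle of 1-forms on M with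
   values in the Lie algebra o(nu + tau, (n + k) - (nu + tau)). *)
Record so_form (p : R) (nu k tau : nat) (omega : matrix_form (n + k)) : Prop := {
  so_form_law : forall c d, atlas c -> atlas d ->
    {ae leb R n, forall x, overlap c d x -> forall m,
      omega c x m = \sum_(r < n)
        transition_jac c d x m r *: omega d (transition c d x) r};
  so_form_Lp : forall c, atlas c -> forall m a b,
    Lp_loc p (cimg c) (fun x => omega c x m a b);
  so_form_so : forall c, atlas c ->
    {ae leb R n, forall x, cimg c x ->
      forall m, so_algebra (signature k nu tau) (omega c x m)}
}.

Definition bounded_Lp_loc (N : nat) (p : R) (I : Type)
    (omega : I -> matrix_form N) : Prop :=
  forall c, atlas c -> forall K, compact K -> K `<=` cimg c ->
  exists C : R, forall i m a b,
    (\int[leb R n]_(x in K) (`|omega i c x m a b| `^ p)%:E <= C%:E)%E.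

Definition weak_cvg_form (N : nat) (p : R) (omega : nat -> matrix_form N)
    (omega0 : matrix_form N) : Prop :=
  forall c, atlas c -> forall m a b,
  weak_cvg_Lp_loc p (cimg c) (fun j x => omega j c x m a b)
    (fun x => omega0 c x m a b).

(* d omega = omega /\ omega in the sense of distributions, with the convention
   (d omega)(d/dx^i, d/dx^j) = d_i omega_j - d_j omega_i. *)
Definition cartan_system (N : nat) (omega : matrix_form N) : Prop :=
  forall c, atlas c -> forall (i j : 'I_n) (a b : 'I_N) phi,
  test_function (cimg c) phi ->
  \int[leb R n]_(x in cimg c)
    (omega c x i a b * partial j phi x - omega c x j a b * partial i phi x) =
  \int[leb R n]_(x in cimg c)
    ((omega c x i *m omega c x j - omega c x j *m omega c x i) a b * phi x).

(* An orthonormal frame of TM over the open set O. The i-th row of e c x holds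
   the components of the i-th frame vector in the chart c, and
   (De c x m) i r is the distributional derivative along d/dx^m of its r-th
   component. *)
Record orthonormal_frame (p : R) (nu : nat) (g : bilinear_field) (O : set M)
    (e : bilinear_field) (De : christoffel) : Prop := {
  frame_law : forall c d, atlas c -> atlas d ->
    {ae leb R n, forall x, overlap c d x -> O (cfrom c x) ->
      e d (transition c d x) = e c x *m transition_jac c d x};
  frame_orthonormal : forall c, atlas c ->
    {ae leb R n, forall x, region O c x ->
      e c x *m g c x *m (e c x)^T = diag_mx (sign_row n nu)};
  frame_Linf : forall c, atlas c -> forall i r,
    Linf_loc (region O c) (fun x => e c x i r);
  frame_deriv_Lp : forall c, atlas c -> forall m i r,
    Lp_loc p (region O c) (fun x => De c x m i r);
  frame_deriv : forall c, atlas c -> forall m i r,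
    weak_partial (region O c) m (fun x => e c x i r) (fun x => De c x m i r)
}.

(* omega evaluated on the l-th vector of the frame e. *)
Definition form_on_frame (N : nat) (omega : matrix_form N) (e : bilinear_field)
    c (x : 'rV[R]_n) (l : 'I_n) : 'M[R]_N :=
  \sum_(m < n) e c x l m *: omega c x m.

(* Row i: the covariant derivative of the i-th frame vector along the l-th one,
   in chart components; its components in the frame, i.e. its values under the
   dual coframe, are obtained by multiplying by invmx (e c x) on the right. *)
Definition nabla_frame (Gamma : christoffel) (e : bilinear_field)
    (De : christoffel) c (x : 'rV[R]_n) (l : 'I_n) : 'M[R]_n :=
  \sum_(m < n) e c x l m *: (De c x m + e c x *m Gamma c x m).

(* Over O, omega is the connection 1-form, relative to the orthonormal frame e
   of TM and an orthonormal frame of a bundle E with fibre R^k_tau, of a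
   symmetric tensor II with values in E and a metric connection on E:
   II c x alpha i j is the alpha-component of II on the i-th and j-th vectors
   of e, and (nE c x l) alpha beta is the beta-component of the E-derivative of
   the alpha-th vector of the frame of E along the l-th vector of e.
   The indices of E are shifted by n in omega. *)
Definition connection_form_on (nu k tau : nat) (Gamma : christoffel) (O : set M)
    (e : bilinear_field) (De : christoffel) (omega : matrix_form (n + k)) : Prop :=
  exists (II : chart R n M -> 'rV[R]_n -> 'I_k -> 'M[R]_n)
         (nE : chart R n M -> 'rV[R]_n -> 'I_n -> 'M[R]_k),
  forall c, atlas c -> {ae leb R n, forall x, region O c x ->
  let w := form_on_frame omega e c x in
  (forall al, (II c x al)^T = II c x al) /\
  (forall l, nE c x l *m diag_mx (sign_row k tau)
             + diag_mx (sign_row k tau) *m (nE c x l)^T = 0) /\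
  [/\ forall l i j, w l (lshift k i) (lshift k j) =
        (nabla_frame Gamma e De c x l *m invmx (e c x)) i j,
      forall j i al, w j (lshift k i) (rshift n al) = II c x al i j,
      forall l al be, w l (rshift n al) (rshift n be) = nE c x l al be &
      forall l i al, w l (rshift n al) (lshift k i) =
        - (sign_row n nu ord0 i * sign_row k tau ord0 al
           * w l (lshift k i) (rshift n al))]}.

End geometry.

(* Main.v *)
Require Import Defs.
From HB Require Import structures.
From mathcomp Require Import all_boot all_order all_algebra.
From mathcomp Require Import all_classical all_reals all_analysis.
From mathcomp Require Import measurable_realfun ring lra.
Set Implicit Arguments.
Unset Strict Implicit.
Unset Printing Implicit Defensive.
Import Order.TTheory GRing.Theory Num.Theory.
Import numFieldNormedType.Exports.
Local Open Scope classical_set_scope.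
Local Open Scope ring_scope.

(* Local L^p bounds give a subsequence whose components converge weakly in every
   chart: in a countable atlas by a diagonal argument on the integrals over dyadic
   cells (for p > 1 these determine the integrals over all measurable sets), and
   in the other charts by the change of variables along the transition maps.
   Linear conditions with bounded coefficients pass to weak limits, so that the
   point is the quadratic term W /\ W tested against phi.

   Mollify W at the scales h = 2^-k with kernels K k such that K k.+1 - K k is the
   divergence of kernels of size O(h). Since the exterior derivative is tested only
   through differences d_i W_m - d_m W_i, after an integration by parts the change
   of the integral of phi (W_k /\ W_k) from one scale to the next involves W and
   dW = W /\ W, but no other derivative of W. As dW is bounded in L^1 because
   p >= 2, it gains a factor h; where this pointwise gain is lost one uses the
   integrability of |W|^p with p > 2. The change is O(2^-(k delta)) uniformly along
   the sequence, while at a fixed scale the mollified forms converge pointwise and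
   boundedly. Hence the quadratic terms converge to that of the limit. *)

(** * Dyadic cells and Lebesgue measure *)

(** Only the combinations d_i W_m - d_m W_i are controlled. The divergence of W is free, so W need
    not converge strongly and products of its entries need not converge one by one; only
    antisymmetrised products do. W /\ W is a sum over c of wedges of the scalar forms W^a_c and
    W^c_b, and the argument treats each summand. From one scale to the next, a mollified scalar form
    a changes by minus the differential of a function f of size O(h), up to a term in da. Tested
    against phi and a second form eta, this leaves terms like h |da| |eta|, where da is controlled
    by |W|^2 only: for p < 3 such cubic terms have no uniform bound. The same terms are also of the
    order of |W|^2 at most, without gain. Interpolating at the level L = 2^(k/(p-1)) gives the rate
    2^(-k(p-2)/(p-1)), whence p > 2. Weak limits are obtained as Radon-Nikodym densities of limits
    of set functions, and the change of variables also goes through a density: its boundedness,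
    which suffices, follows from the Lipschitz continuity of the inverse map. *)

Section dyadic_cells.
Context (R : realType) (n : nat).
Implicit Types (x y : 'rV[R]_n) (k : nat).

(** Dyadic sets are represented as preimages under this index rather than as subsets: cells of one
    generation are then disjoint by construction, there are countably many of them, and they are
    half-open in each coordinate. *)
Definition cell k x : 'rV[int]_n := \row_i Num.floor (2 ^+ k * x ord0 i).

Lemma rV_ballP x (e : R) y : 0 < e ->
  (forall i, `|x ord0 i - y ord0 i| < e) -> ball x e y.
Proof.
move=> e0 h; split => // i j; rewrite ord1; exact: h.
Qed.

Lemma ball_rVP x (e : R) y i : ball x e y -> `|x ord0 i - y ord0 i| < e.
Proof. by case=> _ /(_ ord0 i). Qed.

Lemma cellP k x y i : cell k x = cell k y -> `|x ord0 i - y ord0 i| < 2 ^- k.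
Proof.
move=> /rowP/(_ i); rewrite !mxE => xy.
have k0 : 0 < 2 ^+ k :> R by rewrite exprn_gt0.
have := floor_itv (2 ^+ k * x ord0 i).
have := floor_itv (2 ^+ k * y ord0 i).
rewrite xy => /andP[a b] /andP[c d].
rewrite -(ltr_pM2l k0) divff ?gt_eqF// -{1}(gtr0_norm k0) -normrM mulrBr ltr_norml.
move: b d; rewrite intrD; lra.
Qed.

Lemma cell_small x (e : R) : 0 < e ->
  exists k, forall l y, (k <= l)%N -> cell l y = cell l x -> ball x e y.
Proof.
move=> e0; have [k _ ke] := near_infty_natSinv_lt (PosNum e0).
exists k => l y kl yx; apply: rV_ballP => // i.
apply: lt_trans (cellP i (esym yx)) _.
apply: le_lt_trans (ke k _); last by rewrite /=.
rewrite /= lef_pV2 ?posrE ?exprn_gt0// -natrX ler_nat.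
by rewrite (leq_ltn_trans kl)// ltn_expl.
Qed.

(** The coarse index is a function of the fine one: floor (2^k z) is the floor of floor (2^l z) /
    2^(l - k). *)
Lemma cell_le k l x y : (k <= l)%N -> cell l x = cell l y -> cell k x = cell k y.
Proof.
move=> kl /rowP xy; apply/rowP => i; have := xy i; rewrite !mxE => xyi.
have H (z : R) : Num.floor (2 ^+ k * z) =
    Num.floor ((Num.floor (2 ^+ l * z))%:~R / (2 ^+ (l - k)) : R).
  have lk0 : 0 < 2 ^+ (l - k) :> R by rewrite exprn_gt0.
  have -> : 2 ^+ k * z = 2 ^+ l * z / 2 ^+ (l - k).
    by rewrite -{1}(subnK kl) exprD; field; rewrite gt_eqF.
  set t := 2 ^+ l * z.
  apply/esym/floor_def/andP; split.
    rewrite ler_pdivlMr//.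
    have -> : 2 ^+ (l - k) = (2 ^+ (l - k))%:~R :> R by rewrite rmorphXn.
    rewrite -intrM ler_int floor_ge_int intrM rmorphXn/= -ler_pdivlMr//.
    exact: floor_le.
  rewrite ltr_pdivrMr// (le_lt_trans (floor_le _))// -ltr_pdivrMr//.
  exact: floorD1_gt.
by rewrite H [RHS]H xyi.
Qed.

Lemma measurable_coord_all (A : 'I_n -> set R) : (forall i, measurable (A i)) ->
  measurable [set x : 'rV[R]_n | forall i, A i (x ord0 i)].
Proof.
move=> mA; rewrite (_ : [set x | _] = \bigcap_(i in setT) (@rV_coord R n i @^-1` A i)).
  apply: fin_bigcap_measurable => // i _; rewrite -[X in measurable X]setTI.
  exact: (measurable_rV_coord _ measurableT (mA i)).
by apply/seteqP; split => [x h i _|x h i]; [exact: h|exact: (h i I)].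
Qed.

Lemma measurable_cell1 k z : measurable [set x | cell k x = z].
Proof.
have -> : [set x : 'rV[R]_n | cell k x = z] =
    [set x : 'rV[R]_n | forall i, [set t : R | Num.floor (2 ^+ k * t) = z ord0 i] (x ord0 i)].
  apply/seteqP; split => [x <- i|x h]; first by rewrite /= mxE.
  by apply/rowP => i; rewrite mxE h.
apply: (@measurable_coord_all (fun i => [set t : R | Num.floor (2 ^+ k * t) = z ord0 i])) => i.
have k0 : 0 < 2 ^+ k :> R by rewrite exprn_gt0.
rewrite (_ : [set t | _] = `[(z ord0 i)%:~R / 2 ^+ k, ((z ord0 i) + 1)%:~R / 2 ^+ k[%classic); first exact: measurable_itv.
apply/seteqP; split => [t /= <-|t /=]; rewrite in_itv/=.
  rewrite ler_pdivrMr// ltr_pdivlMr// [t * _]mulrC.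
  by have := floor_itv (2 ^+ k * t).
rewrite ler_pdivrMr// ltr_pdivlMr// [t * _]mulrC => h.
exact: floor_def.
Qed.

Lemma measurable_cell k (P : set 'rV[int]_n) : measurable [set x | P (cell k x)].
Proof.
rewrite (_ : [set x | _] = \bigcup_(z in P) [set x | cell k x = z]); last first.
  apply/seteqP; split => [x Px|x [z Pz /= xz]]; [by exists (cell k x)|by rewrite xz].
rewrite bigcup_mkcond.
apply: (@countable_bigcupT_measurable _ _ 'rV[int]_n) => [|z]; first exact: countableP.
by case: ifP => // _; exact: measurable_cell1.
Qed.

(** An open set is the union of the cells that it contains. This connects the topology with the
    sigma-algebra, which is generated by the coordinates. *)
Lemma open_measurable_rV (A : set 'rV[R]_n) : open A -> measurable A.
Proof.
move=> oA.
rewrite (_ : A = \bigcup_k [set x | [set z | forall y, cell k y = z -> A y] (cell k x)]).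
  by apply: bigcupT_measurable => k; exact: measurable_cell.
apply/seteqP; split => [x Ax|x [k _ /=]]; last exact.
have /nbhs_ballP[e /= e0 he] : nbhs x A by exact: open_nbhs_nbhs.
have [k kP] := cell_small x e0; exists k => //= y yx; apply: he.
exact: (kP k).
Qed.

Lemma closed_measurable_rV (A : set 'rV[R]_n) : closed A -> measurable A.
Proof.
move=> /closed_openC/open_measurable_rV/measurableC; by rewrite setCK.
Qed.

Lemma compact_measurable_rV (A : set 'rV[R]_n) : compact A -> measurable A.
Proof.
move=> cA; apply: closed_measurable_rV; apply: compact_closed => //.
Qed.

Lemma continuous_on_measurable_rV (A : set 'rV[R]_n) (f : 'rV[R]_n -> R) :
  open A -> (forall x, A x -> {for x, continuous f}) -> measurable_fun A f.
Proof.
move=> oA cf; apply: (@measurability _ _ _ _ _ _ (@RGenOpens.G R) (RGenOpens.measurableE R)).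
move=> _ [_ [a [b ->] <-]].
apply: open_measurable_rV.
rewrite openE => x [Ax fx].
apply: filterI; first exact: open_nbhs_nbhs.
apply: cf => //; apply: open_nbhs_nbhs; split => //.
Qed.

Lemma continuous_measurable_rV (f : 'rV[R]_n -> R) :
  continuous f -> measurable_fun setT f.
Proof. by move=> cf; apply: (@continuous_on_measurable_rV [set: 'rV[R]_n]) => [|x _]; [exact: openT|exact: cf]. Qed.

End dyadic_cells.

(** * Tonelli, product sets and translation invariance for [leb] *)

Section leb_formulas.
Context (R : realType).
Local Open Scope ereal_scope.

Lemma ge0_integral_leb_step n (f : 'rV[R]_n.+1 -> \bar R) :
  measurable_fun [set: 'rV[R]_n.+1] f -> (forall x, 0 <= f x) ->
  \int[leb R n.+1]_x f x =
  \int[lebesgue_measure]_a \int[leb R n]_y f (rV_cons (a, y)).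
Proof.
move=> mf f0.
transitivity (\int[pushforward (@lebesgue_measure R \x leb R n) (@rV_cons R n)]_x f x).
  by apply: eq_measure_integral => [|A mA _]; [exact: measurable_rV_cons|].
rewrite (ge0_integral_pushforward (@measurable_rV_cons R n))//=.
rewrite preimage_setT fubini_tonelli1//.
by apply: measurableT_comp => //; exact: measurable_rV_cons.
Qed.

Lemma rV_cons0 n (p : measurableTypeR R * 'rV[R]_n) : rV_cons p ord0 ord0 = p.1.
Proof. by rewrite -{2}(rV_consK p). Qed.

Lemma rV_cons_lift n (p : measurableTypeR R * 'rV[R]_n) i :
  rV_cons p ord0 (lift ord0 i) = p.2 ord0 i.
Proof.
rewrite (_ : lift ord0 i = rshift 1 i); last exact/val_inj.
by rewrite (@row_mxEr R 1 1 n (p.1)%:M p.2 ord0 i).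
Qed.

Lemma measurable_prod_coord n (f : 'I_n -> R -> R) :
  (forall i, measurable_fun setT (f i)) ->
  measurable_fun setT (fun x : 'rV[R]_n => (\prod_i f i (x ord0 i))%R).
Proof.
move=> mf; apply: measurable_prod => i _.
by apply: (measurableT_comp (mf i)); exact: measurable_rV_coord.
Qed.

Lemma integral_leb_prod n (f : 'I_n -> R -> R) (c : 'I_n -> R) :
  (forall i, measurable_fun setT (f i)) -> (forall i t, (0 <= f i t)%R) ->
  (forall i, \int[lebesgue_measure]_t (f i t)%:E = (c i)%:E) ->
  \int[leb R n]_x (\prod_i f i (x ord0 i))%:E = (\prod_i c i)%:E.
Proof.
elim: n f c => [|n IH] f c mf f0 fc.
  rewrite /leb integral_dirac//= ?big_ord0 ?diracT ?mul1e//.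
  by apply/measurable_EFinP; exact: measurable_prod_coord.
rewrite ge0_integral_leb_step; last 2 first.
- by apply/measurable_EFinP; exact: measurable_prod_coord.
- by move=> x; rewrite lee_fin prodr_ge0.
rewrite big_ord_recl.
under eq_integral => a _.
  under eq_integral => y _.
    rewrite big_ord_recl rV_cons0 /=.
    under eq_bigr do rewrite rV_cons_lift/=.
    rewrite EFinM; over.
  rewrite ge0_integralZl//; last 3 first.
  - by apply/measurable_EFinP; exact: (@measurable_prod_coord n (fun i => f (lift ord0 i))).
  - by move=> y _; rewrite lee_fin prodr_ge0.
  - by rewrite lee_fin.
  rewrite (IH (fun i => f (lift ord0 i)) (fun i => c (lift ord0 i)))//.
  over.
rewrite ge0_integralZr//; last 3 first.
- by apply/measurable_EFinP; exact: mf.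
- by move=> y _; rewrite lee_fin.
- rewrite lee_fin; apply: prodr_ge0 => i _; rewrite -lee_fin -fc.
  by apply: integral_ge0 => t _; rewrite lee_fin.
by rewrite fc EFinM.
Qed.

Lemma measurable_box n (a b : 'I_n -> R) :
  measurable [set x : 'rV[R]_n | forall i, (a i <= x ord0 i <= b i)%R].
Proof.
rewrite (_ : [set x | _] = [set x : 'rV[R]_n | forall i, `[a i, b i]%classic (x ord0 i)]).
  by apply: (@measurable_coord_all R n (fun i => `[a i, b i]%classic)) => i; exact: measurable_itv.
by apply/seteqP; split => x /= h i; have := h i; rewrite in_itv.
Qed.

Lemma leb_prod_set n (A : 'I_n -> set R) (c : 'I_n -> R) :
  (forall i, measurable (A i)) -> (forall i, lebesgue_measure (A i) = (c i)%:E) ->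
  leb R n [set x | forall i, A i (x ord0 i)] = (\prod_i c i)%:E.
Proof.
move=> mA Ac; rewrite -(@integral_leb_prod n (fun i => \1_(A i)) c)//.
- have mB := measurable_coord_all mA.
  rewrite -[LHS]mul1e -integral_cst// integral_mkcond.
  apply: eq_integral => x _; rewrite patchE.
  case: ifPn => [/set_mem/= h|/negP h].
    by rewrite big1// => i _; rewrite indicE mem_set.
  have [i hi] : exists i, ~ A i (x ord0 i).
    by apply/existsNP => H; apply: h; exact: mem_set.
  by rewrite (bigD1 i)//= indicE memNset ?mul0r.
- move=> i; rewrite integral_indic//=; last exact: mA.
  by rewrite setIT; exact: Ac.
Qed.

Lemma leb_box n (a b : 'I_n -> R) : (forall i, (a i <= b i)%R) ->
  leb R n [set x | forall i, (a i <= x ord0 i <= b i)%R] = (\prod_i (b i - a i))%:E.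
Proof.
move=> ab; rewrite -(@leb_prod_set n (fun i => `[a i, b i]%classic))//.
move=> i; rewrite lebesgue_measure_itv/= lte_fin.
  case: ltP => //; rewrite le_eqVlt ltNge ab orbF => /eqP ->.
  by rewrite subrr.
Qed.

(** The image of Lebesgue measure under the shift takes the right values on the intervals []c, d]],
    hence is Lebesgue measure. *)
Lemma lebesgue_shift (a : R) (f : R -> \bar R) : measurable_fun [set: measurableTypeR R] f ->
  (forall x, 0 <= f x) ->
  \int[lebesgue_measure]_x f (x + a)%R = \int[lebesgue_measure]_x f x.
Proof.
move=> mf f0.
have ms : measurable_fun (setT : set (measurableTypeR R)) (fun x : measurableTypeR R => (x + a)%R : measurableTypeR R).
  exact: measurable_funD.
rewrite -(@ge0_integral_pushforward _ _ (measurableTypeR R) (measurableTypeR R) R _ ms lebesgue_measure setT f)//.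
apply: eq_measure_integral => A mA _.
rewrite -lebesgue_measure_unique//.
move=> _ [[c d]/= _ <-].
rewrite /pushforward.
rewrite (_ : _ @^-1` _ = `](c - a)%R, (d - a)%R]%classic); last first.
  by apply/seteqP; split => x /=; rewrite !in_itv/= => /andP[? ?]; apply/andP; split; lra.
rewrite /= !lebesgue_measure_itv/= !lte_fin.
rewrite ltrD2r; case: ifP => // _; by rewrite -!EFinD; congr EFin; lra.
Qed.

Lemma measurable_shift n (a : 'rV[R]_n) : measurable_fun setT (fun x : 'rV[R]_n => (x + a)%R).
Proof.
apply: measurable_fun_rVP => i.
rewrite (_ : _ \o _ = fun x => (@rV_coord R n i x + a ord0 i)%R); last first.
  by apply/funext => x /=; rewrite /rV_coord mxE.
apply: measurable_funD => //; exact: measurable_rV_coord.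
Qed.

Lemma ge0_integral_leb_shift n (a : 'rV[R]_n) (f : 'rV[R]_n -> \bar R) :
  measurable_fun [set: 'rV[R]_n] f -> (forall x, 0 <= f x) ->
  \int[leb R n]_x f (x + a)%R = \int[leb R n]_x f x.
Proof.
elim: n a f => [|n IH] a f mf f0.
  by apply: eq_integral => x _; congr f; apply/rowP => -[].
rewrite (ge0_integral_leb_step mf f0).
rewrite ge0_integral_leb_step; [|by apply: (measurableT_comp mf); exact: measurable_shift|by move=> x; exact: f0].
pose F b := \int[leb R n]_y f (rV_cons (b, y)).
have mF : measurable_fun setT F.
  apply: (@measurable_fun_fubini_tonelli_F _ _ (measurableTypeR R) 'rV[R]_n R (leb R n) (fun z => f (rV_cons z))) => //.
  by apply: measurableT_comp => //; exact: measurable_rV_cons.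
rewrite -(@lebesgue_shift (a ord0 ord0) F mF); last by move=> x; exact: integral_ge0.
apply: eq_integral => b _.
rewrite /F -[RHS](IH (rV_uncons a).2)//; last first.
  apply: measurableT_comp => //.
  apply: (measurableT_comp (@measurable_rV_cons R n)).
  exact: pair1_measurable.
apply: eq_integral => y _; congr f; apply/rowP => i.
rewrite mxE; case: (unliftP ord0 i) => [j ->|->].
  have H (z : R) (t : 'rV[R]_n) : rV_cons (z, t) 0%R (lift ord0 j) = t ord0 (j : 'I_n) := rV_cons_lift (z, t) j.
  rewrite !H !mxE; congr (_ + a _ _)%R; exact/val_inj.
have H (z : R) (t : 'rV[R]_n) : rV_cons (z, t) 0%R ord0 = z := rV_cons0 (z, t).
by rewrite !H.
Qed.

Lemma leb_compact_lty n (K : set 'rV[R]_n) : compact K -> leb R n K < +oo.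
Proof.
move=> cK.
have [M [_ hM]] := compact_bounded cK.
pose m := (Num.max 1 (M + 1))%R.
have Mm : (M < m)%R by rewrite lt_max ltrDl ltr01 orbT.
have m0 : (0 <= m)%R by rewrite le_max ler01.
apply: (@le_lt_trans _ _ (leb R n [set x | forall i, (- m <= x ord0 i <= m)%R])).
  apply: le_measure; rewrite ?inE.
  - exact: compact_measurable_rV.
  - exact: measurable_box.
  - move=> x Kx i.
    have := hM m Mm x Kx; rewrite /Num.norm/= mx_normrE => h.
    rewrite -ler_norml; apply: le_trans h.
    by apply/bigmax_geP; right => /=; exists (ord0, i).
by rewrite leb_box ?ltry// => i; rewrite ge0_cp.
Qed.

End leb_formulas.

(** * Elementary inequalities with a free level *)

Section powR_inequalities.
Context (R : realType).
Implicit Types x y l p : R.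

(** Above the level l, write x = x^(1 - p) x^p with a nonpositive exponent 1 - p. Integrated, this
    is the uniform integrability of an L^p-bounded family; optimised in l, it is Jensen's inequality
    up to a constant. *)
Lemma le_powR_split p l x : 1 <= p -> 0 < l -> 0 <= x ->
  x <= l + l `^ (1 - p) * x `^ p.
Proof.
move=> p1 l0 x0; have [xl|/ltW lx] := leP x l.
  by rewrite (le_trans xl)// lerDl mulr_ge0// powR_ge0.
rewrite ler_wpDl ?(ltW l0)// -(mulr_powRB1 x0); last by lra.
rewrite mulrCA ler_peMr// -(opprB p 1) powRN mulrC ler_pdivlMr ?powR_gt0// mul1r.
by apply: ge0_ler_powR; rewrite ?nnegrE ?subr_ge0// ltW.
Qed.

(** If y >= l, the maximum m of x and y is at least l, and x y <= m^2 = m^(2 - p) m^p <= l^(2 - p)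
    m^p. The factor l^(2 - p), which tends to 0 as l grows when p > 2, is the source of decay in the
    sequel. *)
Lemma le_mul_split p l x y : 2 <= p -> 0 < l -> 0 <= x -> 0 <= y ->
  x * y <= l * x + l `^ (2 - p) * (x `^ p + y `^ p).
Proof.
move=> p2 l0 x0 y0; have [yl|/ltW ly] := leP y l.
  rewrite ler_wpDr//; first by rewrite mulr_ge0 ?addr_ge0 ?powR_ge0.
  by rewrite mulrC ler_wpM2r.
rewrite ler_wpDl ?mulr_ge0 ?(ltW l0)//.
set m := Num.max x y.
have m0 : 0 <= m by rewrite le_max x0.
have lm : l <= m by rewrite le_max ly orbT.
have mp : m `^ p <= x `^ p + y `^ p.
  by rewrite /m; case: (leP x y) => _; rewrite ?lerDl ?lerDr powR_ge0.
apply: (@le_trans _ _ (m * m)).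
  by rewrite ler_pM// le_max lexx ?orbT.
apply: (@le_trans _ _ (l `^ (2 - p) * m `^ p)); last first.
  by rewrite ler_wpM2l// powR_ge0.
have mgt0 : 0 < m := lt_le_trans l0 lm.
have -> : m * m = m `^ 2 by rewrite powR_mulrn// expr2.
rewrite {1}(_ : 2 = p + (2 - p)); last by lra.
rewrite powRD; last by apply/implyP => _; rewrite gt_eqF.
rewrite mulrC ler_wpM2r ?powR_ge0// -(opprB p 2) !powRN lef_pV2 ?posrE ?powR_gt0//.
by apply: ge0_ler_powR; rewrite ?nnegrE ?subr_ge0// ltW.
Qed.

(** Compare y with l x^(p - 1): below it the first term dominates, above it the second. This is
    Young's inequality with a parameter, the sharp constants being given up. *)
Lemma young_split p l x y : 1 < p -> 0 < l -> 0 <= x -> 0 <= y ->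
  x * y <= l * x `^ p + l `^ (- (p - 1)^-1) * y `^ (p / (p - 1)).
Proof.
move=> p1 l0 x0 y0.
have p10 : 0 < p - 1 by lra.
have [yt|/ltW ty] := leP y (l * x `^ (p - 1)).
  rewrite ler_wpDr//; first by rewrite mulr_ge0 ?powR_ge0.
  by rewrite -(mulr_powRB1 x0); [rewrite mulrCA ler_wpM2l|lra].
rewrite ler_wpDl//; first by rewrite mulr_ge0 ?powR_ge0// ltW.
have -> : p / (p - 1) = (p - 1)^-1 + 1 by field; rewrite gt_eqF.
have [->|y_neq0] := eqVneq y 0.
  by rewrite mulr0 mulr_ge0 ?powR_ge0.
rewrite powRD; last by apply/implyP.
rewrite powRr1// mulrA ler_wpM2r//.
rewrite powRN mulrC ler_pdivlMr ?powR_gt0//.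
have -> : x = (x `^ (p - 1)) `^ (p - 1)^-1.
  by rewrite -powRrM divff ?gt_eqF// powRr1.
rewrite mulrC -powRM ?powR_ge0 ?(ltW l0)//.
by apply: ge0_ler_powR; rewrite ?nnegrE ?invr_ge0 ?mulr_ge0 ?powR_ge0 ?(ltW l0) ?(ltW p10).
Qed.

Lemma powR_addle p x y : 1 <= p -> 0 <= x -> 0 <= y ->
  (x + y) `^ p <= 2 `^ p * (x `^ p + y `^ p).
Proof.
move=> p1 x0 y0; set m := Num.max x y.
have m0 : 0 <= m by rewrite le_max x0.
have mp : m `^ p <= x `^ p + y `^ p.
  by rewrite /m; case: (leP x y) => _; rewrite ?lerDl ?lerDr powR_ge0.
apply: (@le_trans _ _ ((2 * m) `^ p)).
  apply: ge0_ler_powR; rewrite ?nnegrE ?addr_ge0 ?mulr_ge0//; first by lra.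
  by rewrite mulr_natl mulr2n lerD// le_max lexx ?orbT.
by rewrite powRM// ler_wpM2l// powR_ge0.
Qed.

End powR_inequalities.

Lemma eq_cvgn (R : realType) (f g : nat -> R) (a b : R) :
  (forall j, f j = g j) -> a = b -> f @ \oo --> a -> g @ \oo --> b.
Proof. by move=> /funext -> ->. Qed.

Lemma cvgn_sum (R : realType) (J : Type) (s : seq J) (f : J -> nat -> R) (a : J -> R) :
  (forall i, f i @ \oo --> a i) ->
  (fun j => \sum_(i <- s) f i j) @ \oo --> \sum_(i <- s) a i.
Proof.
move=> fa; elim: s => [|i s IH].
  apply: (@eq_cvgn _ (fun=> 0)) (cvg_cst _); rewrite ?big_nil// => j.
  by rewrite big_nil.
rewrite big_cons; apply: eq_cvgn (cvgD (fa i) IH) => // j.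
by rewrite big_cons.
Qed.

Section real_integrals.
Context d (T : measurableType d) (R : realType) (mu : {measure set T -> \bar R}).
Implicit Types (D : set T) (f g : T -> R).

Lemma le_integrableR D f g : measurable D -> measurable_fun D f ->
  mu.-integrable D (EFin \o g) -> (forall x, D x -> `|f x| <= g x) ->
  mu.-integrable D (EFin \o f).
Proof.
move=> mD mf ig fg; apply: le_integrable ig => //; first exact/measurable_EFinP.
move=> x Dx /=; rewrite lee_fin (le_trans (fg x Dx))//; exact: ler_norm.
Qed.

Lemma le_norm_Rintegral D f g : measurable D -> measurable_fun D f ->
  mu.-integrable D (EFin \o g) -> (forall x, D x -> `|f x| <= g x) ->
  `|\int[mu]_(x in D) f x| <= \int[mu]_(x in D) g x.
Proof.
move=> mD mf ig fg; have if_ := le_integrableR mD mf ig fg.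
apply: le_trans (le_normr_Rintegral mD if_) _.
by apply: le_Rintegral => //; exact: integrable_norm.
Qed.

Lemma RintegralE D f : mu.-integrable D (EFin \o f) -> measurable D ->
  (\int[mu]_(x in D) (f x)%:E = (\int[mu]_(x in D) f x)%:E)%E.
Proof. by move=> if_ mD; rewrite /Rintegral fineK// integrable_fin_num. Qed.

Lemma Rintegral_sum D (J : Type) (s : seq J) (F : J -> T -> R) : measurable D ->
  (forall i, mu.-integrable D (EFin \o F i)) ->
  \int[mu]_(x in D) (\sum_(i <- s) F i x) = \sum_(i <- s) \int[mu]_(x in D) F i x.
Proof.
move=> mD iF; elim: s => [|i s IH].
  rewrite big_nil; under eq_Rintegral do rewrite big_nil.
  by rewrite Rintegral_cst// mul0r.
rewrite big_cons; under eq_Rintegral do rewrite big_cons.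
rewrite RintegralD// ?IH//.
rewrite (_ : _ \o _ = fun x => (\sum_(i <- s) (EFin \o F i) x)%E); last first.
  by apply/funext => x /=; rewrite sumEFin.
exact: integrable_sum.
Qed.

Lemma integrable_sumR D (J : Type) (s : seq J) (F : J -> T -> R) : measurable D ->
  (forall i, mu.-integrable D (EFin \o F i)) ->
  mu.-integrable D (EFin \o (fun x => \sum_(i <- s) F i x)).
Proof.
move=> mD iF.
rewrite (_ : _ \o _ = fun x => (\sum_(i <- s) (EFin \o F i) x)%E); last first.
  by apply/funext => x /=; rewrite sumEFin.
exact: integrable_sum.
Qed.

Lemma integrable_powR D f p : measurable D -> measurable_fun D f ->
  (\int[mu]_(x in D) (`|f x| `^ p)%:E < +oo)%E ->
  mu.-integrable D (EFin \o (fun x => `|f x| `^ p)).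
Proof.
move=> mD mf fp; apply/integrableP; split.
  apply/measurable_EFinP.
  apply: (measurableT_comp (measurable_powR p)).
  exact: measurableT_comp.
under eq_integral do rewrite /= ger0_norm ?powR_ge0//.
exact: fp.
Qed.

Lemma integrable_cstR D r : measurable D -> (mu D < +oo)%E ->
  mu.-integrable D (EFin \o (fun=> r)).
Proof.
move=> mD Doo; apply: measurable_bounded_integrable => //.
by exists `|r|; split => // M rM x _ /=; exact: ltW.
Qed.

Lemma integrableZR D r f : measurable D -> mu.-integrable D (EFin \o f) ->
  mu.-integrable D (EFin \o (fun x => r * f x)).
Proof.
move=> mD if_; rewrite (_ : _ \o _ = fun x => (r%:E * (EFin \o f) x)%E)//.
exact: integrableZl.
Qed.

Lemma integrableDR D f g : measurable D -> mu.-integrable D (EFin \o f) ->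
  mu.-integrable D (EFin \o g) -> mu.-integrable D (EFin \o (fun x => f x + g x)).
Proof.
move=> mD if_ ig; rewrite (_ : _ \o _ = (EFin \o f) \+ (EFin \o g))%E//.
exact: integrableD.
Qed.

Lemma integrableBR D f g : measurable D -> mu.-integrable D (EFin \o f) ->
  mu.-integrable D (EFin \o g) -> mu.-integrable D (EFin \o (fun x => f x - g x)).
Proof.
move=> mD if_ ig; rewrite (_ : _ \o _ = (EFin \o f) \- (EFin \o g))%E//.
exact: integrableB.
Qed.

Lemma dominated_cvg_Rintegral D (f_ : nat -> T -> R) f g : measurable D ->
  (forall j, measurable_fun D (f_ j)) -> measurable_fun D f ->
  (forall x, D x -> (f_ ^~ x) @ \oo --> f x) ->
  mu.-integrable D (EFin \o g) -> (forall j x, D x -> `|f_ j x| <= g x) ->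
  (fun j => \int[mu]_(x in D) f_ j x) @ \oo --> \int[mu]_(x in D) f x.
Proof.
move=> mD mf_ mf fcvg ig fg.
have [|||||_ _ H] := @dominated_convergence _ _ _ mu D mD (fun j => EFin \o f_ j) (EFin \o f) (EFin \o g).
- by move=> j; exact/measurable_EFinP.
- exact/measurable_EFinP.
- apply/nearW => x Dx; apply/fine_cvgP; split; first by apply: nearW.
  exact: fcvg.
- by [].
- by apply/nearW => x j Dx /=; rewrite lee_fin fg.
have if_ : mu.-integrable D (EFin \o f).
  apply: (le_integrableR mD mf ig) => x Dx.
  by apply: (cvgr_to_le (cvg_norm (fcvg x Dx))); apply: nearW => j; exact: fg.
by move: H; rewrite -[X in _ --> X]fineK ?integrable_fin_num// => /fine_cvgP[_].
Qed.

Lemma dominated_cvg0_Rintegral D (f_ : nat -> T -> R) g : measurable D ->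
  (forall j, measurable_fun D (f_ j)) ->
  (forall x, D x -> (f_ ^~ x) @ \oo --> 0) ->
  mu.-integrable D (EFin \o g) -> (forall j x, D x -> `|f_ j x| <= g x) ->
  (fun j => \int[mu]_(x in D) f_ j x) @ \oo --> 0.
Proof.
move=> mD mf_ fcvg ig fg.
have := @dominated_cvg_Rintegral D f_ (fun=> 0) g mD mf_.
by rewrite Rintegral_cst// mul0r; apply => //.
Qed.

End real_integrals.

(** * Weak limits in L^p *)

Section setwise_convergence.
Context d (T : measurableType d) (R : realType) (mu : {measure set T -> \bar R}).
Implicit Types (D : set T) (f g psi : T -> R).

(** Integrals of p-th powers are bounded instead of norms, as in [bounded_Lp_loc]. Measurability is
    required on D alone, since components of forms are known to be measurable only on the image of a
    chart. *)
Definition Lp_le D (p : R) f (C : R) :=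
  measurable_fun D f /\ (\int[mu]_(x in D) (`|f x| `^ p)%:E <= C%:E)%E.

Lemma Lp_le_integrable D p f C : measurable D -> Lp_le D p f C ->
  mu.-integrable D (EFin \o (fun x => `|f x| `^ p)).
Proof.
by move=> mD [mf fC]; apply: integrable_powR => //; apply: le_lt_trans fC _; rewrite ltry.
Qed.

Lemma Lp_le_Rintegral D p f C : measurable D -> Lp_le D p f C ->
  \int[mu]_(x in D) (`|f x| `^ p) <= C.
Proof.
move=> mD fC; rewrite -lee_fin -RintegralE//; [exact: fC.2|exact: Lp_le_integrable fC].
Qed.

Lemma Lp_le_L1 D p f C : measurable D -> (mu D < +oo)%E -> 1 <= p ->
  Lp_le D p f C -> mu.-integrable D (EFin \o f).
Proof.
move=> mD Doo p1 fC.
have ig := Lp_le_integrable mD fC.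
apply: (@le_integrableR _ _ _ _ D f (fun x => 1 + `|f x| `^ p)) => //.
- exact: fC.1.
- by apply: integrableDR => //; exact: integrable_cstR.
- move=> x _; have := le_powR_split p1 ltr01 (normr_ge0 (f x)).
  by rewrite powR1 mul1r.
Qed.

Lemma Lp_le_unif_integrable D p f C l A : measurable D -> (mu D < +oo)%E ->
  1 <= p -> 0 < l -> Lp_le D p f C -> measurable A ->
  \int[mu]_(x in D `&` A) `|f x| <= l * fine (mu (D `&` A)) + l `^ (1 - p) * C.
Proof.
move=> mD Doo p1 l0 fC mA.
have mDA : measurable (D `&` A) by exact: measurableI.
have sDA : D `&` A `<=` D by exact: subIsetl.
have DAoo : (mu (D `&` A) < +oo)%E by apply: le_lt_trans Doo; apply: le_measure; rewrite ?inE.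
have ig := Lp_le_integrable mD fC.
have ig' := integrableS mD mDA sDA ig.
have i1 := Lp_le_L1 mD Doo p1 fC.
have il : mu.-integrable (D `&` A) (EFin \o (fun x => l `^ (1 - p) * `|f x| `^ p)).
  exact: integrableZR.
apply: (@le_trans _ _ (\int[mu]_(x in D `&` A) (l + l `^ (1 - p) * `|f x| `^ p))).
  apply: le_Rintegral => //.
  - by apply: integrable_norm => //; exact: integrableS i1.
  - by apply: integrableDR => //; exact: integrable_cstR.
  - move=> x _; exact: le_powR_split.
rewrite RintegralD//; last exact: integrable_cstR.
rewrite Rintegral_cst// lerD2l RintegralZl// ler_wpM2l ?powR_ge0//.
apply: le_trans (Lp_le_Rintegral mD fC).
rewrite -lee_fin -!RintegralE//; apply: ge0_subset_integral => //.
  by apply/measurable_EFinP/measurable_EFinP; exact: measurable_int ig.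
Qed.

(** The sum is eta times the integer part of t / eta, a staircase approximating t from below; N only
    has to be large enough for the steps to reach t. *)
Lemma sum_layer (eta t : R) N : 0 < eta -> 0 <= t <= N%:R * eta ->
  0 <= t - \sum_(i < N) (eta * (i.+1%:R * eta <= t)%R%:R) <= eta.
Proof.
move=> eta0; elim: N => [|N IH] /andP[t0 tN].
  by rewrite big_ord0 subr0 t0 (le_trans tN)// mul0r ltW.
have H : N%:R * eta <= t -> \sum_(i < N) (eta * (i.+1%:R * eta <= t)%R%:R) = N%:R * eta.
  move=> Nt; rewrite (eq_bigr (fun=> eta)).
    by rewrite sumr_const card_ord mulr_natl.
  move=> i _; rewrite (le_trans _ Nt) ?mulr1// ler_pM2r// ler_nat.
  exact: ltn_ord.
rewrite big_ord_recr/=.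
have [Nt|Nt] := leP (N.+1%:R * eta) t.
  have -> : t = N.+1%:R * eta by apply/eqP; rewrite eq_le tN.
  rewrite [X in _ - (X + _)](_ : _ = N%:R * eta).
    by rewrite mulr1 -natr1 mulrDl mul1r opprD addrACA !subrr addr0 lexx ltW.
  rewrite (eq_bigr (fun=> eta)); first by rewrite sumr_const card_ord mulr_natl.
  by move=> i _; rewrite ler_pM2r// ler_nat ltnS ltnW ?ltn_ord// mulr1.
rewrite mulr0 addr0.
have [tN'|/ltW Nt'] := leP t (N%:R * eta); first by apply: IH; rewrite t0.
rewrite H// subr_ge0 Nt' lerBlDr addrC -[X in _ + X]mul1r -mulrDl natr1.
exact: ltW.
Qed.

Section core.
Variables (D : set T) (p C : R) (w : nat -> T -> R).
Hypotheses (mD : measurable D) (Doo : (mu D < +oo)%E) (p1 : 1 < p).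
Hypothesis wC : forall j, Lp_le D p (w j) C.
Hypothesis wA : forall A, measurable A ->
  (fun j => \int[mu]_(x in D `&` A) w j x) @ \oo --> (0 : R).

Let C0 : 0 <= C.
Proof.
apply: le_trans (Lp_le_Rintegral mD (wC 0%N)).
by apply: Rintegral_ge0 => x _; exact: powR_ge0.
Qed.

Let iw j : mu.-integrable D (EFin \o w j).
Proof. exact: Lp_le_L1 (ltW p1) (wC j). Qed.

(** Up to a height M, psi is approximated by a staircase L with step eta; the part above M is
    [tail M]. The staircase is a simple function, for which [wA] gives the convergence. The error
    eta costs eta times a uniform L^1 bound, and the tail is absorbed by Young's inequality: its
    first term is small by the choice of l, its second by the choice of M. *)
Lemma cvg0_setwise_weak_ge0 psi : measurable_fun D psi -> (forall x, 0 <= psi x) ->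
  (\int[mu]_(x in D) (`|psi x| `^ (p / (p - 1)))%:E < +oo)%E ->
  (fun j => \int[mu]_(x in D) (w j x * psi x)) @ \oo --> (0 : R).
Proof.
move=> mpsi psi0 psiq; set q := p / (p - 1) in psiq *.
have p10 : 0 < p - 1 by rewrite subr_gt0.
have q0 : 0 < q by rewrite divr_gt0// (lt_trans ltr01).
have iq := integrable_powR mD mpsi psiq.
apply/cvgr0Pnorm_lt => e e0.
(* A uniform bound for the L^1 norms, obtained at the level 1; the last summand only makes it
   positive. *)
pose C1 := fine (mu D) + C + 1.
have C10 : 0 < C1 by rewrite ltr_wpDl// addr_ge0// fine_ge0.
have wL1 j : \int[mu]_(x in D) `|w j x| <= C1.
  have := Lp_le_unif_integrable mD Doo (ltW p1) ltr01 (wC j) measurableT.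
  rewrite setIT powR1 !mul1r => h; apply: le_trans h _.
  by rewrite /C1 lerDl ler01.
(* Parameter of Young's inequality: the term l |w|^p costs less than e / 4. Since M is chosen after
   l, the factor l' in front of the tail may be large. *)
pose l := e / (4 * (C + 1)).
have l0 : 0 < l by rewrite divr_gt0// mulr_gt0// ltr_wpDl.
have lC : l * C < e / 4.
  rewrite /l invfM mulrA -[X in X < _]mulrA gtr_pMr ?divr_gt0//.
  by rewrite mulrC ltr_pdivrMr ?ltr_wpDl// mul1r ltrDl.
set l' := l `^ (- (p - 1)^-1).
pose tail M x := if psi x <= M%:R then 0 else psi x.
have mtail M : measurable_fun D (tail M).
  apply: measurable_fun_if => //.
  - by apply: measurable_fun_ler => //; exact: measurable_cst.
  - by apply: measurable_funS mpsi => //; exact: subIsetl.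
have tail0 M x : 0 <= tail M x by rewrite /tail; case: ifP.
have mtq M : measurable_fun D (fun x => tail M x `^ q).
  by apply: (measurableT_comp (measurable_powR q)).
have tailq M x : tail M x `^ q <= `|psi x| `^ q.
  rewrite /tail ger0_norm//; case: ifP => // _.
  by rewrite powR0 ?gt_eqF// powR_ge0.
have itq M : mu.-integrable D (EFin \o (fun x => tail M x `^ q)).
  apply: (le_integrableR mD (mtq M) iq) => x _.
  by rewrite ger0_norm ?powR_ge0.
have tcvg : (fun M => \int[mu]_(x in D) (tail M x `^ q)) @ \oo --> (0 : R).
  apply: (dominated_cvg0_Rintegral mD mtq _ iq) => [x _|M x _]; last first.
    by rewrite ger0_norm ?powR_ge0.
  apply: cvg_near_cst; have [k kpsi] := near_infty_natSinv_lt (PosNum (ltr01 : 0 < (1:R))).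
  exists (Num.truncn (psi x)).+1 => // M /= Mx.
  rewrite /tail ltW ?powR0 ?gt_eqF//.
  apply: lt_le_trans (_ : (Num.truncn (psi x)).+1%:R <= _); last by rewrite ler_nat.
  exact: truncnS_gt.
have l'0 : 0 < l' by rewrite powR_gt0.
have [M _ /(_ M (leqnn _)) /=] : \forall M \near \oo, `|\int[mu]_(x in D) (tail M x `^ q)| < e / 4 / l'.
  by move/cvgr0Pnorm_lt : tcvg; apply; rewrite !divr_gt0.
rewrite ger0_norm; last by apply: Rintegral_ge0 => x _; exact: powR_ge0.
rewrite ltr_pdivlMr// mulrC => tM.
pose eta := e / (4 * C1).
have eta0 : 0 < eta by rewrite divr_gt0// mulr_gt0.
pose N := (Num.truncn (M%:R / eta)).+1.
have MN : M%:R <= N%:R * eta by rewrite -ler_pdivrMr// ltW// truncnS_gt.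
(* The levels are cut off above M, so that the staircase L vanishes where [tail M] lives. *)
pose B (i : nat) := [set x | i.+1%:R * eta <= psi x <= M%:R].
have mB i : measurable (D `&` B i).
  rewrite (_ : B i = psi @^-1` `[i.+1%:R * eta, M%:R]%classic); last first.
    by apply/seteqP; split => x; rewrite /B /= in_itv.
  exact: mpsi.
pose L x := \sum_(i < N) eta * \1_(D `&` B i) x.
have iwB (i : 'I_N) j : mu.-integrable D (EFin \o (fun x => w j x * (eta * \1_(D `&` B i) x))).
  apply: (@le_integrableR _ _ _ _ _ _ (fun x => eta * `|w j x|)) => //.
  - apply: measurable_funM; first exact: (wC j).1.
    apply: measurable_funM; first exact: measurable_cst.
    exact: measurable_indic.
  - by apply: integrableZR => //; exact: integrable_norm.
  - move=> x _; rewrite normrM [X in _ <= X]mulrC ler_wpM2l// normrM (gtr0_norm eta0).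
    by rewrite ger_pMr// indicE ger0_norm// lern1; case: (_ \in _).
have wL j : \int[mu]_(x in D) (w j x * L x) = \sum_(i < N) eta * \int[mu]_(x in D `&` (D `&` B i)) w j x.
  rewrite /L; under eq_Rintegral do rewrite mulr_sumr.
  rewrite (@Rintegral_sum _ _ _ _ D _ _ (fun (i : 'I_N) x => w j x * (eta * \1_(D `&` B i) x)))//.
  apply: eq_bigr => i _; under eq_Rintegral do rewrite mulrCA.
  rewrite RintegralZl//; last first.
    apply: (@le_integrableR _ _ _ _ _ _ (fun x => `|w j x|)) => //.
    - apply: measurable_funM; first exact: (wC j).1.
      exact: measurable_indic.
    - exact: integrable_norm.
    - move=> x _; rewrite normrM ler_piMr// indicE ger0_norm// lern1; case: (_ \in _) => //.
  rewrite Rintegral_mkcondr; congr (_ * _); apply: eq_Rintegral => x _.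
  by rewrite patchE indicE; case: (_ \in _); rewrite ?mulr1 ?mulr0.
have Lcvg : (fun j => \int[mu]_(x in D) (w j x * L x)) @ \oo --> (0 : R).
  apply: (@eq_cvgn _ (fun j => \sum_(i < N) eta * \int[mu]_(x in D `&` (D `&` B i)) w j x) _ (\sum_(i < N) eta * 0)).
  - by move=> j; rewrite wL.
  - by rewrite big1// => i _; rewrite mulr0.
  - apply: (@cvgn_sum _ _ _ (fun (i : 'I_N) j => eta * \int[mu]_(x in D `&` (D `&` B i)) w j x)) => i.
    apply: cvgM; first exact: cvg_cst.
    exact: wA.
have iwL j : mu.-integrable D (EFin \o (fun x => w j x * L x)).
  rewrite /L; under [X in EFin \o X]eq_fun do rewrite mulr_sumr.
  exact: integrable_sumR.
have Lapprox x : D x -> `|psi x - L x - tail M x| <= eta.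
  move=> Dx; rewrite /tail; case: ifPn => [psiM|].
    rewrite subr0 /L.
    have := @sum_layer eta (psi x) N eta0; rewrite psi0 (le_trans psiM)// => /(_ isT).
    rewrite (eq_bigr (fun i : 'I_N => eta * \1_(D `&` B i) x)); last first.
      move=> i _; congr (_ * _); rewrite indicE /B; congr (nat_of_bool _)%:R.
      by apply/idP/idP => [h|/set_mem[_ /= /andP[]]//]; apply/mem_set; split => //=; rewrite h.
    by move=> /andP[a b]; rewrite ger0_norm.
  rewrite -ltNge => Mpsi; rewrite /L big1 ?subr0 ?subrr ?normr0 ?ltW// => i _.
  by rewrite indicE memNset ?mulr0// => -[_ /= /andP[_]]; rewrite leNgt Mpsi.
have mL : measurable_fun D L.
  apply: measurable_sum => i; apply: measurable_funM; first exact: measurable_cst.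
  exact: measurable_indic.
have iwt j : mu.-integrable D (EFin \o (fun x => l * `|w j x| `^ p + l' * tail M x `^ q)).
  apply: integrableDR => //.
    by apply: integrableZR => //; exact: Lp_le_integrable (wC j).
  by apply: integrableZR.
near=> j.
have [mw _] := wC j.
have ipsi : mu.-integrable D (EFin \o (fun x => w j x * (psi x - L x))).
  apply: (@le_integrableR _ _ _ _ _ _ (fun x => eta * `|w j x| + (l * `|w j x| `^ p + l' * tail M x `^ q))) => //.
  - by apply: measurable_funM => //; exact: measurable_funB.
  - apply: integrableDR => //.
    by apply: integrableZR => //; exact: integrable_norm.
  - move=> x Dx; rewrite normrM.
    have -> : psi x - L x = (psi x - L x - tail M x) + tail M x by rewrite subrK.
    apply: (@le_trans _ _ (`|w j x| * (eta + tail M x))).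
      rewrite ler_wpM2l// (le_trans (ler_normD _ _))// lerD ?Lapprox//.
      by rewrite ger0_norm.
    rewrite mulrDr lerD//; first by rewrite mulrC.
    exact: young_split.
have -> : \int[mu]_(x in D) (w j x * psi x) =
    \int[mu]_(x in D) (w j x * L x) + \int[mu]_(x in D) (w j x * (psi x - L x)).
  by rewrite -RintegralD//; apply: eq_Rintegral => x _; rewrite -mulrDr subrKC.
apply: le_lt_trans (ler_normD _ _) _.
rewrite (_ : e = e / 4 + (e / 4 + (e / 4 + e / 4))); last by field.
apply: ltrD.
  near: j; move/cvgr0Pnorm_lt : Lcvg; apply; exact: divr_gt0.
apply: le_lt_trans (_ : \int[mu]_(x in D) (eta * `|w j x| + (l * `|w j x| `^ p + l' * tail M x `^ q)) < _).
  apply: le_norm_Rintegral => //.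
  - by apply: measurable_funM => //; exact: measurable_funB.
  - apply: integrableDR => //.
    by apply: integrableZR => //; exact: integrable_norm.
  - move=> x Dx; rewrite normrM.
    have -> : psi x - L x = (psi x - L x - tail M x) + tail M x by rewrite subrK.
    apply: (@le_trans _ _ (`|w j x| * (eta + tail M x))).
      rewrite ler_wpM2l// (le_trans (ler_normD _ _))// lerD ?Lapprox//.
      by rewrite ger0_norm.
    rewrite mulrDr lerD//; first by rewrite mulrC.
    exact: young_split.
have iLp := Lp_le_integrable mD (wC j).
rewrite RintegralD//; last first.
  by apply: integrableZR => //; exact: integrable_norm.
rewrite RintegralD//; last 2 first.
- exact: integrableZR.
- exact: integrableZR.
rewrite !RintegralZl//; last exact: integrable_norm.
apply: ler_ltD.
  apply: le_trans (ler_wpM2l (ltW eta0) (wL1 j)) _.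
  by rewrite /eta invfM mulrA mulfVK// gt_eqF.
apply: (ltrD _ tM).
apply: le_lt_trans lC; rewrite ler_wpM2l ?(ltW l0)//.
exact: Lp_le_Rintegral.
Unshelve. all: by end_near.
Qed.

Lemma cvg0_setwise_weak psi : measurable_fun D psi ->
  (\int[mu]_(x in D) (`|psi x| `^ (p / (p - 1)))%:E < +oo)%E ->
  (fun j => \int[mu]_(x in D) (w j x * psi x)) @ \oo --> (0 : R).
Proof.
move=> mpsi psiq; set q := p / (p - 1) in psiq *.
have p10 : 0 < p - 1 by rewrite subr_gt0.
have q0 : 0 < q by rewrite divr_gt0// (lt_trans ltr01).
have iq := integrable_powR mD mpsi psiq.
have key (s : T -> R) : measurable_fun D s -> (forall x, 0 <= s x <= `|psi x|) ->
    (forall j, mu.-integrable D (EFin \o (fun x => w j x * s x))) /\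
    (fun j => \int[mu]_(x in D) (w j x * s x)) @ \oo --> (0 : R).
  move=> ms s_psi.
  have sle x : `|s x| `^ q <= `|psi x| `^ q.
    have /andP[s0 sp] := s_psi x.
    by apply: ge0_ler_powR; rewrite ?nnegrE ?(ger0_norm s0)// ltW.
  split.
    move=> j; apply: (@le_integrableR _ _ _ _ _ _ (fun x => 1 * `|w j x| `^ p + 1 `^ (- (p - 1)^-1) * `|psi x| `^ q)) => //.
    - by apply: measurable_funM => //; exact: (wC j).1.
    - apply: integrableDR => //.
        by apply: integrableZR => //; exact: Lp_le_integrable (wC j).
      by apply: integrableZR => //.
    - move=> x _; rewrite normrM (le_trans _ (young_split p1 ltr01 _ _))//.
      rewrite ler_wpM2l//; have /andP[s0 sp] := s_psi x.
      by rewrite (ger0_norm s0).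
  apply: (cvg0_setwise_weak_ge0 ms); first by move=> x; case/andP : (s_psi x).
  apply: le_lt_trans psiq; apply: ge0_le_integral => //.
  - apply/measurable_EFinP; apply: (measurableT_comp (measurable_powR q)); exact: measurableT_comp.
  - apply/measurable_EFinP; apply: (measurableT_comp (measurable_powR q)); exact: measurableT_comp.
  - by move=> x _; rewrite lee_fin.
have [] := key (fun x => Num.max (psi x) 0).
- by apply: measurable_maxr => //; exact: measurable_cst.
- by move=> x; rewrite le_max lexx orbT/= ge_max ler_norm normr_ge0.
move=> i1 c1; have [] := key (fun x => Num.max (- psi x) 0).
- by apply: measurable_maxr => //; exact: measurable_funN.
- by move=> x; rewrite le_max lexx orbT/= ge_max normr_ge0 -normrN ler_norm.
move=> i2 c2.
apply: eq_cvgn (cvgB c1 c2); last by rewrite subrr.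
move=> j; transitivity (\int[mu]_(x in D) (w j x * Num.max (psi x) 0) -
  \int[mu]_(x in D) (w j x * Num.max (- psi x) 0)) => //.
rewrite -RintegralB//; apply: eq_Rintegral => x _.
rewrite -mulrBr; congr (_ * _); rewrite /Num.max.
by case: ltP => h1; case: ltP => h2; lra.
Qed.

End core.

Lemma cvg_setwise_weak D p C (u : nat -> T -> R) u0 psi : measurable D ->
  (mu D < +oo)%E -> 1 < p -> (forall j, Lp_le D p (u j) C) -> Lp_le D p u0 C ->
  (forall A, measurable A -> (fun j => \int[mu]_(x in D `&` A) u j x) @ \oo -->
     \int[mu]_(x in D `&` A) u0 x) ->
  measurable_fun D psi ->
  (\int[mu]_(x in D) (`|psi x| `^ (p / (p - 1)))%:E < +oo)%E ->
  (fun j => \int[mu]_(x in D) (u j x * psi x)) @ \oo -->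
  \int[mu]_(x in D) (u0 x * psi x).
Proof.
move=> mD Doo p1 uC u0C uA mpsi psiq.
have iup f : Lp_le D p f C -> mu.-integrable D (EFin \o (fun x => f x * psi x)).
  move=> fC; apply: (@le_integrableR _ _ _ _ _ _ (fun x => 1 * `|f x| `^ p + 1 `^ (- (p - 1)^-1) * `|psi x| `^ (p / (p - 1)))) => //.
  - by apply: measurable_funM => //; exact: fC.1.
  - apply: integrableDR => //.
      by apply: integrableZR => //; exact: Lp_le_integrable fC.
    apply: integrableZR => //.
    exact: integrable_powR.
  - by move=> x _; rewrite normrM; exact: young_split.
have H : (fun j => \int[mu]_(x in D) ((u j x - u0 x) * psi x)) @ \oo --> (0 : R).
  apply: (@cvg0_setwise_weak D p (2 `^ p * (C + C))) => //.
    move=> j; split; first by apply: measurable_funB; [exact: (uC j).1|exact: u0C.1].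
    apply: (@le_trans _ _ (\int[mu]_(x in D) ((2 `^ p * (`|u j x| `^ p + `|u0 x| `^ p))%:E))%E).
      apply: ge0_le_integral => //.
      - apply/measurable_EFinP; apply: (measurableT_comp (measurable_powR p)).
        apply: measurableT_comp => //; apply: measurable_funB; [exact: (uC j).1|exact: u0C.1].
      - apply/measurable_EFinP; apply: measurable_funM; first exact: measurable_cst.
        by apply: measurable_funD; apply: (measurableT_comp (measurable_powR p));
          apply: measurableT_comp => //; [exact: (uC j).1|exact: u0C.1].
      - move=> x _; rewrite lee_fin.
        apply: le_trans (powR_addle (ltW p1) (normr_ge0 _) (normr_ge0 _)).
        apply: ge0_ler_powR; rewrite ?nnegrE ?addr_ge0 ?ler_normB//; lra.
    rewrite RintegralE//; last first.
      apply: integrableZR => //; apply: integrableDR => //.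
        exact: Lp_le_integrable (uC j).
      exact: Lp_le_integrable u0C.
    rewrite lee_fin RintegralZl//; last first.
      by apply: integrableDR => //; [exact: Lp_le_integrable (uC j)|exact: Lp_le_integrable u0C].
    rewrite ler_wpM2l ?powR_ge0// RintegralD//;
      [|exact: Lp_le_integrable (uC j)|exact: Lp_le_integrable u0C].
    by apply: lerD; [exact: (Lp_le_Rintegral mD (uC j))|exact: (Lp_le_Rintegral mD u0C)].
  move=> A mA; have mDA : measurable (D `&` A) by exact: measurableI.
  under eq_fun => j.
    rewrite RintegralB//; last 2 first.
    - exact: integrableS (Lp_le_L1 mD Doo (ltW p1) (uC j)).
    - exact: integrableS (Lp_le_L1 mD Doo (ltW p1) u0C).
    over.
  by apply/subr_cvg0; exact: uA.
apply/subr_cvg0; apply: cvg_trans H; apply: near_eq_cvg; apply: nearW => j /=.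
rewrite -(RintegralB mD (iup _ (uC j)) (iup _ u0C)).
by apply: eq_Rintegral => x _; rewrite mulrBl.
Qed.

End setwise_convergence.

Section weak_limit.
Context d (T : measurableType d) (R : realType) (mu : {sigma_finite_measure set T -> \bar R}).
Implicit Types (D : set T) (f g psi : T -> R).

Lemma Lp_le_unif_small D p C (e : R) : measurable D -> (mu D < +oo)%E -> 1 < p ->
  0 < e -> exists2 r : R, 0 < r & forall f A, Lp_le mu D p f C -> measurable A ->
    fine (mu (D `&` A)) <= r -> \int[mu]_(x in D `&` A) `|f x| <= e.
Proof.
move=> mD Doo p1 e0.
have p10 : 0 < p - 1 by rewrite subr_gt0.
(* The level l is such that l^(1 - p) C = C / c <= e / 2; the radius r then satisfies l r = e /
   2. *)
pose c := 2 * (`|C| + 1) / e.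
have c0 : 0 < c by rewrite divr_gt0// mulr_gt0// ltr_wpDl.
pose l := c `^ (p - 1)^-1.
have l0 : 0 < l by rewrite powR_gt0.
exists (e / 2 / l) => [|f A fC mA sA]; first by rewrite !divr_gt0.
apply: le_trans (Lp_le_unif_integrable mD Doo (ltW p1) l0 fC mA) _.
have -> : l `^ (1 - p) = c^-1.
  rewrite /l -powRrM -[1 - p]opprB mulrN mulVf ?gt_eqF//.
  by rewrite powR_inv1// ltW.
rewrite [e in X in _ <= X](_ : e = e / 2 + e / 2); last by field.
apply: lerD; first by rewrite mulrC -ler_pdivlMr.
rewrite mulrC ler_pdivrMr//.
have -> : e / 2 * c = `|C| + 1 by rewrite /c; field; rewrite gt_eqF.
by rewrite (le_trans (ler_norm C))// lerDl.
Qed.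

Section limit_charge.
Variables (D : set T) (p C : R) (u : nat -> T -> R).
Hypotheses (mD : measurable D) (Doo : (mu D < +oo)%E) (p1 : 1 < p).
Hypothesis uC : forall j, Lp_le mu D p (u j) C.
Hypothesis uA : forall A, measurable A ->
  cvgn (fun j => \int[mu]_(x in D `&` A) u j x).

Let L A : R := limn (fun j => \int[mu]_(x in D `&` A) u j x).

Let iu j A : measurable A -> mu.-integrable (D `&` A) (EFin \o u j).
Proof.
move=> mA; have := Lp_le_L1 mD Doo (ltW p1) (uC j).
by apply: integrableS => //; exact: measurableI.
Qed.

Let L0 : L set0 = 0.
Proof.
apply/cvg_lim => //; apply: (@eq_cvgn _ (fun=> 0)) (cvg_cst _) => // j.
by rewrite setI0 Rintegral_set0.
Qed.

Let LU A B : measurable A -> measurable B -> A `&` B = set0 ->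
  L (A `|` B) = L A + L B.
Proof.
move=> mA mB AB; apply/cvg_lim => //.
apply: eq_cvgn (cvgD (uA mA) (uA mB)) => // j.
rewrite -[LHS]/(\int[mu]_(x in D `&` A) u j x + \int[mu]_(x in D `&` B) u j x).
rewrite setIUr Rintegral_setU//; try exact: measurableI.
- by rewrite -setIUr; apply: iu; exact: measurableU.
- by apply/disj_set2P; rewrite setIACA AB setI0.
Qed.

Let L_small (e : R) : 0 < e -> exists2 r : R, 0 < r & forall A, measurable A ->
  fine (mu (D `&` A)) <= r -> `|L A| <= e.
Proof.
move=> e0; have [r r0 rP] := Lp_le_unif_small C mD Doo p1 e0.
exists r => // A mA Ar; apply: (cvgr_to_le (cvg_norm (uA mA))).
apply: nearW => j; apply: le_trans (rP _ _ (uC j) mA Ar).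
apply: le_normr_Rintegral; [exact: measurableI|exact: iu].
Qed.

Let nu A : \bar R := (L A)%:E.

(** L is finitely additive and absolutely continuous, since the equi-integrability of the u_j passes
    to the limit. The tails [G k] of the union decrease to the empty set, so their measure within D,
    and with it L (G k), tends to 0. *)
Let nu_sigma_additive : semi_sigma_additive nu.
Proof.
move=> F mF tF mUF.
pose G k := \bigcup_i F i `\` \big[setU/set0]_(i < k) F i.
have mG k : measurable (G k).
  by apply: measurableD => //; exact: bigsetU_measurable.
have GS k : G k = F k `|` G k.+1.
  rewrite /G big_ord_recr/=; apply/seteqP; split => x.
    move=> [[i _ Fix] nx]; have [Fkx|nFkx] := pselect (F k x); first by left.
    by right; split; [exists i|move=> [|]].
  move=> [Fkx|[]]; last by move=> UF nx; split => // ?; apply: nx; left.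
  split; first by exists k.
  rewrite -bigcup_mkord => -[i /= ik Fix].
  have /trivIsetP/(_ i k I I) := tF.
  by rewrite neq_ltn ik => /(_ isT)/seteqP[+ _] => /(_ x (conj Fix Fkx)).
have FG k : F k `&` G k.+1 = set0.
  rewrite /G big_ord_recr/=; apply/seteqP; split => // x [Fx [_ nx]].
  by apply: nx; right.
have LS k : L (\bigcup_i F i) = \sum_(0 <= i < k) L (F i) + L (G k).
  elim: k => [|k ->]; first by rewrite big_nil add0r /G big_ord0 setD0.
  by rewrite big_nat_recr//= -addrA -(LU (mF k) (mG k.+1) (FG k)) -GS.
apply/fine_cvgP; split; first by apply: nearW => k; rewrite sumEFin.
have LG : (fun k => L (G k)) @ \oo --> 0.
  apply/cvgr0Pnorm_le => e e0; have [r r0 rP] := L_small e0.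
  have : (mu \o (fun k => D `&` G k)) @ \oo --> mu (\bigcap_k (D `&` G k)).
    apply: nonincreasing_cvg_mu.
    - apply: le_lt_trans Doo; apply: le_measure; rewrite ?inE//.
      exact: measurableI.
    - by move=> k; exact: measurableI.
    - by apply: bigcapT_measurable => k; exact: measurableI.
    - move=> k l kl; apply/subsetPset; apply: setIS; apply: setDS.
      exact: subset_bigsetU.
  have -> : \bigcap_k (D `&` G k) = set0.
    apply/seteqP; split => // x Gx; have [_ [[i _ Fi] _]] := Gx 0%N I.
    have [_ [_ /=]] := Gx i.+1 I; apply; rewrite -bigcup_mkord; exists i => //=.
  rewrite measure0 => /fine_cvgP[_ /cvgr0Pnorm_le/(_ _ r0)].
  apply: filterS => k /=; rewrite ger0_norm ?fine_ge0// => kr.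
  exact: rP.
have H : (fun k => L (\bigcup_i F i) - L (G k)) @ \oo --> L (\bigcup_i F i) - 0.
  by apply: cvgB LG; exact: cvg_cst.
apply: eq_cvgn H; last by rewrite subr0.
by move=> k; rewrite (LS k) addrK /= sumEFin.
Qed.

Lemma limit_charge : exists2 f, mu.-integrable setT (EFin \o f) &
  forall A, measurable A -> \int[mu]_(x in A) f x = L A.
Proof.
pose nu' : {charge set T -> \bar R} := HB.pack nu
  (isCharge.Build d T R nu (congr1 EFin L0) (fun _ _ => isT) nu_sigma_additive).
have numu : nu' `<< mu.
  apply/null_content_dominatesP => A mA A0 /=; congr EFin.
  apply/eqP; rewrite -normr_eq0 eq_le normr_ge0 andbT; apply/ler_addgt0Pr => e e0.
  rewrite add0r; have [r r0] := L_small e0; apply => //.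
  have -> : mu (D `&` A) = 0%E.
    apply/eqP; rewrite eq_le measure_ge0 andbT -A0; apply: le_measure; rewrite ?inE//.
    exact: measurableI.
  by rewrite ltW.
have iR := Radon_Nikodym_integrable numu.
pose f x := fine (Radon_Nikodym nu' mu x).
have fE : EFin \o f = Radon_Nikodym nu' mu.
  by apply/funext => x /=; rewrite fineK// Radon_Nikodym_fin_num.
exists f; first by rewrite fE.
move=> A mA; rewrite /Rintegral -[X in fine X]/(\int[mu]_(x in A) (EFin \o f) x)%E fE.
by rewrite -Radon_Nikodym_integral.
Qed.

(** The density f of the limit charge is integrable; that it satisfies the same bound C in L^p is
    seen by duality. On the set [E M] where |f| <= M, test the convergence against s = f |f|^(p -
    2), for which f s = |f|^p. Young's inequality with exact constants gives X <= C / p + X (1 - 1 /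
    p), where X is the integral of |f|^p over the part of D in [E M]. It is finite thanks to the
    truncation, so X <= C. Then M goes to infinity by monotone convergence. *)
Lemma exists_weak_limit : exists u0, [/\ measurable_fun setT u0, Lp_le mu D p u0 C &
  forall A, measurable A -> (fun j => \int[mu]_(x in D `&` A) u j x) @ \oo -->
    \int[mu]_(x in D `&` A) u0 x].
Proof.
have p0 : 0 < p := lt_trans ltr01 p1.
have p10 : 0 < p - 1 by rewrite subr_gt0.
have [f if_ fL] := limit_charge.
have mf : measurable_fun setT f by apply/measurable_EFinP; exact: measurable_int if_.
have mfD : measurable_fun D f by exact: measurable_funTS.
have cA A : measurable A -> (fun j => \int[mu]_(x in D `&` A) u j x) @ \oo -->
    \int[mu]_(x in D `&` A) f x.
  move=> mA; rewrite fL; last exact: measurableI.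
  rewrite /L setIA setIid; exact: uA.
have C0 : 0 <= C.
  apply: le_trans (Lp_le_Rintegral mD (uC 0%N)).
  by apply: Rintegral_ge0 => x _; exact: powR_ge0.
exists f; split => //; split => //.
pose E (M : nat) := [set x | `|f x| <= M%:R].
have mE M : measurable (E M).
  rewrite -[X in measurable X]setTI.
  have := @measurable_fun_ler _ _ _ setT (fun x => `|f x|) (fun=> M%:R).
  move=> /(_ _ _ measurableT [set true]) h; apply: h => //.
  exact: measurableT_comp.
pose X M := \int[mu]_(x in D) ((\1_(E M) x) * `|f x| `^ p).
have fEM M x : `|\1_(E M) x * f x| <= M%:R.
  rewrite indicE; case: (boolP (x \in E M)) => [/set_mem|_].
    by rewrite mul1r.
  by rewrite mul0r normr0.
have mfE M : measurable_fun D (fun x => \1_(E M) x * f x).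
  by apply: measurable_funM => //; exact: measurable_indic.
have powM M x : `|\1_(E M) x * f x| `^ p = \1_(E M) x * `|f x| `^ p.
  rewrite indicE; case: (_ \in _); rewrite ?mul1r// !mul0r normr0 powR0//.
  by rewrite gt_eqF.
have mpw (h : T -> R) r : measurable_fun D h -> measurable_fun D (fun x => `|h x| `^ r).
  move=> mh; apply: (measurableT_comp (measurable_powR r)); exact: measurableT_comp.
have iE M : mu.-integrable D (EFin \o (fun x => `|\1_(E M) x * f x| `^ p)).
  apply: (@le_integrableR _ _ _ _ D _ (fun=> M%:R `^ p)) => //.
  - exact: mpw.
  - exact: integrable_cstR.
  - move=> x _; rewrite ger0_norm ?powR_ge0//.
    by apply: ge0_ler_powR; rewrite ?nnegrE// ltW.
have XC M : X M <= C.
  pose s x := \1_(E M) x * (f x * `|f x| `^ (p - 2)).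
  have ms : measurable_fun D s.
    apply: measurable_funM; first exact: measurable_indic.
    by apply: measurable_funM => //; exact: mpw.
  have fp x : f x * (f x * `|f x| `^ (p - 2)) = `|f x| `^ p.
    have [->|fx0] := eqVneq (f x) 0.
      by rewrite normr0 !mul0r powR0// gt_eqF.
    rewrite mulrA -expr2 -real_normK ?num_real// -powR_mulrn// -powRD.
      by congr (_ `^ _); rewrite subrKC.
    by rewrite normr_eq0 fx0 implybT.
  have sq x : `|s x| `^ (p / (p - 1)) <= `|\1_(E M) x * f x| `^ p.
    rewrite powM /s indicE; case: (_ \in _); last first.
      by rewrite !mul0r normr0 powR0// gt_eqF// divr_gt0.
    rewrite !mul1r normrM norm_powR// ?normr_id.
    have [->|fx0] := eqVneq (f x) 0.
      by rewrite normr0 mul0r !powR0 ?gt_eqF// ?divr_gt0.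
    have -> : `|f x| * `|f x| `^ (p - 2) = `|f x| `^ (p - 1).
      rewrite -{1}[`|f x|]powRr1// -powRD; last by rewrite normr_eq0 fx0 implybT.
      by congr (_ `^ _); ring.
    by rewrite -powRrM mulrCA divff ?gt_eqF// mulr1.
  have isq : mu.-integrable D (EFin \o (fun x => `|s x| `^ (p / (p - 1)))).
    apply: (le_integrableR mD _ (iE M)); first exact: mpw.
    by move=> x _; rewrite ger0_norm ?powR_ge0.
  have XE : \int[mu]_(x in D) (\1_(E M) x * f x * s x) = X M.
    apply: eq_Rintegral => x _; rewrite /s mulrACA fp; congr (_ * _).
    by rewrite indicE; case: (_ \in _); rewrite ?mulr1 ?mulr0.
  have X0 : 0 <= X M.
    by apply: Rintegral_ge0 => x _; rewrite mulr_ge0 ?powR_ge0// indicE.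
  have iM j A : measurable A -> \int[mu]_(x in D `&` A) (\1_(E M) x * u j x) =
      \int[mu]_(x in D `&` (A `&` E M)) u j x.
    move=> mA; rewrite [in RHS]setIA [RHS]Rintegral_mkcondr; apply: eq_Rintegral => x _.
    by rewrite patchE indicE; case: (_ \in _); rewrite ?mul1r ?mul0r.
  have muE j : measurable_fun D (fun x => \1_(E M) x * u j x).
    by apply: measurable_funM; [exact: measurable_indic|exact: (uC j).1].
  have uE j x : `|\1_(E M) x * u j x| <= `|u j x|.
    by rewrite normrM ler_piMl// indicE ger0_norm// lern1; case: (_ \in _).
  have wcv : (fun j => \int[mu]_(x in D) (\1_(E M) x * u j x * s x)) @ \oo -->
      \int[mu]_(x in D) (\1_(E M) x * f x * s x).
    (* C bounds the truncated u_j and X M the truncated f; their sum serves for both. *)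
    apply: (@cvg_setwise_weak _ _ _ mu D p (C + X M)) => //.
    - move=> j; split => //; apply: le_trans (_ : C%:E <= _)%E; last by rewrite lee_fin lerDl.
      apply: le_trans (uC j).2; apply: ge0_le_integral => //.
      + by apply/measurable_EFinP; exact: mpw.
      + by apply/measurable_EFinP; apply: mpw; exact: (uC j).1.
      + move=> x _; rewrite lee_fin; apply: ge0_ler_powR; rewrite ?nnegrE//.
        exact: ltW.
    - split => //; rewrite RintegralE// lee_fin [X in X <= _](_ : _ = X M) ?lerDr//.
      by apply: eq_Rintegral => x _; rewrite powM.
    - move=> A mA; have := cA _ (measurableI _ _ mA (mE M)); apply: eq_cvgn.
        by move=> j; rewrite iM.
      rewrite setIA [LHS]Rintegral_mkcondr; apply: eq_Rintegral => x _.
      by rewrite patchE indicE; case: (_ \in _); rewrite ?mul1r ?mul0r.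
    - by rewrite RintegralE// ltry.
  have qp : p^-1 + (p / (p - 1))^-1 = 1.
    by field; rewrite !gt_eqF.
  have : X M <= C / p + X M / (p / (p - 1)).
    rewrite -{1}XE; apply: (cvgr_to_le wcv); apply: nearW => j.
    have iup := Lp_le_integrable mD (uC j).
    apply: le_trans (ler_norm _) _.
    apply: le_trans (_ : \int[mu]_(x in D) (p^-1 * `|u j x| `^ p + (p / (p - 1))^-1 * `|s x| `^ (p / (p - 1))) <= _).
      apply: le_norm_Rintegral => //.
      - exact: measurable_funM.
      - by apply: integrableDR => //; exact: integrableZR.
      - move=> x _; rewrite normrM.
        apply: le_trans (ler_wpM2r (normr_ge0 _) (uE j x)) _.
        rewrite ![_^-1 * _]mulrC; apply: conjugate_powR => //.
        by rewrite divr_gt0.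
    rewrite RintegralD//; [|exact: integrableZR|exact: integrableZR].
    rewrite !RintegralZl// [C / p]mulrC [X M / _]mulrC; apply: lerD.
      by apply: ler_wpM2l; [rewrite invr_ge0 ltW|exact: Lp_le_Rintegral (uC j)].
    apply: ler_wpM2l; first by rewrite invr_ge0 divr_ge0// ltW.
    rewrite -XE; apply: le_Rintegral => //.
      rewrite (_ : _ \o _ = EFin \o (fun x => `|\1_(E M) x * f x| `^ p))//.
      apply/funext => x /=; rewrite powM /s mulrACA fp; congr (_ * _)%:E.
      by rewrite indicE; case: (_ \in _); rewrite ?mulr1 ?mulr0.
    move=> x _; apply: le_trans (sq x) _; rewrite powM /s mulrACA fp.
    by rewrite indicE; case: (_ \in _); rewrite ?mulr1 ?mulr0.
  have -> : (p / (p - 1))^-1 = 1 - p^-1 by apply/esym/eqP; rewrite subr_eq addrC qp.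
  rewrite mulrBr mulr1 addrCA lerDl subr_ge0 => h.
  by rewrite -(ler_pM2r (_ : 0 < p^-1)) ?invr_gt0.
pose g M x := (\1_(E M) x * `|f x| `^ p)%:E.
have mg M : measurable_fun D (g M).
  by apply/measurable_EFinP; apply: measurable_funM; [exact: measurable_indic|exact: mpw].
have g0 M x : (0 <= g M x)%E by rewrite lee_fin mulr_ge0 ?powR_ge0// indicE.
have ndg x : D x -> {homo g^~ x : a b / (a <= b)%N >-> (a <= b)%E}.
  move=> Dx a b ab; rewrite lee_fin ler_wpM2r ?powR_ge0//.
  rewrite !indicE ler_nat; case: (boolP (x \in E a)) => // /set_mem Ea.
  by rewrite mem_set//=; apply: le_trans Ea _; rewrite ler_nat.
have gcv x : limn (g^~ x) = (`|f x| `^ p)%:E.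
  apply/cvg_lim => //; apply: cvg_near_cst.
  exists (Num.truncn `|f x|).+1 => // M /= Mx.
  rewrite /g indicE mem_set ?mul1r//=; apply: ltW.
  by apply: lt_le_trans (truncnS_gt _) _; rewrite ler_nat.
have <- : (\int[mu]_(x in D) limn (g^~ x) = \int[mu]_(x in D) (`|f x| `^ p)%:E)%E.
  by apply: eq_integral => x _; rewrite gcv.
apply: (cvge_to_le (cvg_monotone_convergence mD mg (fun M x _ => g0 M x) ndg)).
apply: nearW => M.
rewrite RintegralE ?lee_fin//; first exact: XC.
rewrite (_ : _ \o _ = EFin \o (fun x => `|\1_(E M) x * f x| `^ p))//.
by apply/funext => x /=; rewrite powM.
Qed.


End limit_charge.
End weak_limit.

(** * Approximation of measurable sets by finite unions of cells *)

Section cell_approximation.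
Context (R : realType) (n : nat).
Implicit Types (A E : set 'rV[R]_n) (P : set 'rV[int]_n).

Definition cylinder : set_system 'rV[R]_n :=
  [set A | exists k P, A = [set x | P (cell k x)]].

Lemma open_bigcup_cylinder A : open A ->
  A = \bigcup_k [set x | [set z | forall y, cell k y = z -> A y] (cell k x)].
Proof.
move=> oA; apply/seteqP; split => [x Ax|x [k _ /=]]; last exact.
have /nbhs_ballP[e /= e0 he] : nbhs x A by exact: open_nbhs_nbhs.
have [k kP] := cell_small x e0; exists k => //= y yx; apply: he.
exact: (kP k).
Qed.

(** Open sets are countable unions of cylinders, and the preimage of []a, b]] under a coordinate is
    a difference of two open half-spaces. *)
Lemma sigma_cylinder A : measurable A -> <<s cylinder >> A.
Proof.
have oC O : open O -> <<s cylinder >> O.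
  move=> /open_bigcup_cylinder ->; apply: sigma_algebra_bigcup => k.
  by apply: sub_sigma_algebra; exists k, [set z | forall y, cell k y = z -> O y].
have : <<s \big[setU/set0]_(i < n)
     preimage_set_system setT (@rV_coord R n i) measurable >> A -> <<s cylinder >> A.
  apply: smallest_sub; first exact: smallest_sigma_algebra.
  rewrite -bigcup_seq/=; apply: bigcup_sub => i _ _ [B mB <-].
  rewrite setTI.
  suff : [set B | <<s cylinder >> (@rV_coord R n i @^-1` B)] B by [].
  move: B mB; apply: smallest_sub.
    split => /=.
    - by rewrite preimage_set0; exact: sigma_algebra0.
    - by move=> B mB; rewrite setTD preimage_setC; exact: sigma_algebraC.
    - by move=> F mF; rewrite preimage_bigcup; exact: sigma_algebra_bigcup.
  move=> _ [[a b] _ <-] /=.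
  have oi c : open (@rV_coord R n i @^-1` `]c, +oo[%classic).
    apply: open_comp; last exact: interval_open.
    by move=> x _; exact: coord_continuous.
  rewrite (_ : _ @^-1` _ = (@rV_coord R n i @^-1` `]a, +oo[%classic) `\`
      (@rV_coord R n i @^-1` `]b, +oo[%classic)).
    exact: (@measurableD _ (g_sigma_algebraType cylinder) _ _ (oC _ (oi a)) (oC _ (oi b))).
  apply/seteqP; split => x /=; rewrite !in_itv/= !andbT.
    by move=> /andP[-> xb]; split => //; apply/negP; rewrite -leNgt.
  by move=> [-> /negP]; rewrite -leNgt.
exact.
Qed.

Definition symdiff (T : Type) (A E : set T) := (A `\` E) `|` (E `\` A).

Lemma measurable_symdiff A E : measurable A -> measurable E -> measurable (symdiff A E).
Proof. by move=> mA mE; apply: measurableU; exact: measurableD. Qed.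

Section approx.
Variable lam : {measure set 'rV[R]_n -> \bar R}.
Hypothesis lamT : (lam setT < +oo)%E.

Let lam_fin A : measurable A -> (lam A < +oo)%E.
Proof. by move=> mA; apply: le_lt_trans lamT; apply: le_measure; rewrite ?inE. Qed.

Let Cl A := measurable A /\ forall e : R, 0 < e -> exists k P,
  (lam (symdiff A [set x | P (cell k x)]) < e%:E)%E.

Let Cl0 : Cl set0.
Proof.
split => // e e0; exists 0%N, set0; rewrite (_ : symdiff _ _ = set0) ?measure0//.
by apply/seteqP; split => // x [] [].
Qed.

Let ClC A : Cl A -> Cl (~` A).
Proof.
move=> [mA hA]; split; first exact: measurableC.
move=> e /hA[k [P h]]; exists k, (~` P); move: h.
rewrite (_ : symdiff _ _ = symdiff (~` A) [set x | (~` P) (cell k x)])//.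
apply/seteqP; split => x [] [/= a b].
- by right; split.
- by left; split => // /(_ a).
- by right; split => //; apply: contrapT.
- by left; split => //; apply: contrapT.
Qed.

Let ClU A B : Cl A -> Cl B -> Cl (A `|` B).
Proof.
move=> [mA hA] [mB hB]; split; first exact: measurableU.
move=> e e0; have e20 : 0 < e / 2 by rewrite divr_gt0.
have [k [P hP]] := hA _ e20; have [l [Q hQ]] := hB _ e20.
(* By [cell_le], membership in either dyadic set depends only on the cell of generation [maxn k l],
   so the choice of the representative x of z does not matter. *)
exists (maxn k l), [set z | exists2 x : 'rV[R]_n, cell (maxn k l) x = z & P (cell k x) \/ Q (cell l x)].
rewrite (_ : [set x | _] = [set x | P (cell k x)] `|` [set x | Q (cell l x)]).
  apply: (@le_lt_trans _ _ (lam (symdiff A [set x | P (cell k x)] `|` symdiff B [set x | Q (cell l x)]))).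
    apply: le_measure; rewrite ?inE.
    - by apply: measurable_symdiff; apply: measurableU => //; exact: measurable_cell.
    - by apply: measurableU; apply: measurable_symdiff => //; exact: measurable_cell.
    - move=> x [] [[] /= a] b.
      + by left; left; split => // ?; apply: b; left.
      + by right; left; split => // ?; apply: b; right.
      + by left; right; split => // ?; apply: b; left.
      + by right; right; split => // ?; apply: b; right.
  apply: le_lt_trans (measureU2 _ _ _) _; try by apply: measurable_symdiff => //; exact: measurable_cell.
  by rewrite (_ : e = e / 2 + e / 2) ?EFinD ?lteD//; field.
apply/seteqP; split => x /=.
  move=> [y yx [Py|Qy]]; [left|right].
    by rewrite -(cell_le (leq_maxl k l) yx).
  by rewrite -(cell_le (leq_maxr k l) yx).
by move=> h; exists x.
Qed.

(** A countable union is a finite one up to a set of small measure, by continuity from above; this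
    uses that lam is finite. *)
Let Cl_bigcup (F : nat -> set 'rV[R]_n) : (forall i, Cl (F i)) -> Cl (\bigcup_i F i).
Proof.
move=> ClF; have mF i : measurable (F i) by case: (ClF i).
have mUF : measurable (\bigcup_i F i) by exact: bigcupT_measurable.
split => // e e0; have e20 : 0 < e / 2 by rewrite divr_gt0.
pose U k := \big[setU/set0]_(i < k) F i.
have ClUk k : Cl (U k).
  rewrite /U; elim: k => [|k IH]; first by rewrite big_ord0.
  by rewrite big_ord_recr; exact: ClU.
have : (lam \o (fun k => \bigcup_i F i `\` U k)) @ \oo --> lam (\bigcap_k (\bigcup_i F i `\` U k)).
  apply: nonincreasing_cvg_mu.
  - by apply: lam_fin; apply: measurableD => //; case: (ClUk 0%N).
  - by move=> k; apply: measurableD => //; case: (ClUk k).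
  - by apply: bigcapT_measurable => k; apply: measurableD => //; case: (ClUk k).
  - by move=> k l kl; apply/subsetPset; apply: setDS; exact: subset_bigsetU.
rewrite (_ : \bigcap_k _ = set0); last first.
  apply/seteqP; split => // x Gx; have [[i _ Fi] _] := Gx 0%N I.
  by have [_ /=] := Gx i.+1 I; apply; rewrite /U -bigcup_mkord; exists i => /=.
rewrite measure0 => /fine_cvgP[_ /cvgr0Pnorm_lt/(_ _ e20)][N _ /(_ N (leqnn N))/=].
have mDU : measurable (\bigcup_i F i `\` U N) by apply: measurableD => //; case: (ClUk N).
rewrite ger0_norm ?fine_ge0// => hN.
have [mU /(_ _ e20)[k [P hP]]] := ClUk N; exists k, P.
apply: (@le_lt_trans _ _ (lam ((\bigcup_i F i `\` U N) `|` symdiff (U N) [set x | P (cell k x)]))).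
  apply: le_measure; rewrite ?inE.
  - by apply: measurable_symdiff => //; exact: measurable_cell.
  - by apply: measurableU => //; apply: measurable_symdiff => //; exact: measurable_cell.
  - move=> x [[Fx Px]|[Px Fx]].
      by have [Ux|Ux] := pselect (U N x); [right; left|left].
    right; right; split => // Ux; apply: Fx.
    by move: Ux; rewrite /U -bigcup_mkord => -[i _ Fi]; exists i.
apply: le_lt_trans (measureU2 _ _ _) _ => //.
  by apply: measurable_symdiff => //; exact: measurable_cell.
rewrite (_ : e = e / 2 + e / 2); last by field.
rewrite EFinD lteD//.
by rewrite -[X in (X < _)%E]fineK ?lte_fin// ge0_fin_numE// lam_fin.
Qed.

(** The sets that can be approximated by dyadic sets of a single generation form a sigma-algebra
    containing the cylinders. Infinitely many cells are then cut down to finitely many by keeping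
    those whose code is below m. *)
Lemma cell_approx A (e : R) : measurable A -> 0 < e -> exists k (s : seq 'rV[int]_n),
  (lam (symdiff A [set x | cell k x \in s]) < e%:E)%E.
Proof.
move=> mA e0; have : Cl A.
  have := sigma_cylinder mA; apply: smallest_sub.
    by split; [exact: Cl0|move=> B; rewrite setTD; exact: ClC|exact: Cl_bigcup].
  move=> _ [k [P ->]]; split; first exact: measurable_cell.
  move=> r r0; exists k, P; rewrite (_ : symdiff _ _ = set0) ?measure0//.
  by apply/seteqP; split => // x [] [].
have e20 : 0 < e / 2 by rewrite divr_gt0.
move=> [_ /(_ _ e20)[k [P hP]]].
pose s m := [seq z <- pmap (@pickle_inv 'rV[int]_n) (iota 0 m) | `[< P z >]].
have sP m z : (z \in s m) = `[< P z >] && (pickle z < m)%N.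
  rewrite mem_filter mem_pmap; congr andb; apply/mapP/idP => [[i]|zm].
    rewrite mem_iota add0n /= => im iz.
    by have := @pickle_invK 'rV[int]_n i; case: (pickle_inv i) iz => // _ [<-] /= ->.
  by exists (pickle z); rewrite ?mem_iota ?pickleK_inv.
pose E := [set x : 'rV[R]_n | P (cell k x)]; pose Em m := [set x : 'rV[R]_n | cell k x \in s m].
have mE : measurable E by exact: measurable_cell.
have mEm m : measurable (Em m) by exact: (measurable_cell (R := R) k [set z | z \in s m]).
have : (lam \o (fun m => E `\` Em m)) @ \oo --> lam (\bigcap_m (E `\` Em m)).
  apply: nonincreasing_cvg_mu.
  - by apply: lam_fin; exact: measurableD.
  - by move=> m; exact: measurableD.
  - by apply: bigcapT_measurable => m; exact: measurableD.
  - move=> a b ab; apply/subsetPset; apply: setDS => x.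
    by rewrite /Em /= !sP => /andP[-> /leq_trans ->].
rewrite (_ : \bigcap_m _ = set0); last first.
  apply/seteqP; split => // x Gx; have [Ex _] := Gx 0%N I.
  have [_ /=] := Gx (pickle (cell k x)).+1 I; apply; rewrite /Em/= sP ltnSn andbT.
  exact/asboolP.
rewrite measure0 => /fine_cvgP[_ /cvgr0Pnorm_lt/(_ _ e20)][m _ /(_ m (leqnn m))/=].
rewrite ger0_norm ?fine_ge0// => hm.
exists k, (s m).
apply: (@le_lt_trans _ _ (lam (symdiff A E `|` (E `\` Em m)))).
  apply: le_measure; rewrite ?inE.
  - exact: (measurable_symdiff mA (mEm m)).
  - by apply: measurableU; [exact: measurable_symdiff|exact: measurableD].
  - move=> x [[Ax Ex]|[Ex Ax]].
      by have [Px|Px] := pselect (E x); [right|left; left].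
    left; right; split => //.
    by move: Ex => /=; rewrite sP => /andP[/asboolP].
apply: le_lt_trans (measureU2 _ _ _) _; [exact: measurable_symdiff|exact: measurableD|].
rewrite (_ : e = e / 2 + e / 2); last by field.
rewrite EFinD lteD//.
rewrite -[X in (X < _)%E]fineK ?lte_fin// ge0_fin_numE// lam_fin//.
exact: measurableD.
Qed.

End approx.

End cell_approximation.

Section diagonal.
Context (R : realType).

(** [G i] composes the extractions made for the sequences 0 to i. By [GS], past the index i the
    diagonal takes values of [G i] at indices at least as large, and so inherits the convergence of
    the i-th sequence. *)
Lemma diagonal_subsequence (x : nat -> nat -> R) :
  (forall i, exists M : R, forall j, `|x i j| <= M) ->
  exists phi : nat -> nat, (forall i j, (i < j)%N -> (phi i < phi j)%N) /\
    forall i, cvgn (fun j => x i (phi j)).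
Proof.
move=> bx.
have bw i (g : nat -> nat) : {f : nat -> nat | increasing_seq f /\ cvgn (fun j => x i (g (f j)))}.
  apply: cid; have [M hM] := bx i.
  have [|f fi fc] := @bolzano_weierstrass R (fun j => x i (g j)).
    by exists M; split => [|N MN j _ /=]; [exact: num_real|apply: le_trans (hM _) (ltW MN)].
  by exists f; split.
pose G := fix G i := if i is i'.+1 then (G i') \o sval (bw i (G i')) else sval (bw 0%N id).
have ltf (f : nat -> nat) : increasing_seq f -> forall a b, (a < b)%N -> (f a < f b)%N.
  by move=> fi a b ab; rewrite ltnNge; have := fi b a; rewrite !leEnat => ->; rewrite -ltnNge.
have gef (f : nat -> nat) : increasing_seq f -> forall a, (a <= f a)%N.
  move=> fi; elim => // a IH; exact: leq_ltn_trans IH (ltf _ fi _ _ (ltnSn a)).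
have Gi i : forall a b, (a < b)%N -> (G i a < G i b)%N.
  elim: i => [|i IH] a b ab /=.
    by case: (bw 0%N id) => f /= [fi _]; exact: ltf.
  by case: (bw i.+1 (G i)) => f /= [fi _]; apply: IH; exact: ltf.
have Gc i : cvgn (fun j => x i (G i j)).
  by case: i => [|i] /=; case: (bw _ _) => f /= [].
have GS i d a : exists2 b, (a <= b)%N & G (i + d)%N a = G i b.
  elim: d a => [|d IH] a; first by exists a; rewrite ?addn0.
  rewrite addnS /=; case: (bw (i + d).+1 (G (i + d)%N)) => f /= [fi _].
  have [b ab ->] := IH (f a); exists b => //; apply: leq_trans ab; exact: gef.
exists (fun j => G j j); split.
  have S j : (G j j < G j.+1 j.+1)%N.
    have [b jb] := GS j 1%N j.+1; rewrite addn1 => ->.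
    by apply: Gi.
  move=> i j; elim: j => // j IH; rewrite ltnS leq_eqVlt => /predU1P[->//|/IH].
  by move=> h; exact: ltn_trans h (S j).
move=> i; apply/cvg_ex; have /cvg_ex[l hl] := Gc i; exists l => /=.
apply/cvgrPdist_lt => e e0; have /cvgrPdist_lt/(_ e e0)[N _ hN] := hl.
exists (maxn N i) => // j /=; rewrite geq_max => /andP[Nj ij].
have [b jb] := GS i (j - i)%N j; rewrite subnKC// => ->.
by apply: hN => /=; exact: leq_trans jb.
Qed.

End diagonal.

(** * Countable covers adapted to a local property *)

Section exhaustion.
Context (R : realType) (n : nat).
Implicit Types (U A K : set 'rV[R]_n) (x y : 'rV[R]_n).

Definition cube x (e : R) : set 'rV[R]_n :=
  [set y | forall i, x ord0 i - e <= y ord0 i <= x ord0 i + e].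

Lemma cubeP x (e : R) y : cube x e y <-> forall i, `|x ord0 i - y ord0 i| <= e.
Proof.
split=> h i; have := h i; rewrite ?ler_norml => /andP[a b]; apply/andP; split; lra.
Qed.

Lemma compact_cube x (e : R) : compact (cube x e).
Proof.
have := @rV_compact R n (fun i => `[x ord0 i - e, x ord0 i + e]%classic).
rewrite (_ : [set v | _] = cube x e); first by apply => i; exact: segment_compact.
by apply/seteqP; split => y h i; have := h i; rewrite /= in_itv/=.
Qed.

Lemma measurable_cube x (e : R) : measurable (cube x e).
Proof. exact: measurable_box. Qed.

Lemma ball_cube x (e : R) : ball x e `<=` cube x e.
Proof. by move=> y xy; apply/cubeP => i; exact/ltW/ball_rVP. Qed.

Lemma cube_ball x (e r : R) : 0 < r -> e < r -> cube x e `<=` ball x r.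
Proof.
move=> r0 er y /cubeP xy; apply: rV_ballP => // i; exact: le_lt_trans (xy i) er.
Qed.

Lemma open_compact_nbhs U x : open U -> U x ->
  exists2 e : R, 0 < e & cube x e `<=` U.
Proof.
move=> oU Ux; have /nbhs_ballP[r /= r0 hr] : nbhs x U by exact: open_nbhs_nbhs.
exists (r / 2); first by rewrite divr_gt0.
by apply: subset_trans hr; apply: cube_ball => //; rewrite ltr_pdivrMr// ltr_pMr// ltr1n.
Qed.

(** The candidates are the balls of radius 2^-k about the points of the grid of mesh 2^-k, countably
    many in all. Those that are not good are replaced by the empty set, which is why [set0] has to
    be good. *)
Lemma good_cover (good : set 'rV[R]_n -> Prop) U :
  good set0 -> (forall A B, A `<=` B -> good B -> good A) ->
  (forall x, U x -> exists2 e : R, 0 < e & good (ball x e)) ->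
  exists B : nat -> set 'rV[R]_n, [/\ forall m, open (B m) /\ good (B m),
    U `<=` \bigcup_m B m &
    forall K, compact K -> K `<=` U -> exists N, K `<=` \bigcup_(m in `I_N) B m].
Proof.
move=> g0 gS gU.
pose b (kz : nat * 'rV[int]_n) : set 'rV[R]_n :=
  ball (\row_i ((kz.2 ord0 i)%:~R / 2 ^+ kz.1) : 'rV[R]_n) (2 ^- kz.1 : R).
pose B m := if @pickle_inv (nat * 'rV[int]_n)%type m is Some kz then
  if `[< good (b kz) >] then b kz else set0 else set0.
have UB : U `<=` \bigcup_m B m.
  move=> x Ux; have [e e0 ge] := gU x Ux.
  (* A grid point lies within distance 2^-k of x; its ball contains x and, since twice 2^-k is less
     than e, stays inside the ball of radius e about x. *)
  have [k _ ke] := near_infty_natSinv_lt (PosNum (divr_gt0 e0 (ltr0n _ 2))).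
  have {}ke : 2 ^- k < e / 2.
    apply: le_lt_trans (ke k (leqnn k)).
    by rewrite lef_pV2 ?posrE ?exprn_gt0// -natrX ler_nat ltn_expl.
  have k0 : 0 < 2 ^+ k :> R by rewrite exprn_gt0.
  have xb : b (k, cell k x) x.
    apply: rV_ballP; first by rewrite invr_gt0.
    move=> i; rewrite /= !mxE; set c := (Num.floor _)%:~R.
    have -> : c / 2 ^+ k - x ord0 i = (c - 2 ^+ k * x ord0 i) / 2 ^+ k.
      by field; rewrite gt_eqF.
    rewrite normrM (gtr0_norm (_ : 0 < 2 ^- k)) ?invr_gt0//.
    rewrite -[X in _ < X]mul1r ltr_pM2r ?invr_gt0//.
    rewrite distrC ger0_norm ?subr_ge0 ?floor_le//.
    by have := floorD1_gt (2 ^+ k * x ord0 i); rewrite intrD /c; lra.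
  exists (pickle (k, cell k x)) => //; rewrite /B pickleK_inv asboolT//.
  apply: gS ge => y yb; apply: rV_ballP => // i.
  have := ball_rVP i xb; have := ball_rVP i yb.
  rewrite !ltr_norml => /andP[? ?] /andP[? ?]; apply/andP; split; lra.
exists B; split => //.
  move=> m; rewrite /B; case: pickle_inv => [kz|]; last by split => //; exact: open0.
  case: asboolP => gb; last by split => //; exact: open0.
  by split => //; exact: ball_open.
move=> K cK KU; have := cK; rewrite compact_cover.
move=> /(_ nat setT B) [||D _ KD].
- move=> m _; rewrite /B; case: pickle_inv => [kz|]; last exact: open0.
  case: asboolP => gb; last exact: open0.
  by exact: ball_open.
- exact: subset_trans KU UB.
- exists (\max_(i <- finmap.enum_fset D) i).+1 => x /KD[i /= iD Bix]; exists i => //=.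
  by rewrite ltnS; apply: leq_bigmax_seq.
Qed.

(** The uncountably many exceptional null sets, one for each point, are reduced to countably many by
    [good_cover]. *)
Lemma ae_local (P : 'rV[R]_n -> Prop) U :
  (forall x, U x -> exists2 e : R, 0 < e & {ae leb R n, forall y, ball x e y -> P y}) ->
  {ae leb R n, forall x, U x -> P x}.
Proof.
move=> h; pose good A := {ae leb R n, forall y, A y -> P y}.
have [||B [Bg UB _]] := @good_cover good U _ _ h.
- exact: aeW.
- by move=> A B AB; rewrite /good; apply: filterS => y h' /AB.
have : {ae leb R n, forall x, forall m, B m x -> P x}.
  by apply/ae_foralln => m; exact: (Bg m).2.
by apply: filterS => x hx /UB[m _ /hx].
Qed.

End exhaustion.

Section local_weak_limit.
Context (R : realType) (n : nat).
Implicit Types (U A K D : set 'rV[R]_n) (f u : 'rV[R]_n -> R).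
Notation mu := (leb R n).

Lemma Rintegral_disjoint_cover D A (E : nat -> set 'rV[R]_n) N f :
  measurable D -> measurable A -> (forall m, measurable (E m)) -> trivIset setT E ->
  D `<=` \bigcup_(m in `I_N) E m -> mu.-integrable D (EFin \o f) ->
  \int[mu]_(x in D `&` A) f x = \sum_(m < N) \int[mu]_(x in E m `&` (D `&` A)) f x.
Proof.
move=> mD mA mE tE DE if_.
have mDA : measurable (D `&` A) by exact: measurableI.
have iDA : mu.-integrable (D `&` A) (EFin \o f) by apply: integrableS if_ => //; exact: subIsetl.
rewrite Rintegral_mkcond.
under [RHS]eq_bigr do rewrite Rintegral_mkcond.
rewrite -Rintegral_sum//; last first.
  move=> m; have mED : measurable (E m `&` (D `&` A)) by exact: measurableI.
  rewrite (_ : _ \o _ = (EFin \o f) \_ (E m `&` (D `&` A))); last first.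
    by rewrite restrict_EFin.
  by rewrite -integrable_mkcond//; apply: integrableS iDA => //; exact: subIsetr.
apply: eq_Rintegral => x _; rewrite patchE; case: ifPn => [/set_mem DAx|DAx].
  have [m /= mN Emx] := DE x DAx.1.
  rewrite (bigD1 (Ordinal mN))//= patchE mem_set// big1 ?addr0// => i im.
  rewrite patchE memNset// => -[Eix _].
  have /trivIsetP/(_ m i I I) := tE.
  have mi : m != i by apply: contraNneq im => mi; apply/eqP/val_inj.
  by move=> /(_ mi)/seteqP[/(_ x (conj Emx Eix))].
rewrite big1// => i _; rewrite patchE memNset// => -[_ DAx'].
by move: DAx; rewrite mem_set.
Qed.

(** Local limits are glued along a countable cover made disjoint by [seqDU]. A compact subset of U
    is covered by finitely many of the pieces, so that both the L^p bound of the glued function and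
    the setwise convergence on K reduce to finite sums. *)
Lemma local_weak_limit (p : R) U (u : nat -> 'rV[R]_n -> R) : 1 < p -> open U ->
  (forall j, measurable_fun U (u j)) ->
  (forall K, compact K -> K `<=` U -> exists C : R, forall j,
     (\int[mu]_(x in K) (`|u j x| `^ p)%:E <= C%:E)%E) ->
  (forall x, U x -> exists2 e : R, 0 < e & exists K, [/\ compact K, K `<=` U, ball x e `<=` K &
     forall A, measurable A -> A `<=` ball x e -> cvgn (fun j => \int[mu]_(x in A) u j x)]) ->
  exists2 u0, Lp_loc p U u0 & weak_cvg_Lp_loc p U u u0.
Proof.
move=> p1 oU mu_ uC hloc.
have mU := open_measurable_rV oU.
have p0 : 0 < p := lt_trans ltr01 p1.
pose good B := exists K, [/\ compact K, K `<=` U, B `<=` K &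
     forall A, measurable A -> A `<=` B -> cvgn (fun j => \int[mu]_(x in A) u j x)].
have [||B [Bg UB cB]] := @good_cover R n good U _ _ hloc.
- exists set0; split => //; first exact: compact0.
  move=> A mA; rewrite subset0 => ->; apply/cvg_ex; exists 0.
  by apply: (@eq_cvgn _ (fun=> 0)) (cvg_cst _) => // j; rewrite Rintegral_set0.
- move=> A E AE [K [cK KU EK hK]]; exists K; split => //; first exact: subset_trans EK.
  by move=> A' mA' A'A; apply: hK => //; exact: subset_trans AE.
pose D m := seqDU B m.
have mB m : measurable (B m) by apply: open_measurable_rV; case: (Bg m).
have mD m : measurable (D m).
  by apply: measurableD => //; apply: bigsetU_measurable.
have tD : trivIset setT D by exact: trivIset_seqDU.
have DB m : D m `<=` B m by exact: subset_seqDU.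
have DN N : \bigcup_(m in `I_N) B m = \bigcup_(m in `I_N) D m.
  by rewrite !bigcup_mkord -bigsetU_seqDU.
have DU m : D m `<=` U.
  move=> x /DB; have [_ [K [cK KU BK _]]] := Bg m; by move=> /BK /KU.
have Doo m : (mu (D m) < +oo)%E.
  have [_ [K [cK KU BK _]]] := Bg m.
  apply: le_lt_trans (leb_compact_lty cK); apply: le_measure; rewrite ?inE//.
    exact: compact_measurable_rV.
  exact: subset_trans (DB m) BK.
have ex m : exists C u0, [/\ measurable_fun setT u0, forall j, Lp_le mu (D m) p (u j) C,
    Lp_le mu (D m) p u0 C &
    forall A, measurable A -> (fun j => \int[mu]_(x in D m `&` A) u j x) @ \oo -->
    \int[mu]_(x in D m `&` A) u0 x].
  have [_ [K [cK KU BK hK]]] := Bg m.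
  have mK := compact_measurable_rV cK.
  have [C hC] := uC K cK KU.
  have uL j : Lp_le mu (D m) p (u j) C.
    split; first by apply: measurable_funS (mu_ j) => //; exact: DU.
    apply: le_trans (hC j); apply: ge0_subset_integral => //.
    - apply/measurable_EFinP; apply: (measurableT_comp (measurable_powR p)).
      apply: measurableT_comp => //; exact: measurable_funS (mu_ j).
    - exact: subset_trans (DB m) BK.
  have [A mA|u0 [mu0 u0C u0A]] := exists_weak_limit (mD m) (Doo m) p1 uL.
    apply: hK; first exact: measurableI.
    by apply: subset_trans (DB m); exact: subIsetl.
  by exists C, u0; split.
move: ex => /choice[C /choice[v hv]].
pose u0 x := if pselect (exists m, D m x) is left h then v (sval (cid h)) x else 0.
have u0E m x : D m x -> u0 x = v m x.
  move=> Dx; rewrite /u0; case: pselect => [h|]; last by case; exists m.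
  case: cid => /= i Dix; have [->//|im] := eqVneq i m.
  have /trivIsetP/(_ i m I I im)/seteqP[/(_ x (conj Dix Dx))] := tD.
  by [].
have UD : U = \bigcup_m D m.
  apply/seteqP; split => [x /UB|x [m _]]; last exact: DU.
  by rewrite seqDU_bigcup_eq.
have mu0 : measurable_fun U u0.
  rewrite UD; apply/measurable_fun_bigcup => // m.
  apply: (@eq_measurable_fun _ _ _ _ _ (v m)).
    by move=> x /set_mem Dx; rewrite (u0E m).
  by apply: measurable_funTS; have [] := hv m.
have mpw (A : set 'rV[R]_n) (f : 'rV[R]_n -> R) : measurable_fun A f ->
    measurable_fun A (fun x => (`|f x| `^ p)%:E).
  move=> mf; apply/measurable_EFinP; apply: (measurableT_comp (measurable_powR p)).
  exact: measurableT_comp.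
have u0K K : compact K -> K `<=` U -> exists C' : R, (\int[mu]_(x in K) (`|u0 x| `^ p)%:E <= C'%:E)%E.
  move=> cK KU; have [N KN] := cB K cK KU.
  have mDN : measurable (\big[setU/set0]_(m < N) D m) by exact: bigsetU_measurable.
  have DNU : \big[setU/set0]_(m < N) D m `<=` U.
    by rewrite -bigcup_mkord => x [m _]; exact: DU.
  exists (\sum_(m < N) C m).
  apply: (@le_trans _ _ (\int[mu]_(x in \big[setU/set0]_(m < N) D m) (`|u0 x| `^ p)%:E)%E).
    apply: ge0_subset_integral => //.
    - exact: compact_measurable_rV.
    - by apply: mpw; exact: measurable_funS mu0.
    - by apply: subset_trans KN _; rewrite DN bigcup_mkord.
  rewrite ge0_integral_bigsetU//.
  - rewrite -sumEFin; apply: lee_sum => m _.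
    have [_ _ [_ h] _] := hv m; apply: le_trans h.
    rewrite le_eqVlt; apply/orP; left; apply/eqP; apply: eq_integral => x /set_mem Dx.
    by rewrite (u0E m).
  - exact: index_enum_uniq.
  - by move=> a b _ _ h; apply/val_inj; exact: (tD a b I I h).
  - by apply: mpw; exact: measurable_funS mu0.
exists u0.
  split => // K cK KU; have [C' h] := u0K K cK KU.
  by apply: le_lt_trans h _; rewrite ltry.
move=> K cK KU psi mpsi psiq.
have mK := compact_measurable_rV cK.
have [N KN] := cB K cK KU; have [C1 hC1] := uC K cK KU.
have [C2 hC2] := u0K K cK KU.
rewrite DN in KN.
have Koo := leb_compact_lty cK.
have uL j : Lp_le mu K p (u j) (Num.max C1 C2).
  split; first exact: measurable_funS (mu_ j).
  by apply: le_trans (hC1 j) _; rewrite lee_fin le_max lexx.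
have u0L : Lp_le mu K p u0 (Num.max C1 C2).
  split; first exact: measurable_funS mu0.
  by apply: le_trans hC2 _; rewrite lee_fin le_max lexx orbT.
apply: (cvg_setwise_weak mK Koo p1 uL u0L) => // A mA.
rewrite (Rintegral_disjoint_cover mK mA mD tD KN); last exact: Lp_le_L1 (ltW p1) u0L.
have : (fun j => \sum_(m < N) \int[mu]_(x in D m `&` (K `&` A)) u j x) @ \oo -->
    \sum_(m < N) \int[mu]_(x in D m `&` (K `&` A)) u0 x.
  apply: (@cvgn_sum _ _ _ (fun (m : 'I_N) j => \int[mu]_(x in D m `&` (K `&` A)) u j x)) => m.
  have [_ _ _ h] := hv m.
  rewrite [X in _ --> X](_ : _ = \int[mu]_(x in D m `&` (K `&` A)) v m x).
    by apply: h; exact: measurableI.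
  by apply: eq_Rintegral => x /set_mem[Dx _]; rewrite (u0E m).
apply: eq_cvgn => // j.
by rewrite -(Rintegral_disjoint_cover mK mA mD tD KN)//; exact: Lp_le_L1 (ltW p1) (uL j).
Qed.


End local_weak_limit.

(** * Change of variables *)

Section directional.
Context (R : realType) (n : nat).
Implicit Types (f : 'rV[R]_n -> R) (a v x : 'rV[R]_n).

Lemma is_derive_line f a v (t : R) : differentiable f (a + t *: v) ->
  is_derive t (1 : R) (fun s : R => f (a + s *: v)) ('D_v f (a + t *: v)).
Proof.
move=> df.
have E : (fun h : R => h^-1 *: (((fun s : R => f (a + s *: v)) \o shift t) (h *: (1 : R)) - f (a + t *: v)))
   = (fun h : R => h^-1 *: ((f \o shift (a + t *: v)) (h *: v) - f (a + t *: v))).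
  apply/funext => h /=; congr (_ *: (f _ - _)).
  by rewrite [h *: _]mulr1 scalerDl addrCA.
split; first by rewrite /derivable E; exact: diff_derivable.
by rewrite /derive E.
Qed.

Lemma derive_sum_partial f v x : differentiable f x ->
  'D_v f x = \sum_i v ord0 i * partial i f x.
Proof.
move=> df; rewrite deriveE// {1}(row_sum_delta v) linear_sum/=.
apply: eq_bigr => i _; rewrite linearZ/= /partial deriveE//.
Qed.

Lemma smooth_diff U f x : smooth_on U f -> U x -> differentiable f x.
Proof. by move=> sf Ux; exact: (sf [::] x Ux). Qed.

Lemma smooth_partial U f i : smooth_on U f -> smooth_on U (partial i f).
Proof. by move=> sf s x Ux; have := sf (rcons s i) x Ux; rewrite foldr_rcons. Qed.

Lemma smooth_continuous U f x : smooth_on U f -> U x -> {for x, continuous f}.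
Proof. by move=> sf Ux; apply: differentiable_continuous; exact: smooth_diff sf Ux. Qed.

Lemma le_increment01 (g dg : R -> R) (B : R) :
  (forall t : R, t \in `[0, 1] -> is_derive t (1 : R) g (dg t)) ->
  (forall t : R, t \in `[0, 1] -> `|dg t| <= B) -> `|g 1 - g 0| <= B.
Proof.
move=> dl gB.
have le01 : (0 : R) <= 1 by exact: ler01.
have H1 (x : R) : x \in `]0, 1[ -> is_derive x (1 : R) g (dg x).
  by move=> x01; apply: dl; exact: subset_itv_oo_cc x01.
have H2 : {within `[0, 1], continuous g}.
  apply: derivable_within_continuous => t t01.
  exact: (@ex_derive _ _ _ _ _ _ _ (dl t t01)).
have [t t01 ->] := MVT_segment le01 H1 H2.
by rewrite subr0 mulr1; exact: gB.
Qed.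

(** On a small ball, which is convex, the partial derivatives stay within 1 of their values at x0;
    the mean value theorem along segments gives the constant. *)
Lemma local_lipschitz U f x0 : open U -> smooth_on U f -> U x0 ->
  exists e L : R, [/\ 0 < e, 0 <= L, ball x0 e `<=` U &
    forall y y' (eta : R), ball x0 e y -> ball x0 e y' ->
      (forall i, `|y ord0 i - y' ord0 i| <= eta) -> `|f y - f y'| <= L * eta].
Proof.
move=> oU sf Ux0.
pose c i := `|partial i f x0| + 1.
have : \forall y \near x0, U y /\ forall i, `|partial i f y| <= c i.
  apply: filterI; first exact: open_nbhs_nbhs.
  have H := @filter_forall 'rV[R]_n 'I_n (fun i => [set y | `|partial i f y| <= c i]) (nbhs x0) _.
  apply: H => i.
  have := smooth_continuous (smooth_partial i sf) Ux0.
  move=> /cvgrPdist_le/(_ 1 ltr01); apply: filterS => y h.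
  rewrite /= /c -lerBlDl; apply: le_trans h; rewrite distrC; exact: lerB_dist.
move=> /nbhs_ballP[e /= e0 he].
exists e, (\sum_i c i); split => //.
- by apply: sumr_ge0 => i _; rewrite addr_ge0.
- by move=> y /he[].
move=> y y' eta yB y'B yy'.
pose v : 'rV[R]_n := y - y'.
pose g (s : R) : R := f (y' + s *: v).
pose dg (s : R) : R := 'D_v f (y' + s *: v).
have line (t : R) : t \in `[0, 1] -> ball x0 e (y' + t *: v).
  rewrite in_itv/= => /andP[t0 t1]; apply: rV_ballP => // i; rewrite !mxE.
  have hy := ball_rVP i yB; have hy' := ball_rVP i y'B.
  set A := x0 ord0 i - y ord0 i in hy; set B := x0 ord0 i - y' ord0 i in hy'.
  have -> : x0 ord0 i - (y' ord0 i + t * (y ord0 i - y' ord0 i)) = t * A + (1 - t) * B.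
    by rewrite /A /B; ring.
  have mlt : Num.max `|A| `|B| < e by rewrite gt_max hy.
  apply: le_lt_trans mlt; apply: le_trans (ler_normD _ _) _.
  have s0 : 0 <= 1 - t by rewrite subr_ge0.
  rewrite !normrM (ger0_norm t0) (ger0_norm s0).
  apply: (@le_trans _ _ (t * Num.max `|A| `|B| + (1 - t) * Num.max `|A| `|B|)); last first.
    by rewrite -mulrDl subrKC mul1r.
  by apply: lerD; apply: ler_wpM2l => //; rewrite le_max lexx ?orbT.
have dl (t : R) : t \in `[0, 1] -> is_derive t (1 : R) g (dg t).
  by move=> t01; apply: is_derive_line; apply: (smooth_diff sf); have [] := he _ (line t t01).
have -> : f y - f y' = g 1 - g 0.
  by rewrite /g scale1r scale0r addr0 /v subrKC.
apply: (le_increment01 dl) => t t01.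
have [Ut ct] := he _ (line t t01).
rewrite /dg derive_sum_partial; last exact: smooth_diff sf Ut.
rewrite mulr_suml; apply: le_trans (ler_norm_sum _ _ _) _; apply: ler_sum => i _.
rewrite normrM mulrC; apply: ler_pM => //.
by rewrite !mxE; exact: yy'.
Qed.

End directional.

(** * Domination of measures tested on dyadic cells *)

Section dyadic_domination.
Context (R : realType) (n : nat).
Notation mu := (leb R n).

Lemma leb_cell k z : mu [set x | cell k x = z] = ((2 ^- k) ^+ n)%:E.
Proof.
have k0 : 0 < 2 ^+ k :> R by rewrite exprn_gt0.
have -> : [set x : 'rV[R]_n | cell k x = z] =
    [set x : 'rV[R]_n | forall i, [set t : R | Num.floor (2 ^+ k * t) = z ord0 i] (x ord0 i)].
  apply/seteqP; split => [x <- i|x h]; first by rewrite /= mxE.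
  by apply/rowP => i; rewrite mxE h.
have E i : [set t : R | Num.floor (2 ^+ k * t) = z ord0 i] =
    `[(z ord0 i)%:~R / 2 ^+ k, ((z ord0 i) + 1)%:~R / 2 ^+ k[%classic.
  apply/seteqP; split => [t /= <-|t /=]; rewrite in_itv/=.
    rewrite ler_pdivrMr// ltr_pdivlMr// [t * _]mulrC.
    by have := floor_itv (2 ^+ k * t).
  rewrite ler_pdivrMr// ltr_pdivlMr// [t * _]mulrC => h.
  exact: floor_def.
have H := @leb_prod_set R n (fun i => [set t : R | Num.floor (2 ^+ k * t) = z ord0 i]) (fun=> 2 ^- k).
rewrite prodr_const card_ord in H; apply: H => i; rewrite E; first exact: measurable_itv.
rewrite lebesgue_measure_itv/= lte_fin ltr_pM2r ?invr_gt0// ltr_int ltrDl ltr01.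
by rewrite -EFinB -mulrBl -intrB addrAC subrr add0r mul1r.
Qed.

(** A is approximated by a finite union of cells simultaneously for lam and for mu near the support
    of lam. Since [cell_approx] asks for a finite measure, mu is cut off to the cube of radius 2; a
    cell that meets the cube of radius 1 has side at most 1 and stays in it. *)
Lemma dyadic_domination (lam : {measure set 'rV[R]_n -> \bar R}) (y0 : 'rV[R]_n) (C : R) :
  (lam setT < +oo)%E -> 0 <= C -> lam (~` cube y0 1) = 0%E ->
  (forall k z, (lam [set x | cell k x = z] <= C%:E * mu [set x | cell k x = z])%E) ->
  forall A, measurable A -> (lam A <= C%:E * mu A)%E.
Proof.
move=> lamT C0 lam0 lamC A mA.
have mK := @measurable_cube R n y0 2.
pose La := measure_add lam (mrestr mu mK).
have LaE B : La B = (lam B + mu (B `&` cube y0 2))%E by rewrite /La measure_addE.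
have LaT : (La setT < +oo)%E.
  rewrite LaE setTI lte_add_pinfty//; apply: leb_compact_lty; exact: compact_cube.
apply/lee_addgt0Pr => e e0.
(* The error d occurs once for lam and C times for mu. *)
pose d := e / (C + 1).
have d0 : 0 < d by rewrite divr_gt0// ltr_wpDl.
have [k [s hs]] := cell_approx LaT mA d0.
pose s' := [seq z <- undup s | `[< exists2 x, cube y0 1 x & cell k x = z >]].
pose E := [set x : 'rV[R]_n | cell k x \in s]; pose E' := [set x : 'rV[R]_n | cell k x \in s'].
have mE : measurable E by exact: (measurable_cell (R := R) k [set z | z \in s]).
have mE' : measurable E' by exact: (measurable_cell (R := R) k [set z | z \in s']).
have E'E : E' `<=` E by move=> x; rewrite /E' /E /= mem_filter mem_undup => /andP[].
have E'K : E' `<=` cube y0 2.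
  move=> x; rewrite /E' /= mem_filter => /andP[/asboolP[y /cubeP yK xy] _].
  apply/cubeP => i; have := yK i; have := cellP i xy.
  have : 2 ^- k <= 1 :> R by rewrite invf_le1 ?exprn_gt0// exprn_ege1// ler1n.
  rewrite ltr_norml !ler_norml => ? /andP[? ?] /andP[? ?]; apply/andP; split; lra.
have msd : measurable (symdiff A E) by exact: measurable_symdiff.
have {}hs : (La (symdiff A E) < d%:E)%E := hs.
rewrite LaE in hs.
have h1 : (lam (symdiff A E) <= d%:E)%E.
  by apply: ltW; apply: le_lt_trans hs; rewrite leeDl.
have h2 : (mu (symdiff A E `&` cube y0 2) <= d%:E)%E.
  by apply: ltW; apply: le_lt_trans hs; rewrite leeDr.
have lamA : (lam A <= lam E' + d%:E)%E.
  apply: (@le_trans _ _ (lam (E' `|` (symdiff A E `|` ~` cube y0 1)))).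
    apply: le_measure; rewrite ?inE//.
      by apply: measurableU => //; apply: measurableU => //; apply: measurableC; exact: measurable_cube.
    move=> x Ax; have [Kx|] := pselect (cube y0 1 x); last by right; right.
    have [Ex|Ex] := pselect (E x); last by right; left; left.
    left; rewrite /E' /= mem_filter mem_undup; apply/andP; split => //.
    by apply/asboolP; exists x.
  apply: le_trans (measureU2 _ _ _) _ => //.
    by apply: measurableU => //; apply: measurableC; exact: measurable_cube.
  rewrite leeD2l//; apply: le_trans (measureU2 _ _ _) _ => //.
    by apply: measurableC; exact: measurable_cube.
  rewrite -[d%:E]adde0; apply: leeD => //.
  by rewrite le_eqVlt; apply/orP; left; apply/eqP; exact: lam0.
have lamE' : (lam E' <= C%:E * mu E')%E.
  have : uniq s' by rewrite filter_uniq// undup_uniq.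
  rewrite /E'; elim: s' {E' mE' E'E E'K lamA} => [|z s' IH] /=.
    rewrite (_ : [set x | _] = set0) ?measure0 ?mule0//.
    by apply/seteqP; split.
  move=> /andP[zs' us'].
  rewrite (_ : [set x | _] = [set x | cell k x = z] `|` [set x | cell k x \in s']); last first.
    apply/seteqP; split => x /=; rewrite inE => h.
      by case/orP : h => [/eqP|]; [left|right].
    by case: h => [->|->]; rewrite ?eqxx ?orbT.
  have m1 := @measurable_cell1 R n k z.
  have m2 : measurable [set x : 'rV[R]_n | cell k x \in s'].
    exact: (measurable_cell (R := R) k [set z | z \in s']).
  have dis : [set x : 'rV[R]_n | cell k x = z] `&` [set x | cell k x \in s'] = set0.
    by apply/seteqP; split => // x [/= ->]; rewrite (negbTE zs').
  rewrite !measureU// muleDr ?ge0_adde_def ?inE//.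
  by apply: leeD; [exact: lamC|exact: IH].
have muE' : (mu E' <= mu A + d%:E)%E.
  apply: (@le_trans _ _ (mu (A `|` (symdiff A E `&` cube y0 2)))).
    apply: le_measure; rewrite ?inE//.
      by apply: measurableU => //; exact: measurableI.
    move=> x E'x; have [Ax|Ax] := pselect (A x); [by left|right].
    by split; [right; split => //; exact: E'E|exact: E'K].
  apply: le_trans (measureU2 _ _ _) _ => //; first exact: measurableI.
  exact: leeD2l.
apply: le_trans lamA _; apply: (@le_trans _ _ (C%:E * (mu A + d%:E) + d%:E)%E).
  rewrite leeD2r//; apply: le_trans lamE' _; exact: lee_wpmul2l.
rewrite muleDr ?ge0_adde_def ?inE//; last by rewrite lee_fin ltW.
rewrite -addeA leeD2l// -EFinM -EFinD lee_fin.
rewrite -[X in _ + X]mul1r -mulrDl /d mulrCA divff ?mulr1//.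
by rewrite gt_eqF// ltr_wpDl.
Qed.

End dyadic_domination.

Lemma ge0_integral_mrestr d (T : measurableType d) (R : realType)
    (mu : {measure set T -> \bar R}) (D : set T) (mD : measurable D) (f : T -> \bar R) :
  measurable_fun setT f -> (forall x, 0 <= f x)%E ->
  (\int[mrestr mu mD]_x f x = \int[mu]_(x in D) f x)%E.
Proof.
move=> mf f0; rewrite -(setUv D) ge0_integral_setU//; last 3 first.
- exact: measurableC.
- by rewrite setUv.
- by apply/disj_set2P; rewrite setICr.
rewrite [X in (_ + X)%E](_ : _ = 0%E).
  rewrite adde0; apply: eq_measure_integral => A mA AD.
  by rewrite /= /mrestr setIidl.
rewrite -[RHS](@integral_measure_zero _ _ R (~` D) f).
apply: eq_measure_integral => A mA AD; rewrite /= /mrestr /mzero.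
by apply/eqP; rewrite (_ : A `&` D = set0) ?measure0//; apply/seteqP; split => // x [/AD].
Qed.

Section chart_transfer.
Context (R : realType) (n : nat).
Notation mu := (leb R n).
Variables (V V' : set 'rV[R]_n) (T S : 'rV[R]_n -> 'rV[R]_n) (x0 : 'rV[R]_n).
Hypotheses (oV : open V) (oV' : open V').
Hypothesis cT : forall x, V x -> {for x, continuous T}.
Hypothesis TV : forall x, V x -> V' (T x).
Hypothesis TK : forall x, V x -> S (T x) = x.
Hypothesis sS : forall r, smooth_on V' (fun y => S y ord0 r).
Hypothesis Vx0 : V x0.

Let y0 := T x0.

Let lipschitz_inverse : exists e L : R, [/\ 0 < e, 0 < L, ball y0 e `<=` V' &
  forall y y' (eta : R), ball y0 e y -> ball y0 e y' ->
    (forall i, `|y ord0 i - y' ord0 i| <= eta) -> forall r, `|S y ord0 r - S y' ord0 r| <= L * eta].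
Proof.
have Vy0 : V' y0 by exact: TV.
have ex r : exists eL : R * R, [/\ 0 < eL.1, 0 <= eL.2 &
    forall y y' (eta : R), ball y0 eL.1 y -> ball y0 eL.1 y' ->
      (forall i, `|y ord0 i - y' ord0 i| <= eta) -> `|S y ord0 r - S y' ord0 r| <= eL.2 * eta].
  have [e [L [e0 L0 _ h]]] := local_lipschitz oV' (sS r) Vy0.
  by exists (e, L); split.
move: ex => /choice[eL heL].
have : nbhs y0 (V' `&` [set y | forall r, ball y0 (eL r).1 y]).
  apply: filterI; first exact: open_nbhs_nbhs.
  have H := @filter_forall 'rV[R]_n 'I_n (fun r => ball y0 (eL r).1) (nbhs y0) _.
  by apply: H => r; have [e0 _ _] := heL r; exact: nbhsx_ballx.
move=> /nbhs_ballP[e /= e0 he].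
have L0 r : 0 <= (eL r).2 by have [] := heL r.
exists e, (\sum_r (eL r).2 + 1); split => //.
- by rewrite ltr_wpDl// sumr_ge0.
- by move=> y /he[].
move=> y y' eta yB y'B h r.
have [_ yB'] := he _ yB; have [_ y'B'] := he _ y'B.
have [_ _ H] := heL r.
apply: le_trans (H y y' eta (yB' r) (y'B' r) h) _.
have eta0 : 0 <= eta.
  by apply: le_trans (h r).
rewrite ler_wpM2r// (bigD1 r)//= -addrA lerDl addr_ge0// sumr_ge0//.
Qed.

(** No determinant is computed. Near T x0 the map S is Lipschitz with a constant L, so the preimage
    under T of a cell of side 2^-k lies in a cube of side 2 L 2^-k. Hence the image under T of
    Lebesgue measure on a small ball is at most C = (2 L)^n times Lebesgue measure on cells, and
    then on all measurable sets by [dyadic_domination]. Its density h is therefore bounded by C. *)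
Lemma chart_transfer : exists (e C : R) (K : set 'rV[R]_n) (h : 'rV[R]_n -> R),
  [/\ 0 < e /\ ball x0 e `<=` V, compact K /\ K `<=` V',
      (forall x, ball x0 e x -> K (T x)) /\
      (forall i, measurable_fun (ball x0 e) (fun x => T x ord0 i)),
      measurable_fun setT h /\ (forall y, 0 <= h y <= C) &
      forall w : 'rV[R]_n -> R, mu.-integrable K (EFin \o w) ->
        mu.-integrable (ball x0 e) (EFin \o (w \o T)) /\
        \int[mu]_(x in ball x0 e) w (T x) = \int[mu]_(y in K) (w y * h y)].
Proof.
have [e' [L [e'0 L0 e'V hL]]] := lipschitz_inverse.
(* At most 1 for the sake of [dyadic_domination], and less than e' so that K stays where S is
   Lipschitz. *)
pose rho := Num.min (e' / 2) 1.
have rho0 : 0 < rho by rewrite lt_min ltr01 divr_gt0.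
have rhoe' : rho < e'.
  by rewrite gt_min ltr_pdivrMr// ltr_pMr// ltr1n.
pose K := cube y0 rho.
have KB : K `<=` ball y0 e' by exact: cube_ball.
have cK : compact K by exact: compact_cube.
have mK : measurable K by exact: measurable_cube.
have Koo : (mu K < +oo)%E := leb_compact_lty cK.
have : nbhs x0 (V `&` T @^-1` ball y0 rho).
  apply: filterI; first exact: open_nbhs_nbhs.
  by apply: cT => //; exact: nbhsx_ballx.
move=> /nbhs_ballP[e /= e0 he].
pose N : set 'rV[R]_n := ball x0 e.
have oN : open N by exact: ball_open.
have mN : measurable N by exact: open_measurable_rV.
have NV : N `<=` V by move=> x /he[].
have TNK x : N x -> K (T x) by move=> /he[_ /= h]; exact: ball_cube.
have mT i : measurable_fun N (fun x => T x ord0 i).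
  apply: continuous_on_measurable_rV => // x Nx.
  apply: (@continuous_comp _ _ _ T (fun y => y ord0 i)); first exact/cT/NV.
  exact: coord_continuous.
have Noo : (mu N < +oo)%E.
  have Qoo := leb_compact_lty (@compact_cube R n x0 e).
  apply: le_lt_trans Qoo; apply: le_measure; rewrite ?inE//.
    exact: measurable_cube.
  exact: ball_cube.
(* Extension by 0, measurable on the whole space; the measure that is pushed forward is restricted
   to N and does not see it. *)
pose T' x := if x \in N then T x else 0.
have mT' : measurable_fun [set: 'rV[R]_n] T'.
  apply: measurable_fun_rVP => i.
  rewrite (_ : _ \o _ = (fun x => T x ord0 i) \_ N).
    by apply: (measurable_restrictT _ mN).1; exact: mT.
  by apply/funext => x; rewrite patchE /= /T' /rV_coord; case: ifP => // _; rewrite mxE.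
pose lam : {measure set 'rV[R]_n -> \bar R} :=
  measure_function_pushforward__canonical__measure_function_Measure (mrestr mu mN) mT'.
have lamE A : lam A = mu (T' @^-1` A `&` N) by [].
have lamT : (lam setT < +oo)%E by rewrite lamE preimage_setT setTI.
pose C := (2 * L) ^+ n.
have C0 : 0 <= C by rewrite exprn_ge0// mulr_ge0// ltW.
have lamK : lam (~` K) = 0%E.
  rewrite lamE (_ : _ `&` _ = set0) ?measure0//; apply/seteqP; split => // x [/= + Nx].
  by rewrite /T' mem_set// => /(_ (TNK x Nx)).
have lamC A : measurable A -> (lam A <= C%:E * mu A)%E.
  apply: (@dyadic_domination _ _ lam y0) => //.
    apply/eqP; rewrite eq_le measure_ge0 andbT.
    rewrite -[X in (_ <= X)%E]lamK; apply: le_measure; rewrite ?inE.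
    - by apply: measurableC; exact: measurable_cube.
    - exact: measurableC.
    - apply: subsetC => y /cubeP h; apply/cubeP => i; apply: le_trans (h i) _.
      by rewrite ge_min lexx orbT.
  move=> k z; rewrite lamE leb_cell.
  have [->|/set0P[x [/= xz Nx]]] := eqVneq (T' @^-1` [set x | cell k x = z] `&` N) set0.
    by rewrite measure0 -EFinM lee_fin mulr_ge0// exprn_ge0// invr_ge0 exprn_ge0.
  apply: (@le_trans _ _ (mu (cube x (L * 2 ^- k)))).
    apply: le_measure; rewrite ?inE.
    - apply: measurableI => //; rewrite -[X in measurable X]setTI.
      apply: (@mT' measurableT [set x | cell k x = z]).
      exact: measurable_cell1.
    - exact: measurable_cube.
    - move=> x' [/= x'z Nx']; apply/cubeP => i.
      move: xz x'z; rewrite /T' !mem_set// => xz x'z.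
      rewrite -[x](TK (NV _ Nx)) -[x'](TK (NV _ Nx')); apply: hL; try exact/KB/TNK.
      by move=> j; apply: ltW; apply: cellP; rewrite xz x'z.
  have k0 : 0 <= 2 ^- k :> R by rewrite invr_ge0 exprn_ge0.
  rewrite leb_box; last by move=> i; rewrite lerD2l ge0_cp// mulr_ge0// ltW.
  rewrite -EFinM lee_fin (eq_bigr (fun=> 2 * L * 2 ^- k)); last by move=> i _; ring.
  by rewrite prodr_const card_ord /C exprMn.
have numu : mfrestr measurableT lamT `<< mu.
  apply/null_content_dominatesP => A mA A0 /=; rewrite /mfrestr /mrestr setIT.
  by apply/eqP; rewrite eq_le measure_ge0 andbT; apply: le_trans (lamC A mA) _; rewrite A0 mule0.
pose f := Radon_Nikodym_SigmaFinite.f (mfrestr measurableT lamT) mu.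
have f0 x : (0 <= f x)%E by exact: Radon_Nikodym_SigmaFinite.f_ge0.
have ffin x : f x \is a fin_num by exact: Radon_Nikodym_SigmaFinite.f_fin_num.
have fint : mu.-integrable setT f by exact: Radon_Nikodym_SigmaFinite.f_integrable.
have mf : measurable_fun [set: 'rV[R]_n] f := measurable_int _ fint.
have flam A : measurable A -> lam A = (\int[mu]_(x in A) f x)%E.
  move=> mA; rewrite -Radon_Nikodym_SigmaFinite.f_integral//=.
  by rewrite /mfrestr /mrestr setIT.
pose fr x := fine (f x).
have fE x : f x = (fr x)%:E by rewrite fineK.
have mfr : measurable_fun [set: 'rV[R]_n] fr.
  by apply/measurable_EFinP; rewrite (_ : _ \o _ = f)//; apply/funext => x; rewrite /= -fE.
have fr0 x : 0 <= fr x by rewrite -lee_fin -fE.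
(* On the set D where the density exceeds C, the integral of fr - C is lam D - C mu D <= 0, so D is
   a null set. *)
have frC : {ae mu, forall x, K x -> fr x <= C}.
  pose D := K `&` [set x | C < fr x].
  have mD : measurable D.
    apply: measurableI => //; rewrite -[X in measurable X]setTI.
    exact: (@measurable_fun_ltr _ _ _ setT (fun=> C) fr (measurable_cst _) mfr measurableT [set true] I).
  have Doo : (mu D < +oo)%E.
    by apply: le_lt_trans Koo; apply: le_measure; rewrite ?inE//; exact: subIsetl.
  have mg : measurable_fun D (fun x => (fr x - C)%:E).
    apply/measurable_EFinP; apply: measurable_funB => //; exact: measurable_funTS.
  have ifr : mu.-integrable D (EFin \o fr).
    rewrite (_ : _ \o _ = f); last by apply/funext => x; rewrite /= -fE.
    exact: integrableS fint.
  have g0 : (\int[mu]_(x in D) `|(fr x - C)%:E| = 0)%E.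
    apply/eqP; rewrite eq_le integral_ge0// andbT.
    rewrite (_ : \int[mu]_(x in D) _ = \int[mu]_(x in D) ((fr x)%:E - C%:E))%E; last first.
      apply: eq_integral => x /set_mem[_ /= Cf].
      by rewrite ger0_norm ?EFinB// subr_ge0 ltW.
    rewrite integralB_EFin//; last exact: integrable_cstR.
    rewrite integral_cst//= sube_le0. apply: le_trans (lamC D mD); rewrite (flam D mD).
    by rewrite le_eqVlt; apply/orP; left; apply/eqP; apply: eq_integral => x _; rewrite fE.
  have := (ae_eq_integral_abs mu mD mg).1 g0.
  apply: filterS => x h Kx; rewrite leNgt; apply/negP => Cf.
  have := h (conj Kx Cf) => /= -[] /eqP; rewrite subr_eq0 => /eqP E.
  by move: Cf; rewrite E ltxx.
(* This turns the bound almost everywhere into a pointwise one. *)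
pose h x := Num.min (fr x) C.
have mh : measurable_fun [set: 'rV[R]_n] h by apply: measurable_minr => //; exact: measurable_cst.
have h0 x : 0 <= h x <= C by rewrite le_min fr0 C0/= ge_min lexx orbT.
have key (g : 'rV[R]_n -> \bar R) : measurable_fun [set: 'rV[R]_n] g -> (forall x, 0 <= g x)%E ->
    (\int[mu]_(x in N) g (T x) = \int[mu]_(y in K) (g y * (h y)%:E))%E.
  move=> mg g0.
  transitivity (\int[mu]_(x in N) g (T' x))%E.
    by apply: eq_integral => x xN; rewrite /T' xN.
  rewrite -(@ge0_integral_mrestr _ _ _ mu N mN (g \o T'))//; last 2 first.
  - exact: measurableT_comp.
  - by move=> x /=.
  rewrite -[LHS](ge0_integral_pushforward mT' (mrestr mu mN) (D := setT))//.
  rewrite -(setUv K) ge0_integral_setU//; last 3 first.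
  - exact: measurableC.
  - by rewrite setUv.
  - by apply/disj_set2P; rewrite setICr.
  rewrite [X in (_ + X)%E](_ : _ = 0%E); last first.
    apply: null_set_integral => //; first exact: measurableC.
    exact: measurable_funTS.
  rewrite adde0.
  transitivity (\int[mfrestr measurableT lamT]_(x in K) g x)%E.
    by apply: eq_measure_integral => A mA _; rewrite /= /mfrestr /mrestr setIT.
  rewrite -(Radon_Nikodym_SigmaFinite.change_of_variables numu)//; last exact: measurable_funTS.
  apply: ae_eq_integral => //.
  - by apply: emeasurable_funM; exact: measurable_funTS.
  - by apply: emeasurable_funM; [exact: measurable_funTS|apply/measurable_EFinP; exact: measurable_funTS].
  - apply: filterS frC => x hx Kx; rewrite -/f fE /h; congr (_ * _%:E)%E.
    by apply/esym/min_idPl; exact: hx.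
exists e, C, K, h; split => //.
- by split => //; exact: subset_trans KB e'V.
move=> w iw.
have mw : measurable_fun K w by apply/measurable_EFinP; exact: measurable_int iw.
pose w' := w \_ K.
have mw' : measurable_fun [set: 'rV[R]_n] w' by apply: (measurable_restrictT _ mK).1; exact: mw.
have w'E x : K x -> w' x = w x by move=> Kx; rewrite /w' patchE mem_set.
have w'T x : N x -> w' (T x) = w (T x) by move=> Nx; apply: w'E; exact: TNK.
have iwT : mu.-integrable N (EFin \o (w \o T)).
  apply: (@eq_integrable _ _ _ _ _ mN (EFin \o (w' \o T))).
    by move=> x /set_mem Nx /=; rewrite w'T.
  apply/integrableP; split.
    apply/measurable_EFinP; apply: (@eq_measurable_fun _ _ _ _ _ (w' \o T')).
      by move=> x xN /=; rewrite /T' xN.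
    by apply: measurable_funTS; exact: measurableT_comp.
  rewrite (key (fun y => `|(w' y)%:E|)%E)//; last first.
    by apply: measurableT_comp => //; exact/measurable_EFinP.
  apply: (@le_lt_trans _ _ (\int[mu]_(y in K) (C%:E * `|(w y)%:E|))%E).
    apply: ge0_le_integral => //.
    - move=> x _; rewrite mule_ge0// lee_fin; by case/andP: (h0 x).
    - apply: emeasurable_funM; last by apply/measurable_EFinP; exact: measurable_funTS.
      by apply: measurableT_comp => //; apply/measurable_EFinP; exact: measurable_funTS.
    - by apply: emeasurable_funM => //; apply: measurableT_comp => //; exact/measurable_EFinP.
    - move=> x Kx; rewrite w'E// muleC lee_wpmul2r// lee_fin; by case/andP: (h0 x).
  rewrite ge0_integralZl//; last by apply: measurableT_comp => //; exact/measurable_EFinP.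
  case/integrableP : iw => _ iw; rewrite lte_mul_pinfty// lee_fin//.
split => //; rewrite /Rintegral; congr fine.
rewrite [LHS]integralE [RHS]integralE; congr (_ - _)%E.
  transitivity (\int[mu]_(x in N) (Num.max (w' (T x)) 0)%:E)%E.
    by apply: eq_integral => x /set_mem Nx; rewrite funeposE w'T// EFin_max.
  rewrite (key (fun y => (Num.max (w' y) 0)%:E)); last 2 first.
  - by apply/measurable_EFinP; apply: measurable_maxr => //; exact: measurable_cst.
  - by move=> x; rewrite lee_fin le_max lexx orbT.
  apply: eq_integral => x /set_mem Kx; rewrite funeposE w'E// -EFinM -EFin_max.
  by congr EFin; rewrite maxr_pMl ?mul0r//; case/andP: (h0 x).
transitivity (\int[mu]_(x in N) (Num.max (- w' (T x)) 0)%:E)%E.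
  by apply: eq_integral => x /set_mem Nx; rewrite funenegE w'T// EFin_max.
rewrite (key (fun y => (Num.max (- w' y) 0)%:E)); last 2 first.
- by apply/measurable_EFinP; apply: measurable_maxr => //; exact: measurable_funN.
- by move=> x; rewrite lee_fin le_max lexx orbT.
apply: eq_integral => x /set_mem Kx; rewrite funenegE w'E// -EFinM -EFinN -EFin_max.
by congr EFin; rewrite maxr_pMl ?mul0r ?mulNr//; case/andP: (h0 x).
Qed.

End chart_transfer.

(** * Mollifiers *)

Section smooth_step.
Context (R : realType).
Implicit Types (f g : R -> R) (t : R) (P : {poly R}).

(** k-fold differentiability with the derivatives as existential witnesses: closure under sums,
    products, affine substitutions and inverses then goes by induction on k, without formulas for
    higher derivatives. *)
Fixpoint diffn k g : Prop := match k with
  | 0%N => True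
  | k'.+1 => exists2 dg : R -> R, (forall t, is_derive t (1 : R) g (dg t)) & diffn k' dg
  end.

Lemma is_derive_ext t f df df' : is_derive t (1 : R) f df -> df = df' ->
  is_derive t (1 : R) f df'.
Proof. by move=> h <-. Qed.

Lemma is_derive_fun_mul t f g df dg : is_derive t (1 : R) f df -> is_derive t (1 : R) g dg ->
  is_derive t (1 : R) (fun t => f t * g t) (f t * dg + g t * df).
Proof. exact: is_deriveM. Qed.

Lemma is_derive_fun_add t f g df dg : is_derive t (1 : R) f df -> is_derive t (1 : R) g dg ->
  is_derive t (1 : R) (fun t => f t + g t) (df + dg).
Proof. exact: is_deriveD. Qed.

Lemma is_derive_fun_opp t f df : is_derive t (1 : R) f df ->
  is_derive t (1 : R) (fun t => - f t) (- df).
Proof. exact: is_deriveN. Qed.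

Lemma is_derive_fun_comp t f g df dg : is_derive (g t) (1 : R) f df ->
  is_derive t (1 : R) g dg -> is_derive t (1 : R) (fun t => f (g t)) (df * dg).
Proof. exact: is_derive1_comp. Qed.

Lemma is_derive_fun_inv t f df : f t != 0 -> is_derive t (1 : R) f df ->
  is_derive t (1 : R) (fun t => (f t)^-1) (- (f t) ^- 2 * df).
Proof. exact: is_deriveV. Qed.

Lemma is_derive_affine t (a c : R) : is_derive t (1 : R) (fun t => a * t + c) a.
Proof.
apply: (is_derive_ext (is_derive_fun_add (is_derive_fun_mul (is_derive_cst a t 1)
  (is_derive_id t 1)) (is_derive_cst c t 1))).
by rewrite mulr1 mulr0 !addr0.
Qed.

Lemma diffnW k g : diffn k.+1 g -> diffn k g.
Proof.
elim: k g => [//|k IH] g [dg h1 h2].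
by exists dg => //; exact: IH.
Qed.

Lemma diffn_cst k (c : R) : diffn k (fun=> c).
Proof.
elim: k c => [//|k IH] c; exists (fun=> 0) => // t; exact: is_derive_cst.
Qed.

Lemma diffnD k f g : diffn k f -> diffn k g -> diffn k (fun t => f t + g t).
Proof.
elim: k f g => [//|k IH] f g [df f1 f2] [dg g1 g2].
exists (fun t => df t + dg t); last exact: IH.
by move=> t; exact: is_derive_fun_add.
Qed.

Lemma diffnM k f g : diffn k f -> diffn k g -> diffn k (fun t => f t * g t).
Proof.
elim: k f g => [//|k IH] f g /[dup] /diffnW fW [df f1 f2] /[dup] /diffnW gW [dg g1 g2].
exists (fun t => f t * dg t + g t * df t).
  by move=> t; exact: is_derive_fun_mul.
by apply: diffnD; exact: IH.
Qed.

Lemma diffn_affine k f (a c : R) : diffn k f -> diffn k (fun t => f (a * t + c)).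
Proof.
elim: k f => [//|k IH] f [df f1 f2].
exists (fun t => a * df (a * t + c)); last first.
  by apply: diffnM; [exact: diffn_cst|exact: IH].
move=> t; rewrite mulrC; apply: is_derive_fun_comp => //.
exact: is_derive_affine.
Qed.

Lemma diffnV k f : (forall t, f t != 0) -> diffn k f -> diffn k (fun t => (f t)^-1).
Proof.
move=> f0; elim: k => [//|k IH] /[dup] /diffnW fW [df f1 f2].
exists (fun t => -1 * ((f t)^-1 * (f t)^-1 * df t)).
  move=> t; apply: (is_derive_ext (is_derive_fun_inv (f0 t) (f1 t))).
  by rewrite -exprVn expr2 mulN1r mulNr.
apply: diffnM; first exact: diffn_cst.
by apply: diffnM => //; apply: diffnM; exact: IH.
Qed.

Lemma diffn_derive1n g : (forall k, diffn k g) ->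
  forall j t, is_derive t (1 : R) (derive1n j g) (derive1n j.+1 g t).
Proof.
move=> hg j; elim: j g hg => [|j IH] g hg.
  move=> t; have [dg h _] := hg 1%N; have := h t => ht.
  by rewrite derive1n1 derive1E derive_val.
have E dg : (forall t, is_derive t (1 : R) g (dg t)) -> dg = derive1 g.
  by move=> h; apply/funext => t; have := h t => ht; rewrite derive1E derive_val.
move=> t; rewrite derive1Sn [derive1n j.+2 g]derive1Sn; apply: IH => k.
by have [dg /E ->] := hg k.+1.
Qed.

(** The functions P (1 / t) exp (- 1 / t), extended by 0 to t <= 0, form a family closed under
    differentiation: P is replaced by X^2 (P - P'). All derivatives of exp (- 1 / t) are thus
    treated at once. *)
Definition flat P t : R := if t <= 0 then 0 else P.[t^-1] * expR (- t^-1).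

Lemma horner_bound P : exists2 N, 0 < N.2 & forall s : R, 1 <= s -> `|P.[s]| <= N.2 * s ^+ N.1.
Proof.
elim/poly_ind: P => [|P c [[N C] /= C0 h]].
  by exists (0%N, 1) => //= s _; rewrite horner0 normr0 mul1r expr0.
exists (N.+1, C + `|c|) => /=; first by rewrite ltr_pwDl.
move=> s s1; have s0 : 0 <= s by exact: le_trans s1.
rewrite hornerMXaddC; apply: le_trans (ler_normD _ _) _.
rewrite mulrDl lerD//.
  by rewrite normrM (ger0_norm s0) exprSr mulrA ler_wpM2r// h.
by rewrite ler_peMr// exprn_ege1.
Qed.

Lemma expR_ge_pow (s : R) N : 0 <= s -> (s / N.+1%:R) ^+ N.+1 <= expR s.
Proof.
move=> s0; have s' : 0 <= s / N.+1%:R by rewrite divr_ge0.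
rewrite -[X in expR X](@divfK _ N.+1%:R _ s) ?pnatr_eq0// expRM_natr.
rewrite lerXn2r ?nnegrE ?expR_ge0//.
by apply: le_trans (expR_ge1Dx _); rewrite lerDr.
Qed.

(** The exponential beats every power of s = 1 / t: dividing the bound s^N for P by exp s >= (s / (N
    + 2))^(N + 2) leaves a factor t^2, enough for a vanishing derivative at 0. *)
Lemma flat_small P : exists2 C : R, 0 <= C & forall t, `|t| <= 1 -> `|flat P t| <= C * t ^+ 2.
Proof.
have [[N C] /= C0 h] := horner_bound P.
exists (C * N.+2%:R ^+ N.+2); first by rewrite mulr_ge0 ?exprn_ge0// ltW.
move=> t t1; rewrite /flat; case: ifPn => [_|].
  by rewrite normr0 mulr_ge0 ?sqr_ge0// mulr_ge0 ?exprn_ge0// ltW.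
rewrite -ltNge => t0; have s1 : 1 <= t^-1.
  by rewrite invf_ge1//; apply: le_trans t1; rewrite ler_norm.
have s0 : 0 < t^-1 by rewrite invr_gt0.
rewrite normrM (gtr0_norm (expR_gt0 _)) expRN.
have := expR_ge_pow N.+1 (ltW s0); set s := t^-1 => E.
rewrite ler_pdivrMr ?expR_gt0//.
apply: le_trans (h _ s1) _.
rewrite (_ : C * s ^+ N = C * N.+2%:R ^+ N.+2 * t ^+ 2 * (s / N.+2%:R) ^+ N.+2); last first.
  have s_neq0 : s != 0 by rewrite gt_eqF.
  have N0 : N.+2%:R != 0 :> R by rewrite pnatr_eq0.
  rewrite -[t]invrK -/s expr_div_n; set q := N.+2%:R.
  rewrite -{1}[N]add0n !exprS; field.
  by rewrite s_neq0 expf_neq0// -natrD pnatr_eq0.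
by rewrite ler_wpM2l// mulr_ge0 ?sqr_ge0// mulr_ge0 ?exprn_ge0// ltW.
Qed.

Lemma is_derive_flat_at0 f C : (forall t, `|t| <= 1 -> `|f t| <= C * t ^+ 2) ->
  is_derive (0 : R) (1 : R) f 0.
Proof.
move=> h; have f0 : f 0 = 0.
  have := h 0; rewrite normr0 expr0n mulr0 => /(_ ler01).
  by rewrite normr_le0 => /eqP.
have H : (fun u : R => u^-1 *: ((f \o shift (0 : R)) (u *: (1 : R)) - f 0)) @ 0^' --> (0 : R).
  apply/cvgr0Pnorm_le => e e0.
  have C0 : 0 <= C.
    by have := h 1; rewrite normr1 expr1n mulr1 => /(_ (lexx _)); exact: le_trans.
  near=> u.
  have u0 : u != 0 by near: u; exact: nbhs_dnbhs_neq.
  have u1 : `|u| < Num.min 1 (e / (C + 1)).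
    near: u; apply: dnbhs0_lt; rewrite lt_min ltr01 divr_gt0// ltr_wpDl//.
  move: u1; rewrite lt_min => /andP[u1 uC].
  rewrite /= f0 subr0 /GRing.scale/= addr0 mulr1 normrM normfV ler_pdivrMl ?normr_gt0//.
  apply: le_trans (h _ (ltW u1)) _.
  rewrite -real_normK ?num_real// expr2 mulrA [leRHS]mulrC ler_wpM2r//.
  move: uC; rewrite ltr_pdivlMr ?ltr_wpDl// mulrDr mulr1 => /ltW.
  by apply: le_trans; rewrite mulrC lerDl.
by apply: DeriveDef; [apply/cvg_ex; exists 0|apply/cvg_lim].
Unshelve. all: by end_near. Qed.

Lemma is_derive_flat P t : is_derive t (1 : R) (flat P) (flat ('X^2 * (P - P^`())) t).
Proof.
have [t0|t0|->] := ltgtP t 0.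
- rewrite {2}/flat (ltW t0).
  have H0 := @is_derive_cst R R R (0 : R) t (1 : R).
  apply: (near_eq_is_derive _ H0).
  near=> u; rewrite /flat; case: ifPn => //; rewrite -ltNge => u0.
  suff : u < 0 by rewrite ltNge (ltW u0).
  by near: u; exact: lt_nbhsl.
- rewrite {2}/flat leNgt t0/=.
  have tn0 : t != 0 by rewrite gt_eqF.
  have dV := @is_derive_fun_inv t id 1 tn0 (is_derive_id _ _).
  have dP := is_derive_fun_comp (@is_derive_poly _ P (t^-1)) dV.
  have dE := @is_derive_fun_comp t expR (fun u => - u^-1) _ _ (is_derive_expR _)
    (is_derive_fun_opp dV).
  apply: (@is_derive_ext _ _ _ _ (near_eq_is_derive _ (is_derive_fun_mul dP dE))).
    by near=> u; rewrite /flat leNgt ifN// negbK; near: u; exact: lt_nbhsr.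
  by rewrite hornerM hornerXn hornerD hornerN -exprVn; ring.
have [C C0 h] := flat_small P.
by rewrite {2}/flat lexx; exact: is_derive_flat_at0 h.
Unshelve. all: by end_near. Qed.

Lemma diffn_flat k P : diffn k (flat P).
Proof.
elim: k P => [//|k IH] P; exists (flat ('X^2 * (P - P^`()))) => // t.
exact: is_derive_flat.
Qed.

End smooth_step.

Section unit_step.
Context (R : realType).
Implicit Types (f g : R -> R) (t : R).

Lemma derive_outside01 f df : (forall t, is_derive t (1 : R) f (df t)) ->
  (forall t, (t < 0) || (1 < t) -> f t = 0) ->
  forall t, (t < 0) || (1 < t) -> df t = 0.
Proof.
move=> h f0 t t01; have h1 := h t.
have h2 : is_derive t (1 : R) f 0.
  have H0 := @is_derive_cst R R R (0 : R) t (1 : R).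
  apply: (near_eq_is_derive _ H0).
  case/orP : t01 => t01; near=> u; rewrite f0//; apply/orP.
    by left; near: u; exact: lt_nbhsl.
  by right; near: u; exact: lt_nbhsr.
by rewrite -(@derive_val _ _ _ _ _ _ _ h1) (@derive_val _ _ _ _ _ _ _ h2).
Unshelve. all: by end_near. Qed.

Lemma bounded_outside01 f df : (forall t, is_derive t (1 : R) f (df t)) ->
  (forall t, (t < 0) || (1 < t) -> f t = 0) -> exists2 C, 1 <= C & forall t, `|f t| <= C.
Proof.
move=> h f0.
have [|c _ hc] := @EVT_max R (fun t => `|f t|) 0 1 ler01.
  apply: continuous_subspaceT => t; apply: continuous_comp; last exact: norm_continuous.
  apply: differentiable_continuous; apply/derivable1_diffP.
  by have [] := h t.
exists (1 + `|f c|); first by rewrite lerDl.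
move=> t; have [t01|] := boolP (t \in `[0, 1]).
  by apply: le_trans (hc t t01) _; rewrite lerDr.
rewrite in_itv/= negb_and -!ltNge => t01.
by rewrite f0// normr0 addr_ge0.
Qed.

(** B (t) = e (t) / (e (t) + e (1 - t)) with e (t) = exp (- 1 / t) for t > 0 and 0 otherwise; one of
    the two terms in the denominator is always positive. The derivative b serves as a kernel, and
    its primitive B, which is 0 before and 1 after the unit interval, serves to write differences of
    kernels as derivatives. *)
Lemma unit_step_exists : exists (B b : R -> R),
  [/\ forall t, is_derive t (1 : R) B (b t), forall k, diffn k b,
      [/\ forall t, t <= 0 -> B t = 0, forall t, 1 <= t -> B t = 1 & forall t, `|B t| <= 1],
      forall t, 0 <= b t & forall t, (t <= 0) || (1 <= t) -> b t = 0].
Proof.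
pose e := @flat R 1; pose e' := @flat R 'X^2.
have de t : is_derive t (1 : R) e (e' t).
  by have := is_derive_flat 1 t; rewrite derivC subr0 mulr1.
have e0 t : 0 <= e t by rewrite /e /flat; case: ifP => // _; rewrite hornerC mul1r expR_ge0.
have e'0 t : 0 <= e' t.
  by rewrite /e' /flat; case: ifP => // _; rewrite hornerXn mulr_ge0 ?expR_ge0// sqr_ge0.
have ez t : t <= 0 -> e t = 0 by rewrite /e /flat => ->.
have e'z t : t <= 0 -> e' t = 0 by rewrite /e' /flat => ->.
have ep t : 0 < t -> 0 < e t.
  by move=> t0; rewrite /e /flat leNgt t0/= hornerC mul1r expR_gt0.
pose r t : R := -1 * t + 1.
pose D t := e t + e (r t).
have D0 t : 0 < D t.
  have [t0|t0] := ltP 0 t; first by rewrite ltr_pwDl// ep.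
  by rewrite ltr_wpDl// ep// /r mulN1r addrC subr_gt0 (le_lt_trans t0).
have Dn0 t : D t != 0 by rewrite gt_eqF.
have der t : is_derive t (1 : R) (fun t => e (r t)) (e' (r t) * -1).
  by apply: is_derive_fun_comp => //; exact: is_derive_affine.
have dD t : is_derive t (1 : R) D (e' t + e' (r t) * -1) by exact: is_derive_fun_add.
pose B t := e t * (D t)^-1.
pose b t := (e' t * e (r t) + e t * e' (r t)) * (D t)^-1 ^+ 2.
have dB t : is_derive t (1 : R) B (b t).
  apply: (is_derive_ext (is_derive_fun_mul (de t) (is_derive_fun_inv (Dn0 t) (dD t)))).
  have -> : (D t)^-1 * e' t = D t * e' t * (D t)^-1 ^+ 2.
    by rewrite expr2; field; exact: Dn0.
  by rewrite /b -exprVn {2}/D; ring.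
exists B, b; split => //.
- have ne k : diffn k e by exact: diffn_flat.
  have ner k : diffn k (fun t => e (r t)) by apply: (@diffn_affine _ k e).
  have nB k : diffn k B.
    apply: diffnM => //; apply: diffnV => //; exact: diffnD.
  move=> k; have [dg h hk] := nB k.+1.
  rewrite (_ : b = dg)//; apply/funext => t.
  by have h1 := h t; have h2 := dB t; rewrite -(@derive_val _ _ _ _ _ _ _ h1) -(@derive_val _ _ _ _ _ _ _ h2).
- split=> t.
  + by move=> t0; rewrite /B ez// mul0r.
  + move=> t1; rewrite /B /D [e (r t)]ez ?addr0; last by rewrite /r mulN1r addrC subr_le0.
    by rewrite divff// gt_eqF// ep// (lt_le_trans _ t1).
  + rewrite normrM normfV (gtr0_norm (D0 t)) (ger0_norm (e0 t)) ler_pdivrMr// mul1r.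
    by rewrite lerDl.
- by move=> t; rewrite mulr_ge0 ?sqr_ge0// addr_ge0// mulr_ge0.
- move=> t /orP[t0|t1]; rewrite /b; first by rewrite (ez t)// (e'z t)// !mul0r addr0 mul0r.
  have r0 : r t <= 0 by rewrite /r mulN1r addrC subr_le0.
  by rewrite (ez (r t))// (e'z (r t))// !mulr0 addr0 mul0r.
Qed.

End unit_step.

Lemma is_derive_continuous (R : realType) (F f : R -> R) :
  (forall t, is_derive t (1 : R) F (f t)) -> continuous F.
Proof.
move=> h t; apply: differentiable_continuous; apply/derivable1_diffP.
by have [] := h t.
Qed.

Lemma integral_derivative01 (R : realType) (F f : R -> R) :
  (forall t, is_derive t (1 : R) F (f t)) -> continuous f ->
  (forall t, (t < 0) || (1 < t) -> f t = 0) ->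
  (\int[lebesgue_measure]_t (f t)%:E = (F 1 - F 0)%:E)%E.
Proof.
move=> h cf f0; have cF := is_derive_continuous h.
rewrite EFinB -(@continuous_FTC2 _ f F 0 1)//; last 3 first.
- exact: continuous_subspaceT.
- split.
  + by move=> t _; have [] := h t.
  + by apply: cvg_at_right_filter; exact: cF.
  + by apply: cvg_at_left_filter; exact: cF.
- by move=> t _; have h1 := h t; rewrite derive1E derive_val.
rewrite [RHS]integral_mkcond; apply: eq_integral => t _.
rewrite patchE; case: ifPn => // /negP; rewrite inE/= in_itv/= => /negP.
by rewrite negb_and -!ltNge => /f0 ->.
Qed.

Section tensor_products.
Context (R : realType) (n : nat).
Implicit Types (g dg : 'I_n -> R -> R) (x : 'rV[R]_n).

Definition tens g x : R := \prod_i g i (x ord0 i).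

Lemma differentiable_tens g dg x : (forall i t, is_derive t (1 : R) (g i) (dg i t)) ->
  differentiable (tens g) x.
Proof.
move=> h; rewrite /tens; elim: (index_enum _) => [|i s IH].
  by rewrite (_ : (fun _ => _) = cst 1)//; apply/funext => y; rewrite big_nil.
rewrite (_ : (fun _ => _) = (fun y : 'rV[R]_n => g i (y ord0 i)) * (fun y : 'rV[R]_n => \prod_(j <- s) g j (y ord0 j))).
  apply: differentiableM => //.
  apply: (@differentiable_comp _ _ _ _ (fun y : 'rV[R]_n => y ord0 i) (g i)).
    exact: differentiable_coord.
  by apply/derivable1_diffP; have [] := h i (x ord0 i).
by apply/funext => y; rewrite big_cons.
Qed.

Lemma partial_tens g dg m x : (forall i t, is_derive t (1 : R) (g i) (dg i t)) ->
  partial m (tens g) x = tens (fun i => if i == m then dg i else g i) x.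
Proof.
move=> h; set v : 'rV[R]_n := delta_mx ord0 m.
have H1 : is_derive (0 : R) (1 : R) (fun s : R => tens g (x + s *: v)) (partial m (tens g) x).
  have := @is_derive_line R n (tens g) x v 0; rewrite scale0r addr0; apply.
  exact: differentiable_tens.
pose c := \prod_(i | i != m) g i (x ord0 i).
have E s : tens g (x + s *: v) = c * g m (1 * s + x ord0 m).
  rewrite /tens (bigD1 m)//= mulrC; congr (_ * _).
    apply: eq_bigr => i im; congr (g i _).
    by rewrite !mxE eqxx (negbTE im) mulr0 addr0.
  by congr (g m _); rewrite !mxE !eqxx mulr1 mul1r addrC.
have H2 : is_derive (0 : R) (1 : R) (fun s : R => tens g (x + s *: v)) (c * dg m (x ord0 m)).
  rewrite (_ : (fun _ => _) = (fun s => c * g m (1 * s + x ord0 m))); last exact/funext.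
  have A := @is_derive_fun_comp R 0 (g m) (fun s => 1 * s + x ord0 m) _ _ (h m _)
    (@is_derive_affine R 0 1 (x ord0 m)).
  apply: (is_derive_ext (is_derive_fun_mul (is_derive_cst c (0 : R) (1 : R)) A)).
  by rewrite mulr0 add0r !mulr1 mulr0 addr0.
rewrite -(@derive_val _ _ _ _ _ _ _ H1) (@derive_val _ _ _ _ _ _ _ H2).
rewrite /tens [RHS](bigD1 m)//= eqxx mulrC; congr (_ * _).
by apply: eq_bigr => i /negbTE ->.
Qed.

Lemma smooth_tens g : (forall i k, diffn k (g i)) -> smooth_on setT (tens g).
Proof.
move=> h s x _.
have H j i t := diffn_derive1n (h i) j t.
have -> : foldr (@partial R n) (tens g) s = tens (fun i => derive1n (count_mem i s) (g i)).
  elim: s => [//|m s IH] /=; rewrite IH; apply/funext => y.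
  rewrite (@partial_tens _ _ _ _ (fun i t => H (count_mem i s) i t)).
  by congr tens; apply/funext => i; rewrite eq_sym; case: eqP => //= _.
by apply: differentiable_tens => i t; exact: H.
Qed.

Lemma normr_tens_le g (c : 'I_n -> R) x :
  (forall i, `|g i (x ord0 i)| <= c i) -> `|tens g x| <= \prod_i c i.
Proof.
by move=> h; rewrite /tens normr_prod; apply: ler_prod => i _; rewrite normr_ge0/=.
Qed.

Lemma normr_partial_tens_le g dg (c : 'I_n -> R) (q : R) m x :
  (forall i t, is_derive t (1 : R) (g i) (dg i t)) ->
  (forall i t, `|g i t| <= c i) -> (forall i t, `|dg i t| <= q * c i) ->
  `|partial m (tens g) x| <= q * \prod_i c i.
Proof.
move=> h hc hq; rewrite (partial_tens _ _ h).
apply: (le_trans (@normr_tens_le _ (fun i => (if i == m then q else 1) * c i) _ _)).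
  by move=> i; case: eqP => // _; rewrite mul1r.
rewrite big_split/= ler_wpM2r//; last first.
  rewrite (bigD1 m)//= eqxx big1 ?mulr1// => i /negbTE ->//.
by rewrite prodr_ge0// => i _; apply: le_trans (hc i 0).
Qed.

Lemma tens_eq0 g x i : g i (x ord0 i) = 0 -> tens g x = 0.
Proof. by move=> h; rewrite /tens (bigD1 i)//= h mul0r. Qed.

End tensor_products.

Section mollifier.
Context (R : realType) (n : nat).
Implicit Types (k : nat) (z : 'rV[R]_n) (kap : 'rV[R]_n -> R).

(* The mollifiers are one-sided, supported in the cube [0, h]^n, because the
   half-open dyadic cells are stable under small shifts in these directions. *)
Definition kernel (h c : R) kap : Prop :=
  [/\ smooth_on setT kap,
      forall z i, ~~ (0 <= z ord0 i <= h) -> kap z = 0,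
      forall z, `|kap z| <= c * h^-1 ^+ n &
      forall i z, `|partial i kap z| <= c * h^-1 * h^-1 ^+ n].

Lemma kernel_partial_eq0 h c kap i j z : kernel h c kap ->
  ~~ (0 <= z ord0 j <= h) -> partial i kap z = 0.
Proof.
move=> [_ k0 _ _] zj.
rewrite /partial (@near_eq_derive _ _ _ kap (fun=> 0)) ?derive_cst//.
have cc : {for z, continuous (fun y : 'rV[R]_n => y ord0 j)} by exact: coord_continuous.
move: zj; rewrite negb_and -!ltNge => /orP[z0|zh].
  have : \forall y \near z, (y : 'rV[R]_n) ord0 j < 0 by exact: cc (lt_nbhsl z0).
  by apply: filterS => y y0; rewrite (k0 y j)// negb_and -!ltNge y0.
have : \forall y \near z, h < (y : 'rV[R]_n) ord0 j by exact: cc (lt_nbhsr zh).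
by apply: filterS => y y0; rewrite (k0 y j)// negb_and -!ltNge y0 orbT.
Qed.

Lemma kernel_tens (h q c : R) (g dg : 'I_n -> R -> R) (gam : 'I_n -> R) :
  (forall i k, diffn k (g i)) ->
  (forall i t, is_derive t (1 : R) (g i) (dg i t)) ->
  (forall i t, ~~ (0 <= t <= h) -> g i t = 0) ->
  (forall i t, `|g i t| <= gam i) -> (forall i t, `|dg i t| <= q * h^-1 * gam i) ->
  0 < h -> 1 <= q -> \prod_i gam i <= c * h^-1 ^+ n -> kernel h (q * c) (tens g).
Proof.
move=> sg hg g0 hgam hdg h0 q1 hc; have q0 := lt_le_trans ltr01 q1.
have c0 : 0 <= c * h^-1 ^+ n.
  by apply: le_trans hc; rewrite prodr_ge0// => i _; apply: le_trans (hgam i 0).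
split; first exact: smooth_tens.
- by move=> z i zi; apply: (@tens_eq0 _ _ _ _ i); exact: g0.
- move=> z; apply: le_trans (@normr_tens_le _ _ g gam _ _) _ => //.
  by apply: le_trans hc _; rewrite -mulrA ler_peMl.
- move=> i z; apply: le_trans (@normr_partial_tens_le _ _ g dg gam _ i z hg hgam hdg) _.
  rewrite (_ : q * c * h^-1 * h^-1 ^+ n = q * h^-1 * (c * h^-1 ^+ n)); last by ring.
  by rewrite ler_wpM2l// mulr_ge0 ?invr_ge0// ltW.
Qed.

(** [K k] is the n-fold product of the rescaled bump [bb k]. Passing from [K k] to [K k.+1] one
    coordinate at a time gives a telescoping sum, in whose m-th term the m-th factor is the
    difference of the two bumps, that is, the derivative of [s k]. As a difference of two steps that
    agree outside [0, h], the function [s k] is supported there; and it is bounded without the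
    factor 1 / h of [bb k], which accounts for the additional h in the size of [sig k]. *)
Lemma mollifier_exists : exists (C : R) (K : nat -> 'rV[R]_n -> R)
    (sig : nat -> 'I_n -> 'rV[R]_n -> R),
  [/\ 0 <= C,
      forall k, [/\ kernel (2 ^- k) C (K k), kernel (2 ^- k) C (K k.+1) &
        forall m, kernel (2 ^- k) (C * 2 ^- k) (sig k m)],
      forall k z, 0 <= K k z,
      forall k, (\int[leb R n]_z (K k z)%:E = 1)%E &
      forall k z, K k.+1 z - K k z = \sum_m partial m (sig k m) z].
Proof.
have [B [b [dB sb [B0 B1 Ble] b0 bz]]] := unit_step_exists R.
have db t : is_derive t (1 : R) b (derive1n 1 b t) by exact: (diffn_derive1n sb 0 t).
have bz' t : (t < 0) || (1 < t) -> b t = 0.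
  by move=> t01; apply: bz; case/orP : t01 => /ltW ->//; rewrite orbT.
have [be1 be1_1 hbe1] := bounded_outside01 db bz'.
have [be2 be2_1 hbe2] := bounded_outside01 (diffn_derive1n sb 1%N) (derive_outside01 db bz').
pose be := Num.max be1 be2.
have be_1 : 1 <= be by rewrite le_max be1_1.
have be0 : 0 < be by exact: lt_le_trans be_1.
have hb t : `|b t| <= be by rewrite le_max hbe1.
have hdb t : `|derive1n 1 b t| <= be by rewrite le_max hbe2 orbT.
pose h k : R := 2 ^- k.
have h0 k : 0 < h k by rewrite invr_gt0 exprn_gt0.
have hV k : (h k)^-1 = 2 ^+ k by rewrite invrK.
have hS k : (h k.+1)^-1 = 2 * (h k)^-1 by rewrite !hV exprS.
have sc t (a : R) (f df : R -> R) : (forall t, is_derive t (1 : R) f (df t)) ->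
    is_derive t (1 : R) (fun t => f (a * t)) (df (a * t) * a).
  move=> hf; have A := is_derive_affine t a 0; rewrite (_ : (fun t => a * t + 0) = *%R a) in A.
    exact: is_derive_fun_comp.
  by apply/funext => u; rewrite addr0.
have dsc k (a : R) (f : R -> R) : diffn k f -> diffn k (fun t => f (a * t)).
  move=> /(@diffn_affine _ _ _ a 0); congr diffn; apply/funext => t; by rewrite addr0.
pose bb k t := 2 ^+ k * b (2 ^+ k * t).
pose dbb k t := 2 ^+ k * (derive1n 1 b (2 ^+ k * t) * 2 ^+ k).
have dbbP k t : is_derive t (1 : R) (bb k) (dbb k t).
  apply: (is_derive_ext (is_derive_fun_mul (is_derive_cst _ _ _) (sc _ _ _ _ db))).
  by rewrite mulr0 addr0.
have sbb j k : diffn j (bb k) by apply: diffnM; [exact: diffn_cst|exact: dsc].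
have bbz k t : ~~ (0 <= t <= h k) -> bb k t = 0.
  rewrite negb_and -!ltNge /bb => t0; rewrite bz ?mulr0//.
  case/orP : t0 => t0; apply/orP; [left|right]; first by rewrite pmulr_rle0 ?exprn_gt0// ltW.
  by rewrite -hV ler_pdivlMl// mulr1 ltW.
pose s k t := B (2 ^+ k.+1 * t) - B (2 ^+ k * t).
pose ds k t := bb k.+1 t - bb k t.
have dsP k t : is_derive t (1 : R) (s k) (ds k t).
  apply: (is_derive_ext (is_derive_fun_add (sc _ _ _ _ dB) (is_derive_fun_opp (sc _ _ _ _ dB)))).
  by rewrite /ds /bb; ring.
have ss j k : diffn j (s k).
  have dB' i : diffn i B by apply: diffnW; exists b.
  apply: diffnD; first exact: dsc.
  have := diffnM (diffn_cst j (-1)) (dsc j (2 ^+ k) B (dB' j)).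
  by congr diffn; apply/funext => t; rewrite mulN1r.
have sz k t : ~~ (0 <= t <= h k) -> s k t = 0.
  rewrite negb_and -!ltNge /s => /orP[t0|t1].
    by rewrite !B0 ?subrr// pmulr_rle0 ?exprn_gt0// ltW.
  have E : 1 <= 2 ^+ k * t by rewrite -hV ler_pdivlMl// mulr1 ltW.
  rewrite !B1 ?subrr//; apply: le_trans E _; rewrite exprS -mulrA ler_peMl ?ler1n//.
  by rewrite mulr_ge0 ?exprn_ge0// (le_trans _ (ltW t1))// ltW.
have hbb k t : `|bb k t| <= be * (h k)^-1.
  by rewrite normrM ger0_norm ?exprn_ge0// hV mulrC ler_wpM2r ?exprn_ge0.
have hdbb k t : `|dbb k t| <= be * (h k)^-1 * (h k)^-1.
  rewrite !normrM ger0_norm ?exprn_ge0// hV mulrA ler_wpM2r ?exprn_ge0//.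
  by rewrite mulrC ler_wpM2r ?exprn_ge0.
(* One bound for the factors of both generations and, multiplied by h, for [s k]: the finer bump is
   at most 2 be / h with derivative at most 4 be / h^2, while |s k| <= 2 <= 3 be, with derivative at
   most 3 be / h. Each derivative is at most 2 / h times the bound of its function. *)
pose ga k := 3 * be * (h k)^-1.
have hV0 k : 0 < (h k)^-1 by rewrite invr_gt0.
have bg k t : `|bb k t| <= ga k.
  apply: le_trans (hbb k t) _; rewrite /ga -mulrA ler_peMl ?ler1n// mulr_ge0// ltW//.
have bg' k t : `|bb k.+1 t| <= ga k.
  by apply: le_trans (hbb _ t) _; rewrite /ga hS mulrA ler_wpM2r ?(ltW (hV0 _))//; lra.
have dbg k t : `|dbb k t| <= 2 * (h k)^-1 * ga k.
  apply: le_trans (hdbb k t) _.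
  rewrite (_ : 2 * _ * _ = 6 * (be * (h k)^-1 * (h k)^-1)); last by rewrite /ga; ring.
  by rewrite ler_peMl ?ler1n// !mulr_ge0// ltW.
have dbg' k t : `|dbb k.+1 t| <= 2 * (h k)^-1 * ga k.
  apply: le_trans (hdbb _ t) _; rewrite hS.
  rewrite (_ : 2 * _ * ga k = 6 * (be * (h k)^-1 * (h k)^-1)); last by rewrite /ga; ring.
  rewrite (_ : be * _ * _ = 4 * (be * (h k)^-1 * (h k)^-1)); last by ring.
  by rewrite ler_wpM2r ?ler_nat// !mulr_ge0// ltW.
have sg k t : `|s k t| <= 3 * be.
  apply: le_trans (ler_normB _ _) _; apply: (@le_trans _ _ (1 + 1)); first exact: lerD.
  lra.
have dsg k t : `|ds k t| <= 2 * (h k)^-1 * (3 * be).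
  apply: le_trans (ler_normB _ _) _; apply: le_trans (lerD (hbb _ t) (hbb _ t)) _.
  have := hV0 k; rewrite hS; have := ltW be0; set u := (h k)^-1 => be0' u0.
  have : 0 <= be * u by rewrite mulr_ge0// ltW.
  by rewrite -subr_ge0 => P; rewrite -subr_ge0 (_ : _ - _ = 3 * (be * u - 0)) ?mulr_ge0//; ring.
(* Generation k + 1 in the coordinates below m and k in the others, so that T interpolates between
   [K k] at m = 0 and [K k.+1] at m = n. *)
pose T k m := tens (fun i : 'I_n => if (i < m)%N then bb k.+1 else bb k).
pose sgf k (m : 'I_n) (i : 'I_n) := if i == m then s k else if (i < m)%N then bb k.+1 else bb k.
pose dsgf k (m : 'I_n) (i : 'I_n) := if i == m then ds k else if (i < m)%N then dbb k.+1 else dbb k.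
pose K k := tens (fun _ : 'I_n => bb k).
have prodg k : \prod_(i < n) ga k = (3 * be) ^+ n * (h k)^-1 ^+ n.
  by rewrite prodr_const card_ord exprMn.
have bbz' k t : ~~ (0 <= t <= h k) -> bb k.+1 t = 0.
  move=> t0; apply: bbz; apply: contra t0 => /andP[-> /le_trans -> //].
  by rewrite /h lef_pV2 ?posrE ?exprn_gt0// exprS ler_peMl ?exprn_ge0// ler1n.
exists (2 * (3 * be) ^+ n), K, (fun k m => tens (sgf k m)); split.
- by rewrite mulr_ge0// exprn_ge0// mulr_ge0// ltW.
- move=> k; split.
  + apply: (@kernel_tens _ _ _ _ (fun=> dbb k) (fun=> ga k)) => //; first by move=> _; exact: bbz.
    by rewrite ler1n.
    by rewrite prodg.
  + apply: (@kernel_tens _ _ _ _ (fun=> dbb k.+1) (fun=> ga k)) => //; first by move=> _; exact: bbz'.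
    by rewrite ler1n.
    by rewrite prodg.
  + move=> m; rewrite -mulrA.
    apply: (@kernel_tens _ _ _ _ (dsgf k m) (fun i => if i == m then 3 * be else ga k)) => //.
    * by move=> i j; rewrite /sgf; case: eqP => // _; case: ifP.
    * by move=> i t; rewrite /sgf /dsgf; case: eqP => // _; case: ifP.
    * by move=> i t t0; rewrite /sgf; case: eqP => [_|_]; [exact: sz|case: ifP => _; [exact: bbz'|exact: bbz]].
    * by move=> i t; rewrite /sgf; case: eqP => // _; case: ifP.
    * by move=> i t; rewrite /dsgf; case: eqP => // _; case: ifP.
    * by rewrite ler1n.
    * rewrite (_ : _ * 2 ^- k * _ = \prod_(i < n) (ga k * (if i == m then h k else 1))).
        rewrite le_eqVlt; apply/orP; left; apply/eqP; apply: eq_bigr => i _.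
        by case: eqP => _; rewrite ?mulr1// /ga divfK// gt_eqF.
      rewrite big_split/= prodg [X in _ = _ * X](bigD1 m)//= eqxx big1 ?mulr1.
        by rewrite /h; ring.
      by move=> i /negbTE ->.
- move=> k z; rewrite /K /tens prodr_ge0// => i _; rewrite mulr_ge0 ?exprn_ge0//.
- move=> k; rewrite (@integral_leb_prod _ _ (fun=> bb k) (fun=> 1)).
  + by rewrite big1.
  + move=> i; apply: continuous_measurable_fun; exact: is_derive_continuous (dbbP k).
  + by move=> i t; rewrite mulr_ge0 ?exprn_ge0.
  + have dBk t : is_derive t (1 : R) (fun t => B (2 ^+ k * t)) (bb k t).
      by apply: (is_derive_ext (sc _ _ _ _ dB)); rewrite mulrC.
    move=> i; rewrite (integral_derivative01 dBk).
    * have E1 : 1 <= 2 ^+ k :> R by rewrite exprn_ege1// ler1n.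
      by rewrite mulr0 mulr1 (B1 _ E1) B0 ?subr0.
    * exact: is_derive_continuous (dbbP k).
    * move=> t t01; apply: bbz; move: t01; rewrite negb_and -!ltNge => /orP[->//|t1].
      by apply/orP; right; apply: le_lt_trans t1; rewrite /h invf_le1 ?exprn_gt0// exprn_ege1// ler1n.
- move=> k z.
  have -> : K k.+1 z - K k z = T k n z - T k 0%N z.
    by rewrite /K /T /tens; congr (_ - _); apply: eq_bigr => i _; rewrite ?ltn_ord.
  rewrite -(telescope_sumr (fun m => T k m z) (leq0n n)) big_mkord; apply: eq_bigr => m _.
  have dsgP i t : is_derive t (1 : R) (sgf k m i) (dsgf k m i t).
    by rewrite /sgf /dsgf; case: eqP => // _; case: ifP.
  rewrite (partial_tens _ _ dsgP).
  rewrite /T /tens (bigD1 m)//= [X in _ - X](bigD1 m)//= [RHS](bigD1 m)//=.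
  rewrite ltnSn ltnn eqxx /dsgf eqxx /ds mulrBl; congr (_ * _ - _ * _).
    apply: eq_bigr => i im; rewrite /sgf (negbTE im) ltnS leq_eqVlt.
    by rewrite (_ : (i == m :> nat) = false)//; apply/negbTE.
  by apply: eq_bigr => i im; rewrite /sgf (negbTE im).
Qed.

End mollifier.

(** * Convolution *)

Section difference_quotients.
Context (R : realType) (n : nat).
Notation mu := (leb R n).
Implicit Types (F G dF dG : 'rV[R]_n -> R) (v x z : 'rV[R]_n).

Lemma smooth_lipschitz F i (q : R) z (s : R) : smooth_on setT F ->
  (forall x, `|partial i F x| <= q) ->
  `|F (z + s *: delta_mx ord0 i) - F z| <= q * `|s|.
Proof.
move=> sF hq; set v : 'rV[R]_n := s *: delta_mx ord0 i.
have H (t : R) : is_derive t (1 : R) (fun t : R => F (z + t *: v)) (s * partial i F (z + t *: v)).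
  have dF : differentiable F (z + t *: v) by exact: (smooth_diff sF).
  apply: (is_derive_ext (is_derive_line dF)).
  rewrite derive_sum_partial// (bigD1 i)//= big1 ?addr0.
    by rewrite /v !mxE !eqxx mulr1.
  by move=> j ji; rewrite /v !mxE eqxx/= (negbTE ji) mulr0 mul0r.
have := @le_increment01 R (fun t => F (z + t *: v)) _ (q * `|s|) (fun t _ => H t).
rewrite scale1r scale0r addr0; apply => t _.
by rewrite normrM mulrC ler_wpM2r.
Qed.

Lemma cvg_pow2V : (fun j => 2 ^- j : R) @ \oo --> (0 : R).
Proof.
rewrite (_ : (fun _ => _) = (fun j => (2^-1 : R) ^+ j)); last first.
  by apply/funext => j; rewrite exprVn.
by apply: cvg_expr; rewrite ger0_norm ?invr_ge0// invf_lt1// ltr1n.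
Qed.

Lemma cvg_quotient F v z : differentiable F z ->
  (fun j => 2 ^+ j * (F (z + 2 ^- j *: v) - F z)) @ \oo --> 'D_v F z.
Proof.
move=> dF; have /cvg_ex[l hl] := @diff_derivable _ _ _ F z v dF.
have E : 'D_v F z = l by exact/cvg_lim.
rewrite E.
apply: (@cvg_trans _ ((fun h : R => h^-1 *: ((F \o shift z) (h *: v) - F z)) @
   ((fun j => 2 ^- j : R) @ \oo))).
  apply: near_eq_cvg; near=> j.
  by rewrite /= invrK /GRing.scale/= [_ + z]addrC.
apply: cvg_trans hl; apply: cvg_app.
move=> A /= [e e0 he].
have : \forall j \near \oo, ball (0 : R) e (2 ^- j : R).
  by move/cvgrPdist_lt : cvg_pow2V => /(_ e e0).
apply: filterS => j hj; apply: he => //; by rewrite invr_eq0 expf_neq0.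
Unshelve. all: by end_near. Qed.

Lemma Rintegral_leb_shift F (a : 'rV[R]_n) : measurable_fun [set: 'rV[R]_n] F ->
  \int[mu]_x F (x + a) = \int[mu]_x F x.
Proof.
move=> mF; rewrite /Rintegral; congr fine; rewrite [LHS]integralE [RHS]integralE.
have mE : measurable_fun [set: 'rV[R]_n] (EFin \o F) by exact/measurable_EFinP.
congr (_ - _)%E.
- rewrite -[RHS](@ge0_integral_leb_shift R n a ((EFin \o F)^\+)%E)//.
    by apply: eq_integral => x _; rewrite !funeposE.
  by apply: measurable_funepos.
- rewrite -[RHS](@ge0_integral_leb_shift R n a ((EFin \o F)^\-)%E)//.
    by apply: eq_integral => x _; rewrite !funenegE.
  by apply: measurable_funeneg.
Qed.

Lemma integrable_indicR (Q : set 'rV[R]_n) : measurable Q -> (mu Q < +oo)%E ->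
  mu.-integrable setT (EFin \o (\1_Q : 'rV[R]_n -> R)).
Proof.
move=> mQ Qoo; rewrite (_ : _ \o _ = (EFin \o (fun=> 1 : R)) \_ Q).
  by apply/(integrable_mkcond _ mQ); exact: integrable_cstR.
by apply/funext => x; rewrite patchE /= indicE; case: ifP.
Qed.

(* The quotients of F in the direction i are bounded by C and converge to dF;
   weaker than differentiability, but stable under products and under
   convolution of an integrable function with a smooth kernel. *)
Definition quotient_cvg i F dF (C : R) : Prop :=
  [/\ measurable_fun [set: 'rV[R]_n] F, forall x, `|F x| <= C,
      forall x (s : R), `|F (x + s *: delta_mx ord0 i) - F x| <= C * `|s| &
      forall x, (fun j => 2 ^+ j * (F (x + 2 ^- j *: delta_mx ord0 i) - F x)) @ \oo --> dF x].

Lemma quotient_cvg_measurable i F dF C : quotient_cvg i F dF C ->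
  measurable_fun [set: 'rV[R]_n] dF.
Proof.
move=> [mF _ _ hd].
have mq j : measurable_fun [set: 'rV[R]_n] (fun x => 2 ^+ j * (F (x + 2 ^- j *: delta_mx ord0 i) - F x)).
  apply: measurable_funM; first exact: measurable_cst.
  apply: measurable_funB => //.
  by apply: (measurableT_comp mF); exact: measurable_shift.
apply/measurable_EFinP.
apply: (emeasurable_fun_cvg (fun j x => (2 ^+ j * (F (x + 2 ^- j *: delta_mx ord0 i) - F x))%:E)).
  by move=> j; exact/measurable_EFinP.
by move=> x _; apply: cvg_EFin; [exact: nearW|exact: hd].
Qed.

Lemma quotient_cvg_le i F dF C x : quotient_cvg i F dF C -> `|dF x| <= C.
Proof.
move=> [_ _ hq hd].
apply: (cvgr_to_le (cvg_norm (hd x))); near=> j.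
rewrite normrM; apply: le_trans (ler_wpM2l (normr_ge0 _) (hq _ _)) _.
by rewrite mulrCA -normrM divff ?expf_neq0// normr1 mulr1.
Unshelve. all: by end_near. Qed.

Lemma quotient_cvgM i F dF C G dG D : quotient_cvg i F dF C -> quotient_cvg i G dG D ->
  quotient_cvg i (fun x => F x * G x) (fun x => dF x * G x + F x * dG x) (2 * C * D).
Proof.
move=> [mF F1 F2 F3] [mG G1 G2 G3].
have C0 : 0 <= C by apply: le_trans (F1 0).
have D0 : 0 <= D by apply: le_trans (G1 0).
have CD0 : 0 <= C * D by exact: mulr_ge0.
split.
- exact: measurable_funM.
- move=> x; rewrite normrM -mulrA; apply: (@le_trans _ _ (C * D)); first exact: ler_pM.
  by rewrite ler_peMl// ler1n.
- move=> x s; set y := x + _.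
  rewrite (_ : F y * G y - F x * G x = (F y - F x) * G y + F x * (G y - G x)); last by ring.
  apply: le_trans (ler_normD _ _) _; rewrite !normrM.
  rewrite (_ : 2 * C * D * `|s| = C * `|s| * D + C * (D * `|s|)); last by ring.
  apply: lerD; first by apply: ler_pM => //; exact: F2.
  by apply: ler_pM => //; exact: G2.
- move=> x; set e := delta_mx ord0 i.
  pose y j := x + (2 ^- j : R) *: e.
  have GG : (fun j => G (y j)) @ \oo --> G x.
    apply/cvgrPdist_le => r r0; near=> j.
    rewrite distrC; apply: le_trans (G2 _ _) _.
    have : `|2 ^- j| <= r / (D + 1) :> R.
      near: j; have /cvgr0Pnorm_le := cvg_pow2V; apply.
      by rewrite divr_gt0// ltr_wpDl.
    rewrite ler_pdivlMr ?ltr_wpDl// => h; apply: le_trans h.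
    by rewrite mulrC ler_wpM2l// lerDl.
  apply: (@cvg_trans _ ((fun j => (2 ^+ j * (F (y j) - F x)) * G (y j) +
      F x * (2 ^+ j * (G (y j) - G x))) @ \oo)).
    by apply: near_eq_cvg; near=> j; rewrite /y; ring.
  by apply: cvgD; [apply: cvgM => //; exact: F3|apply: cvgM; [exact: cvg_cst|exact: G3]].
Unshelve. all: by end_near. Qed.

(** The difference quotients of F have integral 0 by translation invariance, and they converge
    boundedly to dF with supports in a fixed cube. Applied to a product, this is integration by
    parts. *)
Lemma quotient_cvg_int0 i F dF C (r : R) : quotient_cvg i F dF C ->
  (forall x, ~ cube 0 r x -> F x = 0) -> \int[mu]_x dF x = 0.
Proof.
move=> /[dup] H [mF F1 F2 F3] Fr; have mdF := quotient_cvg_measurable H.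
set e := delta_mx ord0 i in F2 F3.
pose q j x := 2 ^+ j * (F (x + (2 ^- j : R) *: e) - F x).
(* Enlarged by 1, because the shifts 2^-j are at most 1. *)
pose Q := cube (0 : 'rV[R]_n) (r + 1).
have mQ : measurable Q by exact: measurable_cube.
have Qoo : (mu Q < +oo)%E by exact: leb_compact_lty (@compact_cube _ _ _ _).
have C0 : 0 <= C by apply: le_trans (F1 0).
have mq j : measurable_fun [set: 'rV[R]_n] (q j).
  apply: measurable_funM; first exact: measurable_cst.
  by apply: measurable_funB => //; apply: (measurableT_comp mF); exact: measurable_shift.
have iF : mu.-integrable setT (EFin \o F).
  apply: (@le_integrableR _ _ _ mu _ F (fun x => C * \1_Q x)) => //.
    apply: integrableZR => //.
    exact: integrable_indicR.
  move=> x _; have [Qx|Qx] := pselect (Q x).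
    by rewrite indicE mem_set// mulr1.
  rewrite Fr ?normr0 ?mulr_ge0// => rx; apply: Qx => k.
  by have := rx k; rewrite !mxE !sub0r !add0r => /andP[h1 h2]; apply/andP; split; lra.
have mFa (a : 'rV[R]_n) : measurable_fun [set: 'rV[R]_n] (fun x => F (x + a)).
  by apply: (measurableT_comp mF); exact: measurable_shift.
have iFa (a : 'rV[R]_n) : mu.-integrable setT (EFin \o (fun x => F (x + a))).
  apply/integrableP; split; first exact/measurable_EFinP.
  rewrite (@ge0_integral_leb_shift R n a (fun x => `|(F x)%:E|)%E)//.
    by case/integrableP : iF.
  by apply: measurableT_comp => //; exact/measurable_EFinP.
have q0 j : \int[mu]_x q j x = 0.
  rewrite /q RintegralZl//; last by apply: integrableBR => //; exact: iFa.
  rewrite (RintegralB measurableT (iFa _) iF).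
  by rewrite Rintegral_leb_shift// subrr mulr0.
have : (fun j => \int[mu]_x q j x) @ \oo --> \int[mu]_x dF x.
  apply: (@dominated_cvg_Rintegral _ _ _ mu setT _ _ (fun x => C * \1_Q x)) => //.
  - by move=> x _; exact: F3.
  - by apply: integrableZR => //; exact: integrable_indicR.
  move=> j x _; rewrite /q.
  have j1 : `|2 ^- j| <= 1 :> R.
    by rewrite ger0_norm ?invr_ge0// invf_le1 ?exprn_gt0// exprn_ege1// ler1n.
  have [Qx|Qx] := pselect (Q x).
    rewrite indicE mem_set// mulr1 normrM; apply: le_trans (ler_wpM2l (normr_ge0 _) (F2 _ _)) _.
    by rewrite mulrCA -normrM divff ?expf_neq0// normr1 mulr1.
  rewrite !Fr ?subr0 ?mulr0 ?normr0 ?mulr_ge0// => rx; apply: Qx => k; have := rx k.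
  - by rewrite !mxE !sub0r !add0r => /andP[h1 h2]; apply/andP; split; lra.
  - rewrite !mxE !sub0r !add0r eqxx/=.
    move: j1; rewrite ler_norml => /andP[j1 j2].
    move: (2 ^- j : R) j1 j2 => t t1 t2.
    by case: (k == i); rewrite ?mulr1 ?mulr0 => /andP[h1 h2]; apply/andP; split; lra.
rewrite (eq_cvg _ _ q0) => h; exact: (cvg_unique _ h (cvg_cst _)).
Qed.

End difference_quotients.

Section convolution.
Context (R : realType) (n : nat).
Notation mu := (leb R n).
Notation "'L1' u" := (mu.-integrable [set: 'rV[R]_n] (EFin \o u)) (at level 10).
Implicit Types (u v kap : 'rV[R]_n -> R) (x y z : 'rV[R]_n).

(** The kernel is translated but not reflected: as a function of y, kap (y - x) is directly a test
    function, supported in x + [0, h]^n when kap has width h. The price is the sign in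
    [conv_quotient_cvg]. *)
Definition conv u kap x : R := \int[mu]_y (u y * kap (y - x)).

Lemma integrable_measurableR u : L1 u -> measurable_fun [set: 'rV[R]_n] u.
Proof. by move=> iu; apply/measurable_EFinP; exact: measurable_int iu. Qed.

Lemma integrable_mul_bounded u v (C : R) : L1 u -> measurable_fun [set: 'rV[R]_n] v ->
  (forall y, `|v y| <= C) -> L1 (fun y => u y * v y).
Proof.
move=> iu mv vC; have mu_ := integrable_measurableR iu.
apply: (@le_integrableR _ _ _ mu _ _ (fun y => C * `|u y|)) => //.
- exact: measurable_funM.
- by apply: integrableZR => //; exact: integrable_norm iu.
- by move=> y _; rewrite normrM mulrC ler_wpM2r.
Qed.

Lemma measurable_conv_kernel kap x : measurable_fun [set: 'rV[R]_n] kap ->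
  measurable_fun [set: 'rV[R]_n] (fun y => kap (y - x)).
Proof. by move=> mk; apply: (measurableT_comp mk); exact: measurable_shift. Qed.

Lemma integrable_conv u kap (C : R) x : L1 u -> measurable_fun [set: 'rV[R]_n] kap ->
  (forall z, `|kap z| <= C) -> L1 (fun y => u y * kap (y - x)).
Proof.
move=> iu mk kC; apply: (integrable_mul_bounded iu) => //.
exact: measurable_conv_kernel.
Qed.

Lemma conv_dominated u v kap kap' (C : R) x : L1 u -> L1 v ->
  measurable_fun [set: 'rV[R]_n] kap -> measurable_fun [set: 'rV[R]_n] kap' ->
  (forall z, `|kap' z| <= C) -> (forall y, `|u y| <= v y) ->
  (forall z, `|kap z| <= kap' z) -> `|conv u kap x| <= conv v kap' x.
Proof.
move=> iu iv mk mk' kC uv kk'; apply: le_norm_Rintegral => //.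
- apply: measurable_funM; first exact: integrable_measurableR.
  exact: measurable_conv_kernel.
- exact: integrable_conv kC.
- by move=> y _; rewrite normrM ler_pM.
Qed.

Lemma convZ u kap (c C : R) x : L1 u -> measurable_fun [set: 'rV[R]_n] kap ->
  (forall z, `|kap z| <= C) -> conv u (fun z => c * kap z) x = c * conv u kap x.
Proof.
move=> iu mk kC; rewrite /conv -RintegralZl//; last exact: integrable_conv kC.
by apply: eq_Rintegral => y _; rewrite mulrCA.
Qed.

Lemma measurable_diff : measurable_fun [set: 'rV[R]_n * 'rV[R]_n] (fun q => q.2 - q.1).
Proof.
apply: measurable_fun_rVP => i.
rewrite (_ : _ \o _ = (fun q : 'rV[R]_n * 'rV[R]_n => rV_coord i q.2 - rV_coord i q.1)).
  apply: measurable_funB.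
  - by apply: measurableT_comp; [exact: measurable_rV_coord|exact: measurable_snd].
  - by apply: measurableT_comp; [exact: measurable_rV_coord|exact: measurable_fst].
by apply/funext => q; rewrite /= /rV_coord !mxE.
Qed.

Lemma measurable_conv u kap : measurable_fun [set: 'rV[R]_n] u ->
  measurable_fun [set: 'rV[R]_n] kap -> measurable_fun [set: 'rV[R]_n] (conv u kap).
Proof.
move=> mu_ mk; pose F (q : 'rV[R]_n * 'rV[R]_n) := (u q.2 * kap (q.2 - q.1))%:E.
have mF : measurable_fun setT F.
  apply/measurable_EFinP; apply: measurable_funM.
    by apply: measurableT_comp => //; exact: measurable_snd.
  by apply: measurableT_comp => //; exact: measurable_diff.
apply: (@measurableT_comp _ _ _ _ _ _ (@fine R)); first exact: fine_measurable.
rewrite (_ : (fun _ => _) = (fun x => fubini_F mu (F^\+)%E x - fubini_F mu (F^\-)%E x)%E); last first.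
  apply/funext => x; rewrite integralE /fubini_F; congr (_ - _)%E.
    by apply: eq_integral => y _; rewrite !funeposE.
  by apply: eq_integral => y _; rewrite !funenegE.
apply: emeasurable_funB; apply: measurable_fun_fubini_tonelli_F => //.
- exact: measurable_funepos.
- exact: measurable_funeneg.
Qed.

Definition box (h : R) : set 'rV[R]_n := [set z | forall i, 0 <= z ord0 i <= h].

(** Normalised indicator of [0, h]^n. All kernels of width h are dominated by multiples of it, so
    that pointwise estimates only involve averages over cubes. *)
Definition avg (h : R) z : R := h^-1 ^+ n * \1_(box h) z.

Lemma measurable_avg h : measurable_fun [set: 'rV[R]_n] (avg h).
Proof.
apply: measurable_funM; first exact: measurable_cst.
apply: measurable_indic; exact: (@measurable_box _ _ (fun=> 0) (fun=> h)).
Qed.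

Lemma avg_ge0 h z : 0 < h -> 0 <= avg h z.
Proof. by move=> h0; rewrite mulr_ge0// exprn_ge0// invr_ge0 ltW. Qed.

Lemma avg_le h z : 0 < h -> `|avg h z| <= h^-1 ^+ n.
Proof.
move=> h0; rewrite ger0_norm ?avg_ge0// /avg indicE -[leRHS]mulr1.
have hi : 0 <= h^-1 ^+ n by rewrite exprn_ge0// invr_ge0 ltW.
by rewrite ler_wpM2l//; case: (_ \in _).
Qed.

Lemma kernel_le_avg h c kap z : kernel h c kap -> `|kap z| <= c * avg h z.
Proof.
move=> [_ k0 kc _]; rewrite /avg indicE; case: (boolP (z \in box h)) => [_|].
  by rewrite mulr1.
rewrite notin_setE => /existsNP[i /negP zi]; rewrite (k0 z i zi) normr0.
by rewrite mulr0 mulr0.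
Qed.

Lemma kernel_partial_le_avg h c kap i z : kernel h c kap ->
  `|partial i kap z| <= c * h^-1 * avg h z.
Proof.
move=> hk; have [_ k0 _ kc] := hk; rewrite /avg indicE; case: (boolP (z \in box h)) => [_|].
  by rewrite mulr1.
rewrite notin_setE => /existsNP[j /negP zj].
by rewrite (kernel_partial_eq0 _ hk zj) normr0 !mulr0.
Qed.

Lemma kernel_measurable h c kap : kernel h c kap -> measurable_fun [set: 'rV[R]_n] kap.
Proof.
move=> [sk _ _ _]; apply: continuous_measurable_rV => x; exact: (smooth_continuous sk).
Qed.

Lemma kernel_partial_measurable h c kap i : kernel h c kap ->
  measurable_fun [set: 'rV[R]_n] (partial i kap).
Proof.
move=> [sk _ _ _]; apply: continuous_measurable_rV => x.
exact: (smooth_continuous (smooth_partial i sk)).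
Qed.

Lemma conv_avg_ge0 h u x : 0 < h -> (forall y, 0 <= u y) -> 0 <= conv u (avg h) x.
Proof. by move=> h0 u0; apply: Rintegral_ge0 => y _; rewrite mulr_ge0// avg_ge0. Qed.

Lemma conv_kernel_le h c kap u v x : 0 < h -> kernel h c kap -> L1 u -> L1 v ->
  (forall y, `|u y| <= v y) -> `|conv u kap x| <= c * conv v (avg h) x.
Proof.
move=> h0 hk iu iv uv; have ha z := avg_le z h0.
rewrite -(convZ _ _ iv (measurable_avg h) ha).
apply: (conv_dominated (C := `|c| * h^-1 ^+ n)) => //.
- exact: kernel_measurable hk.
- apply: measurable_funM; [exact: measurable_cst|exact: measurable_avg].
- by move=> z; rewrite normrM ler_wpM2l.
- by move=> z; exact: kernel_le_avg.
Qed.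

Lemma conv_partial_le h c kap i u v x : 0 < h -> kernel h c kap -> L1 u -> L1 v ->
  (forall y, `|u y| <= v y) -> `|conv u (partial i kap) x| <= c * h^-1 * conv v (avg h) x.
Proof.
move=> h0 hk iu iv uv; have ha z := avg_le z h0.
rewrite -(convZ _ _ iv (measurable_avg h) ha).
apply: (conv_dominated (C := `|c * h^-1| * h^-1 ^+ n)) => //.
- exact: kernel_partial_measurable hk.
- apply: measurable_funM; [exact: measurable_cst|exact: measurable_avg].
- by move=> z; rewrite normrM ler_wpM2l.
- by move=> z; exact: kernel_partial_le_avg.
Qed.

Lemma conv_kernel_bound h c kap u x : kernel h c kap -> L1 u ->
  `|conv u kap x| <= c * h^-1 ^+ n * \int[mu]_y `|u y|.
Proof.
move=> hk iu; have [_ _ kc _] := hk.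
rewrite -RintegralZl//; last exact: integrable_norm iu.
apply: le_norm_Rintegral => //.
- apply: measurable_funM; first exact: integrable_measurableR.
  by apply: measurable_conv_kernel; exact: kernel_measurable hk.
- by apply: integrableZR => //; exact: integrable_norm iu.
- by move=> y _; rewrite normrM mulrC ler_wpM2r.
Qed.

(** u is merely integrable and the derivative falls on the kernel, whose Lipschitz bound dominates
    the quotients under the integral. In the constant, the two summands of 1 + h^-1 cover the bound
    of the function and that of its quotients. *)
Lemma conv_quotient_cvg h c kap u i : 0 < h -> 0 <= c -> kernel h c kap -> L1 u ->
  quotient_cvg i (conv u kap) (fun x => - conv u (partial i kap) x)
    (c * (1 + h^-1) * h^-1 ^+ n * \int[mu]_y `|u y|).
Proof.
move=> h0 c0 hk iu; have [sk k0 kc kq] := hk.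
have mk := kernel_measurable hk.
have mu_ := integrable_measurableR iu.
have iu' : L1 (fun y => `|u y|) by exact: integrable_norm iu.
have U0 : 0 <= \int[mu]_y `|u y| by apply: Rintegral_ge0.
have hi : 0 <= h^-1 ^+ n by rewrite exprn_ge0// invr_ge0 ltW.
have hi' : 0 <= h^-1 by rewrite invr_ge0 ltW.
set e : 'rV[R]_n := delta_mx ord0 i.
have ik x := integrable_conv x iu mk kc.
have E x (s : R) y : kap (y - (x + s *: e)) = kap ((y - x) + (- s) *: e).
  by rewrite scaleNr opprD addrA.
have lip x y (s : R) : `|u y * kap (y - (x + s *: e)) - u y * kap (y - x)| <=
    c * h^-1 * h^-1 ^+ n * `|s| * `|u y|.
  rewrite -mulrBr normrM mulrC ler_wpM2r// E.
  by rewrite -(normrN s); exact: (smooth_lipschitz _ _ sk).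
have mB x (s : R) : measurable_fun [set: 'rV[R]_n]
    (fun y => u y * kap (y - (x + s *: e)) - u y * kap (y - x)).
  by apply: measurable_funB; apply: measurable_funM => //; exact: measurable_conv_kernel.
split.
- exact: measurable_conv.
- move=> x; apply: le_trans (conv_kernel_bound x hk iu) _.
  rewrite ler_wpM2r// ler_wpM2r// ler_peMr// lerDl.
  by [].
- move=> x s; rewrite /conv -RintegralB//.
  apply: (@le_trans _ _ (\int[mu]_y (c * h^-1 * h^-1 ^+ n * `|s| * `|u y|))).
    by apply: le_norm_Rintegral => //; exact: integrableZR.
  rewrite RintegralZl//.
  rewrite (_ : c * (1 + h^-1) * _ * _ * `|s| = c * h^-1 * h^-1 ^+ n * `|s| * \int[mu]_y `|u y| +
     c * h^-1 ^+ n * `|s| * \int[mu]_y `|u y|); last by ring.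
  by rewrite lerDl !mulr_ge0.
- move=> x; rewrite /conv.
  have ip : L1 (fun y => u y * partial i kap (y - x)).
    apply: (integrable_conv x iu _ (kq i)); exact: kernel_partial_measurable hk.
  rewrite -[X in _ --> X]mulN1r -RintegralZl//.
  apply: (@eq_cvgn _ (fun j => \int[mu]_y (2 ^+ j * (u y * kap (y - (x + (2 ^- j : R) *: e)) - u y * kap (y - x)))) _ _ _ _ (erefl _)).
    move=> j; rewrite RintegralZl//; last by apply: integrableBR => //; exact: ik.
    by rewrite RintegralB//; exact: ik.
  apply: (@dominated_cvg_Rintegral _ _ _ mu setT _ _ (fun y => c * h^-1 * h^-1 ^+ n * `|u y|)) => //.
  + by move=> j; apply: measurable_funM; [exact: measurable_cst|exact: mB].
  + apply: measurable_funM; first exact: measurable_cst.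
    exact: integrable_measurableR.
  + move=> y _.
    have dk : differentiable kap (y - x) by exact: (smooth_diff sk).
    have := @cvg_quotient R n kap (- e) _ dk.
    have -> : 'D_(- e) kap (y - x) = - partial i kap (y - x).
      rewrite derive_sum_partial// (bigD1 i)//= big1 ?addr0.
        by rewrite !mxE !eqxx mulN1r.
      by move=> j ji; rewrite !mxE eqxx/= (negbTE ji) oppr0 mul0r.
    move=> /(cvgM (cvg_cst (u y))).
    rewrite (_ : -1 * _ = u y * - partial i kap (y - x)); last by ring.
    apply: cvg_trans; apply: near_eq_cvg; near=> j => /=.
    by rewrite E scalerN scaleNr; ring.
  + exact: integrableZR.
  + move=> j y _; rewrite normrM; apply: le_trans (ler_wpM2l (normr_ge0 _) (lip _ _ _)) _.
    rewrite (_ : _ * (_ * _ * _) = `|2 ^+ j * 2 ^- j| * (c * h^-1 * h^-1 ^+ n * `|u y|)).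
      by rewrite divff ?expf_neq0// normr1 mul1r.
    by rewrite [in RHS]normrM; ring.
Unshelve. all: by end_near. Qed.

End convolution.

Section averages.
Context (R : realType) (n : nat).
Notation mu := (leb R n).
Notation "'L1' u" := (mu.-integrable [set: 'rV[R]_n] (EFin \o u)) (at level 10).
Implicit Types (u v kap : 'rV[R]_n -> R) (x y z : 'rV[R]_n).

Lemma integral_avg_reflect (h : R) y : 0 < h ->
  (\int[mu]_x (avg h (y - x))%:E = 1)%E.
Proof.
move=> h0.
have hn : 0 <= h^-1 ^+ n by rewrite exprn_ge0// invr_ge0 ltW.
pose Q : set 'rV[R]_n := [set x | forall i, y ord0 i - h <= x ord0 i <= y ord0 i].
have mQ : measurable Q by exact: measurable_box.
under eq_integral => x _.
  rewrite (_ : avg h (y - x) = h^-1 ^+ n * \1_Q x); last first.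
    rewrite /avg; congr (_ * _); rewrite !indicE; congr (nat_of_bool _)%:R.
    apply/idP/idP => /set_mem H; apply/mem_set => i; have := H i.
      by rewrite !mxE => /andP[h1 h2]; apply/andP; split; lra.
    by rewrite !mxE => /andP[h1 h2]; apply/andP; split; lra.
  rewrite EFinM; over.
rewrite ge0_integralZl//; last by apply/measurable_EFinP; exact: measurable_indic.
have -> : (\int[mu]_x (\1_Q x)%:E = (h ^+ n)%:E)%E.
  rewrite integral_indic// setIT.
  transitivity (\prod_i (y ord0 i - (y ord0 i - h)))%:E.
    by apply: leb_box => i; rewrite lerBlDr lerDl ltW.
  congr EFin; rewrite (eq_bigr (fun=> h)); last by move=> i _; rewrite opprB addrC subrK.
  by rewrite prodr_const card_ord.
by rewrite -EFinM -exprMn mulVf ?gt_eqF// expr1n.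
Qed.

Lemma integral_avg_shift (h : R) x : 0 < h -> (\int[mu]_y (avg h (y - x))%:E = 1)%E.
Proof.
move=> h0; rewrite (@ge0_integral_leb_shift _ _ (- x) (EFin \o avg h)); last 2 first.
- by apply/measurable_EFinP; exact: measurable_avg.
- by move=> z; rewrite lee_fin avg_ge0.
rewrite -(@integral_avg_reflect h (const_mx h) h0).
apply: eq_integral => z _; congr EFin; rewrite /avg; congr (_ * _); rewrite !indicE.
congr (nat_of_bool _)%:R; apply/idP/idP => /set_mem H; apply/mem_set => i; have := H i.
  by rewrite !mxE => /andP[h1 h2]; apply/andP; split; lra.
by rewrite !mxE => /andP[h1 h2]; apply/andP; split; lra.
Qed.

Lemma integrable_avg_shift (h : R) x : 0 < h -> L1 (fun y => avg h (y - x)).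
Proof.
move=> h0; apply/integrableP; split.
  by apply/measurable_EFinP; exact: (measurable_conv_kernel _ (@measurable_avg R n h)).
rewrite (eq_integral (fun y => (avg h (y - x))%:E)).
  by rewrite integral_avg_shift// ltry.
by move=> y _ /=; rewrite ger0_norm// avg_ge0.
Qed.

Lemma conv_avg_integral (h : R) u : 0 < h -> L1 u -> (forall y, 0 <= u y) ->
  L1 (conv u (avg h)) /\ \int[mu]_x conv u (avg h) x = \int[mu]_y u y.
Proof.
move=> h0 iu u0; have mu_ := integrable_measurableR iu.
have ma := @measurable_avg R n h.
have hn : 0 <= h^-1 ^+ n by rewrite exprn_ge0// invr_ge0 ltW.
have mF : measurable_fun setT (fun q : 'rV[R]_n * 'rV[R]_n => (u q.2 * avg h (q.2 - q.1))%:E).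
  apply/measurable_EFinP; apply: measurable_funM.
    by apply: measurableT_comp => //; exact: measurable_snd.
  by apply: measurableT_comp => //; exact: measurable_diff.
have E x : (conv u (avg h) x)%:E = (\int[mu]_y (u y * avg h (y - x))%:E)%E.
  by rewrite -RintegralE//; apply: (integrable_conv x iu ma) => z; exact: avg_le.
have K : (\int[mu]_x (conv u (avg h) x)%:E = \int[mu]_y (u y)%:E)%E.
  under eq_integral do rewrite E.
  rewrite (@fubini_tonelli _ _ _ _ _ mu mu _ mF)/=; last first.
    by move=> q; rewrite lee_fin mulr_ge0// avg_ge0.
  apply: eq_integral => y _.
  under eq_integral do rewrite EFinM.
  rewrite ge0_integralZl//; last 3 first.
  - apply/measurable_EFinP; apply: measurableT_comp => //.
    apply: measurable_fun_rVP => i.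
    rewrite (_ : _ \o _ = (fun x : 'rV[R]_n => rV_coord i y - rV_coord i x)).
      by apply: measurable_funB; [exact: measurable_cst|exact: measurable_rV_coord].
    by apply/funext => x; rewrite /= /rV_coord !mxE.
  - by move=> x _; rewrite lee_fin avg_ge0.
  - by rewrite lee_fin.
  by rewrite integral_avg_reflect// mule1.
split; last by rewrite /Rintegral K.
apply/integrableP; split.
  by apply/measurable_EFinP; exact: measurable_conv.
rewrite (eq_integral (fun x => (conv u (avg h) x)%:E)).
  by rewrite K RintegralE// ltry.
by move=> x _; rewrite gee0_abs// lee_fin conv_avg_ge0.
Qed.

(** Jensen's inequality up to the constant 2^p. Averaging [le_powR_split] gives a <= l + l^(1 - p) w
    for every level l, and l = w^(1 / p) makes both terms equal; if w = 0, let l tend to 0. *)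
Lemma conv_avg_powR (h p : R) u x : 0 < h -> 1 <= p -> L1 u ->
  L1 (fun y => u y `^ p) -> (forall y, 0 <= u y) ->
  conv u (avg h) x `^ p <= 2 `^ p * conv (fun y => u y `^ p) (avg h) x.
Proof.
move=> h0 p1 iu iup u0; have p0 : 0 < p by exact: lt_le_trans p1.
set a := conv u _ x; set w := conv _ _ x.
have a0 : 0 <= a by exact: conv_avg_ge0.
have w0 : 0 <= w by apply: conv_avg_ge0 => // y; exact: powR_ge0.
have ma := @measurable_avg R n h.
have ia := integrable_avg_shift x h0.
have H (l : R) : 0 < l -> a <= l + l `^ (1 - p) * w.
  move=> l0; have i1 := integrable_conv x iup ma (fun z => avg_le z h0).
  rewrite (_ : l + _ = \int[mu]_y (l * avg h (y - x) + l `^ (1 - p) * (u y `^ p * avg h (y - x)))).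
    apply: le_Rintegral => //.
    - by apply: (integrable_conv x iu ma) => z; exact: avg_le.
    - by apply: integrableDR => //; exact: integrableZR.
    - move=> y _; rewrite mulrA -mulrDl ler_wpM2r ?avg_ge0//.
      exact: le_powR_split.
  rewrite RintegralD//; try exact: integrableZR.
  rewrite (_ : \int[mu]_y (l * _) = l); last first.
    by rewrite RintegralZl// /Rintegral integral_avg_shift//= mulr1.
  by congr (_ + _); rewrite RintegralZl.
have [w00|wp] := eqVneq w 0.
  suff -> : a = 0 by rewrite powR0 ?gt_eqF// mulr_ge0 ?powR_ge0.
  apply/eqP; rewrite eq_le a0 andbT; apply/ler_addgt0Pl => l l0.
  by have := H l l0; rewrite w00 mulr0 addr0.
have wp' : 0 < w by rewrite lt_neqAle eq_sym wp.
have := H (w `^ p^-1) (powR_gt0 _ wp').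
have -> : (w `^ p^-1) `^ (1 - p) * w = w `^ p^-1.
  rewrite -powRrM -[X in _ * X](powRr1 w0) -powRD; last by rewrite wp implybT.
  by congr (_ `^ _); field; rewrite gt_eqF.
move=> aw; rewrite (@le_trans _ _ ((2 * w `^ p^-1) `^ p))//.
  apply: ge0_ler_powR; rewrite ?nnegrE ?mulr_ge0 ?powR_ge0// ?(ltW p0)//.
  by rewrite mulr2n mulrDl !mul1r.
by rewrite powRM ?powR_ge0// -powRrM mulVf ?gt_eqF// powRr1.
Qed.

Lemma convB u v kap (C : R) x : L1 u -> L1 v -> measurable_fun [set: 'rV[R]_n] kap ->
  (forall z, `|kap z| <= C) -> conv (fun y => u y - v y) kap x = conv u kap x - conv v kap x.
Proof.
move=> iu iv mk kC; rewrite /conv -RintegralB//; try exact: integrable_conv kC.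
by apply: eq_Rintegral => y _; rewrite mulrBl.
Qed.

Lemma conv_sum (J : Type) (s : seq J) (c : J -> R) (u : J -> 'rV[R]_n -> R) kap (C : R) x :
  (forall i, L1 (u i)) -> measurable_fun [set: 'rV[R]_n] kap ->
  (forall z, `|kap z| <= C) ->
  conv (fun y => \sum_(i <- s) c i * u i y) kap x = \sum_(i <- s) c i * conv (u i) kap x.
Proof.
move=> iu mk kC; have iuk i := integrable_conv x (iu i) mk kC.
transitivity (\int[mu]_y (\sum_(i <- s) c i * (u i y * kap (y - x)))).
  by apply: eq_Rintegral => y _; rewrite mulr_suml; apply: eq_bigr => i _; rewrite mulrA.
rewrite Rintegral_sum//; last by move=> i; exact: integrableZR.
by apply: eq_bigr => i _; rewrite RintegralZl.
Qed.

End averages.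

Import HBSimple.

(** * Convergence of mollifications in L^1 *)

Section mollification.
Context (R : realType) (n : nat).
Notation mu := (leb R n).
Notation "'L1' u" := (mu.-integrable [set: 'rV[R]_n] (EFin \o u)) (at level 10).
Variables (K : nat -> 'rV[R]_n -> R) (C : R).
Hypotheses (C0 : 0 <= C) (hK : forall k, kernel (2 ^- k) C (K k)).
Hypotheses (K0 : forall k z, 0 <= K k z) (K1 : forall k, (\int[mu]_z (K k z)%:E = 1)%E).
Implicit Types (u v g : 'rV[R]_n -> R).

Let h0 k : 0 < 2 ^- k :> R. Proof. by rewrite invr_gt0 exprn_gt0. Qed.

Let mK k : measurable_fun [set: 'rV[R]_n] (K k) := kernel_measurable (hK k).

Let Kb k z : `|K k z| <= C * (2 ^- k)^-1 ^+ n.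
Proof. by have [_ _ + _] := hK k. Qed.

Let iKs k x : L1 (fun y => K k (y - x)) /\ \int[mu]_y K k (y - x) = 1.
Proof.
have E : (\int[mu]_y (K k (y - x))%:E = 1)%E.
  rewrite (@ge0_integral_leb_shift _ _ (- x) (EFin \o K k)) ?K1//.
    exact/measurable_EFinP.
  by move=> z; rewrite lee_fin.
split; last by rewrite /Rintegral E.
apply/integrableP; split.
  by apply/measurable_EFinP; exact: measurable_conv_kernel.
rewrite (eq_integral (fun y : 'rV[R]_n => (K k (y - x))%:E)) ?E ?ltry//.
by move=> y _ /=; rewrite ger0_norm.
Qed.

Lemma conv_mollifier_integrable k u : L1 u -> L1 (conv u (K k)) /\
  \int[mu]_x `|conv u (K k) x| <= C * \int[mu]_y `|u y|.
Proof.
move=> iu; have iu' : L1 (fun y => `|u y|) by exact: integrable_norm iu.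
have [ia Ea] := conv_avg_integral (h0 k) iu' (fun y => normr_ge0 (u y)).
have mc : measurable_fun [set: 'rV[R]_n] (conv u (K k)).
  by apply: measurable_conv => //; exact: integrable_measurableR.
have le x : `|conv u (K k) x| <= C * conv (fun y => `|u y|) (avg (2 ^- k)) x.
  exact: (conv_kernel_le x (h0 k) (hK k) iu iu').
have ic : L1 (conv u (K k)).
  apply: (@le_integrableR _ _ _ mu _ _ (fun x => C * conv (fun y => `|u y|) (avg (2 ^- k)) x)) => //.
  exact: integrableZR.
split => //; rewrite -Ea -RintegralZl//.
apply: le_Rintegral => //; [exact: integrable_norm ic|exact: integrableZR].
Qed.

Let err k u := \int[mu]_x `|conv u (K k) x - u x|.

Let ierr k u : L1 u -> L1 (fun x => `|conv u (K k) x - u x|).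
Proof.
move=> iu; have [ic _] := conv_mollifier_integrable k iu.
exact: integrable_norm (integrableBR measurableT ic iu).
Qed.

Let err_le k u v : L1 u -> L1 v ->
  err k u <= err k v + (C + 1) * \int[mu]_x `|u x - v x|.
Proof.
move=> iu iv; have iuv := integrableBR measurableT iu iv.
have [ic lc] := conv_mollifier_integrable k iuv.
have H : err k u <= \int[mu]_x (`|conv v (K k) x - v x| +
    (`|conv (fun y => u y - v y) (K k) x| + `|u x - v x|)).
  apply: le_Rintegral => //; first exact: ierr.
    apply: integrableDR => //; first exact: ierr.
    by apply: integrableDR => //; [exact: integrable_norm ic|exact: integrable_norm iuv].
  move=> x _; rewrite (convB x iu iv (mK k) (Kb k)).
  set a := conv u _ x; set b := conv v _ x.
  rewrite (_ : a - u x = (b - v x) + ((a - b) - (u x - v x))); last by ring.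
  apply: le_trans (ler_normD _ _) _; rewrite lerD2l.
  exact: ler_normB.
apply: le_trans H _; rewrite RintegralD//; last 2 first.
- exact: ierr.
- by apply: integrableDR => //; [exact: integrable_norm ic|exact: integrable_norm iuv].
rewrite lerD2l RintegralD//; last 2 first.
- exact: integrable_norm ic.
- exact: integrable_norm iuv.
by rewrite mulrDl mul1r lerD2r.
Qed.

Let err_ge0 k u : 0 <= err k u.
Proof. by apply: Rintegral_ge0. Qed.

(** Mollification is bounded on L^1 uniformly in k, so the functions on which it converges form a
    closed set. *)
Let err_closed u : L1 u -> (forall e : R, 0 < e -> exists v,
    [/\ L1 v, err ^~ v @ \oo --> 0 & \int[mu]_x `|u x - v x| <= e]) ->
  err ^~ u @ \oo --> 0.
Proof.
move=> iu H; apply/cvgr0Pnorm_le => e e0.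
have C1 : 0 < C + 1 by rewrite ltr_wpDl.
have e2 : 0 < e / 2 by rewrite divr_gt0.
have [v [iv cv uv]] := H (e / 2 / (C + 1)) (divr_gt0 e2 C1).
near=> k; rewrite ger0_norm//; apply: le_trans (err_le k iu iv) _.
rewrite [leRHS]splitr; apply: lerD.
  have : `|err k v| <= e / 2 by near: k; have /cvgr0Pnorm_le := cv; apply.
  by rewrite ger0_norm.
by rewrite mulrC -ler_pdivlMr.
Unshelve. all: by end_near. Qed.

(* Such functions are constant on the support of K k (_ - x) for large k. *)
Let right_constant (g : 'rV[R]_n -> R) := forall x : 'rV[R]_n, exists j, forall k (y : 'rV[R]_n), (j <= k)%N ->
  (forall i, 0 <= y ord0 i - x ord0 i <= 2 ^- k) -> g y = g x.

Let err_right_constant g (r : R) : measurable_fun [set: 'rV[R]_n] g ->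
  (forall x, `|g x| <= 1) -> (forall x, ~ cube 0 r x -> g x = 0) ->
  right_constant g -> err ^~ g @ \oo --> 0.
Proof.
move=> mg g1 gr rg.
pose Q := cube (0 : 'rV[R]_n) (r + 1).
have mQ : measurable Q by exact: measurable_cube.
have Qoo : (mu Q < +oo)%E by exact: leb_compact_lty (@compact_cube _ _ _ _).
apply: (@dominated_cvg0_Rintegral _ _ _ mu setT _ (fun x => 2 * \1_Q x)) => //.
- move=> k; apply: measurableT_comp => //; apply: measurable_funB => //.
  exact: measurable_conv.
- move=> x _; have [j hj] := rg x; apply/cvgr0Pnorm_le => e e0; near=> k.
  suff -> : conv g (K k) x = g x by rewrite subrr !normr0 ltW.
  have [iK EK] := iKs k x.
  rewrite -[RHS]mulr1 -EK -RintegralZl//; apply: eq_Rintegral => y _.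
  have [yx|/existsNP[i /negP yi]] := pselect (forall i, 0 <= y ord0 i - x ord0 i <= 2 ^- k).
    by rewrite (hj k)//; near: k; exists j.
  by have [_ k0 _ _] := hK k; rewrite (k0 _ i) ?mulr0// !mxE.
- by apply: integrableZR => //; exact: integrable_indicR.
- move=> k x _; rewrite normr_id.
  have [iK EK] := iKs k x.
  have [Qx|Qx] := pselect (Q x).
    rewrite indicE mem_set// mulr1; apply: le_trans (ler_normB _ _) _.
    apply: (@le_trans _ _ (1 + 1)) => //; apply: lerD => //.
    rewrite -EK; apply: le_norm_Rintegral => //.
      by apply: measurable_funM => //; exact: measurable_conv_kernel.
    by move=> y _; rewrite normrM (ger0_norm (K0 _ _)) ler_piMl.
  have k1 : 2 ^- k <= 1 :> R by rewrite invf_le1 ?exprn_gt0// exprn_ege1// ler1n.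
  have -> : g x = 0.
    apply: gr => rx; apply: Qx => i; have := rx i.
    by rewrite !mxE !sub0r !add0r => /andP[h1 h2]; apply/andP; split; lra.
  rewrite subr0 (_ : conv g (K k) x = 0) ?normr0 ?mulr_ge0//.
  rewrite /conv /Rintegral integral0_eq// => y _; congr EFin.
  have [yr|/gr ->] := pselect (cube 0 r y); last by rewrite mul0r.
  have [yx|/existsNP[i /negP yi]] := pselect (forall i, 0 <= (y - x) ord0 i <= 2 ^- k).
    exfalso; apply: Qx => i; have := yr i; have := yx i.
    rewrite !mxE !sub0r !add0r => /andP[h1 h2] /andP[h3 h4].
    move: (2 ^- k : R) k1 h2 => t k1 h2.
    by apply/andP; split; lra.
  by have [_ k0 _ _] := hK k; rewrite (k0 _ i) ?mulr0.
Unshelve. all: by end_near. Qed.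

(** With x, a half-open cell contains a small cube x + [0, 2^-k]^n, because the distance from 2^m
    x_i up to the next integer is positive. *)
Let right_constant_cell m (P : set 'rV[int]_n) :
  right_constant (\1_[set x : 'rV[R]_n | P (cell m x)]).
Proof.
move=> x.
have : \forall k \near \oo, forall i : 'I_n, 2 ^+ m * (2 ^- k : R) <
    (Num.floor (2 ^+ m * x ord0 i) + 1)%:~R - 2 ^+ m * x ord0 i.
  have H := @filter_forall nat 'I_n (fun i k => 2 ^+ m * (2 ^- k : R) <
    (Num.floor (2 ^+ m * x ord0 i) + 1)%:~R - 2 ^+ m * x ord0 i) \oo _.
  apply: H => i; set d := _ - _.
  have d0 : 0 < d by rewrite subr_gt0 floorD1_gt.
  near=> k.
  have : `|2 ^- k| < d / 2 ^+ m :> R.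
    near: k; have /cvgr0Pnorm_lt := @cvg_pow2V R; apply.
    by rewrite divr_gt0// exprn_gt0.
  by rewrite ger0_norm ?(ltW (h0 _))// ltr_pdivlMr ?exprn_gt0// mulrC.
move=> [j _ hj]; exists j => k y jk yx.
suff E : cell m y = cell m x by rewrite !indicE; congr (nat_of_bool _)%:R;
  apply/idP/idP => /set_mem/= H; apply/mem_set => /=; rewrite ?E// -E.
apply/rowP => i; rewrite !mxE; apply: floor_def; have := hj k jk i; have /andP[y0 yk] := yx i.
have m0 : 0 < 2 ^+ m :> R by rewrite exprn_gt0.
have A : 0 <= 2 ^+ m * (y ord0 i - x ord0 i) by rewrite mulr_ge0// ltW.
have B : 2 ^+ m * (y ord0 i - x ord0 i) <= 2 ^+ m * 2 ^- k by rewrite ler_pM2l.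
have F := floor_le (2 ^+ m * x ord0 i).
move: A B F; rewrite mulrBr; move: (2 ^+ m * (2 ^- k : R)) (2 ^+ m * y ord0 i) (2 ^+ m * x ord0 i) => t a b.
by move=> A B F D; apply/andP; split; lra.
Unshelve. all: by end_near. Qed.

(** The box [-N, N)^n, written as a union of unit cells so that its indicator is right constant as
    well. *)
Let dom (N : nat) : set 'rV[R]_n :=
  [set x | [set z | forall i, - N%:Z <= z ord0 i < N%:Z] (cell 0 x)].

Let mdom N : measurable (dom N).
Proof. exact: (@measurable_cell R n 0 [set z | forall i, - N%:Z <= z ord0 i < N%:Z]). Qed.

Let dom_cube N : dom N `<=` cube 0 N%:R.
Proof.
move=> x /= h i; have := h i; rewrite !mxE expr0 mul1r sub0r add0r => /andP[h1 h2].
apply/andP; split.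
  by apply: le_trans (floor_le _); rewrite (_ : - N%:R = (- N%:Z)%:~R) ?mulrNz// -mulrNz ler_int.
apply: ltW; apply: lt_le_trans (floorD1_gt _) _.
by rewrite (_ : N%:R = N%:Z%:~R)// ler_int lezD1.
Qed.

Let cube_dom (r : R) : exists N, cube 0 r `<=` dom N.
Proof.
exists (Num.truncn (`|r|)).+1 => x rx i; have := rx i; rewrite !mxE expr0 mul1r sub0r add0r => /andP[h1 h2].
have rN : `|r| < (Num.truncn `|r|).+1%:R by exact: truncnS_gt.
set N := (Num.truncn _).+1 in rN *.
have r1 := ler_norm r.
apply/andP; split.
  rewrite floor_ge_int mulrNz; apply: le_trans h1; rewrite lerN2.
  exact: le_trans r1 (ltW rN).
rewrite -(ltr_int R); apply: le_lt_trans (floor_le _) _; apply: le_lt_trans h2 _.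
exact: le_lt_trans r1 rN.
Qed.

Let err_indic N A : measurable A -> A `<=` dom N -> err ^~ (\1_A) @ \oo --> 0.
Proof.
move=> mA AN.
have mD : measurable (dom N) := mdom N.
have Doo : (mu (dom N) < +oo)%E.
  apply: le_lt_trans (leb_compact_lty (@compact_cube R n 0 N%:R)).
  by apply: le_measure; rewrite ?inE//; exact: measurable_cube.
have fin B : measurable B -> B `<=` dom N -> L1 (\1_B : 'rV[R]_n -> R).
  move=> mB BD; apply: integrable_indicR => //; apply: le_lt_trans Doo.
  by apply: le_measure; rewrite ?inE.
apply: err_closed; first exact: fin.
move=> e e0.
pose lam : {measure set 'rV[R]_n -> \bar R} := mrestr mu mD.
have lamT : (lam setT < +oo)%E by rewrite /lam /= /mrestr setTI.
have [k [s hs]] := cell_approx lamT mA e0.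
pose E : set 'rV[R]_n := [set x | cell k x \in s] `&` dom N.
have mE : measurable E.
  by apply: measurableI => //; exact: (@measurable_cell R n k [set z | z \in s]).
have ED : E `<=` dom N by move=> x [].
exists (\1_E); split; first exact: fin.
- apply: (@err_right_constant _ N%:R).
  + exact: measurable_indic.
  + by move=> x; rewrite indicE; case: (_ \in _); rewrite ?normr1 ?normr0.
  + by move=> x xN; rewrite indicE memNset// => /ED/dom_cube.
  + rewrite /E => x.
    have [j1 h1] := @right_constant_cell k (fun z => z \in s) x.
    have [j2 h2] := @right_constant_cell 0 (fun z => forall i, - N%:Z <= z ord0 i < N%:Z) x.
    exists (maxn j1 j2) => l y; rewrite geq_max => /andP[l1 l2] yx.
    rewrite !indicI; congr (_ * _); [exact: (h1 l)|exact: (h2 l)].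
- rewrite (_ : \int[mu]_x _ = fine (lam (symdiff A [set x | cell k x \in s]))).
    rewrite -lee_fin fineK; first exact: ltW.
    by rewrite ge0_fin_numE// (lt_trans hs)// ltry.
  have mS : measurable (symdiff A E) by exact: measurable_symdiff.
  rewrite (eq_Rintegral _ _ (g := \1_(symdiff A E))); last first.
    move=> x _; rewrite !indicE; have [Ax|Ax] := pselect (A x); have [Ex|Ex] := pselect (E x).
    - by rewrite (mem_set Ax) (mem_set Ex) memNset ?subrr ?normr0// => -[] [].
    - by rewrite (mem_set Ax) (memNset Ex) mem_set ?subr0 ?normr1//; left.
    - by rewrite (memNset Ax) (mem_set Ex) mem_set ?sub0r ?normrN ?normr1//; right.
    - by rewrite (memNset Ax) (memNset Ex) memNset ?subrr ?normr0// => -[] [].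
  rewrite /Rintegral integral_indic// setIT; congr fine.
  rewrite /lam /= /mrestr; congr (mu _); apply/seteqP; split => x.
    move=> [[Ax nE]|[[Ex Dx] nA]]; last by split => //; right.
    by split; [left; split => // Ex; apply: nE; split => //; exact: AN|exact: AN].
  by move=> [[[Ax nE]|[Ex nA]] Dx]; [left; split => // -[]|right].
Qed.

(** By density. For the indicator of a finite union of cells the mollification is exact at each
    point once k is large; bounded measurable sets are approximated by such unions, and integrable
    functions by simple functions cut off to a box containing the support. *)
Lemma mollification_cvg u (r : R) : L1 u -> (forall x, ~ cube 0 r x -> u x = 0) ->
  (fun k => \int[mu]_x `|conv u (K k) x - u x|) @ \oo --> 0.
Proof.
move=> iu ur; apply: err_closed => // e e0.
have [N rN] := cube_dom r.
have [g [ig _ cg]] := approximation_sfun_integrable measurableT iu.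
have mD : measurable (dom N) := mdom N.
have : \forall m \near \oo, (\int[mu]_x `|(u x)%:E - (g m x)%:E| < e%:E)%E.
  move/fine_cvgP : cg => [fin /cvgr0Pnorm_lt/(_ _ e0)].
  move=> cg1; near=> m => /=.
  have fm : (\int[mu]_x `|(EFin \o u) x - (g m x)%:E|)%E \is a fin_num by near: m.
  rewrite -(fineK fm) lte_fin; apply: le_lt_trans (ler_norm _) _.
  by near: m.
move=> [m _ /(_ m (leqnn m)) hm].
pose v x := g m x * \1_(dom N) x.
have iv : L1 v.
  apply: (@le_integrableR _ _ _ mu _ _ (fun x => `|g m x|)) => //.
  - by apply: measurable_funM => //; exact: measurable_indic.
  - exact: integrable_norm (ig m).
  - by move=> x _; rewrite normrM indicE ler_piMr//; case: (_ \in _); rewrite ?normr1 ?normr0.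
exists v; split => //.
- pose s : seq R := finmap.enum_fset (fset_set (range (g m))).
  pose A (y : R) := (g m @^-1` [set y]) `&` dom N.
  have vE x : v x = \sum_(y <- s) y * \1_(A y) x.
    rewrite /v {1}(fimfunE (g m)) fsbig_finite//= mulr_suml; apply: eq_bigr => y _.
    by rewrite /A indicI mulrA.
  have mA y : measurable (A y) by apply: measurableI => //; exact: measurable_sfunP.
  have iA y : L1 (\1_(A y) : 'rV[R]_n -> R).
    apply: integrable_indicR => //.
    apply: le_lt_trans (leb_compact_lty (@compact_cube R n 0 N%:R)).
    apply: le_measure; rewrite ?inE//; first exact: measurable_cube.
    by move=> x [_ /dom_cube].
  have le k : err k v <= \sum_(y <- s) `|y| * err k (\1_(A y)).
    apply: (@le_trans _ _ (\int[mu]_x (\sum_(y <- s) `|y| * `|conv (\1_(A y)) (K k) x - \1_(A y) x|))).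
      apply: le_Rintegral => //; first exact: ierr.
        by apply: integrable_sumR => // y; apply: integrableZR => //; exact: ierr.
      move=> x _; rewrite vE (_ : conv v (K k) x = conv (fun y => \sum_(t <- s) t * \1_(A t) y) (K k) x).
        rewrite (@conv_sum R n _ s id (fun y => \1_(A y)) _ _ x iA (mK k) (Kb k)) -sumrB.
        apply: le_trans (ler_norm_sum _ _ _) _; apply: ler_sum => y _.
        by rewrite -mulrBr normrM.
      by congr (conv _ _ _); apply/funext.
    rewrite Rintegral_sum//; last by move=> y; apply: integrableZR => //; exact: ierr.
    by apply: ler_sum => y _; rewrite RintegralZl//; exact: ierr.
  apply: (@squeeze_cvgr _ _ _ _ (fun=> 0) (fun k => \sum_(y <- s) `|y| * err k (\1_(A y)))).
  + by apply: nearW => k; rewrite err_ge0 le.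
  + exact: cvg_cst.
  + rewrite [X in _ --> X](_ : _ = \sum_(y <- s) `|y| * 0); last first.
      by rewrite big1// => y _; rewrite mulr0.
    apply: cvgn_sum => y; apply: cvgM; first exact: cvg_cst.
    by apply: (@err_indic N) => // x [].
- apply: (@le_trans _ _ (\int[mu]_x `|u x - g m x|)).
    apply: le_Rintegral => //.
    + exact: integrable_norm (integrableBR measurableT iu iv).
    + exact: integrable_norm (integrableBR measurableT iu (ig m)).
    + move=> x _; rewrite /v indicE; case: (boolP (x \in dom N)) => [_|]; first by rewrite mulr1.
      by rewrite notin_setE => xN; rewrite mulr0 ur ?subrr ?normr0// => /rN.
  rewrite -lee_fin -RintegralE//; last exact: integrable_norm (integrableBR measurableT iu (ig m)).
  exact: ltW.
Unshelve. all: by end_near. Qed.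

End mollification.

(** * Compensated compactness *)

Section test_functions.
Context (R : realType) (n : nat).
Notation mu := (leb R n).
Notation "'L1' u" := (mu.-integrable [set: 'rV[R]_n] (EFin \o u)) (at level 10).
Implicit Types (U K : set 'rV[R]_n) (f phi : 'rV[R]_n -> R).

(** The existence of a radius is a local property, and it passes to finite unions by taking the
    minimum of the radii. *)
Lemma compact_thickening U K : open U -> compact K -> K `<=` U ->
  exists (r : R) K', [/\ 0 < r, compact K', K' `<=` U & forall x, K x -> cube x r `<=` K'].
Proof.
move=> oU cK KU.
pose good A := exists (r : R) K',
  [/\ 0 < r, compact K', K' `<=` U & forall x : 'rV[R]_n, A x -> cube x r `<=` K'].
have good0 : good set0 by exists 1, set0; split => //; exact: compact0.
have [B [Bgood _ Bcov]] : exists B : nat -> set 'rV[R]_n, [/\ forall m, open (B m) /\ good (B m),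
    U `<=` \bigcup_m B m &
    forall K, compact K -> K `<=` U -> exists N, K `<=` \bigcup_(m in `I_N) B m].
  apply: good_cover => //.
    move=> A A' AA' [r [K' [r0 cK' K'U h]]]; exists r, K'; split => // x /AA'; exact: h.
  move=> x Ux; have [e e0 eU] := open_compact_nbhs oU Ux.
  exists (e / 2); first by rewrite divr_gt0.
  exists (e / 2), (cube x e); split; [by rewrite divr_gt0|exact: compact_cube|by []|].
  move=> y /ball_cube/cubeP xy z /cubeP yz; apply/cubeP => i.
  rewrite (_ : x ord0 i - _ = (x ord0 i - y ord0 i) + (y ord0 i - z ord0 i)); last by ring.
  by apply: le_trans (ler_normD _ _) _; rewrite [leRHS]splitr lerD.
have [N KN] := Bcov K cK KU.
suff [r [K' [r0 cK' K'U h]]] : good (\bigcup_(m in `I_N) B m).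
  by exists r, K'; split => // x /KN; exact: h.
elim: N {KN} => [|N [r [K' [r0 cK' K'U h]]]]; first by rewrite II0 bigcup_set0.
have [_ [r1 [K1 [r10 cK1 K1U h1]]]] := Bgood N.
exists (Num.min r r1), (K' `|` K1); split.
- by rewrite lt_min r0.
- exact: compactU.
- by move=> x [/K'U|/K1U].
- move=> x [m /= mN Bm] y /cubeP xy.
  move: mN; rewrite ltnS leq_eqVlt => /orP[/eqP mN|mN].
    right; apply: (h1 x); first by rewrite -mN.
    by apply/cubeP => i; apply: le_trans (xy i) _; rewrite ge_min lexx orbT.
  left; apply: (h x); first by exists m.
  by apply/cubeP => i; apply: le_trans (xy i) _; rewrite ge_min lexx.
Qed.

Lemma compact_sub_cube K : compact K -> exists r : R, K `<=` cube 0 r.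
Proof.
move=> /compact_bounded[M [_ hM]]; exists (M + 2) => x Kx; apply/cubeP => i.
have xM : `|x| <= M + 1 by apply: hM Kx; rewrite ltrDl.
apply: ltW; apply: (@ball_rVP R n 0 (M + 2) x i).
rewrite -ball_normE /ball_ /= sub0r normrN; apply: le_lt_trans xM _; lra.
Qed.

Lemma partial_outside K f i x : compact K -> (forall y, ~ K y -> f y = 0) ->
  ~ K x -> partial i f x = 0.
Proof.
move=> cK f0 Kx; rewrite /partial (@near_eq_derive _ _ _ f (fun=> 0)) ?derive_cst//.
have : nbhs x (~` K).
  apply: open_nbhs_nbhs; split => //; apply: closed_openC.
  by apply: compact_closed => //; exact: norm_hausdorff.
by apply: filterS => y /f0.
Qed.

Lemma continuous_compact_bound K f : compact K -> continuous f ->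
  (forall y, ~ K y -> f y = 0) -> exists2 C : R, 0 <= C & forall x, `|f x| <= C.
Proof.
move=> cK cf f0; have [K0|/set0P K0] := eqVneq K set0.
  by exists 0 => // x; rewrite f0 ?normr0// K0.
have [|c _ hc] := @compact_EVT_max _ R (fun x => `|f x|) K K0 cK.
  by apply: continuous_subspaceT => x; apply: continuous_comp; [exact: cf|exact: norm_continuous].
exists `|f c| => // x; have [Kx|/f0 ->] := pselect (K x); last by rewrite normr0.
by apply: hc; rewrite inE.
Qed.

Lemma test_function_bound U phi : test_function U phi -> exists (K : set 'rV[R]_n) (C : R),
  [/\ compact K, K `<=` U, forall x, ~ K x -> phi x = 0, 0 <= C &
      forall i, quotient_cvg i phi (partial i phi) C /\ forall x, ~ K x -> partial i phi x = 0].
Proof.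
move=> [sphi [K [cK KU phi0]]].
have p0 i x : ~ K x -> partial i phi x = 0 by exact: partial_outside.
have [C0 C00 hC0] : exists2 C : R, 0 <= C & forall x, `|phi x| <= C.
  by apply: (continuous_compact_bound cK) => // x; exact: (smooth_continuous sphi).
have ex i : exists C : R, 0 <= C /\ forall x, `|partial i phi x| <= C.
  have [C c0 hC] : exists2 C : R, 0 <= C & forall x, `|partial i phi x| <= C.
    apply: (continuous_compact_bound cK); last exact: p0.
    by move=> x; exact: (smooth_continuous (smooth_partial i sphi)).
  by exists C.
move: ex => /choice[Ci hCi].
pose C := C0 + \sum_i Ci i.
have Ci0 i : 0 <= Ci i by have [] := hCi i.
exists K, C; split => //; first by rewrite addr_ge0// sumr_ge0.
have CiC i : Ci i <= C.
  by rewrite /C (bigD1 i)//= addrCA lerDl addr_ge0// sumr_ge0.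
move=> i; split; last exact: p0.
split.
- by apply: continuous_measurable_rV => x; exact: (smooth_continuous sphi).
- by move=> x; apply: le_trans (hC0 x) _; rewrite lerDl sumr_ge0.
- move=> x s; apply: smooth_lipschitz => // y.
  by apply: le_trans (CiC i); have [_] := hCi i.
- move=> x; exact: (@cvg_quotient R n phi (delta_mx ord0 i) x (smooth_diff sphi I)).
Qed.

Lemma partial_shift f x i y : partial i (fun y => f (y - x)) y = partial i f (y - x).
Proof.
rewrite /partial /derive.
rewrite (_ : (fun h : R => h^-1 *: (((fun y => f (y - x)) \o shift y) (h *: delta_mx ord0 i) - _)) =
  (fun h : R => h^-1 *: ((f \o shift (y - x)) (h *: delta_mx ord0 i) - f (y - x))))//.
by apply/funext => h /=; rewrite addrA.
Qed.

Lemma smooth_shift f x : smooth_on setT f -> smooth_on setT (fun y => f (y - x)).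
Proof.
move=> sf s y _.
have -> : foldr (@partial R n) (fun y => f (y - x)) s = fun y => foldr (@partial R n) f s (y - x).
  by elim: s => //= i s ->; apply/funext => z; exact: partial_shift.
apply: (@differentiable_comp _ _ _ _ (fun y : 'rV[R]_n => y - x) (foldr (@partial R n) f s)).
  by apply: differentiableB => //; exact: differentiable_id.
exact: sf.
Qed.

Lemma kernel_test U K (h c : R) kap (r : R) x : compact K -> K `<=` U ->
  cube x r `<=` K -> h <= r -> kernel h c kap ->
  test_function U (fun y => kap (y - x)) /\ forall y, ~ K y -> kap (y - x) = 0.
Proof.
move=> cK KU xK hr [sk k0 _ _].
have kK y : ~ K y -> kap (y - x) = 0.
  move=> Ky; have : ~ (forall i, 0 <= (y - x) ord0 i <= h).
    move=> H; apply: Ky; apply: xK; apply/cubeP => i; have := H i.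
    rewrite !mxE => /andP[h1 h2]; rewrite ler_norml; apply/andP; split; lra.
  by move/existsNP => [i /negP /k0].
by split => //; split; [exact: smooth_shift|exists K].
Qed.

End test_functions.

Section sums_of_quotients.
Context (R : realType) (n : nat).
Notation mu := (leb R n).
Notation "'L1' u" := (mu.-integrable [set: 'rV[R]_n] (EFin \o u)) (at level 10).
Implicit Types (F G dF dG : 'rV[R]_n -> R) (x : 'rV[R]_n).

Lemma quotient_cvgD i F dF (C : R) G dG (D : R) : quotient_cvg i F dF C -> quotient_cvg i G dG D ->
  quotient_cvg i (fun x => F x + G x) (fun x => dF x + dG x) (C + D).
Proof.
move=> [mF F1 F2 F3] [mG G1 G2 G3]; split.
- exact: measurable_funD.
- by move=> x; apply: le_trans (ler_normD _ _) _; exact: lerD.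
- move=> x s; rewrite opprD addrACA mulrDl; apply: le_trans (ler_normD _ _) _.
  by apply: lerD; [exact: F2|exact: G2].
- move=> x; apply: (eq_cvgn _ (erefl _) (cvgD (F3 x) (G3 x))) => j.
  by rewrite opprD addrACA mulrDr.
Qed.

Lemma quotient_cvg_sum (J : Type) (s : seq J) i (F dF : J -> 'rV[R]_n -> R) :
  (forall j, exists C : R, quotient_cvg i (F j) (dF j) C) ->
  exists C : R, quotient_cvg i (fun x => \sum_(j <- s) F j x) (fun x => \sum_(j <- s) dF j x) C.
Proof.
move=> H; elim: s => [|j s [C IH]].
  exists 0; split.
  - by under eq_fun do rewrite big_nil; exact: measurable_cst.
  - by move=> x; rewrite big_nil normr0.
  - by move=> x t; rewrite !big_nil subrr normr0 mul0r.
  - move=> x; rewrite big_nil; apply: (eq_cvgn _ (erefl _) (cvg_cst _)) => l.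
    by rewrite !big_nil subrr mulr0.
have [M HM] := H j; exists (M + C).
have := quotient_cvgD HM IH.
by congr (quotient_cvg _ _ _ _); apply/funext => x; rewrite big_cons.
Qed.

Lemma conv_kernel_sum (J : Type) (s : seq J) u (kap : J -> 'rV[R]_n -> R) (c : J -> R) x :
  L1 u -> (forall j, measurable_fun [set: 'rV[R]_n] (kap j)) ->
  (forall j z, `|kap j z| <= c j) ->
  conv u (fun z => \sum_(j <- s) kap j z) x = \sum_(j <- s) conv u (kap j) x.
Proof.
move=> iu mk kc; rewrite -Rintegral_sum//; last first.
  by move=> j; apply: (integrable_conv x iu (mk j)) => z; exact: kc.
by apply: eq_Rintegral => y _; rewrite mulr_sumr.
Qed.

Lemma conv_kernelB u (kap kap' : 'rV[R]_n -> R) (c c' : R) x :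
  L1 u -> measurable_fun [set: 'rV[R]_n] kap -> measurable_fun [set: 'rV[R]_n] kap' ->
  (forall z, `|kap z| <= c) -> (forall z, `|kap' z| <= c') ->
  conv u (fun z => kap z - kap' z) x = conv u kap x - conv u kap' x.
Proof.
move=> iu mk mk' kc kc'; rewrite -RintegralB//.
- by apply: eq_Rintegral => y _; rewrite mulrBr.
- exact: integrable_conv kc.
- exact: integrable_conv kc'.
Qed.

End sums_of_quotients.

(** * Change of a mollified wedge product from one scale to the next *)

Section wedge_of_mollified_forms.
Context (R : realType) (n : nat).
Notation mu := (leb R n).
Notation "'L1' u" := (mu.-integrable [set: 'rV[R]_n] (EFin \o u)) (at level 10).
Implicit Types (u v f kap : 'rV[R]_n -> R) (h c r : R).

Lemma integrable_bounded_support f c r : measurable_fun [set: 'rV[R]_n] f ->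
  (forall x, `|f x| <= c) -> (forall x, ~ cube 0 r x -> f x = 0) -> L1 f.
Proof.
move=> mf fc fr; have mQ := @measurable_cube R n 0 r.
have Qoo := leb_compact_lty (@compact_cube R n 0 r).
apply: (@le_integrableR _ _ _ mu _ f (fun x => c * \1_(cube 0 r) x)) => //.
  by apply: integrableZR => //; exact: integrable_indicR.
move=> x _; have [Qx|Qx] := pselect (cube 0 r x); first by rewrite indicE mem_set// mulr1.
by rewrite fr// normr0 indicE memNset// mulr0.
Qed.

(** u and v are common majorants of all components and of all exterior derivatives. The estimates
    see the forms only through them, and in the end only through the integrals of u, u^p and v. *)
Definition form_le u v (a : 'I_n -> 'rV[R]_n -> R) (al : 'I_n -> 'I_n -> 'rV[R]_n -> R) :=
  [/\ forall i, L1 (a i), forall i m, L1 (al i m), forall i x, `|a i x| <= u x &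
      forall i m x, `|al i m x| <= v x].

(* On D, al is the exterior derivative of the 1-form a, tested against kernels of
   width h. *)
Definition curl_on (D : set 'rV[R]_n) h (a : 'I_n -> 'rV[R]_n -> R)
    (al : 'I_n -> 'I_n -> 'rV[R]_n -> R) :=
  forall x kap c i m, D x -> kernel h c kap ->
    conv (a i) (partial m kap) x - conv (a m) (partial i kap) x = conv (al i m) kap x.

Definition wedge (phi : 'rV[R]_n -> R) i m (a eta : 'I_n -> 'rV[R]_n -> R) kap kap' :=
  \int[mu]_x (phi x * (conv (a i) kap x * conv (eta m) kap' x -
                       conv (a m) kap x * conv (eta i) kap' x)).

Variables (p : R) (C : R) (K : nat -> 'rV[R]_n -> R) (sig : nat -> 'I_n -> 'rV[R]_n -> R).
Hypotheses (p2 : 2 < p) (C0 : 0 <= C).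
Hypothesis hK : forall k, [/\ kernel (2 ^- k) C (K k), kernel (2 ^- k) C (K k.+1) &
   forall m, kernel (2 ^- k) (C * 2 ^- k) (sig k m)].
Hypothesis dK : forall k z, K k.+1 z - K k z = \sum_m partial m (sig k m) z.
Variables (phi : 'rV[R]_n -> R) (D : set 'rV[R]_n) (Phi r : R).
Hypotheses (phi_q : forall i, quotient_cvg i phi (partial i phi) Phi).
Hypotheses (phi0 : forall x, ~ D x -> phi x = 0)
  (dphi0 : forall i x, ~ D x -> partial i phi x = 0) (Dr : D `<=` cube 0 r) (Phi0 : 0 <= Phi).
Variables u v : 'rV[R]_n -> R.
Hypotheses (iu : L1 u) (iv : L1 v) (iup : L1 (fun x => u x `^ p)).
Hypotheses (u0 : forall x, 0 <= u x) (v0 : forall x, 0 <= v x).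

Let hp k : 0 < 2 ^- k :> R. Proof. by rewrite invr_gt0 exprn_gt0. Qed.

(** With A, V and B the averages of u, v and u^p at the scale h = 2^-k, the first two terms bound
    the integral of min (h V, A) A, split at the level L, and the last one that of h A^2, split at
    the level 1. The factors 2^p come from A^p <= 2^p B. *)
Definition wedge_bound k L : R := Phi * C ^+ 2 * (4 + 4 * n%:R) *
  (L * 2 ^- k * \int[mu]_x v x + 2 * L `^ (2 - p) * (2 `^ p * \int[mu]_x u x `^ p) +
   2 ^- k * (\int[mu]_x u x + 2 * (2 `^ p * \int[mu]_x u x `^ p))).

Let wedge_integrable a al eta bet h c kap h' c' kap' i m : kernel h c kap -> kernel h' c' kap' ->
  0 < h -> 0 < h' ->
  form_le u v a al -> form_le u v eta bet ->
  L1 (fun x => phi x * (conv (a i) kap x * conv (eta m) kap' x -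
                       conv (a m) kap x * conv (eta i) kap' x)).
Proof.
move=> hk hk' h0 h0' [ia _ _ _] [ie _ _ _].
pose Ma i := c * h^-1 ^+ n * \int[mu]_y `|a i y|.
pose Me i := c' * h'^-1 ^+ n * \int[mu]_y `|eta i y|.
have ha j x : `|conv (a j) kap x| <= Ma j by exact: conv_kernel_bound.
have he j x : `|conv (eta j) kap' x| <= Me j by exact: conv_kernel_bound.
have mphi : measurable_fun [set: 'rV[R]_n] phi by have [] := phi_q i.
have bphi x : `|phi x| <= Phi by have [_ + _ _] := phi_q i; exact.
have mca j : measurable_fun [set: 'rV[R]_n] (conv (a j) kap).
  by apply: measurable_conv; [exact: integrable_measurableR|exact: kernel_measurable hk].
have mce j : measurable_fun [set: 'rV[R]_n] (conv (eta j) kap').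
  by apply: measurable_conv; [exact: integrable_measurableR|exact: kernel_measurable hk'].
apply: (@integrable_bounded_support _ (Phi * (Ma i * Me m + Ma m * Me i)) r).
- apply: measurable_funM => //; apply: measurable_funB; exact: measurable_funM.
- move=> x; rewrite normrM; apply: ler_pM => //; apply: le_trans (ler_normB _ _) _.
  by rewrite !normrM; apply: lerD; apply: ler_pM.
- by move=> x xr; rewrite phi0 ?mul0r// => /Dr.
Qed.

Let sum_bound (F : 'I_n -> R) (c : R) : (forall m, `|F m| <= c) -> `|\sum_m F m| <= n%:R * c.
Proof.
move=> h; apply: le_trans (ler_norm_sum _ _ _) _.
apply: (@le_trans _ _ (\sum_(m < n) c)); first exact: ler_sum.
by rewrite sumr_const card_ord mulr_natl.
Qed.

(** The product rule behind a half step. The components of a change by - d_i f + t_i, where Fi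
    stands for d_i f. The subtracted terms are d_i (phi f eta_m) and d_m (phi f eta_i); what remains
    contains no derivative of f, and derivatives of eta only in the combination ci - cm. *)
Let alg (ph dpi dpm a1 a0 b1 b0 Fi Fm ti tm em ei f ci cm : R) :
  a1 - a0 = - Fi + ti -> b1 - b0 = - Fm + tm ->
  ph * (a1 * em - b1 * ei) - ph * (a0 * em - b0 * ei) =
  ph * (ti * em - tm * ei) + f * (dpi * em - dpm * ei) + ph * (f * (ci - cm)) -
  ((dpi * f + ph * Fi) * em + ph * f * (- cm) - ((dpm * f + ph * Fm) * ei + ph * f * (- ci))).
Proof. by move=> /eqP; rewrite subr_eq => /eqP -> /eqP; rewrite subr_eq => /eqP ->; ring. Qed.

Let alg0 (a1 a0 b1 b0 Fi Fm ti tm em ei f c ci cm : R) :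
  0 * (a1 * em - b1 * ei) - 0 * (a0 * em - b0 * ei) =
  0 * (ti * em - tm * ei) + f * (0 * em - 0 * ei) + 0 * (f * c) -
  ((0 * f + 0 * Fi) * em + 0 * f * cm - ((0 * f + 0 * Fm) * ei + 0 * f * ci)).
Proof. by ring. Qed.

Let int_difference_le (W1 W0 Z g1 g2 g : 'rV[R]_n -> R) :
  L1 W1 -> L1 W0 -> L1 g1 /\ \int[mu]_x g1 x = 0 -> L1 g2 /\ \int[mu]_x g2 x = 0 ->
  (forall x, W1 x - W0 x = Z x - (g1 x - g2 x)) -> L1 g -> (forall x, `|Z x| <= g x) ->
  `|\int[mu]_x W1 x - \int[mu]_x W0 x| <= \int[mu]_x g x.
Proof.
move=> i1 i0 [ig1 E1] [ig2 E2] E ig Zg.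
have iZ : L1 Z.
  have := integrableDR measurableT (integrableBR measurableT i1 i0) (integrableBR measurableT ig1 ig2).
  by congr (mu.-integrable _ (EFin \o _)); apply/funext => x; rewrite E subrK.
rewrite -(RintegralB measurableT i1 i0); under eq_Rintegral do rewrite E.
rewrite (RintegralB measurableT iZ (integrableBR measurableT ig1 ig2)).
rewrite (RintegralB measurableT ig1 ig2) E1 E2 !subr0.
apply: le_norm_Rintegral ig _ => //; exact: integrable_measurableR.
Qed.

(* Up to the exact derivatives dG, the difference of the integrands is Z, in which
   every term carries a factor th or f: these are O(h V) because K k.+1 - K k is
   the divergence of sig k, and O(A), with A and V the averages of u and v at
   scale h. The product min (h V, A) * A is split at the level L of A. *)
Let wedge_half_step k kap' a al eta bet i m (L : R) : 0 < L -> kernel (2 ^- k) C kap' ->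
  form_le u v a al -> form_le u v eta bet ->
  curl_on D (2 ^- k) a al -> curl_on D (2 ^- k) eta bet ->
  `|wedge phi i m a eta (K k.+1) kap' - wedge phi i m a eta (K k) kap'| <= wedge_bound k L.
Proof.
move=> L0 hk' fa fe ca ce.
have [ia ial au alv] := fa; have [ie ibe eu bev] := fe.
have [hk hk1 hs] := hK k.
set h : R := 2 ^- k; have h0 : 0 < h := hp k.
have hh : h * h^-1 = 1 by rewrite divff// gt_eqF.
pose A := conv u (avg h); pose V := conv v (avg h).
have A0 x : 0 <= A x by exact: conv_avg_ge0.
have V0 x : 0 <= V x by exact: conv_avg_ge0.
have [iA EA] := conv_avg_integral h0 iu u0.
have [iV EV] := conv_avg_integral h0 iv v0.
have up0 x : 0 <= u x `^ p by exact: powR_ge0.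
have [iB EB] := conv_avg_integral h0 iup up0.
set B := conv (fun x => u x `^ p) (avg h) in iB EB.
have p1 : 1 <= p by apply: ltW; apply: lt_trans p2; rewrite ltr1n.
have AB x : A x `^ p <= 2 `^ p * B x by exact: conv_avg_powR.
(* The increment of the mollified a_j is the sum over j' of its convolutions with d_j' of
   [sig k j']. The curl relation exchanges j and j' and turns this sum into - d_j f plus the
   convolutions [th] of al with sig. *)
pose f x := \sum_j conv (a j) (sig k j) x.
pose F j x := \sum_j' - conv (a j') (partial j (sig k j')) x.
pose th j x := \sum_j' conv (al j j') (sig k j') x.
pose e j x := conv (eta j) kap' x.
pose de j' j x := - conv (eta j) (partial j' kap') x.
have mk z := kernel_measurable hk.
have dA j x : D x -> conv (a j) (K k.+1) x - conv (a j) (K k) x = - F j x + th j x.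
  move=> Dx; have [_ _ b1 _] := hk1; have [_ _ b0 _] := hk.
  rewrite -(conv_kernelB x (ia j) (kernel_measurable hk1) (kernel_measurable hk) b1 b0).
  rewrite (_ : (fun z => _) = (fun z => \sum_j' partial j' (sig k j') z)); last first.
    by apply/funext => z; exact: dK.
  rewrite (@conv_kernel_sum _ _ _ _ (a j) (fun j' => partial j' (sig k j'))
    (fun=> C * h * h^-1 * h^-1 ^+ n) x (ia j)); last 2 first.
  - by move=> j'; exact: kernel_partial_measurable (hs j').
  - by move=> j' z; have [_ _ _ +] := hs j'; exact.
  rewrite /F /th -sumrN -big_split/=; apply: eq_bigr => j' _; rewrite opprK.
  by rewrite -(ca _ _ _ _ _ Dx (hs j')) addrC subrK.
have hF j x : `|F j x| <= n%:R * (C * A x).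
  apply: sum_bound => j'; rewrite normrN.
  apply: le_trans (conv_partial_le _ _ h0 (hs j') (ia j') iu (au j')) _.
  by rewrite -[C * h * h^-1]mulrA hh mulr1.
have hf x : `|f x| <= n%:R * (C * h * A x).
  by apply: sum_bound => j'; exact: (conv_kernel_le x h0 (hs j') (ia j') iu (au j')).
have hth j x : `|th j x| <= n%:R * (C * h * V x).
  by apply: sum_bound => j'; exact: (conv_kernel_le x h0 (hs j') (ial j j') iv (alv j j')).
(* A second bound for [th], without gain but in terms of A alone: [th] is the increment of the
   mollified a plus F, and both are O(A). *)
have hth' j x : D x -> `|th j x| <= (2 + n%:R) * (C * A x).
  move=> Dx; have -> : th j x = (conv (a j) (K k.+1) x - conv (a j) (K k) x) + F j x.
    by rewrite dA//; ring.
  apply: le_trans (ler_normD _ _) _; rewrite mulrDl; apply: lerD; last exact: hF.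
  apply: le_trans (ler_normB _ _) _.
  rewrite (_ : 2 * _ = C * A x + C * A x); last by ring.
  apply: lerD; [exact: (conv_kernel_le x h0 hk1 (ia j) iu (au j))|
                exact: (conv_kernel_le x h0 hk (ia j) iu (au j))].
have he j x : `|e j x| <= C * A x.
  exact: (conv_kernel_le x h0 hk' (ie j) iu (eu j)).
have hb x : `|conv (bet i m) kap' x| <= C * V x.
  exact: (conv_kernel_le x h0 hk' (ibe i m) iv (bev i m)).
(* Likewise, the curl relation bounds the mollified exterior derivative of eta by A / h, and the
   factor h contained in f compensates 1 / h. *)
have hb' x : D x -> `|conv (bet i m) kap' x| <= 2 * (C * h^-1 * A x).
  move=> Dx; rewrite -(ce _ _ _ _ _ Dx hk'); apply: le_trans (ler_normB _ _) _.
  rewrite (_ : 2 * _ = C * h^-1 * A x + C * h^-1 * A x); last by ring.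
  apply: lerD; [exact: (conv_partial_le m x h0 hk' (ie i) iu (eu i))|
                exact: (conv_partial_le i x h0 hk' (ie m) iu (eu m))].
pose Z x := phi x * (th i x * e m x - th m x * e i x) +
  f x * (partial i phi x * e m x - partial m phi x * e i x) +
  phi x * (f x * conv (bet i m) kap' x).
pose G j' x := phi x * f x * e j' x.
pose dG j j' x := (partial j phi x * f x + phi x * F j x) * e j' x + phi x * f x * de j j' x.
have qf j : exists M, quotient_cvg j f (F j) M.
  apply: quotient_cvg_sum => j'; eexists.
  by apply: (conv_quotient_cvg j h0 _ (hs j') (ia j')); rewrite mulr_ge0// ltW.
have qG j j' : exists M, quotient_cvg j (G j') (dG j j') M.
  have [M qfM] := qf j.
  have q1 := quotient_cvgM (phi_q j) qfM.
  have q2 := conv_quotient_cvg j h0 C0 hk' (ie j').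
  by have := quotient_cvgM q1 q2; eexists; eassumption.
have iG j j' : L1 (dG j j') /\ \int[mu]_x dG j j' x = 0.
  have [M qGM] := qG j j'; split.
    apply: (@integrable_bounded_support _ M r).
    - exact: quotient_cvg_measurable qGM.
    - by move=> x; exact: quotient_cvg_le qGM.
    - move=> x xr; have Dx : ~ D x by move=> /Dr.
      by rewrite /dG phi0// dphi0// !(mul0r, addr0).
  apply: (quotient_cvg_int0 qGM (r := r)) => x xr.
  by rewrite /G phi0 ?mul0r// => /Dr.
have E x : phi x * (conv (a i) (K k.+1) x * conv (eta m) kap' x -
             conv (a m) (K k.+1) x * conv (eta i) kap' x) -
           phi x * (conv (a i) (K k) x * conv (eta m) kap' x -
             conv (a m) (K k) x * conv (eta i) kap' x) = Z x - (dG i m x - dG m i x).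
  have [Dx|Dx] := pselect (D x); last first.
    rewrite /Z /dG phi0// !dphi0//; exact: alg0.
  rewrite /Z /dG -(ce _ _ _ _ _ Dx hk') /de; apply: alg; exact: dA.
(* Both bounds together: [th] and h times the mollified exterior derivative of eta are O(X). *)
pose X x := Num.min (h * V x) (A x).
have X0 x : 0 <= X x by rewrite le_min A0 mulr_ge0// ltW.
pose g x := L * h * V x + 2 * L `^ (2 - p) * (2 `^ p * B x) + h * (A x + 2 * (2 `^ p * B x)).
have ig : L1 g.
  have i1 : L1 (fun x => 2 `^ p * B x) by exact: integrableZR.
  by apply: integrableDR => //; [apply: integrableDR => //; exact: integrableZR|
    apply: integrableZR => //; apply: integrableDR => //; exact: integrableZR].
have XV x : X x <= h * V x by rewrite ge_min lexx.
have XA x : X x <= A x by rewrite ge_min lexx orbT.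
have bphi x : `|phi x| <= Phi by have [_ + _ _] := phi_q i; exact.
have bdphi j x : `|partial j phi x| <= Phi by exact: quotient_cvg_le (phi_q j).
have N0 : 0 <= n%:R :> R by [].
have Z0 x : D x -> `|Z x| <= Phi * C ^+ 2 * (4 + 4 * n%:R) * (X x * A x + h * (A x * A x)).
  move=> Dx; have tX j : `|th j x| <= (2 + n%:R) * C * X x.
    have c0 : 0 <= (2 + n%:R) * C by rewrite mulr_ge0// addr_ge0.
    rewrite /X minr_pMr// le_min; apply/andP; split; last by rewrite -mulrA; exact: hth'.
    apply: le_trans (hth j x) _.
    rewrite (_ : (2 + n%:R) * C * _ = 2 * (C * h * V x) + n%:R * (C * h * V x)); last by ring.
    by rewrite lerDr !mulr_ge0// ltW.
  have fb : `|f x * conv (bet i m) kap' x| <= 2 * n%:R * C ^+ 2 * (X x * A x).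
    rewrite normrM (_ : 2 * _ * _ * _ = 2 * n%:R * C ^+ 2 * A x * X x); last by ring.
    have c0 : 0 <= 2 * n%:R * C ^+ 2 * A x by rewrite !mulr_ge0// exprn_ge0.
    rewrite /X minr_pMr// le_min; apply/andP; split.
      apply: le_trans (ler_pM (normr_ge0 _) (normr_ge0 _) (hf x) (hb x)) _.
      rewrite (_ : 2 * n%:R * _ * _ * _ = n%:R * (C * h * A x) * (C * V x) + n%:R * (C * h * A x) * (C * V x)); last by ring.
      by rewrite lerDl !mulr_ge0// ltW.
    apply: le_trans (ler_pM (normr_ge0 _) (normr_ge0 _) (hf x) (hb' x Dx)) _.
    rewrite (_ : n%:R * _ * _ = 2 * n%:R * C ^+ 2 * A x * A x * (h * h^-1)); last by ring.
    by rewrite hh mulr1.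
  have XA0 : 0 <= X x * A x by rewrite mulr_ge0.
  have AA0 : 0 <= h * (A x * A x) by rewrite !mulr_ge0// ltW.
  apply: (@le_trans _ _ (Phi * (2 * ((2 + n%:R) * C * X x * (C * A x))) +
     n%:R * (C * h * A x) * (2 * (Phi * (C * A x))) + Phi * (2 * n%:R * C ^+ 2 * (X x * A x)))).
    rewrite /Z; apply: le_trans (ler_normD _ _) _; apply: lerD; last first.
      by rewrite normrM; apply: ler_pM.
    apply: le_trans (ler_normD _ _) _; rewrite !(mulr_natl _ 2) !mulr2n; apply: lerD.
      rewrite normrM; apply: ler_pM => //; apply: le_trans (ler_normB _ _) _.
      by apply: lerD; rewrite normrM; apply: ler_pM.
    rewrite normrM; apply: ler_pM => //; apply: le_trans (ler_normB _ _) _.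
    by apply: lerD; rewrite normrM; apply: ler_pM.
  (* The terms in X A add up exactly to 2 (2 + n) + 2 n = 4 + 4 n; the term in h A^2 only has the
     coefficient 2 n. *)
  rewrite -subr_ge0 (_ : _ - _ = Phi * C ^+ 2 * (4 + 2 * n%:R) * (h * (A x * A x))); last by ring.
  by rewrite !mulr_ge0 ?exprn_ge0// ?addr_ge0 ?mulr_ge0// ltW.
have Zg x : `|Z x| <= Phi * C ^+ 2 * (4 + 4 * n%:R) * g x.
  have E0 : 0 <= Phi * C ^+ 2 * (4 + 4 * n%:R).
    by rewrite !mulr_ge0// ?exprn_ge0// addr_ge0// mulr_ge0.
  have B0 : 0 <= B x by exact: conv_avg_ge0.
  have [Dx|Dx] := pselect (D x); last first.
    rewrite /Z phi0// !dphi0// !(mul0r, mulr0, subrr, addr0) normr0 mulr_ge0//.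
    by rewrite /g !addr_ge0// !mulr_ge0// ?powR_ge0 ?addr_ge0 ?mulr_ge0 ?powR_ge0// ltW.
  apply: le_trans (Z0 x Dx) _; rewrite ler_wpM2l// /g; apply: lerD.
    apply: le_trans (le_mul_split (ltW p2) L0 (X0 x) (A0 x)) _; apply: lerD.
      by rewrite -mulrA ler_wpM2l// ltW.
    rewrite [2 * _]mulrC -mulrA ler_wpM2l ?powR_ge0// (_ : 2 * _ = 2 `^ p * B x + 2 `^ p * B x); last by ring.
    apply: lerD => //; apply: le_trans (AB x).
    by rewrite ge0_ler_powR ?nnegrE//; apply: le_trans p1.
  rewrite ler_wpM2l ?(ltW h0)//.
  apply: le_trans (le_mul_split (ltW p2) ltr01 (A0 x) (A0 x)) _.
  rewrite mul1r powR1 mul1r lerD2l (_ : 2 * _ = 2 `^ p * B x + 2 `^ p * B x); last by ring.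
  by apply: lerD.
have Eg : Phi * C ^+ 2 * (4 + 4 * n%:R) * \int[mu]_x g x = wedge_bound k L.
  have i1 : L1 (fun x => 2 `^ p * B x) by exact: integrableZR.
  have i2 : L1 (fun x => L * h * V x) by exact: integrableZR.
  have i3 : L1 (fun x => 2 * L `^ (2 - p) * (2 `^ p * B x)) by exact: integrableZR.
  have i4 : L1 (fun x => 2 * (2 `^ p * B x)) by exact: integrableZR.
  have i5 : L1 (fun x => A x + 2 * (2 `^ p * B x)) by exact: integrableDR.
  congr (_ * _); rewrite RintegralD//; [|exact: integrableDR|exact: integrableZR].
  congr (_ + _).
    rewrite RintegralD//; congr (_ + _); first by rewrite RintegralZl// EV.
    by rewrite RintegralZl// RintegralZl// EB.
  rewrite RintegralZl//; congr (_ * _); rewrite RintegralD// EA; congr (_ + _).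
  by rewrite RintegralZl// RintegralZl// EB.
have iW k' : kernel h C (K k') -> L1 (fun x => phi x * (conv (a i) (K k') x * conv (eta m) kap' x -
                       conv (a m) (K k') x * conv (eta i) kap' x)).
  by move=> hk''; exact: (wedge_integrable i m hk'' hk' h0 h0 fa fe).
have igE : L1 (fun x => Phi * C ^+ 2 * (4 + 4 * n%:R) * g x) by exact: integrableZR.
rewrite -Eg -(RintegralZl _ measurableT ig).
exact: (int_difference_le (iW _ hk1) (iW _ hk) (iG i m) (iG m i) E igE Zg).
Qed.

(** By antisymmetry, the half step, which changes the kernel of the first form, also serves for that
    of the second. *)
Let wedge_swap a al eta bet k k' i m : form_le u v a al -> form_le u v eta bet ->
  wedge phi i m a eta (K k) (K k') = - wedge phi i m eta a (K k') (K k).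
Proof.
move=> fa fe; have [hk _ _] := hK k; have [hk' _ _] := hK k'.
rewrite -mulN1r /wedge -RintegralZl//; last first.
  exact: (wedge_integrable i m hk' hk (hp _) (hp _) fe fa).
by apply: eq_Rintegral => x _; ring.
Qed.

Lemma wedge_step k a al eta bet i m (L : R) : 0 < L ->
  form_le u v a al -> form_le u v eta bet ->
  curl_on D (2 ^- k) a al -> curl_on D (2 ^- k) eta bet ->
  `|wedge phi i m a eta (K k.+1) (K k.+1) - wedge phi i m a eta (K k) (K k)| <=
  2 * wedge_bound k L.
Proof.
move=> L0 fa fe ca ce; have [hk hk1 _] := hK k.
have h1 := wedge_half_step i m L0 hk1 fa fe ca ce.
have h2 := wedge_half_step i m L0 hk fe fa ce ca.
rewrite -(subrKA (wedge phi i m a eta (K k) (K k.+1))).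
apply: le_trans (ler_normD _ _) _; rewrite (mulr_natl _ 2) mulr2n; apply: (lerD h1).
by rewrite (wedge_swap _ _ i m fa fe) [X in _ - X](wedge_swap _ _ i m fa fe) -opprD normrN.
Qed.

End wedge_of_mollified_forms.

(** * Convergence of products of mollified functions *)

Section mollified_products.
Context (R : realType) (n : nat).
Notation mu := (leb R n).
Notation "'L1' u" := (mu.-integrable [set: 'rV[R]_n] (EFin \o u)) (at level 10).
Variables (p : R) (C : R) (K : nat -> 'rV[R]_n -> R).
Hypotheses (p2 : 2 < p) (C0 : 0 <= C) (hK : forall k, kernel (2 ^- k) C (K k)).
Hypotheses (K0 : forall k z, 0 <= K k z) (K1 : forall k, (\int[mu]_z (K k z)%:E = 1)%E).
Variables (phi u : 'rV[R]_n -> R) (Phi r : R).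
Hypotheses (mphi : measurable_fun [set: 'rV[R]_n] phi) (bphi : forall x, `|phi x| <= Phi).
Hypotheses (iu : L1 u) (iup : L1 (fun x => u x `^ p)) (u0 : forall x, 0 <= u x).

(** Convergence of the mollifications in L^1 does not control products directly. By [le_mul_split],
    the difference is at most l times the L^1 errors plus l^(2 - p) times a bounded integral of p-th
    powers: fix l large, then let k go to infinity. *)
Lemma mollified_product_cvg f g : L1 f -> L1 g ->
  (forall x, `|f x| <= u x) -> (forall x, `|g x| <= u x) ->
  (forall x, ~ cube 0 r x -> f x = 0) -> (forall x, ~ cube 0 r x -> g x = 0) ->
  (fun k => \int[mu]_x (phi x * (conv f (K k) x * conv g (K k) x))) @ \oo -->
  \int[mu]_x (phi x * (f x * g x)).
Proof.
move=> if_ ig fu gu fr gr.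
have p1 : 1 <= p by apply: ltW; apply: lt_trans p2; rewrite ltr1n.
have p0 : 0 < p by exact: lt_le_trans p1.
have Phi0 : 0 <= Phi by apply: le_trans (bphi 0).
have h0 k : 0 < 2 ^- k :> R by rewrite invr_gt0 exprn_gt0.
(* A common majorant of f, g, their mollifications and the differences, bounded in L^p uniformly in
   k. *)
pose w k x := C * conv u (avg (2 ^- k)) x + u x.
pose err k f := \int[mu]_x `|conv f (K k) x - f x|.
pose U := \int[mu]_x u x `^ p.
have U0 : 0 <= U by apply: Rintegral_ge0 => x _; exact: powR_ge0.
pose M := 2 `^ p * (C `^ p * (2 `^ p * U) + U).
have M0 : 0 <= M by rewrite mulr_ge0 ?powR_ge0// addr_ge0// !mulr_ge0// powR_ge0.
have iA k := conv_avg_integral (h0 k) iu u0.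
have iB k := conv_avg_integral (h0 k) iup (fun x => powR_ge0 (u x) p).
have A0 k x : 0 <= conv u (avg (2 ^- k)) x by exact: conv_avg_ge0.
have w0 k x : 0 <= w k x by rewrite addr_ge0// mulr_ge0.
have wp k x : w k x `^ p <=
    2 `^ p * (C `^ p * (2 `^ p * conv (fun x => u x `^ p) (avg (2 ^- k)) x) + u x `^ p).
  apply: le_trans (powR_addle p1 (mulr_ge0 C0 (A0 k x)) (u0 x)) _.
  rewrite ler_wpM2l ?powR_ge0// lerD2r powRM// ler_wpM2l ?powR_ge0//.
  exact: conv_avg_powR.
have mw k : measurable_fun [set: 'rV[R]_n] (w k).
  apply: measurable_funD; last exact: integrable_measurableR.
  by apply: measurable_funM; [exact: measurable_cst|exact: integrable_measurableR (iA k).1].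
have iwp k : L1 (fun x => w k x `^ p) /\ \int[mu]_x w k x `^ p <= M.
  pose G x := 2 `^ p * (C `^ p * (2 `^ p * conv (fun x => u x `^ p) (avg (2 ^- k)) x) + u x `^ p).
  have i1 : L1 (conv (fun x => u x `^ p) (avg (2 ^- k))) := (iB k).1.
  have i2 : L1 (fun x => 2 `^ p * conv (fun x => u x `^ p) (avg (2 ^- k)) x) by exact: integrableZR.
  have i3 : L1 (fun x => C `^ p * (2 `^ p * conv (fun x => u x `^ p) (avg (2 ^- k)) x)) by exact: integrableZR.
  have i4 : L1 (fun x => C `^ p * (2 `^ p * conv (fun x => u x `^ p) (avg (2 ^- k)) x) + u x `^ p).
    exact: integrableDR.
  have iG : L1 G by exact: integrableZR.
  have iw : L1 (fun x => w k x `^ p).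
    apply: (@le_integrableR _ _ _ mu _ _ G) => //.
      exact: (measurableT_comp (measurable_powR p)).
    by move=> x _; rewrite ger0_norm ?powR_ge0.
  split => //; apply: (@le_trans _ _ (\int[mu]_x G x)); first exact: le_Rintegral.
  rewrite (RintegralZl _ measurableT i4) (RintegralD measurableT i3 iup).
  by rewrite (RintegralZl _ measurableT i2) (RintegralZl _ measurableT i1) (iB k).2.
have fw k f' x : L1 f' -> (forall x, `|f' x| <= u x) -> `|conv f' (K k) x| <= w k x.
  move=> if' fu'; apply: le_trans (conv_kernel_le x (h0 k) (hK k) if' iu fu') _.
  by rewrite lerDl.
have fw' k f' x : L1 f' -> (forall x, `|f' x| <= u x) -> `|conv f' (K k) x - f' x| <= w k x.
  move=> if' fu'; apply: le_trans (ler_normB _ _) _; apply: lerD => //.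
  exact: (conv_kernel_le x (h0 k) (hK k) if' iu fu').
have ierr k f' : L1 f' -> L1 (fun x => `|conv f' (K k) x - f' x|).
  move=> if'; have [ic _] := conv_mollifier_integrable hK k if'.
  exact: integrable_norm (integrableBR measurableT ic if').
have key k (l : R) : 0 < l ->
    `|\int[mu]_x (phi x * (conv f (K k) x * conv g (K k) x)) - \int[mu]_x (phi x * (f x * g x))| <=
    Phi * (l * err k f + l * err k g + 4 * l `^ (2 - p) * M).
  move=> l0; have [iw lw] := iwp k.
  have iwk : L1 (w k) by apply: integrableDR => //; apply: integrableZR => //; exact: (iA k).1.
  have uw x : u x <= w k x by rewrite lerDr mulr_ge0.
  have mf := integrable_measurableR if_; have mg := integrable_measurableR ig.
  have mcf : measurable_fun [set: 'rV[R]_n] (conv f (K k)).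
    by apply: measurable_conv => //; exact: kernel_measurable (hK k).
  have mcg : measurable_fun [set: 'rV[R]_n] (conv g (K k)).
    by apply: measurable_conv => //; exact: kernel_measurable (hK k).
  have iw2 : L1 (fun x => 2 * w k x `^ p) by exact: integrableZR.
  have idom : L1 (fun x => Phi * (w k x + 2 * w k x `^ p)).
    by apply: integrableZR => //; exact: integrableDR.
  have prod (f' g' : R) x : `|f'| <= w k x -> `|g'| <= w k x -> `|f' * g'| <= w k x + 2 * w k x `^ p.
    move=> h1 h2; rewrite normrM; apply: (@le_trans _ _ (w k x * w k x)); first exact: ler_pM.
    apply: le_trans (le_mul_split (ltW p2) ltr01 (w0 k x) (w0 k x)) _.
    by rewrite mul1r powR1 mul1r mulr_natl mulr2n.
  have i1 : L1 (fun x => phi x * (conv f (K k) x * conv g (K k) x)).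
    apply: (le_integrableR _ _ idom) => //.
      by apply: measurable_funM => //; exact: measurable_funM.
    by move=> x _; rewrite normrM; apply: ler_pM => //; apply: prod; exact: fw.
  have i0 : L1 (fun x => phi x * (f x * g x)).
    apply: (le_integrableR _ _ idom) => //.
      by apply: measurable_funM => //; exact: measurable_funM.
    move=> x _; rewrite normrM; apply: ler_pM => //; apply: prod.
      exact: le_trans (fu x) (uw x).
    exact: le_trans (gu x) (uw x).
  rewrite -(RintegralB measurableT i1 i0).
  have split2 (a b : R) x : 0 <= a -> 0 <= b -> a <= w k x -> b <= w k x ->
      a * b <= l * a + 2 * l `^ (2 - p) * w k x `^ p.
    move=> a0 b0 aw bw; apply: le_trans (le_mul_split (ltW p2) l0 a0 b0) _.
    rewrite lerD2l [2 * _]mulrC -mulrA ler_wpM2l ?powR_ge0// mulr_natl mulr2n.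
    by apply: lerD; rewrite ge0_ler_powR ?nnegrE ?(ltW p0).
  pose G x := Phi * (l * `|conv f (K k) x - f x| + l * `|conv g (K k) x - g x| +
     4 * l `^ (2 - p) * w k x `^ p).
  have j1 : L1 (fun x => l * `|conv f (K k) x - f x|) by apply: integrableZR => //; exact: ierr.
  have j2 : L1 (fun x => l * `|conv g (K k) x - g x|) by apply: integrableZR => //; exact: ierr.
  have j3 : L1 (fun x => 4 * l `^ (2 - p) * w k x `^ p) by exact: integrableZR.
  have j4 : L1 (fun x => l * `|conv f (K k) x - f x| + l * `|conv g (K k) x - g x|) by exact: integrableDR.
  have j5 := integrableDR measurableT j4 j3.
  have jG : L1 G by exact: integrableZR.
  apply: (@le_trans _ _ (\int[mu]_x G x)).
    apply: le_norm_Rintegral jG _ => //.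
      exact: integrable_measurableR (integrableBR measurableT i1 i0).
    move=> x _; rewrite -mulrBr normrM; apply: ler_pM => //.
    rewrite (_ : _ - _ = (conv f (K k) x - f x) * conv g (K k) x + f x * (conv g (K k) x - g x)); last by ring.
    apply: le_trans (ler_normD _ _) _; rewrite !normrM [`|f x| * _]mulrC.
    apply: le_trans (lerD (split2 _ _ x (normr_ge0 _) (normr_ge0 _) (fw' k f x if_ fu) (fw k g x ig gu))
      (split2 _ _ x (normr_ge0 _) (normr_ge0 _) (fw' k g x ig gu) (le_trans (fu x) (uw x)))) _.
    by rewrite le_eqVlt; apply/orP; left; apply/eqP; ring.
  rewrite (RintegralZl _ measurableT j5) ler_wpM2l//.
  rewrite (RintegralD measurableT j4 j3) (RintegralD measurableT j1 j2).
  rewrite (RintegralZl _ measurableT (ierr k _ if_)) (RintegralZl _ measurableT (ierr k _ ig)).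
  rewrite lerD2l (RintegralZl _ measurableT iw) ler_wpM2l// mulr_ge0//; exact: powR_ge0.
apply/cvgrPdist_le => e e0.
(* The value wanted for l^(2 - p), making the term 4 Phi M l^(2 - p) at most e / 2. *)
pose t := e / 2 / (4 * Phi * M + 1).
have d0 : 0 < 4 * Phi * M + 1 by rewrite ltr_wpDl// (mulr_ge0 (mulr_ge0 _ Phi0) M0).
have t0 : 0 < t by rewrite !divr_gt0.
pose l := t `^ (2 - p)^-1.
have l0 : 0 < l by exact: powR_gt0.
have lE : l `^ (2 - p) = t.
  by rewrite /l -powRrM mulVf ?powRr1 ?(ltW t0)// lt_eqF// subr_lt0.
have cf := mollification_cvg C0 hK K0 K1 if_ fr.
have cg := mollification_cvg C0 hK K0 K1 ig gr.
have s0 : 0 < e / 4 / (Phi * l + 1) by rewrite !divr_gt0// ltr_wpDl// mulr_ge0// ltW.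
near=> k; rewrite distrC; apply: le_trans (key k l l0) _.
have e1 : err k f <= e / 4 / (Phi * l + 1).
  apply: le_trans (ler_norm _) _; near: k; have /cvgr0Pnorm_le := cf; exact.
have e2 : err k g <= e / 4 / (Phi * l + 1).
  apply: le_trans (ler_norm _) _; near: k; have /cvgr0Pnorm_le := cg; exact.
have small x : 0 <= x -> x <= e / 4 / (Phi * l + 1) -> Phi * l * x <= e / 4.
  move=> x0; rewrite ler_pdivlMr ?ltr_wpDl ?mulr_ge0// ?(ltW l0)// => h.
  by apply: le_trans h; rewrite mulrC mulrDr mulr1 lerDl.
have err0 f' : 0 <= err k f' by apply: Rintegral_ge0.
rewrite lE (_ : Phi * _ = Phi * l * err k f + Phi * l * err k g + 4 * Phi * M * t); last by ring.
have h1 := small _ (err0 _) e1; have h2 := small _ (err0 _) e2.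
have h3 : 4 * Phi * M * t <= e / 2.
  rewrite /t mulrA ler_pdivrMr//; rewrite mulrC ler_wpM2l ?divr_ge0 ?(ltW e0)//.
  by rewrite lerDl.
apply: le_trans (lerD (lerD h1 h2) h3) _; lra.
Unshelve. all: by end_near. Qed.

End mollified_products.

(** Interchange of the limits in k and j. The increments in k decay geometrically and uniformly in
    j, so that B k j is close to P j for all j once k is large; convergence in j then enters at one
    fixed k. *)
Lemma cvg_uniform_geometric (R : realType) (B : nat -> nat -> R) (B0 P : nat -> R)
    (P0 D rho : R) k0 : 0 <= rho < 1 ->
  (forall j k, (k0 <= k)%N -> `|B k.+1 j - B k j| <= D * rho ^+ k) ->
  (forall j, B ^~ j @ \oo --> P j) -> B0 @ \oo --> P0 ->
  (forall k, B k @ \oo --> B0 k) -> P @ \oo --> P0.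
Proof.
move=> /andP[r0 r1] step BP BP0 BB0.
have r1' : 0 < 1 - rho by rewrite subr_gt0.
have D0 : 0 <= D * rho ^+ k0 by apply: le_trans (step 0%N k0 (leqnn _)).
have tail j k l : (k0 <= k)%N -> `|B (k + l)%N j - B k j| <= D * rho ^+ k * (1 - rho ^+ l) / (1 - rho).
  move=> kk; elim: l => [|l IH]; first by rewrite addn0 subrr normr0 expr0 subrr mulr0 mul0r.
  rewrite addnS -(subrKA (B (k + l)%N j)); apply: le_trans (ler_normD _ _) _.
  apply: le_trans (lerD (step j _ (leq_trans kk (leq_addr _ _))) IH) _.
  rewrite le_eqVlt; apply/orP; left; apply/eqP.
  rewrite exprD exprS; field; rewrite gt_eqF//.
have tailP j k : (k0 <= k)%N -> `|P j - B k j| <= D * rho ^+ k / (1 - rho).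
  move=> kk; have c : (fun l => `|B (k + l)%N j - B k j|) @ \oo --> `|P j - B k j|.
    apply: cvg_norm; apply: cvgB; last exact: cvg_cst.
    have := BP j; rewrite -(cvg_shiftn k); apply: eq_cvgn => // l.
    by rewrite addnC.
  apply: (cvgr_to_le c); apply: nearW => l; apply: le_trans (tail _ _ _ kk) _.
  rewrite ler_wpM2r ?invr_ge0 ?(ltW r1')// ler_piMr//.
    have := le_trans (normr_ge0 _) (step j k kk); exact.
  by rewrite gerBl exprn_ge0.
have cD : (fun k => D * rho ^+ k / (1 - rho)) @ \oo --> (0 : R).
  rewrite [X in _ --> X](_ : 0 = D * 0 / (1 - rho)); last by rewrite mulr0 mul0r.
  apply: cvgM; last exact: cvg_cst.
  by apply: cvgM; [exact: cvg_cst|apply: cvg_expr; rewrite ger0_norm].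
apply/cvgrPdist_le => e e0; have e3 : 0 < e / 3 by rewrite divr_gt0.
have [k [kk hk1 hk2]] : exists k, [/\ (k0 <= k)%N, D * rho ^+ k / (1 - rho) <= e / 3 & `|P0 - B0 k| <= e / 3].
  have : \forall k \near \oo, [/\ (k0 <= k)%N, D * rho ^+ k / (1 - rho) <= e / 3 & `|P0 - B0 k| <= e / 3].
    near=> k; split.
    - by near: k; exists k0.
    - by apply: le_trans (ler_norm _) _; near: k; have /cvgr0Pnorm_le := cD; exact.
    - by near: k; have /cvgrPdist_le := BP0; exact.
  by move=> [k _ /(_ k (leqnn k)) h]; exists k.
near=> j.
have h3 : `|B0 k - B k j| <= e / 3 by near: j; have /cvgrPdist_le := BB0 k; exact.
rewrite (_ : P0 - P j = (P0 - B0 k) + (B0 k - B k j) - (P j - B k j)); last by ring.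
apply: le_trans (ler_normB _ _) _.
have h4 := le_trans (tailP j k kk) hk1.
have h5 := le_trans (ler_normD (P0 - B0 k) (B0 k - B k j)) (lerD hk2 h3).
apply: le_trans (lerD h5 h4) _; lra.
Unshelve. all: by end_near. Qed.

(** * The Cartan system on an open subset of R^n *)

Section cartan_on_open_set.
Context (R : realType) (n N : nat).
Notation mu := (leb R n).
Notation "'L1' u" := (mu.-integrable [set: 'rV[R]_n] (EFin \o u)) (at level 10).
Implicit Types (w : 'rV[R]_n -> 'I_n -> 'M[R]_N) (U K : set 'rV[R]_n).

Definition cartan_on U w := forall (i m : 'I_n) (a b : 'I_N) phi, test_function U phi ->
  \int[mu]_(x in U) (w x i a b * partial m phi x - w x m a b * partial i phi x) =
  \int[mu]_(x in U) ((w x i *m w x m - w x m *m w x i) a b * phi x).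

Lemma Rintegral_support U K (f : 'rV[R]_n -> R) : K `<=` U -> (forall x, ~ K x -> f x = 0) ->
  \int[mu]_(x in U) f x = \int[mu]_x f x.
Proof.
move=> KU f0; rewrite Rintegral_mkcond; apply: eq_Rintegral => x _.
by rewrite patchE; case: ifPn => //; rewrite notin_setE => xU; rewrite f0// => /KU.
Qed.

Lemma bounded_integrable_powR K (f : 'rV[R]_n -> R) (q c : R) : compact K ->
  measurable_fun [set: 'rV[R]_n] f -> (forall x, `|f x| <= c) -> 0 <= q ->
  (\int[mu]_(x in K) (`|f x| `^ q)%:E < +oo)%E.
Proof.
move=> cK mf fc q0; have mK := compact_measurable_rV cK.
have Koo := leb_compact_lty cK.
have c0 : 0 <= c by apply: le_trans (fc 0).
apply: (@le_lt_trans _ _ (\int[mu]_(x in K) (c `^ q)%:E)%E).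
  apply: ge0_le_integral => //.
  - apply/measurable_EFinP; apply: (measurableT_comp (measurable_powR q)).
    by apply: measurableT_comp => //; exact: measurable_funTS.
  - by move=> x _; rewrite lee_fin ge0_ler_powR ?nnegrE.
by rewrite integral_cst//= lte_mul_pinfty// lee_fin powR_ge0.
Qed.

Section truncation.
Variables (p : R) (U K : set 'rV[R]_n).
Hypotheses (p2 : 2 < p) (oU : open U) (cK : compact K) (KU : K `<=` U).

Definition trunc w (a b : 'I_N) (i : 'I_n) x : R := w x i a b * \1_K x.

(** The l^p norm over all components: a single majorant for them, whose p-th power integrates to the
    sum of the integrals of their p-th powers. *)
Definition envelope w x : R := (\sum_q `|trunc w q.1.1 q.1.2 q.2 x| `^ p) `^ p^-1.

(** Not the exterior derivative of the truncated form, which may have a singular part on the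
    boundary of K, but the truncation of the wedge product. Under the system the two agree when
    tested against kernels supported in K. *)
Definition trunc_curl w a b (i m : 'I_n) x : R :=
  \sum_c (trunc w a c i x * trunc w c b m x - trunc w a c m x * trunc w c b i x).

Let mK : measurable K := compact_measurable_rV cK.
Let Koo : (mu K < +oo)%E := leb_compact_lty cK.
Let p0 : 0 < p. Proof. by rewrite (lt_trans _ p2). Qed.
Let p1 : 1 <= p. Proof. by apply: ltW; apply: lt_trans p2; rewrite ltr1n. Qed.

Section one_form.
Variable w : 'rV[R]_n -> 'I_n -> 'M[R]_N.
Hypothesis wLp : forall i a b, Lp_loc p U (fun x => w x i a b).

Let t := trunc w.
Let u := envelope w.

Let tE a b i : t a b i = (fun x => w x i a b) \_ K.
Proof.
apply/funext => x; rewrite /t /trunc patchE indicE; case: ifP => _; first by rewrite mulr1.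
by rewrite mulr0.
Qed.

Let mt a b i : measurable_fun [set: 'rV[R]_n] (t a b i).
Proof.
rewrite tE; apply: (measurable_restrictT _ mK).1.
by have [mw _] := wLp i a b; exact: measurable_funS (open_measurable_rV oU) KU mw.
Qed.

Let itp a b i : L1 (fun x => `|t a b i x| `^ p) /\
  \int[mu]_x `|t a b i x| `^ p = \int[mu]_(x in K) `|w x i a b| `^ p.
Proof.
have [mw hw] := wLp i a b; have := hw K cK KU.
have E : (fun x => `|t a b i x| `^ p) = (fun x => `|w x i a b| `^ p) \_ K.
  apply/funext => x; rewrite tE !patchE; case: ifP => // _.
  by rewrite normr0 powR0 ?gt_eqF.
have mwK : measurable_fun K (fun x => w x i a b).
  exact: measurable_funS (open_measurable_rV oU) KU mw.
move=> fin; split; last by rewrite E [RHS]Rintegral_mkcond.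
have := integrable_powR mK mwK fin => /(integrable_mkcond _ mK).
congr (mu.-integrable _ _); apply/funext => x; rewrite patchE /= tE patchE.
by case: ifP => // _; rewrite normr0 powR0 ?gt_eqF.
Qed.

Lemma envelope_ge0 x : 0 <= u x. Proof. exact: powR_ge0. Qed.

Let upE x : u x `^ p = \sum_q `|t q.1.1 q.1.2 q.2 x| `^ p.
Proof.
by rewrite /u /envelope -powRrM mulVf ?gt_eqF// powRr1// sumr_ge0// => q _.
Qed.

Lemma trunc_le a b i x : `|t a b i x| <= u x.
Proof.
have : `|t a b i x| `^ p <= u x `^ p.
  by rewrite upE (bigD1 (a, b, i))//= lerDl sumr_ge0// => q _.
rewrite leNgt => H; rewrite leNgt; apply/negP => ut; move/negP: H; apply.
by apply: gt0_ltr_powR => //; rewrite nnegrE// envelope_ge0.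
Qed.

Lemma envelope_powR_integrable : L1 (fun x => u x `^ p) /\
  \int[mu]_x u x `^ p = \sum_(q : 'I_N * 'I_N * 'I_n) \int[mu]_(x in K) `|w x q.2 q.1.1 q.1.2| `^ p.
Proof.
have E : (fun x => u x `^ p) = (fun x => \sum_q `|t q.1.1 q.1.2 q.2 x| `^ p).
  by apply/funext => x; exact: upE.
split.
  by rewrite E; apply: integrable_sumR => // q; have [] := itp q.1.1 q.1.2 q.2.
rewrite E (Rintegral_sum _ measurableT (fun q => (itp q.1.1 q.1.2 q.2).1)).
by apply: eq_bigr => q _; have [_] := itp q.1.1 q.1.2 q.2.
Qed.

Let mu_ : measurable_fun [set: 'rV[R]_n] u.
Proof.
apply: (measurableT_comp (measurable_powR p^-1)); apply: measurable_sum => q.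
by apply: (measurableT_comp (measurable_powR p)); exact: measurableT_comp.
Qed.

Let u_out x : ~ K x -> u x = 0.
Proof.
move=> xK; rewrite /u /envelope big1 ?powR0 ?invr_eq0 ?gt_eqF// => q _.
by rewrite /trunc indicE memNset// mulr0 normr0 powR0 ?gt_eqF.
Qed.

Lemma envelope_integrable : L1 u /\ \int[mu]_x u x <= fine (mu K) + \int[mu]_x u x `^ p.
Proof.
have [iup _] := envelope_powR_integrable.
have i1 : L1 (fun x => \1_K x + u x `^ p).
  by apply: integrableDR => //; exact: integrable_indicR.
have le x : u x <= \1_K x + u x `^ p.
  have [Kx|xK] := pselect (K x).
    rewrite indicE mem_set//; apply: le_trans (le_powR_split p1 ltr01 (envelope_ge0 x)) _.
    by rewrite powR1 mul1r.
  by rewrite u_out// addr_ge0// powR_ge0.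
have iu : L1 u.
  apply: (le_integrableR _ _ i1) => // x _.
  by rewrite ger0_norm ?envelope_ge0.
split => //; apply: (@le_trans _ _ (\int[mu]_x (\1_K x + u x `^ p))).
  exact: le_Rintegral.
rewrite (RintegralD measurableT (integrable_indicR mK Koo) iup) lerD2r.
by rewrite /Rintegral integral_indic// setIT.
Qed.

Lemma envelope_sq_integrable : L1 (fun x => 2 * N%:R * (u x * u x)) /\
  \int[mu]_x (2 * N%:R * (u x * u x)) <= 2 * N%:R * (\int[mu]_x u x + 2 * \int[mu]_x u x `^ p).
Proof.
have [iup _] := envelope_powR_integrable; have [iu _] := envelope_integrable.
have iup2 : L1 (fun x => 2 * u x `^ p) by exact: integrableZR.
have i1 := integrableDR measurableT iu iup2.
have le x : u x * u x <= u x + 2 * u x `^ p.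
  apply: le_trans (le_mul_split (ltW p2) ltr01 (envelope_ge0 x) (envelope_ge0 x)) _.
  by rewrite mul1r powR1 mul1r mulr_natl mulr2n.
have iuu : L1 (fun x => u x * u x).
  apply: (le_integrableR _ _ i1) => //; first exact: measurable_funM.
  by move=> x _; rewrite ger0_norm ?mulr_ge0 ?envelope_ge0.
split; first exact: integrableZR.
rewrite (RintegralZl _ measurableT iuu) ler_wpM2l//.
rewrite -(RintegralZl _ measurableT iup) -(RintegralD measurableT iu iup2).
exact: le_Rintegral.
Qed.

Lemma trunc_form_le a b :
  form_le u (fun x => 2 * N%:R * (u x * u x)) (t a b) (trunc_curl w a b).
Proof.
have [iu _] := envelope_integrable; have [iv _] := envelope_sq_integrable.
have mc i m : measurable_fun [set: 'rV[R]_n] (trunc_curl w a b i m).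
  apply: measurable_sum => c; apply: measurable_funB; apply: measurable_funM; exact: mt.
have le i m x : `|trunc_curl w a b i m x| <= 2 * N%:R * (u x * u x).
  apply: le_trans (ler_norm_sum _ _ _) _.
  apply: (@le_trans _ _ (\sum_(c < N) 2 * (u x * u x))).
    apply: ler_sum => c _; apply: le_trans (ler_normB _ _) _.
    rewrite (_ : 2 * (u x * u x) = u x * u x + u x * u x); last by ring.
    by apply: lerD; rewrite normrM; apply: ler_pM => //; exact: trunc_le.
  by rewrite sumr_const card_ord -mulr_natr le_eqVlt; apply/orP; left; apply/eqP; ring.
split => //.
- move=> i; apply: (le_integrableR _ _ iu) => // x _; exact: trunc_le.
- by move=> i m; apply: (le_integrableR _ _ iv).
- by move=> i x; exact: trunc_le.
Qed.

(** For x in D the translated kernel is supported in K, so it is an admissible test function for the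
    system and does not see the truncation. *)
Lemma trunc_curl_on (D : set 'rV[R]_n) (r h : R) a b : cartan_on U w ->
  (forall x, D x -> cube x r `<=` K) -> h <= r -> curl_on D h (t a b) (trunc_curl w a b).
Proof.
move=> cw DK hr x kap c i m Dx hk.
have [tk k0] := kernel_test cK KU (DK x Dx) hr hk.
have dk0 j y : ~ K y -> partial j kap (y - x) = 0.
  move=> Ky; rewrite -partial_shift; exact: partial_outside Ky.
have [ia ial _ _] := trunc_form_le a b.
have kb j z : `|partial j kap z| <= c * h^-1 * h^-1 ^+ n by have [_ _ _ +] := hk; exact.
have ic j j' := integrable_conv x (ia j) (kernel_partial_measurable j' hk) (kb j').
rewrite /conv -(RintegralB measurableT (ic i m) (ic m i)).
have := cw i m a b _ tk.
rewrite (Rintegral_support KU); last first.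
  by move=> y Ky; rewrite !partial_shift !dk0// !mulr0 subrr.
rewrite (Rintegral_support KU); last by move=> y Ky; rewrite k0// mulr0.
move=> E; transitivity (\int[mu]_y (w y i a b * partial m (fun y => kap (y - x)) y -
    w y m a b * partial i (fun y => kap (y - x)) y)).
  apply: eq_Rintegral => y _; rewrite !partial_shift /t /trunc.
  have [Ky|Ky] := pselect (K y); first by rewrite indicE mem_set// !mulr1.
  by rewrite !dk0// !mulr0.
rewrite E; apply: eq_Rintegral => y _.
have [Ky|Ky] := pselect (K y); last by rewrite k0// !mulr0.
congr (_ * _); rewrite /trunc_curl !mxE -sumrB; apply: eq_bigr => d _.
by rewrite /trunc indicE mem_set// !mulr1.
Qed.

End one_form.
End truncation.

End cartan_on_open_set.

Section cartan_weak_limit.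
Context (R : realType) (n N : nat).
Notation mu := (leb R n).
Notation "'L1' u" := (mu.-integrable [set: 'rV[R]_n] (EFin \o u)) (at level 10).
Variables (p : R) (U : set 'rV[R]_n).
Variables (w : nat -> 'rV[R]_n -> 'I_n -> 'M[R]_N) (w0 : 'rV[R]_n -> 'I_n -> 'M[R]_N).
Hypotheses (p2 : 2 < p) (oU : open U).
Hypothesis wLp : forall j i a b, Lp_loc p U (fun x => w j x i a b).
Hypothesis w0Lp : forall i a b, Lp_loc p U (fun x => w0 x i a b).
Hypothesis wC : forall K, compact K -> K `<=` U -> exists C : R, forall j i a b,
  (\int[mu]_(x in K) (`|w j x i a b| `^ p)%:E <= C%:E)%E.
Hypothesis wcv : forall i a b, weak_cvg_Lp_loc p U (fun j x => w j x i a b) (fun x => w0 x i a b).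

Section on_a_compact_set.
Variable K1 : set 'rV[R]_n.
Hypotheses (cK1 : compact K1) (K1U : K1 `<=` U).

Let mK1 : measurable K1 := compact_measurable_rV cK1.

Lemma trunc_weak_cvg a b i (psi : 'rV[R]_n -> R) (c : R) :
  measurable_fun [set: 'rV[R]_n] psi -> (forall x, `|psi x| <= c) ->
  (fun j => \int[mu]_x (trunc K1 (w j) a b i x * psi x)) @ \oo -->
  \int[mu]_x (trunc K1 w0 a b i x * psi x).
Proof.
move=> mpsi bpsi.
have q0 : 0 <= p / (p - 1).
  have p0 : 0 < p by rewrite (lt_trans _ p2).
  rewrite divr_ge0 ?(ltW p0)// subr_ge0 ltW//; apply: lt_trans p2; by rewrite ltr1n.
have := @wcv i a b K1 cK1 K1U psi (measurable_funTS mpsi)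
  (bounded_integrable_powR cK1 mpsi bpsi q0).
have E (v : 'rV[R]_n -> 'I_n -> 'M[R]_N) :
    \int[mu]_(x in K1) (v x i a b * psi x) = \int[mu]_x (trunc K1 v a b i x * psi x).
  rewrite Rintegral_mkcond; apply: eq_Rintegral => x _.
  by rewrite patchE /trunc indicE; case: ifP => _; rewrite ?mulr1 ?mulr0 ?mul0r.
by rewrite -E; apply: eq_cvgn => // j; exact: E.
Qed.

Lemma envelope_bounds : exists M : R, forall j, let u := envelope p K1 (w j) in
  [/\ \int[mu]_x u x `^ p <= M, \int[mu]_x u x <= M & \int[mu]_x (2 * N%:R * (u x * u x)) <= M].
Proof.
have [C hC] := wC cK1 K1U.
pose M1 := \sum_(q : 'I_N * 'I_N * 'I_n) C.
pose M2 := fine (mu K1) + M1.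
pose M3 := 2 * N%:R * (M2 + 2 * M1).
exists (Num.max M1 (Num.max M2 M3)) => j u.
have [_ E] := envelope_powR_integrable p2 oU cK1 K1U (wLp j).
have [_ l1] := envelope_integrable p2 oU cK1 K1U (wLp j).
have [_ l2] := envelope_sq_integrable p2 oU cK1 K1U (wLp j).
have h1 : \int[mu]_x u x `^ p <= M1.
  rewrite E; apply: ler_sum => q _; apply: (Lp_le_Rintegral mK1); split => //.
  have [mw _] := wLp j q.2 q.1.1 q.1.2.
  exact: measurable_funS (open_measurable_rV oU) K1U mw.
have h2 : \int[mu]_x u x <= M2 by apply: le_trans l1 _; rewrite lerD2l.
have h3 : \int[mu]_x (2 * N%:R * (u x * u x)) <= M3.
  apply: le_trans l2 _; rewrite ler_wpM2l ?mulr_ge0//; apply: lerD => //.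
  by rewrite ler_wpM2l.
split.
- by apply: le_trans h1 _; rewrite le_max lexx.
- by apply: le_trans h2 _; rewrite !le_max lexx orbT.
- by apply: le_trans h3 _; rewrite !le_max lexx !orbT.
Qed.

Variables (D : set 'rV[R]_n) (phi : 'rV[R]_n -> R) (Phi r r1 : R).
Hypotheses (phi_q : forall i, quotient_cvg i phi (partial i phi) Phi).
Hypotheses (phi0 : forall x, ~ D x -> phi x = 0)
  (dphi0 : forall i x, ~ D x -> partial i phi x = 0) (Dr : D `<=` cube 0 r) (Phi0 : 0 <= Phi).
Hypotheses (r10 : 0 < r1) (DK : forall x, D x -> cube x r1 `<=` K1).
Hypothesis cw : forall j, cartan_on U (w j).

Definition trunc_wedge (v : 'rV[R]_n -> 'I_n -> 'M[R]_N) a b c i m :=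
  \int[mu]_x (phi x * (trunc K1 v a c i x * trunc K1 v c b m x -
                       trunc K1 v a c m x * trunc K1 v c b i x)).

Let phi_mul_integrable (F : 'rV[R]_n -> R) (c : R) (i : 'I_n) : measurable_fun [set: 'rV[R]_n] F ->
  (forall x, `|F x| <= c) -> L1 (fun x => phi x * F x).
Proof.
move=> mF Fc; have [mphi bphi _ _] := phi_q i.
apply: (@integrable_bounded_support _ _ _ (Phi * c) r).
- exact: measurable_funM.
- by move=> x; rewrite normrM ler_pM.
- by move=> x xr; rewrite phi0 ?mul0r// => /Dr.
Qed.

Lemma trunc_mul_integrable (v : 'rV[R]_n -> 'I_n -> 'M[R]_N) a b c d i m :
  (forall i a b, Lp_loc p U (fun x => v x i a b)) ->
  L1 (fun x => phi x * (trunc K1 v a b i x * trunc K1 v c d m x)).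
Proof.
move=> vLp; have [mphi bphi _ _] := phi_q i.
have [it _ tu _] := trunc_form_le p2 oU cK1 K1U vLp a b.
have [it' _ tu' _] := trunc_form_le p2 oU cK1 K1U vLp c d.
have [iu _] := envelope_integrable p2 oU cK1 K1U vLp.
have [iup _] := envelope_powR_integrable p2 oU cK1 K1U vLp.
have iup2 : L1 (fun x => 2 * envelope p K1 v x `^ p) by exact: integrableZR.
have itt : L1 (fun x => trunc K1 v a b i x * trunc K1 v c d m x).
  apply: (le_integrableR _ _ (integrableDR measurableT iu iup2)) => //.
    apply: measurable_funM; exact: integrable_measurableR.
  move=> x _; have u0 := envelope_ge0 p K1 v x; rewrite normrM.
  apply: (@le_trans _ _ (envelope p K1 v x * envelope p K1 v x)); first exact: ler_pM.
  apply: le_trans (le_mul_split (ltW p2) ltr01 u0 u0) _.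
  by rewrite mul1r powR1 mul1r mulr_natl mulr2n.
have := integrable_mul_bounded itt mphi bphi.
by congr (mu.-integrable _ (EFin \o _)); apply/funext => x; rewrite mulrC.
Qed.

(** [B v k] is the wedge product mollified at the scale 2^-k. As k grows it tends to the wedge
    product of v, both for v = w j and for v = w0; at fixed k it converges along j. The rate in
    [step], uniform in j, allows the two limits to be exchanged by [cvg_uniform_geometric]. *)
Lemma trunc_wedge_cvg a b c i m :
  (fun j => trunc_wedge (w j) a b c i m) @ \oo --> trunc_wedge w0 a b c i m.
Proof.
have [C [K [sig [C0 hK K0 iK dK]]]] := mollifier_exists R n.
have hK' k : kernel (2 ^- k) C (K k) by have [] := hK k.
have [r2 K1r] := compact_sub_cube cK1.
have mphi : measurable_fun [set: 'rV[R]_n] phi by have [] := phi_q i.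
have bphi x : `|phi x| <= Phi by have [_ + _ _] := phi_q i; exact.
pose B v k := wedge phi i m (trunc K1 v a c) (trunc K1 v c b) (K k) (K k).
have Lp_facts (v : 'rV[R]_n -> 'I_n -> 'M[R]_N) : (forall i a b, Lp_loc p U (fun x => v x i a b)) ->
    [/\ L1 (envelope p K1 v), L1 (fun x => envelope p K1 v x `^ p),
        forall a b i, L1 (trunc K1 v a b i), forall a b i x, `|trunc K1 v a b i x| <= envelope p K1 v x &
        forall a b i x, ~ cube 0 r2 x -> trunc K1 v a b i x = 0].
  move=> vLp; split.
  - by have [] := envelope_integrable p2 oU cK1 K1U vLp.
  - by have [] := envelope_powR_integrable p2 oU cK1 K1U vLp.
  - by move=> a' b'; have [] := trunc_form_le p2 oU cK1 K1U vLp a' b'.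
  - by move=> a' b'; have [] := trunc_form_le p2 oU cK1 K1U vLp a' b'.
  - move=> a' b' i' x xr; rewrite /trunc indicE memNset ?mulr0// => /K1r; exact: xr.
have Bcv (v : 'rV[R]_n -> 'I_n -> 'M[R]_N) : (forall i a b, Lp_loc p U (fun x => v x i a b)) -> B v @ \oo --> trunc_wedge v a b c i m.
  move=> vLp; have [iu iup it tu tr] := Lp_facts v vLp.
  have u0 x : 0 <= envelope p K1 v x by exact: envelope_ge0.
  have h i' m' := mollified_product_cvg p2 C0 hK' K0 iK mphi bphi iu iup u0
    (it a c i') (it c b m') (tu _ _ i') (tu _ _ m') (tr _ _ i') (tr _ _ m').
  have ic i' m' k : L1 (fun x => phi x * (conv (trunc K1 v a c i') (K k) x *
      conv (trunc K1 v c b m') (K k) x)).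
    pose Mf a b i := C * (2 ^- k)^-1 ^+ n * \int[mu]_y `|trunc K1 v a b i y|.
    have mc a' b' j : measurable_fun [set: 'rV[R]_n] (conv (trunc K1 v a' b' j) (K k)).
      by apply: measurable_conv; [exact: integrable_measurableR|exact: kernel_measurable (hK' k)].
    apply: (@phi_mul_integrable _ (Mf a c i' * Mf c b m') i); first exact: measurable_funM.
    by move=> x; rewrite normrM; apply: ler_pM => //; exact: (conv_kernel_bound x (hK' k)).
  have it0 i' m' : L1 (fun x => phi x * (trunc K1 v a c i' x * trunc K1 v c b m' x)).
    exact: trunc_mul_integrable.
  have E : trunc_wedge v a b c i m = \int[mu]_x (phi x * (trunc K1 v a c i x * trunc K1 v c b m x)) -
      \int[mu]_x (phi x * (trunc K1 v a c m x * trunc K1 v c b i x)).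
    rewrite -(RintegralB measurableT (it0 i m) (it0 m i)); apply: eq_Rintegral => x _; ring.
  apply: (eq_cvgn _ (esym E) (cvgB (h i m) (h m i))) => k.
  rewrite -[LHS](RintegralB measurableT (ic i m k) (ic m i k)); apply: eq_Rintegral => x _; ring.
have [M hM] := envelope_bounds.
(* The mollified component at x is an integral against a fixed bounded function of y, so weak
   convergence gives pointwise convergence; the bound M on the L^1 norms gives a uniform majorant on
   the support of phi. *)
have B0cv k : (fun j => B (w j) k) @ \oo --> B w0 k.
  have mKs x : measurable_fun [set: 'rV[R]_n] (fun y => K k (y - x)).
    by apply: measurable_conv_kernel; exact: kernel_measurable (hK' k).
  have bKs x y : `|K k (y - x)| <= C * (2 ^- k)^-1 ^+ n by have [_ _ + _] := hK' k; exact.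
  have cvt a' b' i' x : (fun j => conv (trunc K1 (w j) a' b' i') (K k) x) @ \oo -->
      conv (trunc K1 w0 a' b' i') (K k) x by exact: trunc_weak_cvg (mKs x) (bKs x).
  pose c1 := C * (2 ^- k)^-1 ^+ n * M.
  have bt a' b' i' j x : `|conv (trunc K1 (w j) a' b' i') (K k) x| <= c1.
    have [iu _ it tu _] := Lp_facts _ (wLp j).
    apply: le_trans (conv_kernel_bound x (hK' k) (it a' b' i')) _.
    apply: ler_wpM2l; first by apply: le_trans (bKs 0 0).
    have [_ l _] := hM j; apply: le_trans l; apply: le_Rintegral => //.
      exact: integrable_norm (it _ _ _).
  have mct (v : 'rV[R]_n -> 'I_n -> 'M[R]_N) a' b' i' : (forall i a b, Lp_loc p U (fun x => v x i a b)) ->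
      measurable_fun [set: 'rV[R]_n] (conv (trunc K1 v a' b' i') (K k)).
    move=> vLp; have [_ _ it _ _] := Lp_facts v vLp.
    by apply: measurable_conv; [exact: integrable_measurableR|exact: kernel_measurable (hK' k)].
  have mW (v : 'rV[R]_n -> 'I_n -> 'M[R]_N) : (forall i a b, Lp_loc p U (fun x => v x i a b)) ->
      measurable_fun [set: 'rV[R]_n]
      (fun x => phi x * (conv (trunc K1 v a c i) (K k) x * conv (trunc K1 v c b m) (K k) x -
        conv (trunc K1 v a c m) (K k) x * conv (trunc K1 v c b i) (K k) x)).
    move=> vLp; apply: measurable_funM => //; apply: measurable_funB; apply: measurable_funM; exact: mct.
  pose Q := cube (0 : 'rV[R]_n) r.
  have mQ : measurable Q by exact: measurable_cube.
  have Qoo : (mu Q < +oo)%E by exact: leb_compact_lty (@compact_cube _ _ _ _).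
  apply: (@dominated_cvg_Rintegral _ _ _ mu setT _ _ (fun x => Phi * (c1 * c1 + c1 * c1) * \1_Q x)) => //.
  - by move=> j; apply: mW; exact: wLp.
  - by apply: mW; exact: w0Lp.
  - move=> x _; apply: cvgM; first exact: cvg_cst.
    by apply: cvgB; apply: cvgM; exact: cvt.
  - by apply: integrableZR => //; exact: integrable_indicR.
  - move=> j x _; have [Qx|Qx] := pselect (Q x); last first.
      by rewrite phi0 ?mul0r ?normr0 ?indicE ?memNset ?mulr0// => /Dr.
    rewrite indicE mem_set// mulr1 normrM; apply: ler_pM => //.
    apply: le_trans (ler_normB _ _) _; rewrite !normrM.
    by apply: lerD; apply: ler_pM => //; exact: bt.
(* The level at scale k is L = ell^k. The choice ell^(p - 1) = 2 balances the terms L 2^-k and L^(2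
   - p) of [wedge_bound], both equal to rho^k; that rho < 1 means ell < 2, that is, p > 2. *)
pose ell : R := 2 `^ (p - 1)^-1.
pose rho : R := ell / 2.
have p1 : 1 < p by apply: lt_trans p2; rewrite ltr1n.
have pm1 : 1 < p - 1 by rewrite ltrBrDr.
have pm0 : p - 1 != 0 by rewrite gt_eqF// (lt_trans ltr01).
have ell1 : 1 <= ell.
  rewrite -(powRr0 2) ler_powR ?ler1n// invr_ge0 ltW// (lt_trans ltr01)//.
have ell0 : 0 < ell by exact: lt_le_trans ell1.
have ell2 : ell < 2.
  rewrite /ell /powR gt_eqF// -[ltRHS]lnK ?posrE// ltr_expR -[ltRHS]mul1r ltr_pM2r ?ln_gt0 ?ltr1n//.
  by rewrite invf_lt1// (lt_trans ltr01).
have rho1 : 0 <= rho < 1.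
  by rewrite divr_ge0 ?(ltW ell0)//= ltr_pdivrMr// mul1r.
have rho_half : 2^-1 <= rho by rewrite /rho -[leLHS]mul1r ler_wpM2r.
have ellp : ell `^ (2 - p) = rho.
  rewrite /ell -powRrM (_ : _ * _ = (p - 1)^-1 + -1); last by field.
  by rewrite powRD ?pnatr_eq0 ?implybT// powR_inv1.
pose E := 2 * (Phi * C ^+ 2 * (4 + 4 * n%:R)) * (M + 2 * (2 `^ p * M) + (M + 2 * (2 `^ p * M))).
(* From k0 on the kernels are no wider than the margin r1 around D within K1, as [trunc_curl_on]
   requires. *)
have [k0 hk0] : exists k0, forall k, (k0 <= k)%N -> 2 ^- k <= r1.
  have /cvgr0Pnorm_le/(_ _ r10)[k0 _ hk] := @cvg_pow2V R.
  by exists k0 => k kk; apply: le_trans (ler_norm _) (hk k kk).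
have step j k : (k0 <= k)%N -> `|B (w j) k.+1 - B (w j) k| <= E * rho ^+ k.
  move=> kk; have [iu iup it tu tr] := Lp_facts _ (wLp j).
  have [iv _] := envelope_sq_integrable p2 oU cK1 K1U (wLp j).
  have u0 x : 0 <= envelope p K1 (w j) x by exact: envelope_ge0.
  have v0 x : 0 <= 2 * N%:R * (envelope p K1 (w j) x * envelope p K1 (w j) x).
    by rewrite !mulr_ge0.
  have fa := trunc_form_le p2 oU cK1 K1U (wLp j) a c.
  have fe := trunc_form_le p2 oU cK1 K1U (wLp j) c b.
  have ca := trunc_curl_on p2 oU cK1 K1U (wLp j) a c (cw j) DK (hk0 k kk).
  have ce := trunc_curl_on p2 oU cK1 K1U (wLp j) c b (cw j) DK (hk0 k kk).
  have L0 : 0 < ell ^+ k by rewrite exprn_gt0.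
  have := wedge_step p2 C0 hK dK phi_q phi0 dphi0 Dr Phi0 iu iv iup u0 v0 i m L0 fa fe ca ce.
  move/le_trans; apply.
  have [h1 h2 h3] := hM j.
  have E0 : 0 <= Phi * C ^+ 2 * (4 + 4 * n%:R).
    by rewrite !mulr_ge0// ?exprn_ge0// addr_ge0// mulr_ge0.
  have Lh : ell ^+ k * 2 ^- k = rho ^+ k by rewrite -exprVn -exprMn.
  have Lp : (ell ^+ k) `^ (2 - p) = rho ^+ k.
    by rewrite -[ell ^+ k]powR_mulrn ?(ltW ell0)// powRAC ellp powR_mulrn//; case/andP: rho1.
  have hh : 2 ^- k <= rho ^+ k by rewrite -exprVn lerXn2r// nnegrE// ?invr_ge0//; case/andP: rho1.
  have rk0 : 0 <= rho ^+ k by rewrite exprn_ge0//; case/andP: rho1.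
  have P0 : 0 <= 2 `^ p :> R by exact: powR_ge0.
  rewrite /wedge_bound Lh Lp.
  rewrite (_ : E * rho ^+ k = 2 * (Phi * C ^+ 2 * (4 + 4 * n%:R) *
    (rho ^+ k * M + 2 * rho ^+ k * (2 `^ p * M) + rho ^+ k * (M + 2 * (2 `^ p * M))))); last first.
    by rewrite /E; ring.
  have U0 : 0 <= \int[mu]_x envelope p K1 (w j) x by apply: Rintegral_ge0.
  have Up0 : 0 <= \int[mu]_x envelope p K1 (w j) x `^ p by apply: Rintegral_ge0 => x _; exact: powR_ge0.
  rewrite ler_wpM2l// ler_wpM2l//; apply: lerD; first apply: lerD.
  - by rewrite ler_wpM2l.
  - by rewrite ler_wpM2l ?mulr_ge0// ler_wpM2l.
  - apply: ler_pM => //; first by rewrite addr_ge0// !mulr_ge0.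
    by apply: lerD => //; rewrite ler_wpM2l// ler_wpM2l.
apply: (@cvg_uniform_geometric R (fun k j => B (w j) k) (B w0) _ _ E rho k0 rho1).
- exact: step.
- by move=> j; apply: Bcv; exact: wLp.
- by apply: Bcv; exact: w0Lp.
- exact: B0cv.
Qed.

End on_a_compact_set.

(** The left side is linear in w and passes to the limit by weak convergence; the right side is a
    sum over c of wedge products. Both are limits of the same sequence. K1 thickens the support D of
    phi, which leaves room for the kernels. *)
Lemma cartan_weak_limit : (forall j, cartan_on U (w j)) -> cartan_on U w0.
Proof.
move=> cw i m a b phi tphi.
have [D [Phi [cD DU phi0 Phi0 hphi]]] := test_function_bound tphi.
have [r1 [K1 [r10 cK1 K1U DK]]] := compact_thickening oU cD DU.
have [r Dr] := compact_sub_cube cD.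
have DK1 : D `<=` K1.
  by move=> x Dx; apply: (DK x Dx); apply/cubeP => i'; rewrite subrr normr0 ltW.
have phi_q j : quotient_cvg j phi (partial j phi) Phi by have [] := hphi j.
have dphi0 j x : ~ D x -> partial j phi x = 0 by have [_] := hphi j; exact.
have phi1 x : ~ K1 x -> phi x = 0 by move=> xK; apply: phi0 => /DK1.
have dphi1 j x : ~ K1 x -> partial j phi x = 0 by move=> xK; apply: dphi0 => /DK1.
have mphi : measurable_fun [set: 'rV[R]_n] phi by have [] := phi_q i.
have bphi x : `|phi x| <= Phi by have [_ + _ _] := phi_q i; exact.
have mdphi j := quotient_cvg_measurable (phi_q j).
have bdphi j x := quotient_cvg_le x (phi_q j).
have lhsE (v : 'rV[R]_n -> 'I_n -> 'M[R]_N) : (forall i a b, Lp_loc p U (fun x => v x i a b)) ->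
    \int[mu]_(x in U) (v x i a b * partial m phi x - v x m a b * partial i phi x) =
    \int[mu]_x (trunc K1 v a b i x * partial m phi x) -
    \int[mu]_x (trunc K1 v a b m x * partial i phi x).
  move=> vLp; have [it _ _ _] := trunc_form_le p2 oU cK1 K1U vLp a b.
  rewrite (Rintegral_support K1U); last by move=> x xK; rewrite !dphi1// !mulr0 subrr.
  rewrite -RintegralB//; last 2 first.
  - exact: (integrable_mul_bounded (it i) (mdphi m) (bdphi m)).
  - exact: (integrable_mul_bounded (it m) (mdphi i) (bdphi i)).
  apply: eq_Rintegral => x _; rewrite /trunc.
  have [Kx|Kx] := pselect (K1 x); first by rewrite indicE mem_set// !mulr1.
  by rewrite !dphi1// !mulr0.
have rhsE (v : 'rV[R]_n -> 'I_n -> 'M[R]_N) : (forall i a b, Lp_loc p U (fun x => v x i a b)) ->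
    \int[mu]_(x in U) ((v x i *m v x m - v x m *m v x i) a b * phi x) =
    \sum_c trunc_wedge K1 phi v a b c i m.
  move=> vLp.
  rewrite (Rintegral_support K1U); last by move=> x xK; rewrite phi1// mulr0.
  rewrite -(Rintegral_sum _ measurableT); last first.
    move=> c; have := integrableBR measurableT
      (trunc_mul_integrable cK1 K1U phi_q a c c b i m vLp) (trunc_mul_integrable cK1 K1U phi_q a c c b m i vLp).
    by congr (mu.-integrable _ (EFin \o _)); apply/funext => x; rewrite mulrBr.
  apply: eq_Rintegral => x _; rewrite -mulr_sumr mulrC.
  have [Kx|Kx] := pselect (K1 x); last by rewrite phi1// !mul0r.
  congr (_ * _); rewrite !mxE -sumrB; apply: eq_bigr => d _.
  by rewrite /trunc indicE mem_set// !mulr1.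
rewrite lhsE// rhsE//.
have cl := cvgB (@trunc_weak_cvg K1 cK1 K1U a b i _ _ (mdphi m) (bdphi m))
  (@trunc_weak_cvg K1 cK1 K1U a b m _ _ (mdphi i) (bdphi i)).
have cr := @cvgn_sum R _ (index_enum 'I_N) _ _ (fun c =>
  @trunc_wedge_cvg K1 cK1 K1U D phi Phi r r1 phi_q phi0 dphi0 Dr Phi0 r10 DK cw a b c i m).
have cr' : (fun j => \int[mu]_x (trunc K1 (w j) a b i x * partial m phi x) -
    \int[mu]_x (trunc K1 (w j) a b m x * partial i phi x)) @ \oo -->
    \sum_c trunc_wedge K1 phi w0 a b c i m.
  by apply: (eq_cvgn _ (erefl _) cr) => j; rewrite -rhsE// -cw// lhsE.
exact: (cvg_unique _ (cl _) cr').
Qed.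

End cartan_weak_limit.

(** * Weak limits of forms on a manifold *)

Section setwise_limits.
Context (R : realType) (n : nat).
Notation mu := (leb R n).

Lemma Rintegral_setI_mul (D A : set 'rV[R]_n) (f : 'rV[R]_n -> R) :
  \int[mu]_(x in D `&` A) f x = \int[mu]_(x in D) (f x * \1_A x).
Proof.
rewrite Rintegral_mkcondr; apply: eq_Rintegral => x _.
by rewrite patchE indicE; case: ifP => _; rewrite ?mulr1 ?mulr0.
Qed.

Lemma le_Rintegral_symdiff (D A E : set 'rV[R]_n) (f : 'rV[R]_n -> R) :
  measurable D -> measurable A -> measurable E -> mu.-integrable D (EFin \o f) ->
  `|\int[mu]_(x in D `&` A) f x - \int[mu]_(x in D `&` E) f x| <=
  \int[mu]_(x in D `&` symdiff A E) `|f x|.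
Proof.
move=> mD mA mE if_.
have mf : measurable_fun D f by apply/measurable_EFinP; exact: measurable_int if_.
have ifn : mu.-integrable D (EFin \o (fun x => `|f x|)) by exact: integrable_norm if_.
have dom (B : set 'rV[R]_n) (v : 'rV[R]_n -> R) : measurable B -> measurable_fun D v -> (forall x, `|v x| <= `|f x|) ->
    mu.-integrable D (EFin \o (fun x => v x * \1_B x)).
  move=> mB mv vf; apply: (le_integrableR _ _ ifn) => //.
    by apply: measurable_funM => //; exact: measurable_indic.
  move=> x _; rewrite normrM indicE; apply: le_trans (vf x).
  by case: (_ \in _); rewrite ?normr1 ?normr0 ?mulr1// mulr0.
rewrite !Rintegral_setI_mul -(RintegralB mD (dom _ _ mA mf (fun=> lexx _)) (dom _ _ mE mf (fun=> lexx _))).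
have mS := measurable_symdiff mA mE.
apply: le_norm_Rintegral => //.
- apply: measurable_funB; apply: measurable_funM => //; exact: measurable_indic.
- apply: dom => //; first exact: measurableT_comp.
  by move=> x; rewrite normr_id.
- move=> x _; rewrite -mulrBr normrM ler_wpM2l// !indicE.
  have [Ax|Ax] := pselect (A x); have [Ex|Ex] := pselect (E x).
  - by rewrite (mem_set Ax) (mem_set Ex) subrr normr0.
  - by rewrite (mem_set Ax) (memNset Ex) mem_set ?subr0 ?normr1//; left.
  - by rewrite (memNset Ax) (mem_set Ex) mem_set ?sub0r ?normrN ?normr1//; right.
  - by rewrite (memNset Ax) (memNset Ex) subrr normr0.
Qed.

(** By equi-integrability, replacing A by a suitable finite union of cells changes all the integrals
    by at most e / 2, uniformly in j, so the integrals over A form a Cauchy sequence. *)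
Lemma setwise_of_cells (D : set 'rV[R]_n) (p C : R) (u : nat -> 'rV[R]_n -> R) :
  measurable D -> (mu D < +oo)%E -> 1 < p -> (forall j, Lp_le mu D p (u j) C) ->
  (forall k (s : seq 'rV[int]_n), cvgn (fun j => \int[mu]_(x in D `&` [set x | cell k x \in s]) u j x)) ->
  forall A, measurable A -> cvgn (fun j => \int[mu]_(x in D `&` A) u j x).
Proof.
move=> mD Doo p1 uC cells A mA; apply: cauchy_cvg; apply/cauchy_exP => e e0.
have e2 : 0 < e / 2 by rewrite divr_gt0.
have [r r0 hr] := Lp_le_unif_small C mD Doo p1 e2.
pose lam : {measure set 'rV[R]_n -> \bar R} := mrestr mu mD.
have lamT : (lam setT < +oo)%E by rewrite /lam /= /mrestr setTI.
have [k [s hs]] := cell_approx lamT mA r0.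
have mE : measurable [set x : 'rV[R]_n | cell k x \in s].
  exact: (@measurable_cell R n k [set z | z \in s]).
have /cvg_ex[l hl] := cells k s.
exists l; have H : \forall j \near \oo, `|l - \int[mu]_(x in D `&` [set x | cell k x \in s]) u j x| < e / 2.
  by have /cvgrPdist_lt := hl; exact.
move: H; apply: filterS => j hj; rewrite /ball /=.
have iu : mu.-integrable D (EFin \o u j) by exact: Lp_le_L1 mD Doo (ltW p1) (uC j).
rewrite -(subrKA (\int[mu]_(x in D `&` [set x | cell k x \in s]) u j x)).
apply: le_lt_trans (ler_normD _ _) _; rewrite (splitr e); apply: ltr_leD => //.
rewrite distrC; apply: le_trans (le_Rintegral_symdiff mD mA mE iu) _.
apply: (hr _ _ (uC j)); first exact: measurable_symdiff.
rewrite -lee_fin fineK; first by rewrite setIC; exact: ltW hs.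
rewrite ge0_fin_numE//; apply: le_lt_trans Doo; apply: le_measure; rewrite ?inE//.
by apply: measurableI => //; exact: measurable_symdiff.
Qed.

Lemma Lp_loc_integrable (p : R) (U K : set 'rV[R]_n) (v : 'rV[R]_n -> R) : 1 <= p ->
  open U -> compact K -> K `<=` U -> Lp_loc p U v -> mu.-integrable K (EFin \o v).
Proof.
move=> p1 oU cK KU [mv /(_ K cK KU) fin].
have mK := compact_measurable_rV cK; have Koo := leb_compact_lty cK.
have mvK := measurable_funS (open_measurable_rV oU) KU mv.
have ip := integrable_powR mK mvK fin.
apply: (@le_integrableR _ _ _ mu K v (fun x => 1 + `|v x| `^ p)) => //.
  by apply: integrableDR => //; exact: integrable_cstR.
move=> x _; apply: le_trans (le_powR_split p1 ltr01 (normr_ge0 _)) _.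
by rewrite powR1 mul1r.
Qed.

Lemma ae_eq_of_integrals (D : set 'rV[R]_n) (f g : 'rV[R]_n -> R) : measurable D ->
  mu.-integrable D (EFin \o f) -> mu.-integrable D (EFin \o g) ->
  (forall A, A `<=` D -> measurable A -> \int[mu]_(x in A) f x = \int[mu]_(x in A) g x) ->
  {ae mu, forall x, D x -> f x = g x}.
Proof.
move=> mD if_ ig H.
have := @integral_ae_eq _ _ _ mu D mD (EFin \o g) (EFin \o f) if_ (measurable_int _ ig).
have /[swap] /[apply] : forall E, E `<=` D -> measurable E ->
    (\int[mu]_(x in E) (EFin \o f) x = \int[mu]_(x in E) (EFin \o g) x)%E.
  move=> E ED mE; rewrite !RintegralE//; try exact: integrableS ED _.
  by rewrite H.
by apply: filterS => x h Dx; have [] := h Dx.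
Qed.

(** The coefficients are locally bounded, so multiplied by the indicator of a small set they are
    admissible test functions; equality of the integrals over all small sets then gives equality
    almost everywhere. *)
Lemma weak_limit_linear (p : R) (U V : set 'rV[R]_n) (Q : finType) (g : Q -> 'rV[R]_n -> R)
    (u : Q -> nat -> 'rV[R]_n -> R) (u0 : Q -> 'rV[R]_n -> R) (G : 'rV[R]_n -> R) :
  1 < p -> open U -> open V -> V `<=` U -> (forall q, Linf_loc V (g q)) ->
  (forall q j, Lp_loc p U (u q j)) -> (forall q, Lp_loc p U (u0 q)) ->
  (forall q, weak_cvg_Lp_loc p U (u q) (u0 q)) ->
  (forall j, {ae mu, forall x, V x -> \sum_q g q x * u q j x = G x}) ->
  {ae mu, forall x, V x -> \sum_q g q x * u0 q x = G x}.
Proof.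
move=> p1 oU oV VU gV uLp u0Lp cu hG.
(* G is an arbitrary function, not even measurable. What enters is that the combination is almost
   everywhere the same for all j, so it is compared with its value at j = 0. *)
suff : {ae mu, forall x, V x -> \sum_q g q x * u0 q x = \sum_q g q x * u q 0%N x}.
  by apply: filterS2 (hG 0%N) => x h1 h2 Vx; rewrite h2// h1.
apply: ae_local => x Vx; have [e e0 eV] := open_compact_nbhs oV Vx.
exists e => //; pose K := cube x e.
have cK : compact K by exact: compact_cube.
have mK : measurable K by exact: measurable_cube.
have Koo : (mu K < +oo)%E := leb_compact_lty cK.
have KU : K `<=` U by exact: subset_trans eV VU.
suff : {ae mu, forall y, K y -> \sum_q g q y * u0 q y = \sum_q g q y * u q 0%N y}.
  by apply: filterS => y h /ball_cube Ky; exact: h.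
have q0 : 0 <= p / (p - 1) by rewrite divr_ge0 ?(ltW (lt_trans ltr01 p1))// subr_ge0 ltW.
have igu q v : Lp_loc p U v -> mu.-integrable K (EFin \o (fun y => g q y * v y)).
  move=> vLp; have [mg /(_ K cK eV)[C hC]] := gV q.
  have iv := Lp_loc_integrable (ltW p1) oU cK KU vLp.
  have mgK := measurable_funS (open_measurable_rV oV) eV mg.
  have mvK : measurable_fun K v by apply/measurable_EFinP; exact: measurable_int iv.
  apply/integrableP; split; first by apply/measurable_EFinP; exact: measurable_funM.
  have iC : mu.-integrable K (EFin \o (fun y => `|C| * `|v y|)).
    by apply: integrableZR => //; exact: integrable_norm iv.
  case/integrableP : iC => mC; apply: le_lt_trans.
  apply: ae_ge0_le_integral => //.
  - by apply: measurableT_comp => //; apply/measurable_EFinP; exact: measurable_funM.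
  - exact: measurableT_comp.
  - apply: filterS hC => y h Ky; rewrite /= lee_fin normrM [leRHS]ger0_norm ?mulr_ge0//.
    by rewrite ler_wpM2r// (le_trans (h Ky))// ler_norm.
apply: ae_eq_of_integrals => //.
- by apply: integrable_sumR => // q; exact: igu.
- by apply: integrable_sumR => // q; exact: igu.
move=> A AK mA.
have igA q v : Lp_loc p U v -> mu.-integrable A (EFin \o (fun y => g q y * v y)).
  by move=> /(igu q); exact: integrableS.
rewrite !(Rintegral_sum _ mA)//; try by move=> q; exact: igA.
have cvA q : (fun j => \int[mu]_(y in A) (g q y * u q j y)) @ \oo --> \int[mu]_(y in A) (g q y * u0 q y).
  have [mg /(_ K cK eV)[C hC]] := gV q.
  have mgK := measurable_funS (open_measurable_rV oV) eV mg.
  have mpsi : measurable_fun K (fun y => g q y * \1_A y).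
    by apply: measurable_funM => //; exact: measurable_indic.
  have fin : (\int[mu]_(y in K) (`|g q y * \1_A y| `^ (p / (p - 1)))%:E < +oo)%E.
    apply: (@le_lt_trans _ _ (\int[mu]_(y in K) (`|C| `^ (p / (p - 1)))%:E)%E).
      apply: ae_ge0_le_integral => //.
      - apply/measurable_EFinP; apply: (measurableT_comp (measurable_powR _)).
        exact: measurableT_comp.
      - apply: filterS hC => y h Ky; rewrite lee_fin ge0_ler_powR ?nnegrE//.
        rewrite normrM; apply: le_trans (le_trans (h Ky) (ler_norm C)).
        by rewrite indicE; case: (_ \in _); rewrite ?normr1 ?normr0 ?mulr1// mulr0.
    by rewrite integral_cst//= lte_mul_pinfty// lee_fin powR_ge0.
  have E v : \int[mu]_(y in K) (v y * (g q y * \1_A y)) = \int[mu]_(y in A) (g q y * v y).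
    rewrite -{2}(setIidr AK) Rintegral_setI_mul; apply: eq_Rintegral => y _; ring.
  by rewrite -E; apply: eq_cvgn (cu q K cK KU _ mpsi fin) => // j; exact: E.
have c1 := @cvgn_sum R _ (index_enum Q) _ _ cvA.
have c2 : (fun j => \sum_q \int[mu]_(y in A) (g q y * u q j y)) @ \oo -->
    \sum_q \int[mu]_(y in A) (g q y * u q 0%N y).
  apply: (eq_cvgn _ (erefl _) (cvg_cst (\sum_q \int[mu]_(y in A) (g q y * u q 0%N y)))) => j.
  rewrite -!(Rintegral_sum _ mA); try by move=> q; exact: igA.
  have iS i := integrable_sumR (index_enum Q) mA (fun q => igA q _ (uLp q i)).
  rewrite /Rintegral; congr fine; apply: ae_eq_integral => //.
  - exact: measurable_int (iS 0%N).
  - exact: measurable_int (iS j).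
  - apply: filterS2 (hG 0%N) (hG j) => y h0 hj Ay.
    by rewrite h0 ?hj//; exact/eV/AK.
exact: (cvg_unique _ c1 c2).
Qed.

End setwise_limits.

(** * Transfer of weak limits between charts *)

Section jacobian_transfer.
Context (R : realType) (n : nat).
Notation mu := (leb R n).
Variables (V V' : set 'rV[R]_n) (T S : 'rV[R]_n -> 'rV[R]_n) (x0 : 'rV[R]_n).
Variable J : 'I_n -> 'I_n -> 'rV[R]_n -> R.
Hypotheses (oV : open V) (oV' : open V').
Hypothesis cT : forall x, V x -> {for x, continuous T}.
Hypothesis TV : forall x, V x -> V' (T x).
Hypothesis TK : forall x, V x -> S (T x) = x.
Hypothesis SV : forall y, V' y -> V (S y).
Hypothesis sS : forall r, smooth_on V' (fun y => S y ord0 r).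
Hypothesis cS : forall y, V' y -> {for y, continuous S}.
Hypothesis cJ : forall m r x, V x -> {for x, continuous (J m r)}.
Hypothesis Vx0 : V x0.

(** The weights are psi = J (S y) 1_A (S y) h (y), with h the density from [chart_transfer]. They
    are bounded and do not depend on f, so weak convergence of the f_r in the target chart can be
    tested against them. *)
Lemma jacobian_transfer : exists (e : R) (K : set 'rV[R]_n),
  [/\ 0 < e, ball x0 e `<=` V, compact K, K `<=` V' &
  forall A, measurable A -> A `<=` ball x0 e ->
  exists psi : 'I_n -> 'I_n -> 'rV[R]_n -> R,
    [/\ forall m r, measurable_fun [set: 'rV[R]_n] (psi m r),
        exists C : R, forall m r y, `|psi m r y| <= C &
    forall f : 'I_n -> 'rV[R]_n -> R, (forall r, mu.-integrable K (EFin \o f r)) ->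
    forall m, mu.-integrable A (EFin \o (fun x => \sum_r J m r x * f r (T x))) /\
      \int[mu]_(x in A) (\sum_r J m r x * f r (T x)) =
      \sum_r \int[mu]_(y in K) (f r y * psi m r y)]].
Proof.
(* A neighbourhood of x0 on which the entries of J are bounded by constants; it makes the weights
   bounded. *)
pose V0 := V `&` [set x | forall q : 'I_n * 'I_n, `|J q.1 q.2 x| < `|J q.1 q.2 x0| + 1].
have oV0 : open V0.
  rewrite openE => x [Vx Jx]; apply: filterI; first exact: open_nbhs_nbhs.
  have H := @filter_forall 'rV[R]_n ('I_n * 'I_n)%type
    (fun q x => `|J q.1 q.2 x| < `|J q.1 q.2 x0| + 1) (nbhs x) _.
  apply: H => q; have c : {for x, continuous (fun y => `|J q.1 q.2 y|)}.
    by apply: continuous_comp; [exact: cJ|exact: norm_continuous].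
  exact: c (lt_nbhsl (Jx q)).
have V0V : V0 `<=` V by move=> x [].
have V0x0 : V0 x0 by split => // q; rewrite ltrDl.
have [e [C [K [h [[e0 eV] [cK KV'] [TKe mTe] [mh hC] key]]]]] :=
  chart_transfer oV0 oV' (fun x Vx => cT (V0V x Vx)) (fun x Vx => TV (V0V x Vx))
    (fun x Vx => TK (V0V x Vx)) sS V0x0.
exists e, K; split => //; first exact: subset_trans eV V0V.
move=> A mA Ae.
have mB : measurable (ball x0 e : set 'rV[R]_n) by apply: open_measurable_rV; exact: ball_open.
have mV' : measurable V' := open_measurable_rV oV'.
pose S' y := if y \in V' then S y else 0.
have mS' : measurable_fun [set: 'rV[R]_n] S'.
  apply: measurable_fun_rVP => i.
  rewrite (_ : _ \o _ = (fun y => S y ord0 i) \_ V').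
    apply: (measurable_restrictT _ mV').1; apply: continuous_on_measurable_rV => // y V'y.
    exact: (smooth_continuous (sS i)).
  by apply/funext => y; rewrite patchE /= /S' /rV_coord; case: ifP => // _; rewrite mxE.
pose A' := V' `&` S' @^-1` A.
have mA' : measurable A'.
  apply: measurableI => //; rewrite -[X in measurable X]setTI; exact: mS'.
pose G m r y := if y \in V' then J m r (S y) else 0.
have mG m r : measurable_fun [set: 'rV[R]_n] (G m r).
  rewrite (_ : G m r = (J m r \o S) \_ V'); last first.
    by apply/funext => y; rewrite patchE /G.
  apply: (measurable_restrictT _ mV').1; apply: continuous_on_measurable_rV => // y V'y.
  apply: continuous_comp; last exact/cJ/SV.
  exact: cS.
pose CJ := \sum_(q : 'I_n * 'I_n) (`|J q.1 q.2 x0| + 1).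
pose psi m r y := G m r y * \1_A' y * h y.
have CJ0 : 0 <= CJ by apply: sumr_ge0 => q _; rewrite addr_ge0.
have Gb m r y : `|G m r y * \1_A' y| <= CJ.
  have [[V'y /= Ay]|Ay] := pselect (A' y); last by rewrite indicE memNset// mulr0 normr0.
  have A'y : A' y by split.
  rewrite indicE (mem_set A'y) mulr1 /G mem_set//.
  move: Ay; rewrite /= /S' mem_set// => /Ae/eV[_ /(_ (m, r)) /= /ltW].
  by move=> /le_trans; apply; rewrite /CJ (bigD1 (m, r))//= lerDl sumr_ge0.
have C0 : 0 <= C by have /andP[] := hC 0; exact: le_trans.
have psib m r y : `|psi m r y| <= CJ * C.
  rewrite normrM; apply: ler_pM => //; have /andP[h0 hc] := hC y; by rewrite ger0_norm.
have mpsi m r : measurable_fun [set: 'rV[R]_n] (psi m r).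
  by apply: measurable_funM => //; apply: measurable_funM => //; exact: measurable_indic.
exists psi; split => //; first by exists (CJ * C).
move=> f if_ m.
have mK := compact_measurable_rV cK.
have iw r : mu.-integrable K (EFin \o (fun y => f r y * (G m r y * \1_A' y))).
  have mfr : measurable_fun K (f r) by apply/measurable_EFinP; exact: measurable_int (if_ r).
  apply: (@le_integrableR _ _ _ mu K _ (fun y => CJ * `|f r y|)) => //.
  - apply: measurable_funM => //; apply: measurable_funTS.
    by apply: measurable_funM => //; exact: measurable_indic.
  - by apply: integrableZR => //; exact: integrable_norm (if_ r).
  - by move=> y _; rewrite normrM mulrC ler_wpM2r.
have E r x : ball x0 e x -> f r (T x) * (G m r (T x) * \1_A' (T x)) = J m r x * f r (T x) * \1_A x.
  move=> ex; have Vx : V x by exact/V0V/eV.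
  have V'T := TV Vx; rewrite /G mem_set// TK//.
  rewrite [in LHS]indicE (_ : (T x \in A') = (x \in A)); first by rewrite -indicE; ring.
  apply/idP/idP => /set_mem H; apply/mem_set.
    by case: H => _ /=; rewrite /S' mem_set// TK.
  by split => //=; rewrite /S' mem_set// TK.
have iT r : mu.-integrable A (EFin \o (fun x => J m r x * f r (T x))) /\
    \int[mu]_(x in A) (J m r x * f r (T x)) = \int[mu]_(y in K) (f r y * psi m r y).
  have [i1 i2] := key _ (iw r); split.
    have iA := integrableS mB mA Ae i1.
    apply: (@eq_integrable _ _ _ _ _ mA _ _ _ iA) => x /set_mem Ax /=.
    by rewrite E ?indicE ?mem_set ?mulr1//; exact: Ae.
  transitivity (\int[mu]_(x in ball x0 e) (J m r x * f r (T x) * \1_A x)).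
    by rewrite -Rintegral_setI_mul setIidr.
  transitivity (\int[mu]_(x in ball x0 e) (f r (T x) * (G m r (T x) * \1_A' (T x)))).
    by apply: eq_Rintegral => x /set_mem ex; rewrite E.
  by rewrite i2; apply: eq_Rintegral => y _; rewrite /psi; ring.
split; first by apply: integrable_sumR => // r; exact: (iT r).1.
rewrite Rintegral_sum//; last by move=> r; exact: (iT r).1.
by apply: eq_bigr => r _; exact: (iT r).2.
Qed.

End jacobian_transfer.

Section diagonal_weak_limits.
Context (R : realType) (n : nat).
Notation mu := (leb R n).

(** Countably many numbers decide everything: the integrals of each [u i] over the finite unions of
    cells within each piece [B i m], all enumerated by [xs]. A subsequence along which they all
    converge converges setwise on each piece by [setwise_of_cells], and weakly by
    [local_weak_limit]. *)
Lemma diagonal_weak_limit (I : countType) (p : R) (U : I -> set 'rV[R]_n)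
    (u : I -> nat -> 'rV[R]_n -> R) : 1 < p -> (forall i, open (U i)) ->
  (forall i j, measurable_fun (U i) (u i j)) ->
  (forall i K, compact K -> K `<=` U i -> exists C : R, forall j,
     (\int[mu]_(x in K) (`|u i j x| `^ p)%:E <= C%:E)%E) ->
  exists phi : nat -> nat, (forall i j, (i < j)%N -> (phi i < phi j)%N) /\
    forall i, exists2 u0, Lp_loc p (U i) u0 & weak_cvg_Lp_loc p (U i) (fun j => u i (phi j)) u0.
Proof.
move=> p1 oU mU uC.
have ex i : exists B : nat -> set 'rV[R]_n,
    (forall m, open (B m) /\ exists K, [/\ compact K, K `<=` U i & B m `<=` K]) /\
    U i `<=` \bigcup_m B m.
  have [B [h1 h2 _]] : exists B : nat -> set 'rV[R]_n, [/\ forall m, open (B m) /\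
      exists K, [/\ compact K, K `<=` U i & B m `<=` K], U i `<=` \bigcup_m B m &
      forall K, compact K -> K `<=` U i -> exists N, K `<=` \bigcup_(m in `I_N) B m].
    apply: (@good_cover _ _ (fun A => exists K, [/\ compact K, K `<=` U i & A `<=` K])).
    - by exists set0; split => //; exact: compact0.
    - by move=> A A' AA' [K [cK KU A'K]]; exists K; split => //; exact: subset_trans A'K.
    - move=> x Ux; have [e e0 eU] := open_compact_nbhs (oU i) Ux.
      by exists e => //; exists (cube x e); split => //; [exact: compact_cube|exact: ball_cube].
  by exists B.
move: ex => /choice[B hB].
have mB i m : measurable (B i m) by have [oB _] := (hB i).1 m; exact: open_measurable_rV.
have Bfacts i m : (mu (B i m) < +oo)%E /\ exists C : R, forall j, Lp_le mu (B i m) p (u i j) C.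
  have [_ [K [cK KU BK]]] := (hB i).1 m; split.
    apply: le_lt_trans (leb_compact_lty cK); apply: le_measure; rewrite ?inE//.
    exact: compact_measurable_rV.
  have [C hC] := uC i K cK KU; exists C => j; split.
    by apply: measurable_funS (mU i j); [exact: open_measurable_rV|exact: subset_trans KU].
  apply: le_trans (hC j); apply: ge0_subset_integral => //.
  - exact: compact_measurable_rV.
  - apply/measurable_EFinP; apply: (measurableT_comp (measurable_powR p)).
    apply: measurableT_comp => //.
    by apply: measurable_funS (mU i j) => //; exact: open_measurable_rV.
pose xs (t : nat) (j : nat) : R :=
  if @unpickle (I * nat * (nat * seq 'rV[int]_n))%type t is Some q then
    \int[mu]_(x in B q.1.1 q.1.2 `&` [set x | cell q.2.1 x \in q.2.2]) u q.1.1 j x else 0.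
have xsb t : exists Mt : R, forall j, `|xs t j| <= Mt.
  rewrite /xs; case: unpickle => [[[i m] [k s]]|] /=; last by exists 0 => j; rewrite normr0.
  have [Boo [C hC]] := Bfacts i m.
  have mE : measurable [set x : 'rV[R]_n | cell k x \in s].
    exact: (@measurable_cell R n k [set z | z \in s]).
  exists (1 * fine (mu (B i m `&` [set x | cell k x \in s])) + 1 `^ (1 - p) * C) => j.
  apply: le_trans (Lp_le_unif_integrable (mB i m) Boo (ltW p1) ltr01 (hC j) mE).
  have iu := Lp_le_L1 (mB i m) Boo (ltW p1) (hC j).
  have iu' := integrableS (mB i m) (measurableI _ _ (mB i m) mE) (@subIsetl _ _ _) iu.
  apply: le_normr_Rintegral => //; exact: measurableI.
have [phi [phi_incr phi_cv]] := diagonal_subsequence xsb.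
exists phi; split => // i; apply: local_weak_limit => //.
- by move=> K cK KU; have [C hC] := uC i K cK KU; exists C => j; exact: hC.
- move=> x Ux; have [m _ Bx] := (hB i).2 x Ux.
  have [oB [K [cK KU BK]]] := (hB i).1 m; have [Boo [C hC]] := Bfacts i m.
  have /nbhs_ballP[e /= e0 eB] : nbhs x (B i m) by exact: open_nbhs_nbhs.
  exists e => //; exists K; split => //; first exact: subset_trans BK.
  move=> A mA Ae; have AB : A `<=` B i m by exact: subset_trans eB.
  have := @setwise_of_cells R n (B i m) p C (fun j => u i (phi j)) (mB i m) Boo p1
    (fun j => hC (phi j)) _ A mA.
  rewrite (setIidr AB); apply => k s.
  have := phi_cv (pickle ((i, m), (k, s))).
  by rewrite /xs pickleK.
Qed.

Lemma weak_cvg_setwise (p : R) (U K A : set 'rV[R]_n) (u : nat -> 'rV[R]_n -> R) u0 :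
  1 < p -> compact K -> K `<=` U -> weak_cvg_Lp_loc p U u u0 -> measurable A -> A `<=` K ->
  (fun j => \int[mu]_(x in A) u j x) @ \oo --> \int[mu]_(x in A) u0 x.
Proof.
move=> p1 cK KU cu mA AK.
have q0 : 0 <= p / (p - 1) by rewrite divr_ge0 ?(ltW (lt_trans ltr01 p1))// subr_ge0 ltW.
have m1 : measurable_fun [set: 'rV[R]_n] (\1_A : 'rV[R]_n -> R) by exact: measurable_indic.
have b1 (x : 'rV[R]_n) : `|\1_A x| <= 1 :> R.
  by rewrite indicE; case: (_ \in _); rewrite ?normr1 ?normr0.
have E v : \int[mu]_(x in K) (v x * \1_A x) = \int[mu]_(x in A) v x.
  by rewrite -Rintegral_setI_mul (setIidr AK).
rewrite -E; apply: eq_cvgn (cu K cK KU _ (measurable_funTS m1)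
  (bounded_integrable_powR cK m1 b1 q0)) => // j; exact: E.
Qed.

End diagonal_weak_limits.

Section charts.
Context (R : realType) (n : nat) (M : smooth_manifold R n).
Implicit Types c d : chart R n M.

(** Lindelof's argument: for each basic open set contained in some chart domain one such chart is
    chosen, the basic sets being numbered by the injection f. The chart c0 is the default for
    numbers without such a set. *)
Lemma countable_atlas c0 : atlas c0 ->
  exists cl : nat -> chart R n M, (forall l, atlas (cl l)) /\ forall y, exists l, cdom (cl l) y.
Proof.
move=> ac0; have [B cB [Bo Bb]] := manifold_second_countable M.
have /countable_injP[f finj] := cB.
have ex (k : nat) : exists c, atlas c /\ forall b, B b -> f b = k ->
    (exists2 c', atlas c' & b `<=` cdom c') -> b `<=` cdom c.
  have [[c' [ac' [b [Bb' fb bc]]]]|H] := pselect (exists c' : chart R n M, atlas c' /\ exists b, [/\ B b, f b = k & b `<=` cdom c']).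
    exists c'; split => // b1 Bb1 fb1 _.
    by rewrite (finj b1 b) ?inE// fb1 fb.
  exists c0; split => // b Bb' fb [c' ac' bc']; exfalso; apply: H.
  by exists c'; split => //; exists b.
move: ex => /choice[cl hcl]; exists cl; split; first by move=> l; have [] := hcl l.
move=> y; have [c ac cy] := atlas_cover y.
have Ny : nbhs y (cdom c) by apply: open_nbhs_nbhs; split => //; exact: cdom_open.
have [b [Bb' yb] bc] := Bb y (cdom c) Ny.
by exists (f b); have [_ h] := hcl (f b); apply: (h b Bb' erefl) => //; exists c.
Qed.

Lemma region_open (O : set M) c : open O -> open (region O c).
Proof.
move=> oO; rewrite openE => x [cx Ox]; apply: filterI.
  by apply: open_nbhs_nbhs; split => //; exact: cimg_open.
by apply: (cfrom_continuous cx); apply: open_nbhs_nbhs.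
Qed.

Lemma overlap_open c d : open (overlap c d).
Proof. exact: region_open (cdom_open d). Qed.

Lemma transition_continuous c d x : overlap c d x -> {for x, continuous (@transition R n M c d)}.
Proof.
move=> [cx dx]; apply: (@continuous_comp _ _ _ (cfrom c) (cto d)).
  exact: cfrom_continuous.
exact: cto_continuous.
Qed.

Lemma transition_overlap c d x : overlap c d x -> overlap d c (transition c d x).
Proof.
move=> [cx dx]; split; first exact: cto_img.
by rewrite /transition ctoK//; exact: cfrom_dom.
Qed.

Lemma transitionK c d x : overlap c d x -> transition d c (transition c d x) = x.
Proof. by move=> [cx dx]; rewrite /transition ctoK// cfromK. Qed.

Lemma transition_jac_continuous c d m r x : atlas c -> atlas d -> overlap c d x ->
  {for x, continuous (fun x => transition_jac c d x m r)}.
Proof.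
move=> ac ad cdx.
have := smooth_continuous (smooth_partial m (atlas_smooth ac ad r)) cdx.
rewrite (_ : (fun x => transition_jac c d x m r) = partial m (fun y => transition c d y ord0 r))//.
by apply/funext => y; rewrite mxE.
Qed.

End charts.

Section matrix_forms.
Context (R : realType) (n : nat) (M : smooth_manifold R n) (N : nat).
Notation mu := (leb R n).
Implicit Types (c d : chart R n M) (omega : matrix_form M N).

Definition form_law omega := forall c d, atlas c -> atlas d ->
  {ae leb R n, forall x, overlap c d x -> forall m,
    omega c x m = \sum_(r < n) transition_jac c d x m r *: omega d (transition c d x) r}.

Definition form_Lp (p : R) omega := forall c, atlas c -> forall m a b,
  Lp_loc p (cimg c) (fun x => omega c x m a b).

Lemma law_entry c d (x : 'rV[R]_n) m (v : 'rV[R]_n -> 'I_n -> 'M[R]_N) a b :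
  (\sum_(r < n) transition_jac c d x m r *: v (transition c d x) r) a b =
  \sum_r transition_jac c d x m r * v (transition c d x) r a b.
Proof. by rewrite summxE; apply: eq_bigr => r _; rewrite mxE. Qed.

(** The components in c are those in d transformed by the law, and [jacobian_transfer] writes their
    integrals over a small set as integrals in d against fixed bounded weights, to which weak
    convergence in d applies. *)
Lemma setwise_transfer (p : R) c d x0 (u : nat -> matrix_form M N) (L : 'rV[R]_n -> 'I_n -> 'M[R]_N) :
  1 < p -> atlas c -> atlas d -> overlap c d x0 ->
  (forall j, form_law (u j)) -> (forall j, form_Lp p (u j)) ->
  (forall m a b, Lp_loc p (cimg d) (fun x => L x m a b)) ->
  (forall m a b, weak_cvg_Lp_loc p (cimg d) (fun j x => u j d x m a b) (fun x => L x m a b)) ->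
  exists (e : R) (K : set 'rV[R]_n), [/\ 0 < e, compact K /\ K `<=` cimg c, ball x0 e `<=` K,
    ball x0 e `<=` overlap c d &
    forall A, measurable A -> A `<=` ball x0 e -> forall m a b,
    mu.-integrable A (EFin \o (fun x => \sum_r transition_jac c d x m r * L (transition c d x) r a b)) /\
    (fun j => \int[mu]_(x in A) u j c x m a b) @ \oo -->
    \int[mu]_(x in A) \sum_r transition_jac c d x m r * L (transition c d x) r a b].
Proof.
move=> p1 ac ad x0V law uLp LLp cu.
have [e1 [K [e10 e1V cK KV' key]]] := @jacobian_transfer R n (overlap c d) (overlap d c)
  (transition c d) (transition d c) x0 (fun m r x => transition_jac c d x m r)
  (@overlap_open R n M c d) (@overlap_open R n M d c) (@transition_continuous R n M c d)
  (@transition_overlap R n M c d) (@transitionK R n M c d) (@transition_overlap R n M d c)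
  (atlas_smooth ad ac) (@transition_continuous R n M d c)
  (fun m r x => @transition_jac_continuous R n M c d m r x ac ad) x0V.
have [e2 e20 e2c] := open_compact_nbhs (@cimg_open _ _ _ c) x0V.1.
have KU : K `<=` cimg d by move=> x /KV'[].
have cK2 : compact (cube x0 e2) by exact: compact_cube.
have be1 : ball x0 (Num.min e1 e2) `<=` ball x0 e1 by apply: le_ball; rewrite ge_min lexx.
have be2 : ball x0 (Num.min e1 e2) `<=` cube x0 e2.
  by apply: subset_trans (@ball_cube R n x0 e2); apply: le_ball; rewrite ge_min lexx orbT.
exists (Num.min e1 e2), (cube x0 e2); split => //.
- by rewrite lt_min e10.
- exact: subset_trans e1V.
move=> A mA Ae m a b.
have Ae1 : A `<=` ball x0 e1 by exact: subset_trans be1.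
have AK : A `<=` cube x0 e2 by exact: subset_trans be2.
have [psi [mpsi [C hC] tr]] := key A mA Ae1.
have iL r : mu.-integrable K (EFin \o (fun x => L x r a b)).
  exact: Lp_loc_integrable (ltW p1) (@cimg_open _ _ _ d) cK KU (LLp r a b).
have [iA EA] := tr (fun r x => L x r a b) iL m; split => //.
have q0 : 0 <= p / (p - 1) by rewrite divr_ge0 ?(ltW (lt_trans ltr01 p1))// subr_ge0 ltW.
have Ej j : \sum_r \int[mu]_(y in K) (u j d y r a b * psi m r y) = \int[mu]_(x in A) u j c x m a b.
  have iu r : mu.-integrable K (EFin \o (fun x => u j d x r a b)).
    exact: Lp_loc_integrable (ltW p1) (@cimg_open _ _ _ d) cK KU (uLp j d ad r a b).
  have iuc := integrableS (compact_measurable_rV cK2) mA AK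
    (Lp_loc_integrable (ltW p1) (@cimg_open _ _ _ c) cK2 e2c (uLp j c ac m a b)).
  have [iA' <-] := tr (fun r x => u j d x r a b) iu m.
  rewrite /Rintegral; congr fine; apply: ae_eq_integral => //.
  - exact: measurable_int iA'.
  - exact: measurable_int iuc.
  - apply: filterS (law j c d ac ad) => y h Ay.
    by rewrite /= (h (e1V _ (Ae1 _ Ay))) law_entry.
apply: eq_cvgn Ej (esym EA) _; apply: cvgn_sum => r.
by apply: (cu r a b K cK KU _ (measurable_funTS (mpsi m r))); apply: bounded_integrable_powR.
Qed.

(** The integrals of [u j c] over small sets converge to those of [u0 c] by weak convergence in c,
    and to those of the transformed [u0 d] by [setwise_transfer]. *)
Lemma weak_limit_form_law (p : R) (u : nat -> matrix_form M N) (u0 : matrix_form M N) :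
  1 < p -> (forall j, form_law (u j)) -> (forall j, form_Lp p (u j)) -> form_Lp p u0 ->
  weak_cvg_form p u u0 -> form_law u0.
Proof.
move=> p1 law uLp u0Lp cu c d ac ad; apply: ae_local => x0 x0V.
have [e [K [e0 [cK KU] eK eV key]]] := setwise_transfer p1 ac ad x0V law uLp (u0Lp d ad) (cu d ad).
have mB : measurable (ball x0 e : set 'rV[R]_n) by apply: open_measurable_rV; exact: ball_open.
exists e => //.
have H (q : 'I_n * 'I_N * 'I_N) : {ae mu, forall x, ball x0 e x -> u0 c x q.1.1 q.1.2 q.2 =
    \sum_r transition_jac c d x q.1.1 r * u0 d (transition c d x) r q.1.2 q.2}.
  case: q => [[m a] b] /=; apply: ae_eq_of_integrals => //.
  - apply: integrableS (compact_measurable_rV cK) mB eK _.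
    exact: Lp_loc_integrable (ltW p1) (@cimg_open _ _ _ c) cK KU (u0Lp c ac m a b).
  - exact: (key _ mB (@subset_refl _ _) m a b).1.
  move=> A Ae mA; have [_ c1] := key A mA Ae m a b.
  have c2 := @weak_cvg_setwise R n p _ K A _ _ p1 cK KU (cu c ac m a b) mA (subset_trans Ae eK).
  exact: (cvg_unique _ c2 c1).
apply: filterS (filter_forall _ H) => x h ex m; apply/matrixP => a b.
by rewrite law_entry; exact: (h (m, a, b)).
Qed.

(** The atlas may be uncountable, yet one subsequence must serve every chart. It is extracted on a
    countable subatlas. In an arbitrary chart the integrals over small sets near each point then
    converge, by transfer from a chart of the subatlas, and [local_weak_limit] glues the limits. *)
Lemma weak_compactness_forms (p : R) (u : nat -> matrix_form M N) : 1 < p ->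
  (forall j, form_law (u j)) -> (forall j, form_Lp p (u j)) -> bounded_Lp_loc p u ->
  exists (phi : nat -> nat) (u0 : matrix_form M N),
    [/\ (forall i j, (i < j)%N -> (phi i < phi j)%N), form_law u0, form_Lp p u0 &
        weak_cvg_form p (fun j => u (phi j)) u0].
Proof.
move=> p1 law uLp bu.
(* The limits of the components are chosen separately for each chart; that they fit together into a
   form is then [weak_limit_form_law]. *)
suff [phi [phi_incr ex]] : exists phi : nat -> nat,
    (forall i j, (i < j)%N -> (phi i < phi j)%N) /\
    forall q : chart R n M * 'I_n * 'I_N * 'I_N, exists v : 'rV[R]_n -> R, atlas q.1.1.1 ->
      Lp_loc p (cimg q.1.1.1) v /\ weak_cvg_Lp_loc p (cimg q.1.1.1)
        (fun j x => u (phi j) q.1.1.1 x q.1.1.2 q.1.2 q.2) v.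
  move: ex => /choice[v hv].
  pose u0 : matrix_form M N := fun c x m => \matrix_(a, b) v (c, m, a, b) x.
  have u0E c m a b : (fun x => u0 c x m a b) = v (c, m, a, b) by apply/funext => x; rewrite mxE.
  have u0Lp : form_Lp p u0 by move=> c ac m a b; rewrite u0E; exact: (hv (c, m, a, b) ac).1.
  have cu : weak_cvg_form p (fun j => u (phi j)) u0.
    by move=> c ac m a b; rewrite u0E; exact: (hv (c, m, a, b) ac).2.
  exists phi, u0; split => //.
  exact: (weak_limit_form_law p1 (fun j => law (phi j)) (fun j => uLp (phi j)) u0Lp cu).
(* Without charts the manifold is empty and there is nothing to extract. *)
have [[c0 ac0]|noatlas] := pselect (exists c : chart R n M, atlas c); last first.
  exists id; split => // q; exists (fun=> 0) => aq; exfalso; apply: noatlas.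
  by exists q.1.1.1.
have [cl [acl clM]] := countable_atlas ac0.
have [||phi [phi_incr phi_cv]] := @diagonal_weak_limit R n (nat * 'I_n * 'I_N * 'I_N)%type p
    (fun q => cimg (cl q.1.1.1)) (fun q j x => u j (cl q.1.1.1) x q.1.1.2 q.1.2 q.2) p1
    (fun q => @cimg_open _ _ _ _).
- by move=> [[[l m] a] b] j; exact: (uLp j _ (acl l) m a b).1.
- move=> [[[l m] a] b] K cK KU /=; have [C hC] := bu _ (acl l) K cK KU.
  by exists C => j; exact: hC.
exists phi; split => // -[[[c m] a] b] /=.
have [ac|nac] := pselect (atlas c); last by exists (fun=> 0).
have [|||v vLp cv] := @local_weak_limit R n p (cimg c) (fun j x => u (phi j) c x m a b) p1 (@cimg_open _ _ _ c).
- by move=> j; exact: (uLp (phi j) c ac m a b).1.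
- by move=> K cK KU; have [C hC] := bu c ac K cK KU; exists C => j; exact: hC.
- move=> x0 cx0; have [l lx0] := clM (cfrom c x0).
  have ex (q : 'I_n * 'I_N * 'I_N) : exists v : 'rV[R]_n -> R, Lp_loc p (cimg (cl l)) v /\
      weak_cvg_Lp_loc p (cimg (cl l)) (fun j x => u (phi j) (cl l) x q.1.1 q.1.2 q.2) v.
    by have [v v1 v2] := phi_cv (l, q.1.1, q.1.2, q.2); exists v.
  move: ex => /choice[v hv].
  pose L (x : 'rV[R]_n) (m : 'I_n) : 'M[R]_N := \matrix_(a, b) v (m, a, b) x.
  have LE r a' b' : (fun x => L x r a' b') = v (r, a', b') by apply/funext => x; rewrite mxE.
  have [|||| e [K [e0 [cK KU] eK _ key]]] := @setwise_transfer p c (cl l) x0 (fun j => u (phi j)) L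
      p1 ac (acl l) (conj cx0 lx0).
  + by move=> j; exact: law.
  + by move=> j; exact: uLp.
  + by move=> r a' b'; rewrite LE; exact: (hv (r, a', b')).1.
  + by move=> r a' b'; rewrite LE; exact: (hv (r, a', b')).2.
  exists e => //; exists K; split => // A mA Ae; have [_ cA] := key A mA Ae m a b.
  by apply/cvg_ex; eexists; exact: cA.
by exists v.
Qed.

End matrix_forms.

(** * Closedness of the linear conditions under weak convergence *)

Section limit_connection_form.
Context (R : realType) (n : nat) (M : smooth_manifold R n).
Notation mu := (leb R n).
Implicit Types (c : chart R n M) (O : set M).

Lemma Linf_loc_cst (V : set 'rV[R]_n) (r : R) : Linf_loc V (fun=> r).
Proof. by split; [exact: measurable_cst|move=> K _ _; exists `|r|; exact: aeW]. Qed.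

Lemma Linf_locZ (V : set 'rV[R]_n) (r : R) (f : 'rV[R]_n -> R) :
  Linf_loc V f -> Linf_loc V (fun x => r * f x).
Proof.
move=> [mf bf]; split; first by apply: measurable_funM => //; exact: measurable_cst.
move=> K cK KV; have [C hC] := bf K cK KV; exists (`|r| * C).
by apply: filterS hC => x h Kx; rewrite normrM ler_wpM2l// h.
Qed.

Lemma so_algebraP (N : nat) (s : 'rV[R]_N) (A : 'M[R]_N) :
  so_algebra s A <-> forall a b, s ord0 a * A b a + A a b * s ord0 b = 0.
Proof.
rewrite /so_algebra; split=> [/matrixP h a b|h].
  by have := h a b; rewrite mxE mul_diag_mx mul_mx_diag !mxE.
by apply/matrixP => a b; rewrite mxE mul_diag_mx mul_mx_diag !mxE.
Qed.

Lemma weak_limit_so (N : nat) (p : R) (s : 'rV[R]_N) (u : nat -> matrix_form M N) (u0 : matrix_form M N) :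
  1 < p -> (forall j, form_Lp p (u j)) -> form_Lp p u0 -> weak_cvg_form p u u0 ->
  (forall j c, atlas c -> {ae mu, forall x, cimg c x -> forall m, so_algebra s (u j c x m)}) ->
  forall c, atlas c -> {ae mu, forall x, cimg c x -> forall m, so_algebra s (u0 c x m)}.
Proof.
move=> p1 uLp u0Lp cu so c ac.
have H (q : 'I_n * 'I_N * 'I_N) : {ae mu, forall x, cimg c x ->
    s ord0 q.1.2 * u0 c x q.1.1 q.2 q.1.2 + u0 c x q.1.1 q.1.2 q.2 * s ord0 q.2 = 0}.
  case: q => [[m a] b] /=.
  (* The condition couples the entries (a, b) and (b, a), here indexed by the booleans to fit
     [weak_limit_linear]. *)
  pose E (t : bool) (A : 'M[R]_N) := if t then A b a else A a b.
  have EL t (v : matrix_form M N) : form_Lp p v -> Lp_loc p (cimg c) (fun x => E t (v c x m)).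
    by move=> vLp; case: t; exact: vLp.
  have := @weak_limit_linear R n p (cimg c) (cimg c) bool (fun t _ => if t then s ord0 a else s ord0 b)
    (fun t j x => E t (u j c x m)) (fun t x => E t (u0 c x m)) (fun=> 0) p1 (@cimg_open _ _ _ c)
    (@cimg_open _ _ _ c) (@subset_refl _ _) (fun t => Linf_loc_cst _ _) (fun t j => EL t _ (uLp j))
    (fun t => EL t _ u0Lp).
  have cE t : weak_cvg_Lp_loc p (cimg c) (fun j x => E t (u j c x m)) (fun x => E t (u0 c x m)).
    by case: t; exact: cu.
  move=> /(_ cE) h; apply: filterS (h _) => [x hx cx|j].
    by have := hx cx; rewrite big_bool /= => <-; rewrite [X in _ + X]mulrC.
  apply: filterS (so j c ac) => x hx cx; have /so_algebraP := hx cx m.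
  by move=> soab; rewrite big_bool /= -[RHS](soab a b) [X in _ + X]mulrC.
by apply: filterS (filter_forall _ H) => x h cx m; apply/so_algebraP => a b; exact: (h (m, a, b)).
Qed.

Lemma form_on_frame_entry (N : nat) (w : matrix_form M N) (e : bilinear_field M) c
    (x : 'rV[R]_n) l a b :
  form_on_frame w e c x l a b = \sum_m e c x l m * w c x m a b.
Proof. by rewrite summxE; apply: eq_bigr => m _; rewrite mxE. Qed.

(** The common shape of the conditions on a connection form: two entries evaluated on frame vectors,
    with constant coefficients, and a right side fixed along the sequence. The frame is fixed too
    and locally bounded, so its components go into the coefficients of [weak_limit_linear]. *)
Lemma weak_limit_frame_linear (N : nat) (p : R) O (e : bilinear_field M) c
    (u : nat -> matrix_form M N) (u0 : matrix_form M N) (k1 k2 : R) l1 a1 b1 l2 a2 b2 (G : 'rV[R]_n -> R) :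
  1 < p -> open O -> atlas c -> (forall i r, Linf_loc (region O c) (fun x => e c x i r)) ->
  (forall j, form_Lp p (u j)) -> form_Lp p u0 -> weak_cvg_form p u u0 ->
  let F w x := k1 * form_on_frame w e c x l1 a1 b1 + k2 * form_on_frame w e c x l2 a2 b2 in
  (forall j, {ae mu, forall x, region O c x -> F (u j) x = G x}) ->
  {ae mu, forall x, region O c x -> F u0 x = G x}.
Proof.
move=> p1 oO ac eb uLp u0Lp cu F.
pose E (q : bool * 'I_n) (w : matrix_form M N) x := if q.1 then w c x q.2 a1 b1 else w c x q.2 a2 b2.
pose g (q : bool * 'I_n) x := if q.1 then k1 * e c x l1 q.2 else k2 * e c x l2 q.2.
have FE w x : F w x = \sum_q g q x * E q w x.
  rewrite /F !form_on_frame_entry -(pair_bigA _ (fun t m => g (t, m) x * E (t, m) w x)) big_bool /=.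
  by rewrite !big_distrr /=; congr (_ + _); apply: eq_bigr => m _; rewrite /g /E/= mulrA.
have EL q w : form_Lp p w -> Lp_loc p (cimg c) (E q w).
  by case: q => [[] m] wLp; exact: wLp.
have cE q : weak_cvg_Lp_loc p (cimg c) (fun j => E q (u j)) (E q u0).
  by case: q => [[] m]; exact: cu.
have gb q : Linf_loc (region O c) (g q) by case: q => [[] m]; exact: Linf_locZ.
have rc : region O c `<=` cimg c by move=> x [].
move=> h; have h' j : {ae mu, forall x, region O c x -> \sum_q g q x * E q (u j) x = G x}.
  by apply: filterS (h j) => x hx rx; rewrite -FE; exact: hx.
have := weak_limit_linear p1 (@cimg_open _ _ _ c) (region_open oO) rc gb
  (fun q j => EL q _ (uLp j)) (fun q => EL q _ u0Lp) cE h'.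
by apply: filterS => x hx rx; rewrite FE; exact: hx.
Qed.

(** Eliminates the unknowns II and nE: they are blocks of omega on the frame, so their existence
    amounts to the symmetry of one block and the skewness of another. The dummy factors 1 and 0
    bring the conditions to the shape of [weak_limit_frame_linear]. *)
Lemma connection_form_onP (nu k tau : nat) (Gamma : christoffel M) O (e : bilinear_field M)
    (De : christoffel M) (omega : matrix_form M (n + k)) :
  connection_form_on nu tau Gamma O e De omega <->
  forall c, atlas c -> {ae mu, forall x, region O c x ->
    let w := form_on_frame omega e c x in
    [/\ forall (q : 'I_n * 'I_n * 'I_k),
          1 * w q.1.2 (lshift k q.1.1) (rshift n q.2) +
          (-1) * w q.1.1 (lshift k q.1.2) (rshift n q.2) = 0,
        forall (q : 'I_n * 'I_k * 'I_k),
          sign_row R k tau ord0 q.2 * w q.1.1 (rshift n q.1.2) (rshift n q.2) +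
          sign_row R k tau ord0 q.1.2 * w q.1.1 (rshift n q.2) (rshift n q.1.2) = 0,
        forall (q : 'I_n * 'I_n * 'I_n), 1 * w q.1.1 (lshift k q.1.2) (lshift k q.2) +
          0 * w q.1.1 (lshift k q.1.2) (lshift k q.2) =
          (nabla_frame Gamma e De c x q.1.1 *m invmx (e c x)) q.1.2 q.2 &
        forall (q : 'I_n * 'I_n * 'I_k),
          1 * w q.1.1 (rshift n q.2) (lshift k q.1.2) +
          sign_row R n nu ord0 q.1.2 * sign_row R k tau ord0 q.2 *
            w q.1.1 (lshift k q.1.2) (rshift n q.2) = 0]}.
Proof.
split=> [[II [nE h]] c ac|h].
  apply: filterS (h c ac) => x hx rx; have [sII [skew [tt tII nn nt]]] := hx rx.
  split=> [[[i j] al]|[[l al] be]|[[l i] j]|[[l i] al]] /=.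
  - rewrite (tII j i al) (tII i j al) -{1}(sII al) mxE; ring.
  - have /matrixP/(_ al be) := skew l; rewrite mxE mul_diag_mx mul_mx_diag !mxE => <-.
    by rewrite !nn [X in X + _]mulrC.
  - by rewrite mul1r mul0r addr0; exact: tt.
  - by rewrite mul1r nt addNr.
pose II c x (al : 'I_k) : 'M[R]_n := \matrix_(i, j) form_on_frame omega e c x j (lshift k i) (rshift n al).
pose nE c x (l : 'I_n) : 'M[R]_k :=
  \matrix_(al, be) form_on_frame omega e c x l (rshift n al) (rshift n be).
exists II, nE => c ac; apply: filterS (h c ac) => x hx rx; have [sII skew tt nt] := hx rx.
split; [|split; [|split]].
- move=> al; apply/matrixP => i j; rewrite !mxE.
  by have := sII (j, i, al); rewrite /= mul1r mulN1r => /subr0_eq.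
- move=> l; apply/matrixP => al be; rewrite mxE mul_diag_mx mul_mx_diag !mxE.
  by have := skew (l, al, be); rewrite /= !mxE => skl; rewrite [X in X + _]mulrC.
- by move=> l i j; rewrite -(tt (l, i, j)) mul1r mul0r addr0.
- by move=> j i al; rewrite mxE.
- by move=> l al be; rewrite mxE.
- by move=> l i al; apply/eqP; rewrite -addr_eq0; have := nt (l, i, al); rewrite mul1r => ->.
Qed.

Lemma weak_limit_connection_form (p : R) (nu k tau : nat) (Gamma : christoffel M) O
    (e : bilinear_field M) (De : christoffel M) (u : nat -> matrix_form M (n + k))
    (u0 : matrix_form M (n + k)) :
  1 < p -> open O ->
  (forall c, atlas c -> forall i r, Linf_loc (region O c) (fun x => e c x i r)) ->
  (forall j, form_Lp p (u j)) -> form_Lp p u0 -> weak_cvg_form p u u0 ->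
  (forall j, connection_form_on nu tau Gamma O e De (u j)) ->
  connection_form_on nu tau Gamma O e De u0.
Proof.
move=> p1 oO eb uLp u0Lp cu h; apply/connection_form_onP => c ac.
have h' j := (connection_form_onP nu tau Gamma O e De (u j)).1 (h j) c ac.
have lim k1 k2 l1 a1 b1 l2 a2 b2 G := @weak_limit_frame_linear (n + k) p O e c u u0
  k1 k2 l1 a1 b1 l2 a2 b2 G p1 oO ac (eb c ac) uLp u0Lp cu.
pose w0 := form_on_frame u0 e c.
have H1 (q : 'I_n * 'I_n * 'I_k) : {ae mu, forall x, region O c x ->
    1 * w0 x q.1.2 (lshift k q.1.1) (rshift n q.2) +
    (-1) * w0 x q.1.1 (lshift k q.1.2) (rshift n q.2) = 0}.
  by apply: lim => j; apply: filterS (h' j) => x hx rx; have [+ _ _ _] := hx rx; exact.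
have H2 (q : 'I_n * 'I_k * 'I_k) : {ae mu, forall x, region O c x ->
    sign_row R k tau ord0 q.2 * w0 x q.1.1 (rshift n q.1.2) (rshift n q.2) +
    sign_row R k tau ord0 q.1.2 * w0 x q.1.1 (rshift n q.2) (rshift n q.1.2) = 0}.
  by apply: lim => j; apply: filterS (h' j) => x hx rx; have [_ + _ _] := hx rx; exact.
have H3 (q : 'I_n * 'I_n * 'I_n) : {ae mu, forall x, region O c x ->
    1 * w0 x q.1.1 (lshift k q.1.2) (lshift k q.2) +
    0 * w0 x q.1.1 (lshift k q.1.2) (lshift k q.2) =
    (nabla_frame Gamma e De c x q.1.1 *m invmx (e c x)) q.1.2 q.2}.
  by apply: lim => j; apply: filterS (h' j) => x hx rx; have [_ _ + _] := hx rx; exact.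
have H4 (q : 'I_n * 'I_n * 'I_k) : {ae mu, forall x, region O c x ->
    1 * w0 x q.1.1 (rshift n q.2) (lshift k q.1.2) +
    sign_row R n nu ord0 q.1.2 * sign_row R k tau ord0 q.2 *
    w0 x q.1.1 (lshift k q.1.2) (rshift n q.2) = 0}.
  by apply: lim => j; apply: filterS (h' j) => x hx rx; have [_ _ _] := hx rx; exact.
apply: filter_app (filter_forall _ H1); apply: filter_app (filter_forall _ H2).
apply: filter_app (filter_forall _ H3); apply: filterS (filter_forall _ H4) => x x4 x3 x2 x1 rx.
split=> q; [exact: x1|exact: x2|exact: x3|exact: x4].
Qed.

End limit_connection_form.

(** The subsequence is extracted before any frame is given. Since the conditions on a connection
    1-form relative to a frame are linear, the limit inherits them for all frames at once. *)
Theorem theorem4p1 (R : realType) (n nu : nat) (M : smooth_manifold R n)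
    (g : bilinear_field M) (p : R) (Gamma : christoffel M)
    (k tau : nat) (I : Type) (W : I -> matrix_form M (n + k))
    (hnu : (nu <= n)%N) (hg : semi_riemannian nu g)
    (hp : 2 < p) (hGamma : levi_civita p g Gamma)
    (hk : (0 < k)%N) (htau : (0 < tau)%N) (htauk : (tau <= k)%N)
    (hW : forall i, so_form p nu tau (W i))
    (hbound : bounded_Lp_loc p W)
    (hcartan : forall i, cartan_system (W i))
    (eps : nat -> I) :
  exists (phi : nat -> nat) (W0 : matrix_form M (n + k)),
    [/\ (forall i j, (i < j)%N -> (phi i < phi j)%N),
        so_form p nu tau W0,
        weak_cvg_form p (fun j => W (eps (phi j))) W0,
        cartan_system W0 &
        forall (O : set M) (e : bilinear_field M) (De : christoffel M),
          open O -> orthonormal_frame p nu g O e De ->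
          (forall i, connection_form_on nu tau Gamma O e De (W i)) ->
          connection_form_on nu tau Gamma O e De W0].
Proof.
have p1 : 1 < p by apply: lt_trans hp; rewrite ltr1n.
have Wlaw i : form_law (W i) by exact: so_form_law (hW i).
have WLp i : form_Lp p (W i) by exact: so_form_Lp (hW i).
have [|phi [W0 [phi_incr law Lp cv]]] := weak_compactness_forms p1
    (fun j => Wlaw (eps j)) (fun j => WLp (eps j)).
  by move=> c ac K cK KU; have [C hC] := hbound c ac K cK KU; exists C => j; exact: hC.
pose u j := W (eps (phi j)).
have uLp j : form_Lp p (u j) by exact: WLp.
exists phi, W0; split => //.
- split => //; apply: (weak_limit_so p1 uLp Lp cv) => j; exact: so_form_so (hW _).
(* The system is a condition chart by chart, so the result on open subsets of R^n applies to the
   image of each chart. *)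
- move=> c ac; apply: (@cartan_weak_limit R n (n + k) p (cimg c) (fun j => u j c) (W0 c) hp
    (@cimg_open _ _ _ c) (fun j => uLp j c ac) (Lp c ac) _ (cv c ac)).
    by move=> K cK KU; have [C hC] := hbound c ac K cK KU; exists C => j; exact: hC.
  by move=> j; exact: hcartan.
- move=> O e De oO fr hc.
  exact: (weak_limit_connection_form p1 oO (frame_Linf fr) uLp Lp cv (fun j => hc (eps (phi j)))).
Qed.
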